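(* Let $p\ge1$ and let $a_0,\dots,a_p$, $b_1,\dots,b_p$, $\tilde a_0,\dots,\tilde a_p$, $\tilde b_1,\dots,\tilde b_p\in\mathbb{C}$ satisfy Condition C. Put $\psi_{p-1}=\sum_{i=1}^{p-1}b_i-\sum_{i=0}^{p-1}a_i$ and $\tilde\psi_{p-1}=\sum_{i=1}^{p-1}\tilde b_i-\sum_{i=0}^{p-1}\tilde a_i$, and assume $\psi_{p-1}\notin\mathbb{Z}$, $\operatorname{Re}(\psi_{p-1}+\tilde\psi_{p-1})>-2$, $\operatorname{Re}(a_p+\tilde a_p)>0$, $\operatorname{Re}(b_p+\tilde b_p-a_p-\tilde a_p)>0$, $\operatorname{Re}(b_j+\tilde b_j-a_p-\tilde a_p)<2$ for $1\le j\le p-1$, and $\operatorname{Re}(b_p+\tilde b_p-a_j-\tilde a_j)<2$ for $0\le j\le p-1$. Let $0<|z|<1$ and assume the integral $$I_{p+1}(z,\bar z)=\int_{\mathbb{C}^p}\prod_{i=1}^{p}\Big[z_i^{a_i-1}\bar z_i^{\tilde a_i-1}(1-z_i)^{b_i-a_i-1}(1-\bar z_i)^{\tilde b_i-\tilde a_i-1}\Big]\Big(1-z\prod_{i=1}^pz_i\Big)^{-a_0}\Big(1-\bar z\prod_{i=1}^p\bar z_i\Big)^{-\tilde a_0}\,dA(z_1)\cdots dA(z_p)$$ converges absolutely. Then $$I_{p+1}(z,\bar z)=\lambda_0\,u_0(z)\,\tilde u_0(\bar z)+\sum_{j=1}^{p}\lambda_j\,z^{1-b_j}\bar z^{1-\tilde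 b_j}\,F_j(z)\,\tilde F_j(\bar z),$$ where $u_0(z)={}_{p+1}F_p(a_0,a_1,\dots,a_p;b_1,\dots,b_p;z)$, $\tilde u_0(\bar z)={}_{p+1}F_p(\tilde a_0,\dots,\tilde a_p;\tilde b_1,\dots,\tilde b_p;\bar z)$, for $1\le j\le p$ $$F_j(z)={}_{p+1}F_p\big(a_0-b_j+1,a_1-b_j+1,\dots,a_p-b_j+1;\ (1+b_i-b_j)_{1\le i\le p,\,i\ne j},\ 2-b_j;\ z\big)$$ and $\tilde F_j$ is the same with all parameters replaced by their tilde versions and $z$ by $\bar z$; and $$\lambda_0=\prod_{i=1}^{p}\mathfrak{B}(a_i,\,b_i-a_i;\,\tilde a_i,\,\tilde b_i-\tilde a_i),$$ $$\lambda_j=(-1)^{\,b_j-\tilde b_j-a_j+\tilde a_j}\,\mathfrak{B}(b_j-1,\,1-a_0;\,\tilde b_j-1,\,1-\tilde a_0)\prod_{\substack{i=1\\ i\ne j}}^{p}\mathfrak{B}(a_i-b_j+1,\,b_i-a_i;\,\tilde a_i-\tilde b_j+1,\,\tilde b_i-\tilde a_i)\quad(1\le j\le p).$$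
   Context: Condition C: (a) $b_j,\tilde b_j,a_i,\tilde a_i\notin\mathbb{Z}$ for $0\le i\le p$, $1\le j\le p$; (b) $a_i-a_k,\ \tilde a_i-\tilde a_k\notin\mathbb{Z}$ for $i\ne k$ in $\{0,\dots,p\}$, and $b_i-b_k,\ \tilde b_i-\tilde b_k\notin\mathbb{Z}$ for $i\ne k$ in $\{1,\dots,p\}$; (c) $a_i-b_j,\ \tilde a_i-\tilde b_j\notin\mathbb{Z}$ for all $0\le i\le p$, $1\le j\le p$; (d) $a_i-\tilde a_i\in\mathbb{Z}$ for $0\le i\le p$ and $b_j-\tilde b_j\in\mathbb{Z}$ for $1\le j\le p$. Convention: for $w\in\mathbb{C}\setminus\{0\}$ and $\alpha,\tilde\alpha$ with $\alpha-\tilde\alpha\in\mathbb{Z}$, $w^{\alpha}\bar w^{\tilde\alpha}:=|w|^{\alpha+\tilde\alpha}e^{i(\alpha-\tilde\alpha)\arg w}$ (single valued). The integrand of $I_{p+1}$ is a product of such pairs (with $w=z_i$, $w=1-z_i$, $w=1-z\prod z_i$), and $z^{1-b_j}\bar z^{1-\tilde b_j}$ is understood the same way. $dA$ is Lebesgue area measure on $\mathbb{C}$. ${}_{p+1}F_p$ is the generalized hypergeometric series, convergent for $|z|<1$. For $\alpha,\beta,\tilde\alpha,\tilde\beta$ with $\alpha-\tilde\alpha,\beta-\tilde\beta\in\mathbb{Z}$ and $\alpha,\beta,\alpha+\beta\notin\mathbb{Z}$, $$\mathfrak{B}(\alpha,\beta;\tilde\alpha,\tilde\beta)=\frac{\Gamma(\alpha)\Gamma(\beta)}{\Gamma(\alpha+\beta)}\,\frac{\Gamma(\tilde\alpha)\Gamma(\tilde\beta)}{\Gamma(\tilde\alpha+\tilde\beta)}\,\frac{\sin\pi\tilde\alpha\,\sin\pi\tilde\beta}{\sin\pi(\tilde\alpha+\tilde\beta)}$$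 (under Condition C all $\mathfrak{B}$'s above are defined). *)

(* Defs.v *)
From HB Require Import structures.
From mathcomp Require Import all_boot all_order all_algebra.
From mathcomp Require Import all_classical all_reals all_analysis.
From mathcomp Require Import complex.
Set Implicit Arguments.
Unset Strict Implicit.
Unset Printing Implicit Defensive.
Import Order.TTheory GRing.Theory Num.Theory.
Import numFieldNormedType.Exports.
Local Open Scope classical_set_scope.
Local Open Scope ring_scope.
Local Open Scope complex_scope.

Section Defs.
Variable R : realType.
Local Notation C := R[i].

Definition cre (x : C) : R := complex.Re x.
Definition cim (x : C) : R := complex.Im x.

Definition cabs (w : C) : R := Num.sqrt (cre w ^+ 2 + cim w ^+ 2).

(* an argument of w <> 0, in (-pi, pi] *)
Definition carg (w : C) : R :=
  if 0 <= cim w then acos (cre w / cabs w) else - acos (cre w / cabs w).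

Definition cexp (w : C) : C :=
  (expR (cre w))%:C * (cos (cim w) +i* sin (cim w)).

Definition rpowc (x : R) (s : C) : C := cexp (s * (ln x)%:C).

Definition csin (w : C) : C := (cexp ('i * w) - cexp (- ('i * w))) / (2%:R * 'i).

Definition minus1pow (x : C) : C := cexp ('i * (pi : R)%:C * x).

Definition isInt (x : C) : Prop := exists k : int, x = k%:~R.

(** The single-valued convention of the paper:
    w^alpha wbar^alpha' := |w|^{alpha+alpha'} e^{i (alpha-alpha') arg w}
    (used when alpha - alpha' is an integer, so the choice of arg w is
    irrelevant). *)
Definition ppow (w alpha alpha' : C) : C :=
  cexp ((alpha + alpha') * (ln (cabs w))%:C
        + 'i * (alpha - alpha') * (carg w)%:C).

Definition climn (u : nat -> C) : C :=
  (limn (fun n => cre (u n))) +i* (limn (fun n => cim (u n))).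

(** Gamma function, Gauss' product formula (valid for s not in -N):
    Gamma(s) = lim_n n! n^s / (s (s+1) ... (s+n)) *)
Definition cGamma (s : C) : C :=
  climn (fun n => (n`!)%:R * rpowc n%:R s / \prod_(k < n.+1) (s + k%:R)).

Definition frakB (al be al' be' : C) : C :=
  cGamma al * cGamma be / cGamma (al + be)
  * (cGamma al' * cGamma be' / cGamma (al' + be'))
  * (csin ((pi : R)%:C * al') * csin ((pi : R)%:C * be')
     / csin ((pi : R)%:C * (al' + be'))).

Definition poch (a : C) (n : nat) : C := \prod_(k < n) (a + k%:R).

Definition hypF (as_ bs : seq C) (x : C) : C :=
  climn (fun N => \sum_(n < N)
     (\prod_(a <- as_) poch a n) / (\prod_(b <- bs) poch b n)
     * x ^+ n / (n`!)%:R).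

Definition dA := ((@lebesgue_measure R) \x (@lebesgue_measure R))%E.

Definition toC (x : R * R) : C := x.1 +i* x.2.

Fixpoint cint (k : nat) (g : seq C -> C) : C :=
  match k with
  | 0 => g [::]
  | k'.+1 =>
    (Rintegral dA setT (fun x => cre (cint k' (fun s => g (toC x :: s)))))
    +i* (Rintegral dA setT (fun x => cim (cint k' (fun s => g (toC x :: s)))))
  end.

(* int_{C^k} |g| dA...dA  (Tonelli: iterated = product integral) *)
Fixpoint cint_abs (k : nat) (g : seq C -> C) : \bar R :=
  match k with
  | 0 => (cabs (g [::]))%:E
  | k'.+1 => (\int[dA]_x cint_abs k' (fun s => g (toC x :: s)))%E
  end.

(** ** The data of the theorem; parameters a, b, a', b' : nat -> C with
    a_0..a_p, b_1..b_p (other values are irrelevant); a' = tilde a etc. *)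

Definition conditionC (p : nat) (a b a' b' : nat -> C) : Prop :=
  ((forall i, (i <= p)%N -> ~ isInt (a i) /\ ~ isInt (a' i)) /\
      (forall j, (1 <= j <= p)%N -> ~ isInt (b j) /\ ~ isInt (b' j))) /\
  ((forall i k, (i <= p)%N -> (k <= p)%N -> i <> k ->
         ~ isInt (a i - a k) /\ ~ isInt (a' i - a' k)) /\
      (forall i k, (1 <= i <= p)%N -> (1 <= k <= p)%N -> i <> k ->
         ~ isInt (b i - b k) /\ ~ isInt (b' i - b' k))) /\
      (forall i j, (i <= p)%N -> (1 <= j <= p)%N ->
         ~ isInt (a i - b j) /\ ~ isInt (a' i - b' j)) /\
  ((forall i, (i <= p)%N -> isInt (a i - a' i)) /\
      (forall j, (1 <= j <= p)%N -> isInt (b j - b' j))).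

Definition psi (p : nat) (a b : nat -> C) : C :=
  \sum_(1 <= i < p) b i - \sum_(0 <= i < p) a i.

Definition integrand (p : nat) (a b a' b' : nat -> C) (z : C) (s : seq C) : C :=
  (\prod_(1 <= i < p.+1)
     (ppow (nth 0 s i.-1) (a i - 1) (a' i - 1)
      * ppow (1 - nth 0 s i.-1) (b i - a i - 1) (b' i - a' i - 1)))
  * ppow (1 - z * \prod_(i < p) nth 0 s i) (- a 0) (- a' 0).

Definition Ipp1 (p : nat) (a b a' b' : nat -> C) (z : C) : C :=
  cint p (integrand p a b a' b' z).

Definition lambda0 (p : nat) (a b a' b' : nat -> C) : C :=
  \prod_(1 <= i < p.+1) frakB (a i) (b i - a i) (a' i) (b' i - a' i).

Definition lambdaj (p : nat) (a b a' b' : nat -> C) (j : nat) : C :=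
  minus1pow (b j - b' j - a j + a' j)
  * frakB (b j - 1) (1 - a 0) (b' j - 1) (1 - a' 0)
  * \prod_(1 <= i < p.+1 | i != j)
       frakB (a i - b j + 1) (b i - a i) (a' i - b' j + 1) (b' i - a' i).

Definition u0 (p : nat) (a b : nat -> C) (x : C) : C :=
  hypF [seq a i | i <- iota 0 p.+1] [seq b i | i <- iota 1 p] x.

Definition Fj (p : nat) (a b : nat -> C) (j : nat) (x : C) : C :=
  hypF [seq a i - b j + 1 | i <- iota 0 p.+1]
       (rcons [seq 1 + b i - b j | i <- iota 1 p & i != j] (2%:R - b j)) x.

End Defs.

(* Main.v *)
(* Put B_0 = 1, let h_i be the weight of the i-th variable, and for a list of
   variables let G (x :: l) w be the integral of h_x(t) G l (w t), with
   G [] w = (1 - w)^(-a_0) (1 - w~)^(-a~_0). By induction on the list, G l w is a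
   sum, over j in 0 :: l, of w^(1 - B_j) w~^(1 - B~_j) times a product of a power
   series in w and one in w~.

   For x :: l, split the integral at |t| = r / |w|. For |t| < r / |w| expand
   G l (w t) term by term: each term is a complex beta integral over a disc
   containing 0 and 1, that is, a value of frakB (the integral over C may
   diverge) minus a tail. This gives all the expected terms of exponents
   j in 0 :: l. The tails and the part |t| >= r / |w| contribute, along w = rho z
   with rho real, rho^(1 - B_x, 1 - B~_x) times a power series in rho. To identify
   that series, exchange x with another variable (Fubini) or, when x is the only
   variable, substitute t -> 1 / (w t), which exchanges the exponents 0 and
   1 - B_x; both sides are then expansions with non-resonant exponents, and those
   are unique.

   The values of frakB come from the bilinear series obtained by integrating in
   polar coordinates; a recursion in the parameters reduces it to Gauss's
   summation theorem and the reflection formula. *)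
Require Import Defs.
From HB Require Import structures.
From mathcomp Require Import all_boot all_order all_algebra.
From mathcomp Require Import all_classical all_reals all_analysis measurable_realfun gauss_integral.
From mathcomp Require Import complex ring lra zify.
Set Implicit Arguments.
Unset Strict Implicit.
Unset Printing Implicit Defensive.
Import Order.TTheory GRing.Theory Num.Theory.
Import numFieldNormedType.Exports.
Local Open Scope classical_set_scope.
Local Open Scope ring_scope.
Local Open Scope complex_scope.

(** Three obstacles shape the proof. The one-variable integral over the plane may diverge at
    infinity, so [frakB] enters only through a bilinear series, and discs give [frakB] minus an
    explicit tail ([beta_partial]). With rho real, w = rho z and its conjugate scale alike, so the
    double and triple series of remainders collapse to one power series in rho whose coefficients
    can be compared; but for rho > 0 only the sums B_j + B~_j are visible, and these are resonant
    when B_j - B_k is half an odd integer, hence the negative rho as well. The convergence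
    conditions at each stage are extracted from absolute convergence: [Ji] is bounded below by every
    expected power of |w|, so finiteness at one point forces real parts to be positive, and
    finiteness then spreads over the punctured unit disc. The convention B_0 = 1 puts u_0, and the
    factorial in hypergeometric coefficients, on the same footing as the other indices. Polar
    integration is carried out through scaling relations on discs and annuli. *)

Section ComplexBasics.
Variable R : realType.
Local Notation C := R[i].
Implicit Types x y z w s : C.

(** * Complex arithmetic, the exponential and single-valued powers *)

Lemma cabsE x : `|x| = (cabs x)%:C.
Proof. by rewrite normc_def. Qed.

Lemma cabs_ge0 x : 0 <= cabs x.
Proof. exact: sqrtr_ge0. Qed.

Lemma cabsM x y : cabs (x * y) = cabs x * cabs y.
Proof. by apply: complexI; rewrite rmorphM /= -!cabsE normrM. Qed.

Lemma cabsV x : cabs x^-1 = (cabs x)^-1.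
Proof. by apply: complexI; rewrite fmorphV /= -!cabsE normfV. Qed.

Lemma cabsN x : cabs (- x) = cabs x.
Proof. by apply: complexI; rewrite -!cabsE normrN. Qed.

Lemma cabsX x n : cabs (x ^+ n) = cabs x ^+ n.
Proof. by apply: complexI; rewrite rmorphXn /= -!cabsE normrX. Qed.

Lemma cabs_conj x : cabs (conjc x) = cabs x.
Proof. by apply: complexI; rewrite -!cabsE normcJ. Qed.

Lemma cabsD x y : cabs (x + y) <= cabs x + cabs y.
Proof. by rewrite -lecR rmorphD /= -!cabsE ler_normD. Qed.

Lemma cabsB x y : cabs (x - y) <= cabs x + cabs y.
Proof. by rewrite -(cabsN y) cabsD. Qed.

Lemma cabs_eq0 x : (cabs x == 0) = (x == 0).
Proof. by rewrite -(inj_eq (@complexI R)) -cabsE rmorph0 normr_eq0. Qed.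

Lemma cabs0 : cabs (0 : C) = 0.
Proof. by apply/eqP; rewrite cabs_eq0. Qed.

Lemma cabs1 : cabs (1 : C) = 1.
Proof. by apply: complexI; rewrite -cabsE normr1. Qed.

Lemma cabsR (r : R) : cabs r%:C = `|r|.
Proof. by rewrite /cabs /= expr0n /= addr0 sqrtr_sqr. Qed.

Lemma cabsn n : cabs (n%:R : C) = n%:R.
Proof. by rewrite -(rmorph_nat (real_complex R)) cabsR normr_nat. Qed.

Lemma cabs_gt0 x : (0 < cabs x) = (x != 0).
Proof. by rewrite lt_neqAle cabs_ge0 andbT eq_sym cabs_eq0. Qed.

Lemma cabs_sqr x : cabs x ^+ 2 = cre x ^+ 2 + cim x ^+ 2.
Proof. by rewrite sqr_sqrtr ?addr_ge0 ?sqr_ge0. Qed.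

Lemma mulcJ x : x * conjc x = (cabs x ^+ 2)%:C.
Proof.
by rewrite cabs_sqr; case: x => a b; apply/eqP; rewrite eq_complex /= ; apply/andP; split; apply/eqP; ring.
Qed.

Lemma cre_le x : `|cre x| <= cabs x.
Proof. by rewrite -sqrtr_sqr ler_wsqrtr // lerDl sqr_ge0. Qed.

Lemma cim_le x : `|cim x| <= cabs x.
Proof. by rewrite -sqrtr_sqr ler_wsqrtr // lerDr sqr_ge0. Qed.

Lemma cabs_le x : cabs x <= `|cre x| + `|cim x|.
Proof.
rewrite -(ler_pXn2r (ltn0Sn 1)) ?nnegrE ?cabs_ge0 ?addr_ge0 // cabs_sqr.
rewrite -(real_normK (num_real (cre x))) -(real_normK (num_real (cim x))).
by rewrite sqrrD -addrA lerD2l lerDr mulrn_wge0 // mulr_ge0.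
Qed.

Lemma creD x y : cre (x + y) = cre x + cre y. Proof. by case: x; case: y. Qed.
Lemma cimD x y : cim (x + y) = cim x + cim y. Proof. by case: x; case: y. Qed.
Lemma creN x : cre (- x) = - cre x. Proof. by case: x. Qed.
Lemma cimN x : cim (- x) = - cim x. Proof. by case: x. Qed.
Lemma creB x y : cre (x - y) = cre x - cre y. Proof. by rewrite creD creN. Qed.
Lemma cimB x y : cim (x - y) = cim x - cim y. Proof. by rewrite cimD cimN. Qed.
Lemma creM x y : cre (x * y) = cre x * cre y - cim x * cim y.
Proof. by case: x; case: y. Qed.
Lemma cimM x y : cim (x * y) = cre x * cim y + cim x * cre y.
Proof. by case: x; case: y. Qed.
Lemma ceqP x y : cre x = cre y -> cim x = cim y -> x = y.
Proof. by case: x; case: y => /= ? ? ? ? -> ->. Qed.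

Lemma creRM (r : R) x : cre (r%:C * x) = r * cre x.
Proof. by rewrite creM /= mul0r subr0. Qed.
Lemma cimRM (r : R) x : cim (r%:C * x) = r * cim x.
Proof. by rewrite cimM /= mul0r addr0. Qed.
Lemma cre_nat n : cre (n%:R : C) = n%:R.
Proof. by rewrite -(rmorph_nat (real_complex R)). Qed.
Lemma cim_nat n : cim (n%:R : C) = 0.
Proof. by rewrite -(rmorph_nat (real_complex R)). Qed.
Lemma intCE (k : int) : (k%:~R : C) = (k%:~R : R)%:C.
Proof. by rewrite -(rmorph_int (real_complex R)). Qed.
Lemma natCE (k : nat) : (k%:R : C) = (k%:R : R)%:C.
Proof. by rewrite -(rmorph_nat (real_complex R)). Qed.
Lemma cre_int (k : int) : cre (k%:~R : C) = k%:~R. Proof. by rewrite intCE. Qed.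
Lemma intC_inj (k l : int) : (k%:~R : C) = l%:~R -> k = l.
Proof. by move/(congr1 (@cre R)); rewrite !cre_int => /intr_inj. Qed.

Lemma isInt0 : isInt (0 : C). Proof. by exists 0. Qed.
Lemma isInt_int (k : int) : isInt (k%:~R : C). Proof. by exists k. Qed.
Lemma isInt_nat (k : nat) : isInt (k%:R : C). Proof. by exists k. Qed.
Lemma isIntD x y : isInt x -> isInt y -> isInt (x + y).
Proof. by move=> [k ->] [l ->]; exists (k + l); rewrite rmorphD. Qed.
Lemma isIntN x : isInt x -> isInt (- x).
Proof. by move=> [k ->]; exists (- k); rewrite rmorphN. Qed.
Lemma isIntB x y : isInt x -> isInt y -> isInt (x - y).
Proof. by move=> ix iy; apply: isIntD => //; apply: isIntN. Qed.

Lemma cexpD x y : cexp (x + y) = cexp x * cexp y.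
Proof.
rewrite /cexp creD cimD expRD cosD sinD; apply: ceqP => /=; ring.
Qed.

Lemma cexp0 : cexp (0 : C) = 1.
Proof. by rewrite /cexp /= expR0 cos0 sin0; apply: ceqP => /=; ring. Qed.

Lemma cabs_cexp x : cabs (cexp x) = expR (cre x).
Proof.
rewrite /cexp cabsM cabsR ger0_norm ?expR_ge0 // /cabs /= cos2Dsin2 sqrtr1.
by rewrite mulr1.
Qed.

Lemma cexp_neq0 x : cexp x != 0.
Proof. by rewrite -cabs_gt0 cabs_cexp expR_gt0. Qed.

Lemma cexpN x : cexp (- x) = (cexp x)^-1.
Proof.
by apply: (mulIf (cexp_neq0 x)); rewrite -cexpD addNr cexp0 mulVf ?cexp_neq0.
Qed.

Lemma cexpB x y : cexp (x - y) = cexp x / cexp y.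
Proof. by rewrite cexpD cexpN. Qed.

Lemma cexpMn x n : cexp (x *+ n) = cexp x ^+ n.
Proof.
by elim: n => [|n IH]; rewrite ?mulr0n ?cexp0 // mulrS cexpD IH exprS.
Qed.

Lemma cexpMz x (n : int) : cexp (n%:~R * x) = cexp x ^ n.
Proof.
rewrite mulrzl; case: n => n; first exact: cexpMn.
by rewrite NegzE /= -exprnN mulrNz cexpN; congr (_^-1); apply: cexpMn.
Qed.

Lemma cexpR (r : R) : cexp r%:C = (expR r)%:C.
Proof. by rewrite /cexp /= cos0 sin0; apply: ceqP => /=; ring. Qed.

Lemma csgn_abs w : w != 0 -> cabs (w / (cabs w)%:C) = 1.
Proof.
by move=> w0; rewrite cabsM cabsV cabsR ger0_norm ?cabs_ge0 // mulfV // cabs_eq0.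
Qed.

(** sin (acos c) is |Im w| / |w|, and the case split in [carg] restores the sign. *)
Lemma cexp_carg w : w != 0 -> cexp ('i * (carg w)%:C) = w / (cabs w)%:C.
Proof.
move=> w0; have wp : 0 < cabs w by rewrite cabs_gt0.
set c := cre w / cabs w.
have c1 : -1 <= c <= 1.
  rewrite -ler_norml normrM normfV (ger0_norm (cabs_ge0 w)).
  by rewrite ler_pdivrMr // mul1r cre_le.
have E : Num.sqrt (1 - c ^+ 2) = `|cim w| / cabs w.
  rewrite -[RHS]ger0_norm ?divr_ge0 ?cabs_ge0 // -sqrtr_sqr; congr Num.sqrt.
  rewrite /c !expr_div_n real_normK ?num_real // -[1](@mulfV _ (cabs w ^+ 2)) ?expf_neq0 ?gt_eqF //.
  by rewrite -mulrBl cabs_sqr addrC addKr.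
have -> : cexp ('i * (carg w)%:C) = cos (carg w) +i* sin (carg w).
  rewrite /cexp; have -> : cre ('i * (carg w)%:C) = 0 by rewrite creM /=; ring.
  have -> : cim ('i * (carg w)%:C) = carg w by rewrite cimM /=; ring.
  by rewrite expR0 mul1r.
have -> : w / (cabs w)%:C = c +i* (cim w / cabs w).
  by rewrite -fmorphV /= /c; apply: ceqP; rewrite ?creM ?cimM /=; ring.
rewrite /carg -/c; case: ifPn => h.
  rewrite acosK // sin_acos // E ger0_norm //.
rewrite cosN sinN acosK // sin_acos // E ltr0_norm ?ltNge //.
by rewrite mulNr opprK.
Qed.

(** Trades the argument of w for an integer power of w / |w|. This form involves no branch, is
    visibly multiplicative and measurable, and is the source of the later rules for [ppow]. *)
Lemma ppowE w s s' (n : int) : w != 0 -> s - s' = n%:~R ->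
  ppow w s s' = cexp ((s + s') * (ln (cabs w))%:C) * (w / (cabs w)%:C) ^ n.
Proof.
move=> w0 e; rewrite /ppow cexpD; congr (_ * _).
by rewrite e (mulrC 'i) -mulrA cexpMz cexp_carg.
Qed.

Lemma cabs_exprz x (n : int) : cabs (x ^ n) = cabs x ^ n.
Proof. by case: n => n; rewrite /exprz ?cabsV cabsX. Qed.

Lemma cabs_ppow w s s' : w != 0 -> isInt (s - s') ->
  cabs (ppow w s s') = cabs w `^ cre (s + s').
Proof.
move=> w0 [n e]; rewrite (ppowE w0 e) cabsM cabs_cexp.
rewrite /powR cabs_eq0 (negbTE w0) (mulrC (s + s')) creRM (mulrC (ln _)).
suff -> : cabs ((w / (cabs w)%:C) ^ n) = 1 by rewrite mulr1.
by rewrite cabs_exprz csgn_abs // exp1rz.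
Qed.

Lemma ppow_neq0 w s s' : ppow w s s' != 0.
Proof. exact: cexp_neq0. Qed.

Lemma ppowD w s s' u u' : ppow w (s + u) (s' + u') = ppow w s s' * ppow w u u'.
Proof. by rewrite /ppow -cexpD; congr cexp; ring. Qed.

Lemma ppow00 w : ppow w 0 0 = 1.
Proof. by rewrite /ppow subr0 addr0 mulr0 !mul0r addr0 cexp0. Qed.

Lemma ppowN w s s' : ppow w (- s) (- s') = (ppow w s s')^-1.
Proof.
by apply: (mulIf (ppow_neq0 w s s')); rewrite -ppowD !addNr ppow00 mulVf ?ppow_neq0.
Qed.

(** Integrality of [s - s'] pays here: the arguments of w1 and w2 need not add up to that of the
    product, but integer powers of unit vectors multiply. *)
Lemma ppowM w1 w2 s s' : w1 != 0 -> w2 != 0 -> isInt (s - s') ->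
  ppow (w1 * w2) s s' = ppow w1 s s' * ppow w2 s s'.
Proof.
move=> w10 w20 [n e]; rewrite !(ppowE _ e) ?mulf_neq0 //.
rewrite cabsM lnM ?posrE ?cabs_gt0 // (rmorphD (real_complex R)) mulrDr cexpD.
by rewrite [RHS]mulrACA -expfzMl (_ : w1 / _ * _ = w1 * w2 / (cabs w1 * cabs w2)%:C) // rmorphM invfM mulrACA.
Qed.

Lemma ppowV w s s' : w != 0 -> isInt (s - s') ->
  ppow w^-1 s s' = ppow w (- s) (- s').
Proof.
move=> w0 i; rewrite ppowN; apply: (mulIf (ppow_neq0 w s s')).
rewrite -ppowM ?invr_eq0 // [RHS]mulVf ?ppow_neq0 // mulVf //.
case: i => n e; rewrite (ppowE (oner_neq0 _) e) cabs1 ln1 mulr0 cexp0 mul1r.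
by rewrite divr1 exp1rz.
Qed.

(** Lets monomials in t and its conjugate be absorbed into the exponents of a weight, which is how
    power series are integrated term by term. *)
Lemma ppow_nat w (m n : nat) : w != 0 -> ppow w m%:R n%:R = w ^+ m * conjc w ^+ n.
Proof.
move=> w0; have e : (m%:R - n%:R : C) = (m%:Z - n%:Z)%:~R by rewrite rmorphB.
have cw : (cabs w)%:C != 0 by rewrite (inj_eq (@complexI R) _ 0) cabs_eq0.
rewrite (ppowE w0 e).
have -> : conjc w = (cabs w)%:C ^+ 2 / w.
  by apply: (mulfI w0); rewrite mulcJ rmorphXn /= mulrCA mulfV // mulr1.
rewrite natCE natCE -rmorphD -rmorphM /= cexpR -natrD expRM_natl lnK ?posrE ?cabs_gt0 //.
rewrite rmorphXn /= exprMn -exprM expfzDr ?mulf_neq0 ?invr_eq0 // -exprnN.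
rewrite -!exprnP !exprMn !exprVn mul2n -addnn !exprD.
by field; rewrite ?expf_neq0 // w0.
Qed.
End ComplexBasics.

(** * Limits of complex sequences *)

Section ComplexLimits.
Variable R : realType.
Local Notation C := R[i].
Implicit Types (u v : nat -> C) (l m x : C).

(** Componentwise, to agree with [climn], in terms of which [cGamma] and [hypF] are defined. *)
Definition ccvg u l :=
  (fun n => cre (u n)) @ \oo --> cre l /\ (fun n => cim (u n)) @ \oo --> cim l.

Lemma ccvg_climn u l : ccvg u l -> climn u = l.
Proof. by move=> [h1 h2]; apply: ceqP; apply: cvg_lim. Qed.

Lemma ccvg_unique u l m : ccvg u l -> ccvg u m -> l = m.
Proof. by move=> /ccvg_climn <- /ccvg_climn. Qed.

Lemma ccvg_cst l : ccvg (fun=> l) l.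
Proof. by split; apply: cvg_cst. Qed.

Lemma ccvgD u v l m : ccvg u l -> ccvg v m -> ccvg (fun n => u n + v n) (l + m).
Proof.
move=> [u1 u2] [v1 v2]; split; rewrite ?creD ?cimD.
- by under eq_fun do rewrite creD; apply: cvgD.
- by under eq_fun do rewrite cimD; apply: cvgD.
Qed.

Lemma ccvgN u l : ccvg u l -> ccvg (fun n => - u n) (- l).
Proof.
move=> [u1 u2]; split; rewrite ?creN ?cimN.
- by under eq_fun do rewrite creN; apply: cvgN.
- by under eq_fun do rewrite cimN; apply: cvgN.
Qed.

Lemma ccvgB u v l m : ccvg u l -> ccvg v m -> ccvg (fun n => u n - v n) (l - m).
Proof. by move=> ul vm; apply: ccvgD => //; apply: ccvgN. Qed.

Lemma ccvgM u v l m : ccvg u l -> ccvg v m -> ccvg (fun n => u n * v n) (l * m).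
Proof.
move=> [u1 u2] [v1 v2]; split; rewrite ?creM ?cimM.
- by under eq_fun do rewrite creM; apply: cvgB; apply: cvgM.
- by under eq_fun do rewrite cimM; apply: cvgD; apply: cvgM.
Qed.

Lemma ccvg_real (u : nat -> R) (l : R) : u @ \oo --> l -> ccvg (fun n => (u n)%:C) l%:C.
Proof. by move=> h; split => //=; apply: cvg_cst. Qed.

Lemma ccvg_conj u l : ccvg u l -> ccvg (fun n => conjc (u n)) (conjc l).
Proof.
have eR x : cre (conjc x) = cre x by case: x.
have eI x : cim (conjc x) = - cim x by case: x.
move=> [u1 u2]; split; rewrite ?eR ?eI.
- by under eq_fun do rewrite eR.
- by under eq_fun do rewrite eI; apply: cvgN.
Qed.

Lemma ccvg_abs u l : ccvg u l -> (fun n => cabs (u n)) @ \oo --> cabs l.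
Proof.
move=> [u1 u2]; apply: (@continuous_cvg _ _ _ _ _ _ (@Num.sqrt R)).
  exact: sqrt_continuous.
by apply: cvgD; rewrite !expr2; under eq_fun do rewrite expr2; apply: cvgM.
Qed.

Lemma ccvgV u l : l != 0 -> ccvg u l -> ccvg (fun n => (u n)^-1) l^-1.
Proof.
move=> l0 ul.
(* Written with the conjugate, the complex inverse only involves the inverse of a real number. *)
have e x : x^-1 = (cabs x ^- 2)%:C * conjc x.
  have [->|x0] := eqVneq x 0; first by rewrite invr0 (_ : conjc 0 = 0) ?mulr0 // conjc0.
  apply: (mulfI x0); rewrite mulfV // mulrCA mulcJ -rmorphM mulVf //.
  by rewrite expf_neq0 // cabs_eq0.
rewrite e (_ : (fun n => _) = (fun n => (cabs (u n) ^- 2)%:C * conjc (u n))); last first.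
  by apply/funext => n; rewrite e.
apply: ccvgM; last exact: ccvg_conj.
apply: ccvg_real; apply: cvgV; first by rewrite expf_neq0 // cabs_eq0.
by rewrite expr2; under eq_fun do rewrite expr2; apply: cvgM; apply: ccvg_abs.
Qed.

Lemma ccvg_div u v l m : m != 0 -> ccvg u l -> ccvg v m ->
  ccvg (fun n => u n / v n) (l / m).
Proof. by move=> m0 ul vm; apply: ccvgM => //; apply: ccvgV. Qed.

Lemma ccvg_near u v l : (\forall n \near \oo, u n = v n) -> ccvg u l -> ccvg v l.
Proof.
move=> h [u1 u2]; split.
- apply: cvg_trans u1; apply: near_eq_cvg; near=> n; rewrite (_ : u n = v n) //.
  by near: n.
- apply: cvg_trans u2; apply: near_eq_cvg; near=> n; rewrite (_ : u n = v n) //.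
  by near: n.
Unshelve. all: by end_near. Qed.

Lemma ccvg_ext u v l : u =1 v -> ccvg u l -> ccvg v l.
Proof. by move=> h; rewrite (_ : u = v) //; apply/funext. Qed.

Lemma ccvg_squeeze u l (e : nat -> R) : (\forall n \near \oo, cabs (u n - l) <= e n) ->
  e @ \oo --> (0 : R) -> ccvg u l.
Proof.
move=> h e0; have h2 (f : C -> R) : (forall x y, f (x - y) = f x - f y) ->
    (forall x, `|f x| <= cabs x) -> (fun n => f (u n)) @ \oo --> f l.
  move=> fB fa; apply/cvgrPdistC_lt => eps eps0.
  have /cvgrPdistC_lt/(_ eps eps0) e1 := e0.
  near=> n; rewrite -fB (le_lt_trans (fa _)) //.
  apply: (le_lt_trans (y := e n)); first by near: n.
  by rewrite (le_lt_trans (ler_norm _)) // -[e n]subr0; near: n.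
split; apply: h2; [exact: creB|exact: cre_le|exact: cimB|exact: cim_le].
Unshelve. all: by end_near. Qed.

Lemma ccvg_shift u l (N : nat) : ccvg u l -> ccvg (fun n => u (n + N)%N) l.
Proof.
by move=> [u1 u2]; split; [rewrite (cvg_shiftn N (fun n => cre (u n))) | rewrite (cvg_shiftn N (fun n => cim (u n)))].
Qed.

Lemma ccvg_unshift u l (N : nat) : ccvg (fun n => u (n + N)%N) l -> ccvg u l.
Proof.
by move=> [u1 u2]; split; [rewrite -(cvg_shiftn N (fun n => cre (u n))) | rewrite -(cvg_shiftn N (fun n => cim (u n)))].
Qed.

Lemma ccvg_cexp u l : ccvg u l -> ccvg (fun n => cexp (u n)) (cexp l).
Proof.
move=> [u1 u2]; rewrite /cexp; apply: ccvgM.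
  by apply: ccvg_real; apply: continuous_cvg u1; apply: continuous_expR.
split => /=.
- by apply: continuous_cvg u2; apply: continuous_cos.
- by apply: continuous_cvg u2; apply: continuous_sin.
Qed.

Lemma ccvg_bounded u l : ccvg u l -> exists M, 0 < M /\ forall n, cabs (u n) <= M.
Proof.
move=> /ccvg_abs h.
have : bounded_fun (fun n => cabs (u n)).
  by apply: cvg_seq_bounded; apply/cvg_ex; exists (cabs l).
move=> /pinfty_ex_gt0 [M M0 hM]; exists M; split => // n.
by have /= := hM n I; rewrite ger0_norm ?cabs_ge0.
Qed.

End ComplexLimits.

(** * Measurability of complex-valued functions *)

Section ComplexMeasurable.
Variable R : realType.
Local Notation C := R[i].

Section cmeas.
Context d (T : measurableType d).
Implicit Types f g : T -> C.

Definition cmeas f :=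
  measurable_fun setT (fun x => cre (f x)) /\ measurable_fun setT (fun x => cim (f x)).

Lemma cmeas_cst (c : C) : cmeas (fun=> c).
Proof. by split; apply: measurable_cst. Qed.

Lemma cmeasD f g : cmeas f -> cmeas g -> cmeas (fun x => f x + g x).
Proof.
move=> [f1 f2] [g1 g2]; split.
- by under eq_fun do rewrite creD; apply: measurable_funD.
- by under eq_fun do rewrite cimD; apply: measurable_funD.
Qed.

Lemma cmeasM f g : cmeas f -> cmeas g -> cmeas (fun x => f x * g x).
Proof.
move=> [f1 f2] [g1 g2]; split.
- by under eq_fun do rewrite creM; apply: measurable_funB; apply: measurable_funM.
- by under eq_fun do rewrite cimM; apply: measurable_funD; apply: measurable_funM.
Qed.

Lemma cmeas_real (r : T -> R) : measurable_fun setT r -> cmeas (fun x => (r x)%:C).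
Proof. by move=> h; split => //=; apply: measurable_cst. Qed.

Lemma cmeas_re f : cmeas f -> measurable_fun setT (fun x => cre (f x)).
Proof. by case. Qed.

Lemma cmeasN f : cmeas f -> cmeas (fun x => - f x).
Proof.
move=> hf; rewrite (_ : (fun _ => _) = (fun x => -1 * f x)); last by apply/funext => x; rewrite mulN1r.
by apply: cmeasM => //; apply: cmeas_cst.
Qed.

Lemma cmeasB f g : cmeas f -> cmeas g -> cmeas (fun x => f x - g x).
Proof. by move=> hf hg; apply: cmeasD => //; apply: cmeasN. Qed.

Lemma cmeas_conj f : cmeas f -> cmeas (fun x => conjc (f x)).
Proof.
move=> [f1 f2]; split.
- by rewrite (_ : (fun _ => _) = (fun x => cre (f x))) //; apply/funext => x; case: (f x).
- rewrite (_ : (fun _ => _) = (fun x => - cim (f x))) //; last by apply/funext => x; case: (f x).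
  exact: measurableT_comp.
Qed.

Lemma cmeas_abs f : cmeas f -> measurable_fun setT (fun x => cabs (f x)).
Proof.
move=> [f1 f2]; apply: (measurableT_comp (f := @Num.sqrt R)) => //.
  by apply: continuous_measurable_fun; apply: sqrt_continuous.
by apply: measurable_funD; rewrite /=; apply: measurable_funX.
Qed.

Lemma cmeas_absE f : cmeas f -> measurable_fun setT (fun x => (cabs (f x))%:E).
Proof. by move=> h; apply/measurable_EFinP; apply: cmeas_abs. Qed.

Lemma cmeas_if (P : T -> bool) f g : measurable_fun setT P -> cmeas f -> cmeas g ->
  cmeas (fun x => if P x then f x else g x).
Proof.
move=> mP [f1 f2] [g1 g2]; split.
- by under eq_fun do rewrite (fun_if (@cre R)); apply: measurable_fun_ifT.
- by under eq_fun do rewrite (fun_if (@cim R)); apply: measurable_fun_ifT.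
Qed.

Lemma cmeasV f : cmeas f -> cmeas (fun x => (f x)^-1).
Proof.
move=> hf; have e x : x^-1 = (cabs x ^- 2)%:C * conjc x :> C.
  have [->|x0] := eqVneq x 0; first by rewrite invr0 (_ : conjc 0 = 0) ?mulr0 // conjc0.
  apply: (mulfI x0); rewrite mulfV // mulrCA mulcJ -rmorphM mulVf //.
  by rewrite expf_neq0 // cabs_eq0.
under eq_fun do rewrite e; apply: cmeasM; last exact: cmeas_conj.
apply: cmeas_real; under eq_fun do rewrite -exprVn; apply: measurable_funX.
(* Away from 0, inversion is the sign times the exponential of minus a logarithm, a composition of
   measurable maps; the point 0 is treated apart. *)
have mi : measurable_fun setT (fun r : R => r^-1).
  rewrite (_ : (fun r => _) = (fun r : R => if r == 0 then 0 else Num.sg r * expR (- ln `|r|))).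
    apply: measurable_fun_ifT => //; first exact: measurable_fun_eqr.
    apply: measurable_funM; last first.
      apply: measurableT_comp => //; apply: measurableT_comp => //.
      by apply: (measurableT_comp (f := @ln R)); [exact: measurable_ln | exact: normr_measurable].
    rewrite (_ : Num.sg = fun r : R => if r == 0 then 0 else if r < 0 then -1 else 1).
      apply: measurable_fun_ifT => //; first exact: measurable_fun_eqr.
      by apply: measurable_fun_ifT => //; apply: measurable_fun_ltr.
    apply/funext => r; have [h|h|h] := ltgtP r 0; last by rewrite h sgr0.
      by rewrite ltr0_sg.
    by rewrite gtr0_sg.
  apply/funext => r; case: eqP => [->|/eqP r0]; first by rewrite invr0.
  rewrite expRN lnK ?posrE ?normr_gt0 // {1}(numEsg r) invfM.
  by congr (_ * _); have [h|h|h] := sgrP r; rewrite ?invr1 ?invrN ?invr1 //; move: r0; rewrite h eqxx.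
by apply: (measurableT_comp mi); apply: cmeas_abs.
Qed.

Lemma cmeas_cexp f : cmeas f -> cmeas (fun x => cexp (f x)).
Proof.
move=> [f1 f2]; rewrite /cexp; apply: cmeasM.
  by apply: cmeas_real; apply: measurableT_comp.
split => /=.
- apply: (measurableT_comp (f := @cos R)) => //.
  by apply: continuous_measurable_fun; apply: continuous_cos.
- apply: (measurableT_comp (f := @sin R)) => //.
  by apply: continuous_measurable_fun; apply: continuous_sin.
Qed.

Lemma cmeas_exp f n : cmeas f -> cmeas (fun x => f x ^+ n).
Proof.
move=> hf; elim: n => [|n IH]; first exact: cmeas_cst.
by under eq_fun do rewrite exprS; apply: cmeasM.
Qed.

Lemma cmeas_expz f (n : int) : cmeas f -> cmeas (fun x => f x ^ n).
Proof.
by case: n => n hf; rewrite /exprz; [apply: cmeas_exp | apply: cmeasV; apply: cmeas_exp].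
Qed.

End cmeas.

Lemma cmeas_comp d d' (T : measurableType d) (T' : measurableType d') (f : T -> C) (g : T' -> T) :
  cmeas f -> measurable_fun setT g -> cmeas (fun x => f (g x)).
Proof.
by move=> [f1 f2] hg; split;
  [apply: (measurableT_comp (f := fun x => cre (f x))) | apply: (measurableT_comp (f := fun x => cim (f x)))].
Qed.

Local Notation plane := (measurableTypeR R * measurableTypeR R)%type.

(** Functions of a complex variable are measured through the identification of C with the plane, on
    which the integrals of the statement are taken. *)
Definition cmeasC (F : C -> C) := cmeas (fun x : plane => F (toC x)).

Lemma cmeas_toC : cmeas (fun x : plane => toC x).
Proof. by split; rewrite /=; [exact: measurable_fst|exact: measurable_snd]. Qed.

Definition ofC (w : C) : plane := (cre w, cim w).
Lemma ofCK w : toC (ofC w) = w. Proof. by case: w. Qed.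
Lemma toCK (x : plane) : ofC (toC x) = x. Proof. by case: x. Qed.

Lemma measurable_ofC d (T : measurableType d) (g : T -> C) : cmeas g ->
  measurable_fun setT (fun x => ofC (g x)).
Proof. by move=> [g1 g2]; apply: measurable_fun_pair. Qed.

Lemma cmeasC_comp d (T : measurableType d) F (g : T -> C) : cmeasC F -> cmeas g ->
  cmeas (fun x => F (g x)).
Proof.
move=> hF hg; rewrite (_ : (fun x => F (g x)) = (fun x => F (toC (ofC (g x))))).
  by apply: (cmeas_comp hF); apply: measurable_ofC.
by apply/funext => x; rewrite ofCK.
Qed.

Lemma measurable_compC d d' (T : measurableType d) (T' : measurableType d') (F : C -> T') (g : T -> C) :
  measurable_fun setT (fun x : plane => F (toC x)) -> cmeas g -> measurable_fun setT (fun x => F (g x)).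
Proof.
move=> hF hg; rewrite (_ : (fun x => F (g x)) = (fun x => F (toC (ofC (g x))))).
  by apply: (measurableT_comp hF); apply: measurable_ofC.
by apply/funext => x; rewrite ofCK.
Qed.

Lemma measurable_ceq0 d (T : measurableType d) (f : T -> C) : cmeas f ->
  measurable_fun setT (fun x => f x == 0).
Proof.
move=> hf; under eq_fun do rewrite -cabs_eq0.
by apply: measurable_fun_eqr => //; apply: cmeas_abs.
Qed.

Lemma cmeasC_ppow s s' : isInt (s - s') -> cmeasC (fun w => ppow w s s').
Proof.
move=> [n e]; have mT := cmeas_toC.
rewrite /cmeasC (_ : (fun x => _) = (fun x => if toC x == 0 then ppow 0 s s'
   else cexp ((s + s') * (ln (cabs (toC x)))%:C) * (toC x / (cabs (toC x))%:C) ^ n)).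
  apply: cmeas_if; [exact: measurable_ceq0|exact: cmeas_cst|].
  have mA := cmeas_abs mT.
  apply: cmeasM.
    apply: cmeas_cexp; apply: cmeasM; first exact: cmeas_cst.
    by apply: cmeas_real; apply: (measurableT_comp (f := @ln R)); [exact: measurable_ln |].
  by apply: cmeas_expz; apply: cmeasM => //; apply: cmeasV; apply: cmeas_real.
by apply/funext => x; case: eqP => [->//|/eqP h]; rewrite (ppowE h e).
Qed.

Lemma measurable_cabs_ltr d (T : measurableType d) (f : T -> C) (r : R) : cmeas f ->
  measurable_fun setT (fun x => cabs (f x) < r).
Proof. by move=> hf; apply: measurable_fun_ltr => //; apply: cmeas_abs. Qed.

Lemma measurable_cabs_gtr d (T : measurableType d) (f : T -> C) (r : R) : cmeas f ->
  measurable_fun setT (fun x => r < cabs (f x)).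
Proof. by move=> hf; apply: measurable_fun_ltr => //; apply: cmeas_abs. Qed.
End ComplexMeasurable.

(** * Complex integrals: linearity, bounds, dominated convergence *)

Section ComplexIntegral.
Variable R : realType.
Local Notation C := R[i].
Context d (T : measurableType d) (mu : {measure set T -> \bar R}).
Implicit Types f g : T -> C.

Definition CI f : C := Rintegral mu setT (fun x => cre (f x)) +i* Rintegral mu setT (fun x => cim (f x)).

Definition cintg f := cmeas f /\ (\int[mu]_x (cabs (f x))%:E < +oo)%E.

Lemma cintg_meas f : cintg f -> cmeas f. Proof. by case. Qed.

Lemma eq_CI f g : (forall x, f x = g x) -> CI f = CI g.
Proof. by move=> h; rewrite (_ : f = g) //; apply/funext. Qed.

Lemma cintg_ext f g : (forall x, f x = g x) -> cintg f -> cintg g.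
Proof. by move=> h; rewrite (_ : f = g) //; apply/funext. Qed.

Lemma cintg_integrable (f : T -> C) (p : C -> R) :
  measurable_fun setT (fun x => p (f x)) -> (forall x, `|p x| <= cabs x) ->
  cintg f -> mu.-integrable setT (EFin \o (fun x => p (f x))).
Proof.
move=> mp hp [mf fi]; apply/integrableP; split; first exact/measurable_EFinP.
apply: le_lt_trans fi; apply: ge0_le_integral => //.
- by apply: measurableT_comp => //; apply/measurable_EFinP.
- exact: cmeas_absE.
- by move=> x _; rewrite /= lee_fin.
Qed.

Lemma cintg_re f : cintg f -> mu.-integrable setT (EFin \o (fun x => cre (f x))).
Proof. by move=> h; apply: (@cintg_integrable f) => //; [case: h => -[]|apply: cre_le]. Qed.
Lemma cintg_im f : cintg f -> mu.-integrable setT (EFin \o (fun x => cim (f x))).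
Proof. by move=> h; apply: (@cintg_integrable f) => //; [case: h => -[]|apply: cim_le]. Qed.

Lemma cintg_le f (g : T -> \bar R) : cmeas f -> measurable_fun setT g -> (forall x, (cabs (f x))%:E <= g x)%E ->
  (\int[mu]_x g x < +oo)%E -> cintg f.
Proof.
move=> mf mg fg gi; split => //; apply: le_lt_trans gi; apply: ge0_le_integral => //.
- by move=> x _; rewrite lee_fin cabs_ge0.
- exact: cmeas_absE.
Qed.

Lemma cintg_dom f g : cmeas f -> (forall x, cabs (f x) <= cabs (g x)) -> cintg g -> cintg f.
Proof.
move=> mf fg [mg gi]; apply: (@cintg_le _ (fun x => (cabs (g x))%:E)) => //.
exact: cmeas_absE.
Qed.

Lemma cintgD f g : cintg f -> cintg g -> cintg (fun x => f x + g x).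
Proof.
move=> [mf fi] [mg gi]; apply: (@cintg_le _ (fun x => (cabs (f x))%:E + (cabs (g x))%:E)%E) => //.
- exact: cmeasD.
- by apply: emeasurable_funD; apply: cmeas_absE.
- by move=> x; rewrite lee_fin cabsD.
- rewrite ge0_integralD //; try (by move=> x _; rewrite lee_fin cabs_ge0); try exact: cmeas_absE.
  exact: lte_add_pinfty.
Qed.

Lemma cintgZ (c : C) f : cintg f -> cintg (fun x => c * f x).
Proof.
move=> [mf fi]; split; first by apply: cmeasM => //; apply: cmeas_cst.
under eq_integral do rewrite cabsM EFinM.
rewrite ge0_integralZl ?lee_fin ?cabs_ge0 //; last 2 first.
- exact: cmeas_absE.
- by move=> x _; rewrite lee_fin cabs_ge0.
by rewrite lte_mul_pinfty ?lee_fin ?cabs_ge0.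
Qed.

Lemma cintg0 : cintg (fun=> 0).
Proof.
by split; [exact: cmeas_cst|under eq_integral do rewrite cabs0; rewrite integral0].
Qed.

Lemma cintgN f : cintg f -> cintg (fun x => - f x).
Proof. by move/(cintgZ (-1)); apply: cintg_ext => x; rewrite mulN1r. Qed.

Lemma cintgB f g : cintg f -> cintg g -> cintg (fun x => f x - g x).
Proof. by move=> hf hg; exact: (cintgD hf (cintgN hg)). Qed.

Lemma cintg_sum (I : Type) (r : seq I) (P : pred I) (F : I -> T -> C) :
  (forall i, P i -> cintg (F i)) -> cintg (fun x => \sum_(i <- r | P i) F i x).
Proof.
move=> h; elim: r => [|i r IH]; first by under eq_fun do rewrite big_nil; apply: cintg0.
case Pi: (P i); under eq_fun do rewrite big_cons Pi; last exact: IH.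
by apply: cintgD => //; apply: h.
Qed.

Lemma CID f g : cintg f -> cintg g -> CI (fun x => f x + g x) = CI f + CI g.
Proof.
move=> hf hg; rewrite /CI; apply: ceqP; rewrite ?creD ?cimD /=.
- under eq_Rintegral do rewrite creD.
  by rewrite RintegralD //; apply: cintg_re.
- under eq_Rintegral do rewrite cimD.
  by rewrite RintegralD //; apply: cintg_im.
Qed.

Lemma CI0 : CI (fun=> 0) = 0.
Proof. by apply: ceqP; rewrite /CI /= /Rintegral integral0. Qed.

Lemma CIZ (c : C) f : cintg f -> CI (fun x => c * f x) = c * CI f.
Proof.
move=> hf; have [h1 h2] := (cintg_re hf, cintg_im hf).
have Z (k : R) h : mu.-integrable setT (EFin \o h) -> mu.-integrable setT (EFin \o (fun x => k * h x)).
  by move=> ih; exact: (integrableZl measurableT k ih).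
apply: ceqP; rewrite ?creM ?cimM /=.
- under eq_Rintegral do rewrite creM.
  by rewrite RintegralB //= ?RintegralZl //; apply: Z.
- under eq_Rintegral do rewrite cimM.
  by rewrite RintegralD //= ?RintegralZl //; apply: Z.
Qed.

Lemma CIN f : cintg f -> CI (fun x => - f x) = - CI f.
Proof. by move=> hf; under eq_CI do rewrite -mulN1r; rewrite CIZ // mulN1r. Qed.

Lemma CIB f g : cintg f -> cintg g -> CI (fun x => f x - g x) = CI f - CI g.
Proof. by move=> hf hg; rewrite (CID hf (cintgN hg)) (CIN hg). Qed.

Lemma CI_sum (I : Type) (r : seq I) (P : pred I) (F : I -> T -> C) :
  (forall i, P i -> cintg (F i)) -> CI (fun x => \sum_(i <- r | P i) F i x) = \sum_(i <- r | P i) CI (F i).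
Proof.
move=> h; elim: r => [|i r IH]; first by under eq_CI do rewrite big_nil; rewrite big_nil CI0.
rewrite big_cons; under eq_CI do rewrite big_cons.
case: ifP => Pi; last by rewrite IH.
by rewrite CID ?IH //; [apply: h|apply: cintg_sum].
Qed.

(** Multiplying f by the unit number that rotates its integral onto the positive axis reduces the
    bound to a real part. *)
Lemma CI_abs f : cintg f -> ((cabs (CI f))%:E <= \int[mu]_x (cabs (f x))%:E)%E.
Proof.
move=> hf; have [->|c0] := eqVneq (CI f) 0; first by rewrite cabs0; apply: integral_ge0 => x _; rewrite lee_fin cabs_ge0.
set c := conjc (CI f) / (cabs (CI f))%:C.
have cf : cintg (fun x => c * f x) by apply: cintgZ.
have c1 : cabs c = 1 by rewrite cabsM cabsV cabsR cabs_conj ger0_norm ?cabs_ge0 // mulfV ?cabs_eq0.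
have : cre (CI (fun x => c * f x)) = cabs (CI f).
  by rewrite CIZ // /c mulrC mulrA mulcJ -fmorphV -(rmorphM (real_complex R)) /= expr2 mulfK // cabs_eq0.
rewrite {1}/CI /= /Rintegral => <-.
have h := cintg_re cf; rewrite fineK; last exact: integrable_fin_num.
apply: le_integral => //.
  apply/integrableP; split; first by apply: cmeas_absE; case: hf.
  by case: hf => _; under [in X in _ -> X]eq_integral do rewrite /= ger0_norm ?cabs_ge0 //.
move=> x _; rewrite lee_fin (le_trans (ler_norm _)) // (le_trans (cre_le _)) //.
by rewrite cabsM c1 mul1r.
Qed.

Lemma ae_eq_CI f g : cmeas f -> cmeas g -> (\forall x \ae mu, f x = g x) -> CI f = CI g.
Proof.
move=> [f1 f2] [g1 g2] h; apply: ceqP; rewrite /CI /= /Rintegral; congr fine.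
- apply: ae_eq_integral => //; try exact/measurable_EFinP.
  by apply: filterS h => x /= -> _.
- apply: ae_eq_integral => //; try exact/measurable_EFinP.
  by apply: filterS h => x /= -> _.
Qed.

Lemma CI_dct (F : nat -> T -> C) f (g : T -> R) :
  (forall n, cmeas (F n)) -> cmeas f -> (forall x, ccvg (F ^~ x) (f x)) ->
  measurable_fun setT g -> (\int[mu]_x (g x)%:E < +oo)%E ->
  (forall n x, cabs (F n x) <= g x) -> cintg f /\ ccvg (fun n => CI (F n)) (CI f).
Proof.
move=> mF mf Ff mg gi Fg.
have g0 x : 0 <= g x by apply: le_trans (Fg 0%N x); apply: cabs_ge0.
have ig : mu.-integrable setT (EFin \o g).
  apply/integrableP; split; first exact/measurable_EFinP.
  by under eq_integral do rewrite /= ger0_norm //.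
have fg x : cabs (f x) <= g x.
  have /ccvg_abs h := Ff x.
  by rewrite -(cvg_lim _ h) //; apply: limr_le; [apply: cvgP h | apply: nearW => n; apply: Fg].
have key (p : C -> R) : (forall h : T -> C, cmeas h -> measurable_fun setT (fun x => p (h x))) ->
    (forall x, `|p x| <= cabs x) -> (forall x, (fun n => p (F n x)) @ \oo --> p (f x)) ->
    (fun n => Rintegral mu setT (fun x => p (F n x))) @ \oo --> Rintegral mu setT (fun x => p (f x)).
  move=> mp hp hc.
  have [|||||_ _ h] := @dominated_convergence _ T R mu setT measurableT
    (fun n x => (p (F n x))%:E) (fun x => (p (f x))%:E) (EFin \o g).
  - by move=> n; apply/measurable_EFinP; apply: mp.
  - by apply/measurable_EFinP; apply: mp.
  - by apply: aeW => x _; apply: cvg_EFin; [near=> n|apply: hc].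
  - exact: ig.
  - by apply: aeW => x n _; rewrite /= lee_fin (le_trans (hp _)).
  apply: fine_cvg; rewrite fineK //.
  apply: integrable_fin_num => //; apply: (cintg_integrable (mp _ mf) hp).
  apply: (@cintg_le _ (EFin \o g)) => //; first exact/measurable_EFinP.
split.
  by apply: (@cintg_le _ (EFin \o g)) => //; exact/measurable_EFinP.
split; apply: key => //.
- by move=> h []. 
- exact: cre_le.
- by move=> x; case: (Ff x).
- by move=> h []. 
- exact: cim_le.
- by move=> x; case: (Ff x).
Unshelve. all: by end_near. Qed.

End ComplexIntegral.

Definition aeM (R : realType) d (T : measurableType d) (mu : {measure set T -> \bar R}) (P : T -> Prop) : Prop :=
  \forall x \ae mu, P x.

Lemma aeM_imp (R : realType) d (T : measurableType d) (mu : {measure set T -> \bar R}) (P Q : T -> Prop) :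
  aeM mu P -> (forall x, P x -> Q x) -> aeM mu Q.
Proof. by rewrite /aeM => h PQ; apply: filterS h => x; exact: PQ. Qed.

Lemma aeM_and (R : realType) d (T : measurableType d) (mu : {measure set T -> \bar R}) (P Q : T -> Prop) :
  aeM mu P -> aeM mu Q -> aeM mu (fun x => P x /\ Q x).
Proof. by rewrite /aeM => hP hQ; apply: filterS2 hP hQ => x. Qed.

(** * Fubini for complex integrands *)

Section ComplexFubini.
Variable R : realType.
Local Notation C := R[i].
Context d1 d2 (T1 : measurableType d1) (T2 : measurableType d2).
Variables (m1 : {sigma_finite_measure set T1 -> \bar R}) (m2 : {sigma_finite_measure set T2 -> \bar R}).
Implicit Type f : T1 * T2 -> C.

Lemma measurable_Rintegral2 (g : T1 * T2 -> R) : measurable_fun setT g ->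
  measurable_fun setT (fun x => Rintegral m2 setT (fun y => g (x, y))).
Proof.
move=> mg; rewrite /Rintegral; apply: (measurableT_comp (f := fine)) => //.
have mg' : measurable_fun setT (EFin \o g) by apply/measurable_EFinP.
(* Tonelli gives measurability for nonnegative integrands, hence the split into positive and
   negative parts. *)
rewrite (_ : (fun x => _) = (fun x => (\int[m2]_y (EFin \o g)^\+ (x, y) - \int[m2]_y (EFin \o g)^\- (x, y))%E)).
  apply: emeasurable_funB; apply: measurable_fun_fubini_tonelli_F => //.
  - exact: measurable_funepos.
  - exact: measurable_funeneg.
by apply/funext => x; rewrite integralE; congr (_ - _)%E; apply: eq_integral => y _; rewrite ?funeposE ?funenegE.
Qed.

Lemma cmeas_CI f : cmeas f -> cmeas (fun x => CI m2 (fun y => f (x, y))).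
Proof. by move=> [f1 f2]; split; rewrite /CI /=; [apply: (measurable_Rintegral2 f1)|apply: (measurable_Rintegral2 f2)]. Qed.

Lemma cintg_fubini f : cmeas f -> (\int[m1]_x \int[m2]_y (cabs (f (x, y)))%:E < +oo)%E ->
  cintg (m1 \x m2)%E f.
Proof.
move=> mf h; split => //; rewrite fubini_tonelli1 //; first exact: cmeas_absE.
by move=> x; rewrite lee_fin cabs_ge0.
Qed.

Lemma cintg_fubini_flip f : cmeas f -> (\int[m2]_y \int[m1]_x (cabs (f (x, y)))%:E < +oo)%E ->
  cintg (m1 \x m2)%E f.
Proof.
move=> mf h; split => //; rewrite fubini_tonelli2 //; first exact: cmeas_absE.
by move=> x; rewrite lee_fin cabs_ge0.
Qed.

Lemma Rintegral12 (g : T1 * T2 -> R) : (m1 \x m2)%E.-integrable setT (EFin \o g) ->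
  measurable_fun setT g ->
  Rintegral m1 setT (fun x => Rintegral m2 setT (fun y => g (x, y))) = Rintegral (m1 \x m2)%E setT g.
Proof.
move=> ig mg; rewrite /Rintegral; congr fine.
(* The inner [Rintegral] is [fine] of an extended integral, so it agrees with the Fubini section
   only where that section is integrable, that is, almost everywhere. *)
rewrite -(integral12_prod_meas1 ig); apply: ae_eq_integral => //.
- by apply/measurable_EFinP; apply: measurable_Rintegral2.
- exact: measurable_fubini_F ig.
have := ae_integrable1 ig; apply: filterS => x /= ix _.
by rewrite /fubini_F fineK //; apply: integrable_fin_num.
Qed.

Lemma CI_fubini f : cintg (m1 \x m2)%E f ->
  CI m1 (fun x => CI m2 (fun y => f (x, y))) = CI (m1 \x m2)%E f.
Proof.
move=> hf; rewrite /CI; apply: ceqP => /=.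
- by apply: (Rintegral12 (g := fun z => cre (f z))); [apply: cintg_re|case: hf => -[]].
- by apply: (Rintegral12 (g := fun z => cim (f z))); [apply: cintg_im|case: hf => -[]].
Qed.

Lemma cintg_CI f : cintg (m1 \x m2)%E f -> cintg m1 (fun x => CI m2 (fun y => f (x, y))).
Proof.
move=> hf; have mf := cintg_meas hf; have mc := cmeas_absE mf.
have hx x : ((cabs (CI m2 (fun y => f (x, y))))%:E <= \int[m2]_y (cabs (f (x, y)))%:E)%E.
  (* Sections of infinite absolute integral are harmless: the bound is then +oo. *)
  have [h|h] := ltP (\int[m2]_y (cabs (f (x, y)))%:E)%E +oo%E; last by apply: le_trans h; rewrite leey.
  apply: CI_abs; split => //; apply: (cmeas_comp mf); exact: measurable_pair1.
apply: (@cintg_le _ _ _ _ _ (fun x => \int[m2]_y (cabs (f (x, y)))%:E)%E); [exact: cmeas_CI| |exact: hx|].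
- apply: (measurable_fun_fubini_tonelli_F (fun z => (cabs (f z))%:E)) => // z.
  by rewrite lee_fin cabs_ge0.
- case: hf => _; rewrite fubini_tonelli1 // => z.
  by rewrite lee_fin cabs_ge0.
Qed.

Lemma cintg_section f : cintg (m1 \x m2)%E f -> aeM m1 (fun x => cintg m2 (fun y => f (x, y))).
Proof.
move=> hf; have mf := cintg_meas hf.
have ia : (m1 \x m2)%E.-integrable setT (EFin \o (fun z => cabs (f z))).
  apply/integrableP; split; first exact: cmeas_absE.
  by case: hf => _; under [in X in _ -> X]eq_integral do rewrite /= ger0_norm ?cabs_ge0 //.
have := ae_integrable1 ia; apply: filterS => x /= /integrableP [_ h]; split.
  by apply: (cmeas_comp mf); exact: measurable_pair1.
apply: le_lt_trans h; rewrite le_eqVlt; apply/orP; left; apply/eqP/eq_integral => y _.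
by rewrite /= ger0_norm ?cabs_ge0.
Qed.

End ComplexFubini.

Section ComplexFubiniSwap.
Variable R : realType.
Local Notation C := R[i].
Context d1 d2 (T1 : measurableType d1) (T2 : measurableType d2).
Variables (m1 : {sigma_finite_measure set T1 -> \bar R}) (m2 : {sigma_finite_measure set T2 -> \bar R}).

Lemma CI_swap (f : T1 -> T2 -> C) : cmeas (fun z : T1 * T2 => f z.1 z.2) ->
  (\int[m1]_x \int[m2]_y (cabs (f x y))%:E < +oo)%E ->
  CI m1 (fun x => CI m2 (f x)) = CI m2 (fun y => CI m1 (fun x => f x y)).
Proof.
move=> mf h; have hf : cintg (m1 \x m2)%E (fun z : T1 * T2 => f z.1 z.2) by apply: cintg_fubini.
have hg : cintg (m2 \x m1)%E (fun z : T2 * T1 => f z.2 z.1).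
  apply: cintg_fubini_flip => //=.
  by apply: (cmeas_comp (g := fun z : T2 * T1 => (z.2, z.1)) mf); apply: measurable_fun_pair.
rewrite (CI_fubini hf) (CI_fubini hg).
have key (p : C -> R) : (forall x, `|p x| <= cabs x) -> measurable_fun setT (fun z : T1 * T2 => p (f z.1 z.2)) ->
   measurable_fun setT (fun z : T2 * T1 => p (f z.2 z.1)) ->
   Rintegral (m1 \x m2)%E setT (fun z => p (f z.1 z.2)) = Rintegral (m2 \x m1)%E setT (fun z => p (f z.2 z.1)).
  move=> hp mp mp'; rewrite /Rintegral; congr fine.
  rewrite -(integral12_prod_meas1 (cintg_integrable mp hp hf)).
  by rewrite -(integral21_prod_meas1 (cintg_integrable mp' hp hg)).
by apply: ceqP; rewrite /CI /=; apply: key => //; [exact: cre_le|case: mf|case: hg => -[]|exact: cim_le|case: mf|case: hg => -[]].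
Qed.
End ComplexFubiniSwap.

(** * Sigma-finite products and the plane measure *)

Section ProductMeasure.
Local Open Scope ereal_scope.
Context d1 d2 (T1 : measurableType d1) (T2 : measurableType d2) (R : realType).
Variables (m1 : {sigma_finite_measure set T1 -> \bar R}) (m2 : {sigma_finite_measure set T2 -> \bar R}).

(* The key [product_measure1] canonically resolves only for finite factors. *)
Definition prodm : set (T1 * T2)%type -> \bar R := m1 \x m2.

HB.instance Definition _ := Measure.copy prodm (m1 \x m2).

(** Both exhaustions are taken increasing, so that the diagonal rectangles already cover the
    product. *)
Lemma prodm_sigma_finite : sigma_finite setT prodm.
Proof.
have /sigma_finiteP[F [TF ndF Foo]] := sigma_finiteT m1.
have /sigma_finiteP[G [TG ndG Goo]] := sigma_finiteT m2.
exists (fun n => F n `*` G n) => [|k].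
  apply/seteqP; split=> // -[x y] _.
  have [n _ Fx] : (\bigcup_n F n) x by rewrite -TF.
  have [k _ Gy] : (\bigcup_n G n) y by rewrite -TG.
  exists (maxn n k) => //; split.
  - exact: (subsetPset _ _ (ndF _ _ (leq_maxl n k))).
  - exact: (subsetPset _ _ (ndG _ _ (leq_maxr n k))).
have [mF Fk] := Foo k; have [mG Gk] := Goo k; split; first exact: measurableX.
by rewrite /prodm product_measure1E // lte_mul_pinfty // ge0_fin_numE.
Qed.

HB.instance Definition _ := Measure_isSigmaFinite.Build _ _ _ prodm prodm_sigma_finite.
End ProductMeasure.

Definition leb (R : realType) : {sigma_finite_measure set (measurableTypeR R) -> \bar R} :=
  @lebesgue_measure R.

(** Convertible to the [dA] of the statement; this form carries the sigma-finite structure that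
    repeated use of Fubini requires. *)
Definition mA (R : realType) : {sigma_finite_measure set (measurableTypeR R * measurableTypeR R)%type -> \bar R} :=
  prodm (leb R) (leb R).

Lemma mA_rect (R : realType) (A B : set (measurableTypeR R)) : measurable A -> measurable B ->
  mA R (A `*` B) = (lebesgue_measure A * lebesgue_measure B)%E.
Proof. exact: product_measure1E. Qed.

(** * Affine maps and complex multiplication in the plane *)

Section PlaneMeasure.
Variable R : realType.
Local Notation C := R[i].
Local Notation leb := (leb R).
Local Notation plane := (measurableTypeR R * measurableTypeR R)%type.
Local Notation dA := (mA R).

(** Lebesgue measure is determined by its values on half-open intervals, so it equals |a| times its
    image under the affine map; the formula is then a push-forward. *)
Lemma ge0_integral_affine (a b : R) (f : R -> \bar R) : a != 0 ->
  measurable_fun setT f -> (forall x, 0 <= f x)%E ->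
  (\int[leb]_x f (a * x + b)%R = (`|a|^-1)%:E * \int[leb]_x f x)%E.
Proof.
move=> a0 mf f0.
have mphi : measurable_fun setT (fun x : measurableTypeR R => a * x + b : measurableTypeR R).
  by apply: measurable_funD => //; apply: measurable_funM.
have na : 0 < `|a| by rewrite normr_gt0.
pose k := NngNum (ltW na).
have H (A : set (measurableTypeR R)) : measurable A -> leb A = (mscale k (pushforward leb (fun x : measurableTypeR R => a * x + b : measurableTypeR R))) A.
  apply: lebesgue_measure_unique => _ [[p q] _ <-].
  suff: lebesgue_measure `]p, q]%classic = (`|a|%:E * lebesgue_measure ((fun x : measurableTypeR R => (a * x + b)%R) @^-1` `]p, q]%classic))%E by [].
  case: (ltgtP a 0) => ha; last by rewrite ha eqxx in a0.
  - rewrite (_ : _ @^-1` _ = `[(q - b) / a, (p - b) / a[%classic); last first.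
      apply/seteqP; split => x /=; rewrite !in_itv /= ler_ndivrMr // ltr_ndivlMr // (mulrC x) lerBrDr ltrBlDr => /andP[-> ->] //.
    rewrite !lebesgue_measure_itv /= !lte_fin ltr_ndivrMr // divfK // ltrD2r.
    case: ifP => _; last by rewrite mule0.
    rewrite -!EFinB -EFinM ltr0_norm //; congr EFin; field; lra.
  - rewrite (_ : _ @^-1` _ = `](p - b) / a, (q - b) / a]%classic); last first.
      apply/seteqP; split => x /=; rewrite !in_itv /= ler_pdivlMr // ltr_pdivrMr // (mulrC x) lerBrDr ltrBlDr => /andP[-> ->] //.
    rewrite !lebesgue_measure_itv /= !lte_fin ltr_pdivrMr // divfK // ?gt_eqF // ltrD2r.
    case: ifP => _; last by rewrite mule0.
    rewrite -!EFinB -EFinM gtr0_norm //; congr EFin; field; lra.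
rewrite [in RHS](eq_measure_integral (mscale k (pushforward leb (fun x : measurableTypeR R => a * x + b : measurableTypeR R)))); last by move=> A mA _; apply: H.
rewrite ge0_integral_mscale // ge0_integral_pushforward // muleA -EFinM /= mulVf ?normr_eq0 //.
by rewrite mul1e.
Qed.

Lemma fst_int (F : plane -> \bar R) : measurable_fun setT F -> (forall x, 0 <= F x)%E ->
  (\int[dA]_x F x = \int[leb]_x \int[leb]_y F (x, y))%E.
Proof. by move=> mF F0; rewrite /mA fubini_tonelli1. Qed.

Lemma snd_int (F : plane -> \bar R) : measurable_fun setT F -> (forall x, 0 <= F x)%E ->
  (\int[dA]_x F x = \int[leb]_y \int[leb]_x F (x, y))%E.
Proof. by move=> mF F0; rewrite /mA fubini_tonelli2. Qed.

Lemma dA_shear1 (s : R) (F : plane -> \bar R) : measurable_fun setT F -> (forall x, 0 <= F x)%E ->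
  (\int[dA]_x F (x.1 + s * x.2, x.2)%R = \int[dA]_x F x)%E.
Proof.
move=> mF F0.
have mF' : measurable_fun setT (fun x : plane => F (x.1 + s * x.2, x.2)).
  apply: (measurableT_comp mF); apply: measurable_fun_pair => //.
  by apply: measurable_funD => //; apply: measurable_funM.
rewrite (snd_int mF' (fun=> F0 _)) (snd_int mF F0).
apply: eq_integral => y _.
have := @ge0_integral_affine 1 (s * y) (fun x => F (x, y)) (oner_neq0 _).
under eq_integral do rewrite mul1r.
rewrite normr1 invr1 mul1e /=; apply => //.
exact: measurableT_comp.
Qed.

Lemma dA_shear2 (s : R) (F : plane -> \bar R) : measurable_fun setT F -> (forall x, 0 <= F x)%E ->
  (\int[dA]_x F (x.1, x.2 + s * x.1)%R = \int[dA]_x F x)%E.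
Proof.
move=> mF F0.
have mF' : measurable_fun setT (fun x : plane => F (x.1, x.2 + s * x.1)).
  apply: (measurableT_comp mF); apply: measurable_fun_pair => //.
  by apply: measurable_funD => //; apply: measurable_funM.
rewrite (fst_int mF' (fun=> F0 _)) (fst_int mF F0).
apply: eq_integral => x _.
have := @ge0_integral_affine 1 (s * x) (fun y => F (x, y)) (oner_neq0 _).
under eq_integral do rewrite mul1r.
rewrite normr1 invr1 mul1e /=; apply => //.
exact: measurableT_comp.
Qed.

Lemma dA_diag (p q b1 b2 : R) (F : plane -> \bar R) : p != 0 -> q != 0 ->
  measurable_fun setT F -> (forall x, 0 <= F x)%E ->
  (\int[dA]_x F (p * x.1 + b1, q * x.2 + b2)%R = (`|p * q|^-1)%:E * \int[dA]_x F x)%E.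
Proof.
move=> p0 q0 mF F0.
have mF' : measurable_fun setT (fun x : plane => F (p * x.1 + b1, q * x.2 + b2)).
  apply: (measurableT_comp mF); apply: measurable_fun_pair => //;
  by apply: measurable_funD => //; apply: measurable_funM.
rewrite (fst_int mF' (fun=> F0 _)) (fst_int mF F0).
transitivity (\int[leb]_x ((`|q|^-1)%:E * \int[leb]_y F ((p * x + b1)%R, y)))%E.
  apply: eq_integral => x _.
  apply: (@ge0_integral_affine q b2 (fun y => F (p * x + b1, y))) => //.
  exact: measurableT_comp.
have mG : measurable_fun setT (fun x => \int[leb]_y F (x, y))%E.
  exact: (@measurable_fun_fubini_tonelli_F _ _ (measurableTypeR R) (measurableTypeR R) R leb F mF F0).
have G0 x : (0 <= \int[leb]_y F (x, y))%E by apply: integral_ge0.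
have mG' : measurable_fun setT (fun x : measurableTypeR R => \int[leb]_y F ((p * x + b1)%R, y))%E.
  apply: (measurableT_comp (f := fun x => \int[leb]_y F (x, y))%E) => //.
  by apply: measurable_funD => //; apply: measurable_funM.
rewrite ge0_integralZl; [|exact: measurableT|exact: mG'|by move=> x _; exact: G0|by rewrite lee_fin invr_ge0].
rewrite (@ge0_integral_affine p b1 (fun x => \int[leb]_y F (x, y))%E) //.
by rewrite muleA -EFinM normrM invfM mulrC.
Qed.

Definition meC (F : C -> \bar R) := measurable_fun setT (fun x : plane => F (toC x)).

Lemma meC_comp d (T : measurableType d) F (g : T -> C) : meC F -> cmeas g ->
  measurable_fun setT (fun x => F (g x)).
Proof. exact: measurable_compC. Qed.

Lemma dA_reflect (c : C) (F : C -> \bar R) : meC F -> (forall x, 0 <= F x)%E ->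
  (\int[dA]_x F (c - toC x)%R = \int[dA]_x F (toC x))%E.
Proof.
move=> mF F0; have := @dA_diag (-1) (-1) (cre c) (cim c) (fun x => F (toC x)).
rewrite oppr_eq0 oner_eq0 mulrNN mul1r normr1 invr1 mul1e => <- //.
apply: eq_integral => x _; congr F; apply: ceqP; rewrite ?creB ?cimB /=; ring.
Qed.

(** For u nonzero, multiplication by u + iv is a shear, then the diagonal map (u, u + v^2 / u), then
    another shear; the determinant is u^2 + v^2. *)
Lemma dA_scale (c : C) (F : C -> \bar R) : c != 0 -> meC F -> (forall x, 0 <= F x)%E ->
  (\int[dA]_x F (c * toC x)%R = (cabs c ^- 2)%:E * \int[dA]_x F (toC x))%E.
Proof.
have main (c' : C) (G : C -> \bar R) : cre c' != 0 -> meC G -> (forall x, 0 <= G x)%E ->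
  (\int[dA]_x G (c' * toC x)%R = (cabs c' ^- 2)%:E * \int[dA]_x G (toC x))%E.
  case: c' => u v /= u0 mG G0; pose q := u + v ^+ 2 / u.
  have q0 : q != 0.
    rewrite /q -[u in u + _](mulfK u0) -mulrDl mulf_neq0 ?invr_eq0 // gt_eqF //.
    by rewrite ltr_wpDr ?sqr_ge0 // -expr2 lt_neqAle sqr_ge0 eq_sym sqrf_eq0 u0.
  pose G1 (x : plane) := G (toC (x.1, x.2 + v / u * x.1)).
  have mG1 : measurable_fun setT G1.
    apply: (measurableT_comp mG); apply: measurable_fun_pair => //.
    by apply: measurable_funD => //; apply: measurable_funM.
  pose G2 (x : plane) := G1 (u * x.1 + 0, q * x.2 + 0).
  have mG2 : measurable_fun setT G2.
    apply: (measurableT_comp mG1); apply: measurable_fun_pair => //;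
    by apply: measurable_funD => //; apply: measurable_funM.
  have := @dA_shear1 (- v / u) G2 mG2 (fun=> G0 _).
  rewrite /G2 (dA_diag 0 0 u0 q0 mG1 (fun=> G0 _)) => h.
  rewrite (_ : \int[dA]_x G (toC x) = \int[dA]_x G1 x)%E; last first.
    by rewrite -(dA_shear2 (v / u) mG).
  rewrite (_ : cabs (u +i* v) ^- 2 = `|u * q|^-1); last first.
    rewrite cabs_sqr /= /q mulrDr (mulrC u (_ / _)) divfK // -expr2 ger0_norm //.
    by rewrite addr_ge0 ?sqr_ge0.
  rewrite -h; apply: eq_integral => x _; congr G; rewrite /q /=.
  by apply: ceqP; rewrite ?creM ?cimM /=; field.
move=> c0 mF F0; have [r0|] := eqVneq (cre c) 0; last by move=> ?; apply: main.
have i0 : cim c != 0 by apply: contraNneq c0 => i0; apply/eqP; apply: ceqP.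
(* A purely imaginary c is factored as c / (1 + i) times 1 + i, both of nonzero real part. *)
pose e : C := 1 +i* 1; have e1 : cre e != 0 by rewrite /= oner_eq0.
have e0 : e != 0 by apply: contraNneq e1 => ->.
have ce : cre (c / e) != 0.
  rewrite (_ : c / e = (cim c / 2) +i* (cim c / 2)); first by rewrite /= mulf_neq0 // invr_eq0 pnatr_eq0.
  by apply: (mulIf e0); rewrite mulfVK //; apply: ceqP; rewrite ?creM ?cimM /= ?r0; field.
pose G x := F (c / e * x).
have mG : meC G by apply: (meC_comp mF); apply: cmeasM; [exact: cmeas_cst|exact: cmeas_toC].
have := main e G e1 mG (fun=> F0 _).
have hc : cabs e ^- 2 * cabs (c / e) ^- 2 = cabs c ^- 2.
  by rewrite -invfM -exprMn -cabsM mulrC divfK.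
rewrite /G main // muleA -EFinM hc.
by move=> <-; apply: eq_integral => x _; rewrite mulrA divfK.
Qed.

End PlaneMeasure.

Section NonnegIntegral.
Variable R : realType.
Local Open Scope ereal_scope.

Lemma ge0_intZl d (T : measurableType d) (mu : {measure set T -> \bar R}) (k : \bar R) (f : T -> \bar R) :
  measurable_fun setT f -> (forall x, 0 <= f x) -> 0 <= k ->
  \int[mu]_x (k * f x) = k * \int[mu]_x f x.
Proof. by move=> mf f0 k0; rewrite ge0_integralZl. Qed.

Lemma ge0_intZr d (T : measurableType d) (mu : {measure set T -> \bar R}) (k : \bar R) (f : T -> \bar R) :
  measurable_fun setT f -> (forall x, 0 <= f x) -> 0 <= k ->
  \int[mu]_x (f x * k) = \int[mu]_x f x * k.
Proof. by move=> mf f0 k0; rewrite ge0_integralZr. Qed.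

Lemma le_int d (T : measurableType d) (mu : {measure set T -> \bar R}) (f g : T -> \bar R) :
  measurable_fun setT f -> measurable_fun setT g -> (forall x, 0 <= f x) -> (forall x, f x <= g x) ->
  \int[mu]_x f x <= \int[mu]_x g x.
Proof. by move=> mf mg f0 fg; apply: ge0_le_integral. Qed.

Lemma tonelli d1 d2 (T1 : measurableType d1) (T2 : measurableType d2)
  (m1 : {sigma_finite_measure set T1 -> \bar R}) (m2 : {sigma_finite_measure set T2 -> \bar R})
  (f : T1 -> T2 -> \bar R) : measurable_fun setT (fun z : T1 * T2 => f z.1 z.2) ->
  (forall x y, 0 <= f x y) -> \int[m1]_x \int[m2]_y f x y = \int[m2]_y \int[m1]_x f x y.
Proof.
by move=> mf f0; apply: (fubini_tonelli (fun z : T1 * T2 => f z.1 z.2)).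
Qed.

Lemma measurable_int2 d1 d2 (T1 : measurableType d1) (T2 : measurableType d2)
  (m2 : {sigma_finite_measure set T2 -> \bar R})
  (f : T1 -> T2 -> \bar R) : measurable_fun setT (fun z : T1 * T2 => f z.1 z.2) ->
  (forall x y, 0 <= f x y) -> measurable_fun setT (fun x => \int[m2]_y f x y).
Proof.
by move=> mf f0; apply: (measurable_fun_fubini_tonelli_F (fun z : T1 * T2 => f z.1 z.2)).
Qed.
End NonnegIntegral.

(** In the infinite cases [fine] returns 0 on both sides. This lets a change of variables act on
    [CI] for every measurable function. *)
Lemma fineZB (R : realType) (k : R) (a b : \bar R) : 0 < k -> (0 <= a)%E -> (0 <= b)%E ->
  fine (k%:E * a - k%:E * b)%E = k * fine (a - b)%E.
Proof.
move=> k0; case: a => [a| |] // a0; case: b => [b| |] // b0.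
- by rewrite -!EFinM -!EFinB /= mulrBr.
- by rewrite gt0_muley ?lte_fin //= mulr0.
- by rewrite gt0_muley ?lte_fin //= mulr0.
- by rewrite gt0_muley ?lte_fin //= mulr0.
Qed.

(** * From nonnegative changes of variables to complex integrals *)

Section Transfer.
Variable R : realType.
Local Notation C := R[i].
Context d (T : measurableType d) (mu : {measure set T -> \bar R}).
Variables (phi : T -> T) (w : T -> R) (k : R).
Hypotheses (w0 : forall x, 0 <= w x) (k0 : 0 < k).
Hypothesis H : forall G : T -> \bar R, measurable_fun setT G -> (forall x, 0 <= G x)%E ->
  (\int[mu]_x ((w x)%:E * G (phi x)) = k%:E * \int[mu]_x G x)%E.

Lemma Rintegral_transfer (g : T -> R) : measurable_fun setT g ->
  Rintegral mu setT (fun x => w x * g (phi x)) = k * Rintegral mu setT g.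
Proof.
move=> mg; have mg' : measurable_fun setT (EFin \o g) by apply/measurable_EFinP.
have e1 : (\int[mu]_x (fun y => (w y * g (phi y))%:E)^\+ x = k%:E * \int[mu]_x (EFin \o g)^\+ x)%E.
  rewrite -H //; last exact: measurable_funepos.
  apply: eq_integral => x _; rewrite !funeposE /= -!EFin_max -EFinM; congr EFin.
  by rewrite maxr_pMr ?mulr0.
have e2 : (\int[mu]_x (fun y => (w y * g (phi y))%:E)^\- x = k%:E * \int[mu]_x (EFin \o g)^\- x)%E.
  rewrite -H //; last exact: measurable_funeneg.
  apply: eq_integral => x _; rewrite !funenegE /= -?EFinN -!EFin_max -EFinM; congr EFin.
  by rewrite maxr_pMr ?mulr0 // mulrN.
rewrite /Rintegral [in LHS]integralE e1 e2 fineZB //; try exact: integral_ge0.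
by congr (_ * fine _); rewrite [RHS]integralE.
Qed.

Lemma CI_transfer (f : T -> C) : cmeas f ->
  CI mu (fun x => (w x)%:C * f (phi x)) = k%:C * CI mu f.
Proof.
move=> [f1 f2]; apply: ceqP; rewrite ?creRM ?cimRM /CI /=.
- by rewrite -(Rintegral_transfer f1); under eq_Rintegral do rewrite creRM.
- by rewrite -(Rintegral_transfer f2); under eq_Rintegral do rewrite cimRM.
Qed.
End Transfer.

(** * The inversion t -> 1 / t, through Haar measure *)

Section PlaneTransfer.
Variable R : realType.
Local Notation C := R[i].
Local Notation leb := (leb R).
Local Notation plane := (measurableTypeR R * measurableTypeR R)%type.
Local Notation dA := (mA R).

Lemma CI_scale (c : C) (F : C -> C) : c != 0 -> cmeasC F ->
  CI dA (fun x => F (c * toC x)) = (cabs c ^- 2)%:C * CI dA (fun x => F (toC x)).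
Proof.
move=> c0 mF; rewrite -(@CI_transfer _ _ _ dA (fun x => ofC (c * toC x)) (fun=> 1)) //.
- by apply: eq_CI => x; rewrite ofCK mul1r.
- by rewrite invr_gt0 exprn_gt0 // cabs_gt0.
- move=> G mG G0; under eq_integral do rewrite mul1e.
  rewrite (@dA_scale _ c (fun w => G (ofC w))) //; last first.
    by rewrite /meC (_ : (fun x => _) = G) //; apply/funext => x; rewrite toCK.
  by congr (_ * _)%E; apply: eq_integral => x _; rewrite toCK.
Qed.

(** Density of the Haar measure of the multiplicative group with respect to area. Its value at 0 is
    0, the inverse of 0 being 0, so the origin drops out. *)
Let w2 (t : C) : R := cabs t ^- 2.

Let w2_ge0 t : (0 <= (w2 t)%:E)%E.
Proof. by rewrite lee_fin /w2 invr_ge0 exprn_ge0 // cabs_ge0. Qed.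

Let w2M c t : w2 (c * t) = w2 c * w2 t.
Proof. by rewrite /w2 cabsM exprMn invfM. Qed.

Let w20 : w2 0 = 0. Proof. by rewrite /w2 cabs0 expr0n invr0. Qed.

Let measurable_w2 d (T : measurableType d) (f : T -> C) : cmeas f ->
  measurable_fun setT (fun x => (w2 (f x))%:E).
Proof.
move=> mf; apply/measurable_EFinP.
rewrite (_ : (fun x => _) = (fun x => cre (((cabs (f x))%:C ^+ 2)^-1))).
  by apply: cmeas_re; apply: cmeasV; apply: cmeas_exp; apply: cmeas_real; apply: cmeas_abs.
by apply/funext => x; rewrite -rmorphXn -fmorphV.
Qed.

Let haar (c : C) (G : C -> \bar R) : c != 0 -> meC G -> (forall x, 0 <= G x)%E ->
  (\int[dA]_x (G (c * toC x)%R * (w2 (toC x))%:E) = \int[dA]_x (G (toC x) * (w2 (toC x))%:E))%E.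
Proof.
move=> c0 mG G0; have cc : 0 < cabs c ^+ 2 by rewrite exprn_gt0 // cabs_gt0.
have m1 : meC (fun u => G u * (w2 u)%:E)%E.
  by apply: emeasurable_funM => //; apply: measurable_w2; apply: cmeas_toC.
have g0 x : (0 <= G x * (w2 x)%:E)%E by apply: mule_ge0.
have := @dA_scale _ c (fun u => (cabs c ^+ 2)%:E * (G u * (w2 u)%:E))%E c0 (measurable_funeM _ m1)
  (fun x => mule_ge0 (ltW cc : (0 <= (cabs c ^+ 2)%:E)%E) (g0 x)).
rewrite [in X in _ = X -> _]ge0_intZl; [|exact: m1|by move=> x; exact: g0|by rewrite lee_fin ltW].
rewrite muleA -EFinM mulVf ?gt_eqF // mul1e => <-.
have hc : cabs c ^+ 2 * w2 c = 1 by rewrite /w2 mulfV // gt_eqF.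
apply: eq_integral => x _; rewrite muleCA; congr (_ * _)%E.
by rewrite w2M -EFinM mulrA hc mul1r.
Qed.

(** A test function of positive finite Haar mass: on its support |t|^2 lies between 1 and 5, whence
    the bounds 1 / 5 and 1 in [rect_w2]. *)
Let rect (t : C) : \bar R := ((1 <= cre t <= 2) && (0 <= cim t <= 1))%:R%:E.

Let rect_ge0 t : (0 <= rect t)%E. Proof. by rewrite lee_fin ler0n. Qed.

Let rectE x : rect (toC x) = (\1_(`[1, 2]%classic `*` `[0, 1]%classic) x)%:E.
Proof.
rewrite /rect indicE; congr (_%:R)%:E; congr nat_of_bool; apply/idP/idP.
  by move=> /andP[h1 h2]; rewrite inE; split; rewrite /= in_itv.
by rewrite inE => -[/=]; rewrite !in_itv /= => -> ->.
Qed.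

Let mrect : meC rect.
Proof.
rewrite /meC; under eq_fun do rewrite rectE.
by apply/measurable_EFinP; apply: measurable_indic; apply: measurableX.
Qed.

Let int_rect : (\int[dA]_x rect (toC x) = 1)%E.
Proof.
under eq_integral do rewrite rectE.
rewrite integral_indic ?setIT //; last by apply: measurableX.
transitivity (lebesgue_measure (`[1%R, 2%R]%classic : set (measurableTypeR R)) * lebesgue_measure (`[0%R, 1%R]%classic : set (measurableTypeR R)))%E; first exact: mA_rect.
rewrite !lebesgue_measure_itv /= !lte_fin ltr01 ltr1n.
by rewrite -!EFinB -EFinM; congr EFin; ring.
Qed.

Let rect_w2 : exists2 a : R, 0 < a & (\int[dA]_x (rect (toC x) * (w2 (toC x))%:E) = a%:E)%E.
Proof.
have m1 : measurable_fun setT (fun x => rect (toC x) * (w2 (toC x))%:E)%E.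
  by apply: emeasurable_funM => //; apply: measurable_w2; apply: cmeas_toC.
have up : (\int[dA]_x (rect (toC x) * (w2 (toC x))%:E) <= 1)%E.
  rewrite -int_rect; apply: le_int => // x; first exact: mule_ge0.
  rewrite /rect; case: andP => /= [[/andP[h1 h2] /andP[h3 h4]]|_]; last by rewrite mul0e.
  rewrite mul1e lee_fin /w2 cabs_sqr /= invf_le1; nra.
have lo : ((1 / 5)%:E <= \int[dA]_x (rect (toC x) * (w2 (toC x))%:E))%E.
  rewrite (_ : (1 / 5)%:E = (1 / 5)%:E * \int[dA]_x rect (toC x))%E; last by rewrite int_rect mule1.
  rewrite -ge0_intZl; [|exact: mrect|by move=> x|by rewrite lee_fin; lra].
  apply: le_int => // [|x|x]; first exact: measurable_funeM.
    by apply: mule_ge0 => //; rewrite lee_fin; lra.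
  rewrite /rect; case: andP => /= [[/andP[h1 h2] /andP[h3 h4]]|_]; last by rewrite mul0e mule0.
  by rewrite mul1e mule1 lee_fin /w2 cabs_sqr /= div1r lef_pV2 ?posrE; nra.
have fn : (\int[dA]_x (rect (toC x) * (w2 (toC x))%:E) \is a fin_num)%E.
  by rewrite ge0_fin_numE ?(le_lt_trans up) ?ltry // integral_ge0 // => x _; apply: mule_ge0.
exists (fine (\int[dA]_x (rect (toC x) * (w2 (toC x))%:E))); last by rewrite fineK.
by rewrite -lte_fin fineK // (lt_le_trans _ lo) // lte_fin; lra.
Qed.

(** Uniqueness of Haar measure by hand. The left side times the mass of [rect] is a double integral
    of G(1 / y) rect(x); replacing x by y x, then y by y / x, then x by x y, with Tonelli in
    between, moves the inversion away from G. *)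
Let haar_inv (G : C -> \bar R) : meC G -> (forall x, 0 <= G x)%E ->
  (\int[dA]_x (G (toC x)^-1%R * (w2 (toC x))%:E) = \int[dA]_x (G (toC x) * (w2 (toC x))%:E))%E.
Proof.
move=> mG G0; have [a a0 ha] := rect_w2.
have mT := @cmeas_toC R.
have mt1 : cmeas (fun z : plane * plane => toC z.1) by apply: (cmeas_comp mT); apply: measurable_fst.
have mt2 : cmeas (fun z : plane * plane => toC z.2) by apply: (cmeas_comp mT); apply: measurable_snd.
suff: (\int[dA]_x (G (toC x)^-1%R * (w2 (toC x))%:E) * a%:E = \int[dA]_x (G (toC x) * (w2 (toC x))%:E) * a%:E)%E.
  move/(congr1 (fun u => u * (a^-1)%:E)%E); rewrite -!muleA -!EFinM mulfV ?gt_eqF //.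
  by rewrite !mule1.
have mGi : measurable_fun setT (fun x => G (toC x)^-1%R * (w2 (toC x))%:E)%E.
  by apply: emeasurable_funM; [apply: (meC_comp mG); apply: cmeasV|apply: measurable_w2].
have mrw : measurable_fun setT (fun x => rect (toC x) * (w2 (toC x))%:E)%E.
  by apply: emeasurable_funM => //; apply: measurable_w2.
have rw0 : (0 <= \int[dA]_x (rect (toC x) * (w2 (toC x))%:E))%E.
  by apply: integral_ge0 => x _; apply: mule_ge0.
have Gw0 : (0 <= \int[dA]_x (G (toC x) * (w2 (toC x))%:E))%E.
  by apply: integral_ge0 => x _; apply: mule_ge0.
have AC (u1 u2 u3 u4 : \bar R) : (u1 * u2 * (u3 * u4) = u4 * (u3 * u1 * u2))%E.
  by rewrite [RHS]muleC -!muleA [RHS]muleCA; congr (_ * _)%E; rewrite muleCA.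
rewrite -ha -ge0_intZr; [|exact: mGi|by move=> x; apply: mule_ge0|exact: rw0].
transitivity (\int[dA]_y \int[dA]_x (G (toC y)^-1%R * (w2 (toC y))%:E * (rect (toC y * toC x)%R * (w2 (toC x))%:E)))%E.
  apply: eq_integral => y _; rewrite ge0_intZl; last 3 first.
  - apply: emeasurable_funM; [|by apply: measurable_w2].
    by apply: (meC_comp mrect); apply: cmeasM => //; apply: cmeas_cst.
  - by move=> x; apply: mule_ge0.
  - by apply: mule_ge0.
  have [y0|y0] := eqVneq (toC y) 0; first by rewrite y0 w20 mule0 !mul0e.
  by congr (_ * _)%E; rewrite (haar y0 mrect).
rewrite (tonelli dA dA (f := fun y x => G (toC y)^-1%R * (w2 (toC y))%:E * (rect (toC y * toC x)%R * (w2 (toC x))%:E))%E); last first.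
- by move=> x y; do ?apply: mule_ge0.
- apply: emeasurable_funM; apply: emeasurable_funM.
  + by apply: (meC_comp mG); apply: cmeasV.
  + exact: measurable_w2.
  + by apply: (meC_comp mrect); apply: cmeasM.
  + exact: measurable_w2.
transitivity (\int[dA]_x \int[dA]_y (rect (toC y) * (w2 (toC y))%:E * (G ((toC y)^-1 * toC x)%R * (w2 (toC x))%:E)))%E.
  apply: eq_integral => x _.
  have [x0|x0] := eqVneq (toC x) 0.
    by rewrite x0 w20; under eq_integral do rewrite !mule0; under [RHS]eq_integral do rewrite !mule0.
  have mP : meC (fun u => rect u * G (toC x / u)%R)%E.
    apply: emeasurable_funM => //; apply: (meC_comp mG).
    by apply: cmeasM; [exact: cmeas_cst|apply: cmeasV].
  have h1 : measurable_fun setT (fun y => rect (toC x * toC y)%R * G (toC x / (toC x * toC y))%R * (w2 (toC y))%:E)%E.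
    apply: emeasurable_funM; last exact: measurable_w2.
    by apply: (meC_comp mP); apply: cmeasM => //; apply: cmeas_cst.
  have h2 : measurable_fun setT (fun y => rect (toC y) * G (toC x / toC y)%R * (w2 (toC y))%:E)%E.
    by apply: emeasurable_funM; last exact: measurable_w2.
  have := haar x0 mP (fun u => mule_ge0 (rect_ge0 u) (G0 _)).
  move/(congr1 (fun u => (w2 (toC x))%:E * u)%E).
  rewrite -ge0_intZl; [|exact: h1|by move=> y; do ?apply: mule_ge0|exact: w2_ge0].
  rewrite -ge0_intZl; [|exact: h2|by move=> y; do ?apply: mule_ge0|exact: w2_ge0].
  move=> h; transitivity (\int[dA]_y ((w2 (toC x))%:E * (rect (toC x * toC y)%R * G (toC x / (toC x * toC y))%R * (w2 (toC y))%:E)))%E.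
    apply: eq_integral => y _; rewrite invfM (mulVKf x0) (mulrC (toC y)).
    exact: AC.
  rewrite h; apply: eq_integral => y _; rewrite (mulrC _^-1) muleC -!muleA; congr (_ * _)%E.
  by rewrite muleCA.
rewrite (tonelli dA dA (f := fun x y => rect (toC y) * (w2 (toC y))%:E * (G ((toC y)^-1 * toC x)%R * (w2 (toC x))%:E))%E); last first.
- by move=> x y; do ?apply: mule_ge0.
- apply: emeasurable_funM; apply: emeasurable_funM.
  + exact: (meC_comp mrect).
  + exact: measurable_w2.
  + by apply: (meC_comp mG); exact: (cmeasM (cmeasV mt2) mt1).
  + exact: measurable_w2.
rewrite muleC -ge0_intZr; [|exact: mrw|by move=> x; apply: mule_ge0|exact: Gw0].
apply: eq_integral => y _.
have [y0|y0] := eqVneq (toC y) 0.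
  by rewrite y0 w20; under eq_integral do rewrite mule0 mul0e; rewrite integral0 mule0 mul0e.
rewrite ge0_intZl; last 3 first.
- apply: emeasurable_funM; last exact: measurable_w2.
  by apply: (meC_comp mG); apply: cmeasM => //; apply: cmeas_cst.
- by move=> x; apply: mule_ge0.
- by apply: mule_ge0.
by rewrite (haar _ mG) ?invr_eq0.
Qed.

(** Invariance of Haar measure, applied to |u|^2 G(u), produces the Jacobian |t|^-4. *)
Lemma dA_inv (G : C -> \bar R) : meC G -> (forall x, 0 <= G x)%E ->
  (\int[dA]_x ((cabs (toC x) ^- 4)%:E * G (toC x)^-1%R) = \int[dA]_x (if toC x == 0%R then 0 else G (toC x)))%E.
Proof.
move=> mG G0; have mT := @cmeas_toC R.
have mH : meC (fun u => (w2 u^-1)%:E * G u)%E.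
  by apply: emeasurable_funM => //; apply: measurable_w2; apply: cmeasV.
have := haar_inv mH (fun u => mule_ge0 (w2_ge0 _) (G0 _)); rewrite /=.
move=> h; transitivity (\int[dA]_x ((w2 (toC x)^-1^-1)%:E * G (toC x)^-1%R * (w2 (toC x))%:E))%E.
  apply: eq_integral => x _; rewrite muleAC -EFinM invrK; congr (_%:E * _)%E.
  by rewrite /w2 -invfM -exprD.
rewrite h; apply: eq_integral => x _; case: eqP => [->|/eqP x0]; first by rewrite w20 mule0.
have e : w2 (toC x)^-1 * w2 (toC x) = 1.
  by rewrite /w2 cabsV exprVn invrK; apply: mulfV; apply: expf_neq0; rewrite cabs_eq0.
by rewrite muleAC -EFinM e mul1e.
Qed.

Lemma ae_toC_neq (c : C) : aeM dA (fun x => toC x != c).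
Proof.
exists (([set cre c] : set (measurableTypeR R)) `*` ([set cim c] : set (measurableTypeR R))); split.
- by apply: measurableX.
- transitivity (lebesgue_measure [set cre c] * lebesgue_measure [set cim c])%E; first exact: mA_rect.
  by rewrite lebesgue_measure_set1 mul0e.
- by move=> x /= /negP; rewrite negbK => /eqP <-.
Qed.

Lemma CI_inv (F : C -> C) : cmeasC F ->
  CI dA (fun x => (cabs (toC x) ^- 4)%:C * F (toC x)^-1) = CI dA (fun x => F (toC x)).
Proof.
move=> mF; rewrite -[RHS]mul1r -[1 in RHS]/((1 : R)%:C) -(@CI_transfer _ _ _ dA (fun x => ofC (toC x)^-1) (fun x => cabs (toC x) ^- 4)) //.
- by move=> x; rewrite invr_ge0 exprn_ge0 // cabs_ge0.
- move=> G mG G0; rewrite (@dA_inv (fun w => G (ofC w))) //; last first.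
    by rewrite /meC (_ : (fun x => _) = G) //; apply/funext => x; rewrite toCK.
  rewrite mul1e; apply: ae_eq_integral => //.
    apply: measurable_fun_ifT => //; first exact/measurable_ceq0/cmeas_toC.
    by rewrite (_ : (fun x => _) = G) //; apply/funext => x; rewrite toCK.
  by apply: (aeM_imp (ae_toC_neq 0)) => x /= /negbTE -> _; rewrite toCK.
Qed.
End PlaneTransfer.

(** * Estimates for exp, sin and cos near 0 *)

Section CexpBounds.
Variable R : realType.
Local Notation C := R[i].

Lemma expR_bound (x : R) : `|x| <= 1 / 2 -> `|expR x - 1 - x| <= 2 * x ^+ 2.
Proof.
move=> hx; have [h1 h2] : - (1 / 2) <= x /\ x <= 1 / 2 by move: hx; rewrite ler_norml => /andP[].
have lo := expR_ge1Dx x; have lo' := expR_ge1Dx (- x).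
have e : expR x * expR (- x) = 1 by rewrite -expRD subrr expR0.
have ep := expR_gt0 x.
have up : expR x * (1 - x) <= expR x * expR (- x) by rewrite ler_wpM2l // ltW.
rewrite e in up.
rewrite ger0_norm; nra.
Qed.

Lemma sin_le_norm (x : R) : `|sin x| <= `|x|.
Proof.
have main (y : R) : 0 < y -> `|sin y| <= y.
  move=> y0.
  have hd (z : R) : z \in `]0, y[%R -> is_derive z 1 (@sin R) (cos z) by move=> _; apply: is_derive_sin.
  have hc : {within `[0, y], continuous (@sin R)} by apply: continuous_subspaceT => z; apply: continuous_sin.
  have [c _] := MVT y0 hd hc.
  rewrite sin0 !subr0 => ->; rewrite normrM (gtr0_norm y0) ler_piMl ?(ltW y0) //.
  exact: cos_max.
have [h|h|->] := ltgtP x 0; last by rewrite sin0 normr0.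
- by rewrite -normrN -sinN (ltr0_norm h) main // oppr_gt0.
- by rewrite (gtr0_norm h) main.
Qed.

Lemma cos_bound (x : R) : `|cos x - 1| <= x ^+ 2 / 2.
Proof.
have -> : cos x = 1 - 2 * sin (x / 2) ^+ 2.
  rewrite {1}(_ : x = x / 2 + x / 2); last by field.
  by rewrite cosD; have := cos2Dsin2 (x / 2); rewrite !expr2 => h; lra.
have h := sin_le_norm (x / 2).
have h2 : sin (x / 2) ^+ 2 <= (x / 2) ^+ 2.
  by rewrite -(real_normK (num_real (sin _))) -(real_normK (num_real (x / 2))) lerXn2r ?nnegrE.
have h3 := sqr_ge0 (sin (x / 2)).
rewrite ler_norml; apply/andP; split; lra.
Qed.

Lemma sin_bound (x : R) : `|sin x - x| <= `|x| * (x ^+ 2 / 2).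
Proof.
have main (y : R) : 0 < y -> `|sin y - y| <= y * (y ^+ 2 / 2).
  move=> y0.
  have hd (z : R) : z \in `]0, y[%R -> is_derive z 1 (fun z => sin z - z) (cos z - 1).
    by move=> _; apply: is_deriveB.
  have hs : {within `[0, y], continuous (fun z : R => sin z - z)}.
    by apply: continuous_subspaceT => z; apply: cvgB; [apply: continuous_sin|apply: cvg_id].
  have [c hc] := MVT y0 hd hs.
  rewrite sin0 !subr0 => ->; rewrite normrM (gtr0_norm y0) mulrC ler_wpM2l ?(ltW y0) //.
  apply: (le_trans (cos_bound c)); move: hc; rewrite in_itv /= => /andP[c0 cy]; nra.
have [h|h|->] := ltgtP x 0; last by rewrite sin0 subr0 normr0 mul0r.
- have := main (- x); rewrite oppr_gt0 => /(_ h).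
  by rewrite (ltr0_norm h) sqrrN sinN -opprD normrN.
- by rewrite (gtr0_norm h) main.
Qed.

(** Each component is within 3 |u|^2, so the constant 7 leaves slack; only the quadratic order
    matters later. *)
Lemma cexp_bound (u : C) : cabs u <= 1 / 2 -> cabs (cexp u - 1 - u) <= 7 * cabs u ^+ 2.
Proof.
set m := cabs u => hm; have m0 : 0 <= m := cabs_ge0 u.
have hx : `|cre u| <= m := cre_le u; have hy : `|cim u| <= m := cim_le u.
set x := cre u in hx; set y := cim u in hy.
have x2 : x ^+ 2 <= m ^+ 2 by rewrite -(real_normK (num_real x)) lerXn2r ?nnegrE.
have y2 : y ^+ 2 <= m ^+ 2 by rewrite -(real_normK (num_real y)) lerXn2r ?nnegrE.
have hA : `|expR x - 1 - x| <= 2 * m ^+ 2 by apply: (le_trans (expR_bound _)); lra.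
have hB : `|cos y - 1| <= m ^+ 2 / 2 by apply: (le_trans (cos_bound y)); lra.
have hD : `|sin y - y| <= m ^+ 2 / 4.
  apply: (le_trans (sin_bound y)); have : `|y| * (y ^+ 2 / 2) <= m * (m ^+ 2 / 2).
    by apply: ler_pM => //; rewrite ?divr_ge0 ?sqr_ge0 //; lra.
  nra.
set A := expR x - 1 - x in hA; set B := cos y - 1 in hB; set D := sin y - y in hD.
have hE : `|expR x| <= 2.
  rewrite (_ : expR x = 1 + x + A); last by rewrite /A; ring.
  have := ler_normD (1 + x) A; have := ler_normD 1 x; rewrite normr1; nra.
have re : `|cre (cexp u - 1 - u)| <= 3 * m ^+ 2.
  rewrite (_ : cre _ = A + expR x * B); last by rewrite /cexp !creB creRM /= -/x -/y /A /B; ring.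
  apply: (le_trans (ler_normD _ _)); rewrite normrM.
  have := ler_pM (normr_ge0 _) (normr_ge0 _) hE hB; nra.
have im : `|cim (cexp u - 1 - u)| <= 3 * m ^+ 2.
  rewrite (_ : cim _ = (x + A) * y + expR x * D); last by rewrite /cexp !cimB cimRM /= -/x -/y /A /D; ring.
  apply: (le_trans (ler_normD _ _)); rewrite !normrM.
  have h1 : `|x + A| <= m + 2 * m ^+ 2 by apply: (le_trans (ler_normD _ _)); lra.
  have := ler_pM (normr_ge0 _) (normr_ge0 _) hE hD.
  have := ler_pM (normr_ge0 _) (normr_ge0 _) h1 hy; nra.
by apply: (le_trans (cabs_le _)); have := sqr_ge0 m; lra.
Qed.

Lemma cexp_lip (u : C) : cabs u <= 1 / 2 -> cabs (cexp u - 1) <= 5 * cabs u.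
Proof.
move=> h; have := cexp_bound h; have := cabsD (cexp u - 1 - u) u; rewrite subrK.
have := cabs_ge0 u; nra.
Qed.

Lemma cvg_inv_nat (a : R) : (fun n => a / n.+1%:R : R) @ \oo --> (0 : R).
Proof. by rewrite -[X in _ --> X](mulr0 a); apply: cvgMr; apply: cvg_harmonic. Qed.

Lemma near_inv_nat (a : R) : \forall n \near \oo, `|a / n.+1%:R| <= 1 / 2.
Proof.
have /cvgrPdistC_le/(_ (1 / 2)) := cvg_inv_nat a.
have h : (0 : R) < 1 / 2 by lra.
by move=> /(_ h); under eq_near do rewrite subr0.
Qed.

(** Stands in for the derivative of [cexp] at 0 in the functional-equation arguments below. *)
Lemma ccvg_cexp_linear (a : C) : ccvg (fun n => n.+1%:R * (cexp (a / n.+1%:R) - 1)) a.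
Proof.
have h (n : nat) : cabs (a / n.+1%:R) = cabs a / n.+1%:R by rewrite cabsM cabsV cabsn.
apply: (@ccvg_squeeze _ _ _ (fun n => 7 * cabs a ^+ 2 / n.+1%:R)); last exact: cvg_inv_nat.
have := near_inv_nat (cabs a); apply: filterS => n.
rewrite ger0_norm ?divr_ge0 ?cabs_ge0 ?ler0n // -h => /cexp_bound hb.
have n0 : (n.+1%:R : C) != 0 by rewrite pnatr_eq0.
rewrite -[a in _ - a](divfK n0) (mulrC (a / _)) -mulrBr cabsM cabsn.
have nr : (0 : R) < n.+1%:R by rewrite ltr0n.
rewrite mulrC -ler_pdivlMr // (le_trans hb) // h expr_div_n ler_pdivlMr //.
rewrite le_eqVlt; apply/orP; left; apply/eqP; field; rewrite gt_eqF //.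
Qed.
End CexpBounds.

(** * Integrals of powers over annuli *)

Section Annuli.
Variable R : realType.
Local Notation C := R[i].
Local Notation dA := (mA R).
Local Notation plane := (measurableTypeR R * measurableTypeR R)%type.

Definition inA (r X : R) (t : C) := (r <= cabs t) && (cabs t < X).

Lemma measurable_inA d (T : measurableType d) (r X : R) (f : T -> C) : cmeas f ->
  measurable_fun setT (fun x => inA r X (f x)).
Proof.
move=> hf; have ha := cmeas_abs hf.
by apply: measurable_and; [apply: measurable_fun_ler|apply: measurable_fun_ltr].
Qed.

Definition areaA (r X : R) : \bar R := (\int[dA]_x ((inA r X (toC x))%:R)%:E)%E.

Lemma measurable_ind d (T : measurableType d) (P : T -> bool) : measurable_fun setT P ->
  measurable_fun setT (fun x => ((P x)%:R : R)%:E).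
Proof.
move=> mP; apply/measurable_EFinP.
rewrite (_ : (fun x => _) = (fun x => if P x then 1 else 0)).
  exact: measurable_fun_ifT.
by apply/funext => x; case: (P x).
Qed.

Lemma areaA_ge0 r X : (0 <= areaA r X)%E.
Proof. by apply: integral_ge0 => x _; rewrite lee_fin ler0n. Qed.

Lemma areaA_fin r X : areaA r X \is a fin_num.
Proof.
rewrite ge0_fin_numE ?areaA_ge0 //.
pose Q : set plane := (`[- X, X] : set (measurableTypeR R)) `*` (`[- X, X] : set (measurableTypeR R)).
have mQ : measurable Q by apply: measurableX.
apply: (@le_lt_trans _ _ (\int[dA]_x (\1_Q x)%:E)%E).
  apply: le_int.
  - by apply: measurable_ind; apply: measurable_inA; apply: cmeas_toC.
  - by apply/measurable_EFinP; apply: measurable_indic.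
  - by move=> x; rewrite lee_fin ler0n.
  - move=> x; rewrite lee_fin indicE; case h: inA; last by rewrite ler0n.
    rewrite mem_set //; case/andP: h => _ h; split; rewrite /= in_itv /= -ler_norml ltW //.
    + exact: le_lt_trans (cre_le (toC x)) h.
    + exact: le_lt_trans (cim_le (toC x)) h.
rewrite integral_indic ?setIT //.
suff: (mA R Q < +oo)%E by [].
by rewrite mA_rect // !lebesgue_measure_itv /=; case: ifP => _; rewrite ?mule0 ?ltry // -EFinB -EFinM ltry.
Qed.

(** The area of the unit disc, kept as an unknown until [kappa_pi]. *)
Definition kappa : R := fine (areaA 0 1).

Lemma kappa_ge0 : 0 <= kappa. Proof. by rewrite fine_ge0 ?areaA_ge0. Qed.

Lemma areaA0 X : 0 < X -> areaA 0 X = (kappa * X ^+ 2)%:E.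
Proof.
move=> X0; have c0 : (X^-1)%:C != 0 :> C by rewrite -cabs_gt0 cabsR ger0_norm ?invr_ge0 ?ltW // invr_gt0.
have := @dA_scale R (X^-1)%:C (fun t => ((inA 0 1 t)%:R)%:E) c0.
have e : (cabs ((X^-1)%:C : C)) = X^-1 by rewrite cabsR ger0_norm // invr_ge0 ltW.
rewrite e => h; rewrite /areaA.
transitivity (\int[dA]_x (inA 0 1 ((X^-1)%:C * toC x))%:R%:E)%E.
  apply: eq_integral => x _; congr (_%:R)%:E; congr nat_of_bool.
  by rewrite /inA cabsM e !mulr_ge0 ?cabs_ge0 ?invr_ge0 ?ltW //= mulrC ltr_pdivrMr // mul1r.
rewrite h; last 2 first.
- by apply: measurable_ind; apply: measurable_inA; apply: cmeas_toC.
- by move=> x; rewrite lee_fin ler0n.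
rewrite exprVn invrK -/(areaA 0 1) -(fineK (areaA_fin 0 1)) -EFinM -/kappa.
by rewrite mulrC.
Qed.

Lemma areaA_rX r X : 0 < r -> r <= X -> areaA r X = (kappa * (X ^+ 2 - r ^+ 2))%:E.
Proof.
move=> r0 rX; have X0 : 0 < X by apply: lt_le_trans rX.
have mi a b : measurable_fun setT (fun x : plane => (inA a b (toC x))%:R%:E : \bar R).
  by apply: measurable_ind; apply: measurable_inA; apply: cmeas_toC.
have : (areaA 0 X = areaA 0 r + areaA r X)%E.
  rewrite /areaA -ge0_integralD //.
  apply: eq_integral => x _; rewrite -EFinD -natrD; congr (_%:R)%:E.
  rewrite /inA cabs_ge0 /=; case: (ltP (cabs (toC x)) r) => h /=.
    by rewrite (lt_le_trans h rX).
  by rewrite add0n.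
rewrite !areaA0 // -(fineK (areaA_fin r X)) -EFinD => -[h]; congr EFin.
by rewrite mulrBr h addrC addKr.
Qed.

Definition annul (r X : R) (F : C -> C) : C :=
  CI dA (fun x => if inA r X (toC x) then F (toC x) else 0).

Lemma cmeas_annul r X (F : C -> C) : cmeasC F ->
  cmeas (fun x : plane => if inA r X (toC x) then F (toC x) else 0).
Proof.
move=> mF; apply: cmeas_if; [|exact: mF|exact: cmeas_cst].
by apply: measurable_inA; apply: cmeas_toC.
Qed.

Lemma annul_bounded r X (F : C -> C) (M : R) : 0 <= M -> cmeasC F ->
  (forall t, inA r X t -> cabs (F t) <= M) ->
  cintg dA (fun x => if inA r X (toC x) then F (toC x) else 0) /\
  cabs (annul r X F) <= M * fine (areaA r X).
Proof.
move=> M0 mF hF.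
have mi : measurable_fun setT (fun x : plane => (inA r X (toC x))%:R%:E : \bar R).
  by apply: measurable_ind; apply: measurable_inA; apply: cmeas_toC.
have hI : (\int[dA]_x (cabs (if inA r X (toC x) then F (toC x) else 0))%:E <= (M * fine (areaA r X))%:E)%E.
  rewrite EFinM fineK ?areaA_fin // /areaA -ge0_intZl; last 3 first.
  - exact: mi.
  - by move=> x; rewrite lee_fin ler0n.
  - by rewrite lee_fin.
  apply: le_int.
  - by apply: cmeas_absE; apply: cmeas_annul.
  - exact: measurable_funeM.
  - by move=> x; rewrite lee_fin cabs_ge0.
  - move=> x; case h: inA; last by rewrite cabs0 mule0.
    by rewrite mule1 lee_fin hF.
have ci : cintg dA (fun x => if inA r X (toC x) then F (toC x) else 0).
  by split; [apply: cmeas_annul|apply: le_lt_trans hI _; rewrite ltry].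
by split => //; rewrite -lee_fin; apply: le_trans (CI_abs ci) hI.
Qed.

Lemma annul_split r m X (F : C -> C) : r <= m -> m <= X ->
  cintg dA (fun x => if inA r m (toC x) then F (toC x) else 0) ->
  cintg dA (fun x => if inA m X (toC x) then F (toC x) else 0) ->
  annul r X F = annul r m F + annul m X F.
Proof.
move=> rm mX i1 i2; rewrite /annul -CID //; apply: eq_CI => x; rewrite /inA.
case: (ltP (cabs (toC x)) m) => h /=.
  by rewrite (lt_le_trans h mX) !andbT addr0.
by rewrite (le_trans rm h) andbF add0r.
Qed.

Lemma annul_scale (c : C) r X (F : C -> C) : c != 0 -> cmeasC F ->
  annul (cabs c * r) (cabs c * X) F = (cabs c ^+ 2)%:C * annul r X (fun t => F (c * t)).
Proof.
move=> c0 mF; have cp : 0 < cabs c by rewrite cabs_gt0.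
have := @CI_scale R c (fun t => if inA (cabs c * r) (cabs c * X) t then F t else 0) c0 (cmeas_annul _ _ mF).
rewrite -/(annul _ _ F) => h; rewrite -[LHS]mul1r.
have -> : 1 = (cabs c ^+ 2)%:C * (cabs c ^- 2)%:C :> C.
  by rewrite -rmorphM mulfV // expf_neq0 // gt_eqF.
rewrite -mulrA -h; congr (_ * _); apply: eq_CI => x.
by rewrite /inA cabsM !ler_pM2l // !ltr_pM2l.
Qed.

Lemma ppow_radial (s : C) (t : C) : ppow t s s = cexp ((s + s) * (ln (cabs t))%:C).
Proof. by rewrite /ppow subrr mulr0 mul0r addr0. Qed.

Lemma cabs_cexp_real (s : C) (x : R) : cabs (cexp (s * x%:C)) = expR (cre s * x).
Proof. by rewrite cabs_cexp (mulrC s) creRM mulrC. Qed.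

Lemma annul_ppow_intg r X (s s' : C) : 0 < r -> isInt (s - s') ->
  cintg dA (fun x => if inA r X (toC x) then ppow (toC x) s s' else 0).
Proof.
move=> r0 si; pose a := cre (s + s').
have [] // := @annul_bounded r X (fun t => ppow t s s') (r `^ a + X `^ a).
- by rewrite addr_ge0 ?powR_ge0.
- exact: cmeasC_ppow.
- move=> t /andP[h1 h2]; have t0 : 0 < cabs t by apply: lt_le_trans h1.
  rewrite cabs_ppow //; last by rewrite -cabs_gt0.
  rewrite -/a; case: (leP 0 a) => ha.
    by rewrite ler_wpDl ?powR_ge0 // ge0_ler_powR ?nnegrE ?(ltW h2) ?(ltW t0) // ltW // (lt_trans t0).
  rewrite ler_wpDr ?powR_ge0 // -[a]opprK !(powRN _ (- a)) lef_pV2 ?posrE ?powR_gt0 //.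
  by rewrite ge0_ler_powR ?nnegrE ?oppr_ge0 ?(ltW ha) ?(ltW t0) // ltW.
Qed.

(** Scaling replaces polar coordinates. The integral P(h) over 1 <= |t| < e^h satisfies P(h + g) =
    P(h) + e^(2sh) P(g), so P(L) is determined by P(L / n) for large n, where the integrand is
    nearly 1 and the area is known. The factor [s] stays on the left because it may vanish. *)
Lemma annul_ppow_radial r X (s : C) : 0 < r -> r < X ->
  annul r X (fun t => ppow t (s - 1) (s - 1)) * s =
  kappa%:C * (cexp ((s + s) * (ln X)%:C) - cexp ((s + s) * (ln r)%:C)).
Proof.
move=> r0 rX; have X0 : 0 < X by apply: lt_trans rX.
pose F t := ppow t (s - 1) (s - 1) : C.
have si : isInt (s - 1 - (s - 1)) by rewrite subrr; exact: isInt0.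
have mF : cmeasC F by apply: cmeasC_ppow.
pose P (h : R) := annul 1 (expR h) F.
have scal c Y : 0 < c -> annul c (c * Y) F = cexp ((s + s) * (ln c)%:C) * annul 1 Y F.
  move=> c0; have cc : cabs (c%:C : C) = c by rewrite cabsR gtr0_norm.
  have c0' : (c%:C : C) != 0 by rewrite -cabs_gt0 cc.
  have := @annul_scale c%:C 1 Y F c0' mF; rewrite cc mulr1 => ->.
  have -> : cexp ((s + s) * (ln c)%:C) = (c ^+ 2)%:C * ppow c%:C (s - 1) (s - 1).
    rewrite ppow_radial cc.
    have -> : (c ^+ 2)%:C = cexp ((1 + 1) * (ln c)%:C) :> C.
      by rewrite mulrDl mul1r cexpD cexpR lnK ?posrE // expr2 rmorphM.
    by rewrite -cexpD; congr cexp; ring.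
  rewrite -mulrA; congr (_ * _).
  have ia : cintg dA (fun x => if inA 1 Y (toC x) then F (toC x) else 0) by apply: annul_ppow_intg.
  rewrite /annul -CIZ //; apply: eq_CI => x; case h : inA; last by rewrite mulr0.
  have t0 : toC x != 0 by rewrite -cabs_gt0; case/andP: h => h _; apply: lt_le_trans h.
  by rewrite /F ppowM.
have addP h g : 0 <= h -> 0 <= g -> P (h + g) = P h + cexp ((s + s) * h%:C) * P g.
  move=> h0 g0; rewrite /P (@annul_split 1 (expR h)).
  - by congr (_ + _); rewrite expRD scal ?expR_gt0 // expRK.
  - by rewrite -expR0 ler_expR.
  - by rewrite ler_expR lerDl.
  - exact: annul_ppow_intg.
  - by apply: annul_ppow_intg => //; apply: expR_gt0.
(* A geometric sum with its denominator multiplied out, since e^(2sh) may be 1. *)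
have mulP h n : 0 <= h -> P (n.+1%:R * h) * (cexp ((s + s) * h%:C) - 1) = P h * (cexp ((s + s) * (n.+1%:R * h)%:C) - 1).
  move=> h0; elim: n => [|n IH]; first by rewrite mul1r.
  have -> : n.+2%:R * h = n.+1%:R * h + h by rewrite -(addn1 n.+1) natrD mulrDl mul1r.
  have a1 := addP (n.+1%:R * h) h (mulr_ge0 (ler0n _ _) h0) h0.
  have e1 : cexp ((s + s) * (n.+1%:R * h + h)%:C) = cexp ((s + s) * (n.+1%:R * h)%:C) * cexp ((s + s) * h%:C).
    by rewrite -cexpD -mulrDr -(rmorphD (real_complex R)).
  have step (p p' q e f g : C) : p' = p + f * q -> g = f * e -> p * (e - 1) = q * (f - 1) -> p' * (e - 1) = q * (g - 1).
    by move=> -> -> k; rewrite mulrDl k; ring.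
  exact: step a1 e1 IH.
have limE (a : C) (L : R) : ccvg (fun n => n.+1%:R * (cexp (a * (L / n.+1%:R)%:C) - 1)) (a * L%:C).
  apply: (ccvg_ext _ (ccvg_cexp_linear (a * L%:C))) => n; congr (_ * (cexp _ - 1)).
  by rewrite rmorphM fmorphV rmorph_nat mulrA.
have limP (L : R) : 0 < L -> ccvg (fun n => n.+1%:R * P (L / n.+1%:R)) ((2 * L * kappa)%:C).
  move=> L0; pose h n := L / n.+1%:R : R.
  have h0 n : 0 < h n by rewrite divr_gt0.
  pose E n : C := n.+1%:R * (cexp ((2%:R : C) * (h n)%:C) - 1).
  have EL : ccvg E (2%:R * L%:C) by apply: limE.
  have hE n : n.+1%:R * (kappa * (expR (h n) ^+ 2 - 1))%:C = kappa%:C * E n.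
    rewrite /E mulrCA rmorphM; congr (_ * (_ * _)).
    by rewrite (rmorphB (real_complex R)) rmorph1 (rmorphXn (real_complex R)) /= -cexpR -cexpMn mulr_natl.
  have -> : (2 * L * kappa)%:C = kappa%:C * (2%:R * L%:C) :> C by rewrite !rmorphM rmorph_nat mulrC.
  (* On the thin annulus the integrand differs from 1 by O(h) and the area is O(h), so n times the
     difference from the area tends to 0. *)
  suff : ccvg (fun n => n.+1%:R * P (h n) - kappa%:C * E n) 0.
    move=> h1; have := ccvgD h1 (ccvgM (ccvg_cst kappa%:C) EL); rewrite add0r.
    by apply: ccvg_ext => n; rewrite subrK.
  have [M [M0 hM]] := ccvg_bounded (ccvgM (ccvg_cst kappa%:C) EL).
  pose B := cabs (s - 1 + (s - 1)).
  have B0 : 0 <= B := cabs_ge0 _.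
  apply: (@ccvg_squeeze _ _ _ (fun n => 5 * B * M * L / n.+1%:R)); last exact: cvg_inv_nat.
  have := near_inv_nat (B * L); apply: filterS => n hn.
  rewrite subr0 -hE -mulrBr cabsM cabsn.
  have i1 : cintg dA (fun x => if inA 1 (expR (h n)) (toC x) then F (toC x) else 0) by apply: annul_ppow_intg.
  have eh1 : 1 <= expR (h n) by rewrite -expR0 ler_expR ltW.
  have [i2 _] := @annul_bounded 1 (expR (h n)) (fun=> 1) 1 ler01 (cmeas_cst _ _) (fun t _ => ltac:(by rewrite cabs1)).
  have -> : (kappa * (expR (h n) ^+ 2 - 1))%:C = annul 1 (expR (h n)) (fun=> 1).
    have <- : fine (areaA 1 (expR (h n))) = kappa * (expR (h n) ^+ 2 - 1).
      by rewrite areaA_rX ?expr1n.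
    rewrite /annul /CI /areaA /Rintegral; apply: ceqP => /=.
      by congr fine; apply: eq_integral => x _; case: inA.
    rewrite -[LHS]/(fine 0%E); congr fine; apply/esym; apply: integral0_eq => x _; by case: inA.
  rewrite /P /annul -CIB //.
  have hb : cabs (annul 1 (expR (h n)) (fun t => F t - 1)) <= 5 * (B * h n) * fine (areaA 1 (expR (h n))).
    apply: (proj2 (annul_bounded _ _ _)).
    - by rewrite !mulr_ge0 // ltW.
    - by apply: cmeasB => //; apply: cmeas_cst.
    - move=> t /andP[t1 t2]; rewrite /F ppow_radial.
      have tp : 0 < cabs t by apply: lt_le_trans t1.
      have l0 : 0 <= ln (cabs t) by rewrite ln_ge0.
      have l1 : ln (cabs t) <= h n by rewrite -(expRK (h n)) ler_ln ?posrE ?expR_gt0 // ltW.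
      have lb : cabs ((s - 1 + (s - 1)) * (ln (cabs t))%:C) <= B * h n.
        by rewrite cabsM cabsR ger0_norm // ler_wpM2l.
      apply: (le_trans (cexp_lip _)); last by rewrite ler_pM2l.
      apply: (le_trans lb); rewrite /h mulrA; apply: le_trans hn; exact: ler_norm.
  have -> : CI dA (fun x => (if inA 1 (expR (h n)) (toC x) then F (toC x) else 0) - (if inA 1 (expR (h n)) (toC x) then 1 else 0))
     = annul 1 (expR (h n)) (fun t => F t - 1).
    by apply: eq_CI => x; case: inA; rewrite ?subrr.
  have nr : (0 : R) < n.+1%:R by rewrite ltr0n.
  have hA : n.+1%:R * fine (areaA 1 (expR (h n))) <= M.
    rewrite areaA_rX // expr1n /= -[X in X <= _]ger0_norm; last first.
      by rewrite mulr_ge0 ?ler0n // mulr_ge0 ?kappa_ge0 // subr_ge0 exprn_ege1.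
    by rewrite -cabsR rmorphM rmorph_nat hE hM.
  apply: (@le_trans _ _ (n.+1%:R * (5 * (B * h n) * fine (areaA 1 (expR (h n)))))).
    by rewrite ler_pM2l.
  rewrite (_ : n.+1%:R * _ = 5 * (B * h n) * (n.+1%:R * fine (areaA 1 (expR (h n))))); last by ring.
  have -> : 5 * B * M * L / n.+1%:R = 5 * (B * h n) * M by rewrite /h; ring.
  by rewrite ler_wpM2l // !mulr_ge0 // ltW.
have mulP' h n T : 0 <= h -> n.+1%:R * h = T -> P T * (cexp ((s + s) * h%:C) - 1) = P h * (cexp ((s + s) * T%:C) - 1).
  by move=> h0 <-; exact: mulP.
have key L : 0 < L -> P L * s = kappa%:C * (cexp ((s + s) * L%:C) - 1).
  move=> L0.
  have l1 : ccvg (fun n => P L * (n.+1%:R * (cexp ((s + s) * (L / n.+1%:R)%:C) - 1))) (P L * ((s + s) * L%:C)).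
    by apply: ccvgM; [apply: ccvg_cst|apply: limE].
  have l2 : ccvg (fun n => n.+1%:R * P (L / n.+1%:R) * (cexp ((s + s) * L%:C) - 1)) ((2 * L * kappa)%:C * (cexp ((s + s) * L%:C) - 1)).
    by apply: ccvgM; [apply: limP|apply: ccvg_cst].
  have e n : P L * (n.+1%:R * (cexp ((s + s) * (L / n.+1%:R)%:C) - 1)) = n.+1%:R * P (L / n.+1%:R) * (cexp ((s + s) * L%:C) - 1).
    have eL : n.+1%:R * (L / n.+1%:R) = L by rewrite mulrC divfK // pnatr_eq0.
    by rewrite (mulrCA (P L)) (mulP' _ _ _ (ltW (divr_gt0 L0 (ltr0Sn _ n))) eL) mulrA.
  have := ccvg_unique (ccvg_ext e l1) l2.
  have L0' : (2 * L)%:C != 0 :> C by rewrite -cabs_gt0 cabsR normr_gt0 gt_eqF // mulr_gt0.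
  move=> hh; apply: (mulfI L0'); rewrite [RHS]mulrA -[(2 * L)%:C * kappa%:C](rmorphM (real_complex R)) -hh.
  by rewrite rmorphM rmorph_nat; ring.
have YX : X = r * (X / r) by rewrite mulrC divfK // gt_eqF.
have Xr : 1 < X / r by rewrite ltr_pdivlMr // mul1r.
rewrite {1}YX scal // (_ : X / r = expR (ln (X / r))); last by rewrite lnK // posrE divr_gt0.
rewrite -mulrA key ?ln_gt0 // mulrCA; congr (_ * _).
have -> : ln X = ln r + ln (X / r) by rewrite ln_div ?posrE //; ring.
by rewrite (rmorphD (real_complex R)) (mulrDr (s + s)) cexpD; ring.
Qed.

Definition onP (P : C -> bool) (F : C -> C) (x : plane) : C := if P (toC x) then F (toC x) else 0.

(** With n = s - s', rotation by e^(i pi / n) preserves the region and changes the sign of the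
    integrand, so the integral is its own opposite. *)
Lemma radial_ppow_angular (P : C -> bool) (s s' : C) : (forall c t, cabs c = 1 -> P (c * t) = P t) ->
  P 0 = false -> measurable_fun setT (fun x : plane => P (toC x)) ->
  cintg dA (onP P (fun t => ppow t (s - 1) (s' - 1))) ->
  isInt (s - s') -> s != s' -> CI dA (onP P (fun t => ppow t (s - 1) (s' - 1))) = 0.
Proof.
move=> Pr P0 mP ci [n e] ss; have n0 : n != 0 by apply: contraNneq ss => n0; rewrite -subr_eq0 e n0.
have e' : s - 1 - (s' - 1) = n%:~R by rewrite -e; ring.
have si : isInt (s - 1 - (s' - 1)) by exists n.
pose c : C := cexp ('i * (pi / n%:~R)%:C).
have c1 : cabs c = 1 by rewrite /c cabs_cexp creM /= mul0r mul1r subr0 expR0.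
have c0 : c != 0 by apply: cexp_neq0.
have hc : ppow c (s - 1) (s' - 1) = -1.
  rewrite (ppowE c0 e') c1 ln1 mulr0 cexp0 mul1r divr1 /c -cexpMz.
  have -> : n%:~R * ('i * (pi / n%:~R)%:C) = 'i * pi%:C :> C.
    rewrite mulrCA intCE -rmorphM mulrC (mulrC _ (pi / _)) divfK 1?mulrC //.
    by rewrite intr_eq0.
  have -> : 'i * pi%:C = 0 +i* pi :> C by apply: ceqP; rewrite ?creM ?cimM /=; ring.
  by rewrite /cexp /= expR0 cospi sinpi; apply: ceqP; rewrite ?creM ?cimM /=; ring.
have mF : cmeasC (fun t => if P t then ppow t (s - 1) (s' - 1) else 0).
  by apply: cmeas_if; [exact: mP|exact: cmeasC_ppow|exact: cmeas_cst].
have := CI_scale c0 mF; rewrite c1 expr1n invr1 mul1r -/(onP P _).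
have -> : CI dA (fun x => if P (c * toC x) then ppow (c * toC x) (s - 1) (s' - 1) else 0)
    = - CI dA (onP P (fun t => ppow t (s - 1) (s' - 1))).
  rewrite -CIN //; apply: eq_CI => x; rewrite Pr // /onP; case h: P; last by rewrite oppr0.
  have t0 : toC x != 0 by apply: contraTneq h => ->; rewrite P0.
  by rewrite ppowM // hc mulN1r.
rewrite -[X in _ = X -> _]/(CI dA (onP P (fun t => ppow t (s - 1) (s' - 1)))) => h.
apply/eqP; have : CI dA (onP P (fun t => ppow t (s - 1) (s' - 1))) *+ 2 == 0.
  by rewrite mulr2n -{1}h addNr.
by rewrite mulrn_eq0.
Qed.
End Annuli.

Section RealToComplex.
Variable R : realType.
Local Notation C := R[i].
Lemma rcD (a b : R) : (a + b)%:C = a%:C + b%:C :> C. Proof. exact: rmorphD. Qed.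
Lemma rcN (a : R) : (- a)%:C = - a%:C :> C. Proof. exact: rmorphN. Qed.
Lemma rcB (a b : R) : (a - b)%:C = a%:C - b%:C :> C. Proof. exact: rmorphB. Qed.
Lemma rcM (a b : R) : (a * b)%:C = a%:C * b%:C :> C. Proof. exact: rmorphM. Qed.
Lemma rcV (a : R) : (a^-1)%:C = (a%:C)^-1 :> C. Proof. exact: fmorphV. Qed.
Lemma rcX (a : R) n : (a ^+ n)%:C = a%:C ^+ n :> C. Proof. exact: rmorphXn. Qed.
Lemma rcn n : (n%:R : R)%:C = n%:R :> C. Proof. exact: rmorph_nat. Qed.
End RealToComplex.

(** * The area of the unit disc *)

Section Kappa.
Variable R : realType.
Local Notation C := R[i].
Local Notation dA := (mA R).
Local Notation leb := (leb R).
Local Notation plane := (measurableTypeR R * measurableTypeR R)%type.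

Lemma integral_exp_tail (a : R) :
  (\int[leb]_u (if a < u then expR (- u) else 0)%:E = (expR (- a))%:E)%E.
Proof.
have dE (x : R) : is_derive x 1 (fun u : R => - expR (- u)) (expR (- x)).
  have := is_deriveN (is_derive1_comp (is_derive_expR (- x)) (is_deriveN (is_derive_id x 1))).
  by move=> h; apply: is_derive_eq h _; ring.
have := @ge0_continuous_FTC2y R (fun u => expR (- u)) (fun u => - expR (- u)) a 0.
rewrite sub0e -EFinN opprK => <-; last 6 first.
- by move=> x _; apply: expR_ge0.
- apply: continuous_subspaceT => x; apply: continuous_comp; first exact: opp_continuous.
  exact: continuous_expR.
- by rewrite -oppr0; apply: cvgN; exact: cvgr_expR.
- by move=> x _; apply: ex_derive.
- apply: cvg_at_right_filter; apply: cvgN; apply: continuous_comp; first exact: opp_continuous.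
  exact: continuous_expR.
- by move=> x _; rewrite derive1E derive_val.
rewrite -integral_itv_obnd_cbnd; last first.
  apply/measurable_funTS/measurable_EFinP; apply: measurableT_comp => //.
rewrite [RHS]integral_mkcond; apply: eq_integral => u _; rewrite patchE.
have -> : (u \in (`]a, +oo[%classic : set R)) = (a < u) by apply/idP/idP; rewrite inE /= in_itv /= andbT.
by case: ifP.
Qed.

Let mtail : measurable_fun setT (fun z : measurableTypeR R * measurableTypeR R => (if z.1 < z.2 then expR (- z.2) else 0 : R)%:E).
Proof.
apply/measurable_EFinP; apply: measurable_fun_ifT => //; first exact: measurable_fun_ltr.
by apply: measurableT_comp => //; apply: measurableT_comp.
Qed.

Let tail0 (a u : R) : (0 <= (if a < u then expR (- u) else 0)%:E :> \bar R)%E.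
Proof. by rewrite lee_fin; case: ifP => // _; apply: expR_ge0. Qed.

Let mtailf d (T : measurableType d) (f g : T -> R) : measurable_fun setT f -> measurable_fun setT g ->
  measurable_fun setT (fun x => (if f x < g x then expR (- g x) else 0)%:E).
Proof.
move=> mf mg; apply/measurable_EFinP; apply: measurable_fun_ifT => //; first exact: measurable_fun_ltr.
by apply: measurableT_comp => //; apply: measurableT_comp.
Qed.

(** Gamma(2) = 1, by writing u as the length of ]0, u[ and exchanging the two integrals. *)
Let int_uexp : (\int[leb]_u (if 0 < u then u * expR (- u) else 0)%:E = 1)%E.
Proof.
have h := integral_exp_tail 0; rewrite oppr0 expR0 in h.
rewrite -h; transitivity (\int[leb]_u \int[leb]_v (if 0 < v then (if v < u then expR (- u) else 0) else 0)%:E)%E.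
  apply: eq_integral => u _; transitivity (\int[leb]_v ((expR (- u))%:E * (\1_(`]0%R, u[%classic : set (measurableTypeR R)) v)%:E))%E.
    rewrite ge0_intZl; last 3 first.
    - by apply/measurable_EFinP; apply: measurable_indic.
    - by move=> x; rewrite lee_fin.
    - by rewrite lee_fin expR_ge0.
    have hl : lebesgue_measure (`]0%R, u[%classic : set (measurableTypeR R)) = (if (0 < u)%R then u%:E else 0)%E.
      by rewrite lebesgue_measure_itv /= lte_fin sube0.
    rewrite integral_indic // setIT [X in (_ * X)%E]hl.
    by case: ifP => _; rewrite ?mule0 // -EFinM mulrC.
  apply: eq_integral => v _; rewrite indicE -EFinM; congr EFin.
  have -> : (v \in (`]0%R, u[%classic : set (measurableTypeR R))) = (0 < v) && (v < u) by apply/idP/idP; rewrite inE /= in_itv /=.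
  by case: (0 < v); case: (v < u); rewrite /= ?mulr1 ?mulr0.
rewrite tonelli; last 2 first.
- rewrite (_ : (fun z => _) = (fun z : measurableTypeR R * measurableTypeR R => if 0 < z.2 then (if z.2 < z.1 then expR (- z.1) else 0)%:E else 0%E)).
    apply: measurable_fun_ifT => //; first exact: measurable_fun_ltr.
    exact: mtailf.
  by apply/funext => z; case: ifP.
- by move=> u v; case: ifP.
apply: eq_integral => v _; case: ltP => v0; last by rewrite integral0.
by rewrite integral_exp_tail.
Qed.

(** e^(-|t|^2) is integrated over the plane in two ways: as a product of one-dimensional Gaussians,
    giving pi, and by layers, since it is the integral of e^(-u) over u > |t|^2 and the disc |t|^2 <
    u has area [kappa] u. *)
Lemma kappa_pi : kappa R = pi.
Proof.
have mg : measurable_fun setT (fun x : plane => (expR (- (cabs (toC x) ^+ 2)))%:E).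
  apply/measurable_EFinP; apply: measurableT_comp => //; apply: measurableT_comp => //.
  by apply: measurable_funX; apply: cmeas_abs; apply: cmeas_toC.
have e1 : (\int[dA]_x (expR (- (cabs (toC x) ^+ 2)))%:E = (pi)%:E)%E.
  rewrite fst_int //.
  transitivity (\int[leb]_x ((gauss_fun x)%:E * (Num.sqrt pi)%:E))%E.
    apply: eq_integral => x _; transitivity (\int[leb]_y ((gauss_fun x)%:E * (gauss_fun y)%:E))%E.
      apply: eq_integral => y _; rewrite -EFinM /gauss_fun -expRD cabs_sqr /=; congr (expR _)%:E; ring.
    rewrite ge0_intZl; first by rewrite [X in (_ * X)%E]integralT_gauss.
    - by apply/measurable_EFinP; apply: measurable_gauss_fun.
    - by move=> y; rewrite lee_fin gauss_fun_ge0.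
    - by rewrite lee_fin gauss_fun_ge0.
  rewrite ge0_intZr; last 3 first.
  - by apply/measurable_EFinP; apply: measurable_gauss_fun.
  - by move=> y; rewrite lee_fin gauss_fun_ge0.
  - by rewrite lee_fin sqrtr_ge0.
  by rewrite [X in (X * _)%E]integralT_gauss -EFinM -expr2 sqr_sqrtr // pi_ge0.
have m2 : measurable_fun setT (fun z : plane * measurableTypeR R => (if cabs (toC z.1) ^+ 2 < z.2 then expR (- z.2) else 0)%:E).
  apply: mtailf => //; apply: measurable_funX; apply: cmeas_abs.
  by apply: (cmeas_comp (cmeas_toC R)); apply: measurable_fst.
have e2 : (\int[dA]_x (expR (- (cabs (toC x) ^+ 2)))%:E = (kappa R)%:E)%E.
  transitivity (\int[dA]_x \int[leb]_u (if cabs (toC x) ^+ 2 < u then expR (- u) else 0)%:E)%E.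
    by apply: eq_integral => x _; rewrite integral_exp_tail.
  rewrite (tonelli dA leb m2) //.
  transitivity (\int[leb]_u ((kappa R)%:E * (if 0 < u then u * expR (- u) else 0)%:E))%E; last first.
    rewrite ge0_intZl ?int_uexp ?mule1 //.
    - apply/measurable_EFinP; apply: measurable_fun_ifT => //; first exact: measurable_fun_ltr.
      by apply: measurable_funM => //; apply: measurableT_comp => //; apply: measurableT_comp.
    - by move=> u; rewrite lee_fin; case: ltP => // u0; rewrite mulr_ge0 ?expR_ge0 // ltW.
    - by rewrite lee_fin kappa_ge0.
  apply: eq_integral => u _; case: (ltP 0 u) => u0; last first.
    rewrite mule0; apply: integral0_eq => x _; rewrite ltNge (le_trans u0) // sqr_ge0 //.
  transitivity (\int[dA]_x ((expR (- u))%:E * ((inA 0 (Num.sqrt u) (toC x))%:R)%:E))%E.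
    apply: eq_integral => x _; rewrite /inA cabs_ge0 /= -EFinM; congr EFin.
    have -> : (cabs (toC x) < Num.sqrt u) = (cabs (toC x) ^+ 2 < u).
      by rewrite -[in RHS](sqr_sqrtr (ltW u0)) ltr_pXn2r ?nnegrE ?cabs_ge0 ?sqrtr_ge0.
    by case: ifP; rewrite ?mulr1 ?mulr0.
  rewrite ge0_intZl; last 3 first.
  - by apply: measurable_ind; apply: measurable_inA; apply: cmeas_toC.
  - by move=> x; rewrite lee_fin ler0n.
  - by rewrite lee_fin expR_ge0.
  rewrite -/(areaA 0 (Num.sqrt u)) areaA0 ?sqrtr_gt0 // sqr_sqrtr ?ltW // -!EFinM; congr EFin; ring.
by move: e2; rewrite e1 => -[].
Qed.
End Kappa.

(** * Integrals of powers over discs *)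

Section DiscPowers.
Variable R : realType.
Local Notation C := R[i].
Local Notation dA := (mA R).
Local Notation plane := (measurableTypeR R * measurableTypeR R)%type.

(** The centre is removed because the rules for [ppow] hold only away from 0. *)
Definition inD (X : R) (t : C) := (t != 0) && (cabs t < X).

Lemma measurable_inD d (T : measurableType d) (X : R) (f : T -> C) : cmeas f ->
  measurable_fun setT (fun x => inD X (f x)).
Proof.
move=> hf; apply: measurable_and; last exact: measurable_cabs_ltr.
by under eq_fun do rewrite -cabs_gt0; apply: measurable_fun_ltr => //; apply: cmeas_abs.
Qed.

Lemma cmeas_onP (P : C -> bool) (F : C -> C) : measurable_fun setT (fun x : plane => P (toC x)) ->
  cmeasC F -> cmeas (onP P F).
Proof. by move=> mP mF; apply: cmeas_if => //; exact: cmeas_cst. Qed.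

Definition pwA (r X sg : R) : \bar R := (\int[dA]_x (if inA r X (toC x) then cabs (toC x) `^ (sg - 2) else 0)%:E)%E.
Definition pwD (X sg : R) : \bar R := (\int[dA]_x (if inD X (toC x) then cabs (toC x) `^ (sg - 2) else 0)%:E)%E.

Lemma measurable_pw (P : C -> bool) (a : R) : measurable_fun setT (fun x : plane => P (toC x)) ->
  measurable_fun setT (fun x : plane => (if P (toC x) then cabs (toC x) `^ a else 0)%:E).
Proof.
move=> mP; apply/measurable_EFinP; apply: measurable_fun_ifT => //.
rewrite (_ : (fun x => _) = (fun x : plane => if toC x == 0 then 0 `^ a else expR (a * ln (cabs (toC x))))).
  apply: measurable_fun_ifT => //; first exact/measurable_ceq0/cmeas_toC.
  apply: measurableT_comp => //; apply: measurable_funM => //.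
  apply: (measurableT_comp (f := @ln R)); first exact: measurable_ln.
  exact/cmeas_abs/cmeas_toC.
by apply/funext => x; case: eqP => [->|/eqP h]; rewrite ?cabs0 // /powR cabs_eq0 (negbTE h).
Qed.

Lemma pw_ge0 (P : C -> bool) (a : R) (x : plane) : (0 <= (if P (toC x) then cabs (toC x) `^ a else 0)%:E :> \bar R)%E.
Proof. by rewrite lee_fin; case: ifP => // _; apply: powR_ge0. Qed.

Lemma powR_cexp (r a : R) : 0 < r -> (r `^ a)%:C = cexp (a%:C * (ln r)%:C) :> C.
Proof. by move=> r0; rewrite -rcM cexpR /powR gt_eqF. Qed.

Lemma pwA_val r X sg : 0 < r -> r < X -> 0 < sg -> pwA r X sg = (pi * (X `^ sg - r `^ sg) * 2 / sg)%:E.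
Proof.
move=> r0 rX s0; have X0 : 0 < X by apply: lt_trans rX.
pose s : C := (sg / 2)%:C; have ss : s + s = sg%:C by rewrite -rcD; congr _%:C; field.
have s0' : s != 0 by rewrite -cabs_gt0 cabsR normr_gt0 gt_eqF // divr_gt0.
have si : isInt (s - 1 - (s - 1)) by rewrite subrr; exact: isInt0.
have := annul_ppow_radial s r0 rX; rewrite kappa_pi ss -!powR_cexp // => h.
have ci := @annul_ppow_intg R r X _ _ r0 si.
have : cre (annul r X (fun t => ppow t (s - 1) (s - 1))) = pi * (X `^ sg - r `^ sg) * 2 / sg.
  apply: (@mulIf _ (sg / 2)); first by rewrite gt_eqF // divr_gt0.
  have := congr1 (@cre R) h; rewrite -rcB -rcM creM /= mulr0 subr0 => ->.
  by field; rewrite gt_eqF.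
rewrite /annul /CI /= /Rintegral => <-; rewrite fineK; last first.
  by apply: integrable_fin_num => //; apply: (cintg_re ci).
apply: eq_integral => x _; congr EFin; case h1: inA => //.
have t0 : 0 < cabs (toC x) by case/andP: h1 => h1 _; apply: lt_le_trans h1.
rewrite ppow_radial (_ : s - 1 + (s - 1) = (sg - 2)%:C) -?powR_cexp //.
by rewrite rcB -ss rcn; ring.
Qed.

(** Monotone convergence along annuli of inner radius X / (n + 1), whose integrals are explicit and
    bounded. *)
Lemma pwD_fin X sg : 0 < X -> 0 < sg -> (pwD X sg < +oo)%E.
Proof.
move=> X0 s0; pose g n (x : plane) : \bar R := (if inA (X / n.+1%:R) X (toC x) then cabs (toC x) `^ (sg - 2) else 0)%:E.
have mg n : measurable_fun setT (g n).
  by apply: measurable_pw; apply: measurable_inA; apply: cmeas_toC.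
have g0 n x : (0 <= g n x)%E by apply: pw_ge0.
have nd x : {homo g^~ x : m n / (m <= n)%N >-> (m <= n)%E}.
  move=> m n mn; rewrite /g lee_fin; case: ifP => [/andP[h1 h2]|_]; last by case: ifP => // _; apply: powR_ge0.
  rewrite /inA h2 (le_trans _ h1) // ler_pM2l // lef_pV2 ?posrE ?ltr0n // ler_nat.
  by rewrite ltnS.
have hl x : limn (g^~ x) = (if inD X (toC x) then cabs (toC x) `^ (sg - 2) else 0)%:E.
  apply: cvg_lim => //; apply: cvg_near_cst; rewrite /g /inD.
  have [->|t0] := eqVneq (toC x) 0.
    by near=> n; rewrite /inA cabs0 leNgt divr_gt0.
  have tp : 0 < cabs (toC x) by rewrite cabs_gt0.
  have /cvgrPdistC_le/(_ _ tp) := cvg_inv_nat X; apply: filterS => n.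
  rewrite subr0 ger0_norm; last by rewrite divr_ge0 // ltW.
  by rewrite /inA => ->.
rewrite /pwD; under eq_integral do rewrite -hl.
rewrite (@monotone_convergence _ _ R dA setT measurableT g mg (fun n x _ => g0 n x) (fun x _ m n => @nd x m n)).
apply: (@le_lt_trans _ _ (pi * X `^ sg * 2 / sg)%:E); last by rewrite ltry.
apply: lime_le.
  apply: ereal_nondecreasing_is_cvgn => m n mn.
  by apply: le_int => // x; apply: nd.
near=> n; rewrite -/(pwA (X / n.+1%:R) X sg) pwA_val ?divr_gt0 //.
  rewrite lee_fin -!mulrA ler_pM2l ?pi_gt0 // ler_wpM2r ?divr_ge0 ?(ltW s0) //.
  by rewrite lerBlDr lerDl powR_ge0.
rewrite ltr_pdivrMr // ltr_pMr // ltr1n; near: n; by exists 1%N.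
Unshelve. all: by end_near. Qed.

Lemma pwA_pos r X sg : 0 < r -> r < X -> (0 < pwA r X sg)%E.
Proof.
move=> r0 rX; have X0 : 0 < X by apply: lt_trans rX.
(* A real power is monotone in |t|, so it is smallest at one of the two radii. *)
pose m := Num.min (r `^ (sg - 2)) (X `^ (sg - 2)).
have m0 : 0 < m by rewrite lt_min !powR_gt0.
have mi : measurable_fun setT (fun x : plane => (inA r X (toC x))%:R%:E : \bar R).
  by apply: measurable_ind; apply: measurable_inA; apply: cmeas_toC.
apply: (@lt_le_trans _ _ (m%:E * areaA r X)%E).
  rewrite areaA_rX ?ltW // kappa_pi -EFinM lte_fin !mulr_gt0 ?pi_gt0 // subr_gt0.
  by rewrite ltr_pXn2r ?nnegrE ?ltW.
rewrite /areaA -ge0_intZl; last 3 first.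
- exact: mi.
- by move=> x; rewrite lee_fin ler0n.
- by rewrite lee_fin ltW.
apply: le_int.
- exact: measurable_funeM.
- by apply: measurable_pw; apply: measurable_inA; apply: cmeas_toC.
- by move=> x; rewrite mule_ge0 // lee_fin ?ler0n ?ltW.
move=> x; case h: inA; last by rewrite mule0.
rewrite mule1 lee_fin; case/andP: h => h1 h2; have tp : 0 < cabs (toC x) by apply: lt_le_trans h1.
have [a0|a0] := leP 0 (sg - 2).
  by rewrite ge_min ge0_ler_powR ?nnegrE ?(ltW r0) ?(ltW tp).
rewrite ge_min; apply/orP; right; rewrite -[sg - 2]opprK !(powRN _ (- (sg - 2))) lef_pV2 ?posrE ?powR_gt0 //.
by rewrite ge0_ler_powR ?nnegrE ?oppr_ge0 ?(ltW a0) ?(ltW tp) ?(ltW X0) // ltW.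
Qed.

(** Halving the radius multiplies the integral by 2^(-sg). If sg <= 0, the half disc would carry at
    least as much as the whole one, against the positive mass of the annulus between them. *)
Lemma pwD_pos X sg : 0 < X -> (pwD X sg < +oo)%E -> 0 < sg.
Proof.
move=> X0 fin; rewrite ltNge; apply/negP => s0.
have h2 : (0 : R) < 1 / 2 by lra.
have Y0 : 0 < X / 2 by rewrite divr_gt0.
have mD Y : measurable_fun setT (fun x : plane => inD Y (toC x)) by apply: measurable_inD; apply: cmeas_toC.
have sp : (pwD X sg = pwD (X / 2) sg + pwA (X / 2) X sg)%E.
  rewrite /pwD /pwA -ge0_integralD //; try by move=> x _; apply: pw_ge0.
  - apply: eq_integral => x _; rewrite -EFinD; congr EFin; rewrite /inD /inA.
    case: (ltP (cabs (toC x)) (X / 2)) => h /=.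
      by rewrite (lt_trans h _) ?addr0 // ltr_pdivrMr //; lra.
    by rewrite -cabs_gt0 (lt_le_trans _ h) //= add0r.
  - exact: measurable_pw.
  - by apply: measurable_pw; apply: measurable_inA; apply: cmeas_toC.
have sc : (pwD (X / 2) sg = ((1 / 2) `^ sg)%:E * pwD X sg)%E.
  have c12 : 0 <= 1 / 2 :> R by rewrite divr_ge0.
  pose c : C := (1 / 2)%:C; have cc : cabs c = 1 / 2 by rewrite cabsR ger0_norm.
  have c0 : c != 0 by rewrite -cabs_gt0 cc.
  have := @dA_scale R c (fun t => (if inD (X / 2) t then cabs t `^ (sg - 2) else 0)%:E) c0.
  rewrite cc => h; have {}h := h (measurable_pw _ (mD _)) (fun t => ltac:(by rewrite lee_fin; case: ifP => // _; apply: powR_ge0)).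
  have e4 : ((1 / 2 : R) `^ sg)%:E = (((1 / 2) `^ (sg - 2))%:E * ((1 / 2) ^+ 2)%:E)%E :> \bar R.
    rewrite -EFinM -powR_mulrn ?ltW // -powRD ?subrK //.
    by apply/implyP => _; rewrite gt_eqF.
  have h4 : ((1 / 2 : R) ^+ 2 * (1 / 2) ^- 2 = 1) by rewrite mulfV // expf_neq0 // gt_eqF.
  have -> : pwD (X / 2) sg = (((1 / 2) ^+ 2)%:E * (((1 / 2) ^- 2)%:E * pwD (X / 2) sg))%E.
    by rewrite muleA -EFinM h4 mul1e.
  rewrite {1}/pwD -h {h}.
  rewrite e4 -muleA muleCA; congr (_ * _)%E.
  rewrite /pwD -ge0_intZl; last 3 first.
  - exact: measurable_pw.
  - exact: pw_ge0.
  - by rewrite lee_fin powR_ge0.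
  apply: eq_integral => x _; rewrite -EFinM; congr EFin.
  have -> : inD (X / 2) (c * toC x) = inD X (toC x).
    by rewrite /inD mulf_eq0 (negbTE c0) /= cabsM cc (_ : X / 2 = 1 / 2 * X); [rewrite ltr_pM2l|ring].
  have ec : cabs (c * toC x) = 1 / 2 * cabs (toC x) by rewrite cabsM cc.
  by case: ifP => _; [exact: (etrans (congr1 (@powR R ^~ (sg - 2)) ec) (powRM _ c12 (cabs_ge0 _)))|rewrite mulr0].
have Df : pwD X sg \is a fin_num.
  by rewrite ge0_fin_numE // integral_ge0 // => x _; apply: pw_ge0.
have := pwA_pos sg Y0 (ltac:(lra) : X / 2 < X).
have D0 : (0 <= pwD X sg)%E by apply: integral_ge0 => x _; apply: pw_ge0.
move: sp; rewrite sc -(fineK Df) in D0 *.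
have : 1 <= (1 / 2 : R) `^ sg.
  have l0 : ln (1 / 2 : R) <= 0 by apply: ln_le0; lra.
  have e0 : 0 <= sg * ln (1 / 2 : R) by nra.
  by rewrite /powR gt_eqF //; apply: le_trans (expR_ge1Dx _); lra.
move: D0; rewrite lee_fin; case: (pwA _ _ _) => [a| |] //.
by rewrite -EFinM -EFinD lte_fin => D0 c1 [] e a0; nra.
Qed.

Lemma disc_ppow_intg X (s s' : C) : 0 < X -> isInt (s - s') -> 0 < cre (s + s') ->
  cintg dA (onP (inD X) (fun t => ppow t (s - 1) (s' - 1))).
Proof.
move=> X0 si s0; have si' : isInt (s - 1 - (s' - 1)) by rewrite (_ : _ - _ = s - s') //; ring.
have mD : measurable_fun setT (fun x : plane => inD X (toC x)) by apply: measurable_inD; apply: cmeas_toC.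
apply: (@cintg_le _ _ _ _ _ (fun x : plane => (if inD X (toC x) then cabs (toC x) `^ (cre (s + s') - 2) else 0)%:E)).
- by apply: (cmeas_onP mD); exact: cmeasC_ppow.
- exact: measurable_pw.
- move=> x; rewrite lee_fin /onP; case: ifP => [/andP[t0 _]|_]; last by rewrite cabs0.
  rewrite cabs_ppow // (_ : s - 1 + (s' - 1) = s + s' - 2%:R); last by ring.
  by rewrite creB cre_nat.
- exact: pwD_fin.
Qed.

(** On the diagonal, D(2) = 2^(2s) D(1) while D(2) - D(1) is an annulus integral, and 2^(2s) is not
    1 because Re s > 0. Off the diagonal, rotation kills the integral. *)
Lemma disc_ppow X (s s' : C) : 0 < X -> isInt (s - s') -> 0 < cre (s + s') ->
  CI dA (onP (inD X) (fun t => ppow t (s - 1) (s' - 1))) =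
  if s == s' then pi%:C * cexp ((s + s') * (ln X)%:C) / s else 0.
Proof.
move=> X0 si s0; have si' : isInt (s - 1 - (s' - 1)) by rewrite (_ : _ - _ = s - s') //; ring.
have mD Y : measurable_fun setT (fun x : plane => inD Y (toC x)) by apply: measurable_inD; apply: cmeas_toC.
have ci Y (Y0 : 0 < Y) := disc_ppow_intg Y0 si s0.
case: eqP => [ss|/eqP ss]; last first.
  apply: (radial_ppow_angular (P := inD X)); [| |exact: mD|exact: ci|exact: si|exact: ss].
  - by move=> c t c1; rewrite /inD cabsM c1 mul1r mulf_eq0 -(cabs_eq0 c) c1 oner_eq0.
  - by rewrite /inD eqxx.
subst s'; pose D Y := CI dA (onP (inD Y) (fun t => ppow t (s - 1) (s - 1))).
rewrite -/(D X).
have sN0 : s != 0 by apply: contraTneq s0 => ->; rewrite addr0 ltxx.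
have sc Y c : 0 < c -> D (c * Y) = cexp ((s + s) * (ln c)%:C) * D Y.
  move=> c0; have cc : cabs (c%:C : C) = c by rewrite cabsR gtr0_norm.
  have c0' : (c%:C : C) != 0 by rewrite -cabs_gt0 cc.
  have mF : cmeasC (fun t => if inD (c * Y) t then ppow t (s - 1) (s - 1) else 0).
    by apply: cmeas_if; [exact: mD|exact: cmeasC_ppow|exact: cmeas_cst].
  have cc2 : (c ^+ 2)%:C * (c ^- 2)%:C = 1 :> C by rewrite -rcM mulfV ?expf_neq0 ?gt_eqF.
  have := CI_scale c0' mF; rewrite cc -/(D (c * Y)) => h.
  have -> : D (c * Y) = (c ^+ 2)%:C * ((c ^- 2)%:C * D (c * Y)) by rewrite mulrA cc2 mul1r.
  rewrite -h {h}.
  have [Y0|Y0] := ltP 0 Y; last first.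
    rewrite /D (_ : onP _ _ = fun=> 0) ?CI0 ?mulr0; last first.
      by apply/funext => x; rewrite /onP /inD ltNge (le_trans Y0) ?cabs_ge0 ?andbF.
    rewrite (_ : (fun x => _) = fun=> 0) ?CI0 ?mulr0 //.
    by apply/funext => x; rewrite /inD cabsM cc ltr_pM2l // ltNge (le_trans Y0) ?cabs_ge0 ?andbF.
  rewrite /D -!CIZ; [|exact: ci|].
    apply: eq_CI => x; rewrite /onP.
    have -> : inD (c * Y) (c%:C * toC x) = inD Y (toC x) by rewrite /inD mulf_eq0 (negbTE c0') /= cabsM cc ltr_pM2l.
    case: ifP => [/andP[t0 _]|_]; last by rewrite !mulr0.
    rewrite ppowM // mulrA; congr (_ * _); rewrite ppow_radial cc.
    have -> : (c ^+ 2)%:C = cexp ((1 + 1) * (ln c)%:C) :> C.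
      by rewrite mulrDl mul1r cexpD cexpR lnK ?posrE // expr2 rcM.
    by rewrite -cexpD; congr cexp; ring.
  have := cintgZ (ppow c%:C (s - 1) (s - 1)) (ci Y Y0); apply: cintg_ext => x; rewrite /onP.
  have -> : inD (c * Y) (c%:C * toC x) = inD Y (toC x) by rewrite /inD mulf_eq0 (negbTE c0') /= cabsM cc ltr_pM2l.
  by case: ifP => [/andP[t0 _]|_]; rewrite ?mulr0 // ppowM.
have sp : D 2 = D 1 + annul 1 2 (fun t => ppow t (s - 1) (s - 1)).
  rewrite /D /annul -CID; [|exact: ci|exact: annul_ppow_intg].
  apply: eq_CI => x; rewrite /onP /inD /inA; case: (ltP (cabs (toC x)) 1) => h /=.
    by rewrite (lt_trans h _) ?addr0 // ltr1n.
  by rewrite -cabs_gt0 (lt_le_trans _ h) //= add0r.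
have h12 : (1 : R) < 2 by rewrite ltr1n.
have := annul_ppow_radial s ltr01 h12; rewrite ln1 mulr0 cexp0 kappa_pi => hA.
pose E : C := cexp ((s + s) * (ln 2)%:C).
have E1 : E - 1 != 0.
  rewrite subr_eq0; apply/eqP => /(congr1 (@cabs R)); rewrite cabs1 cabs_cexp_real => /eqP.
  have : 0 < cre (s + s) * ln 2 by rewrite mulr_gt0 // ln_gt0 // ltr1n.
  by rewrite -expR_gt1 => h; rewrite gt_eqF.
have D1 : D 1 * s = pi%:C.
  apply: (mulIf E1); rewrite mulrAC -hA; congr (_ * _).
  apply: (addrI (D 1)); rewrite -sp.
  have := sc 1 2 (ltr0Sn _ 1); rewrite mulr1 -/E => ->; ring.
by have -> : D X = cexp ((s + s) * (ln X)%:C) * D 1; [rewrite -sc // mulr1|rewrite -D1; field].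
Qed.
End DiscPowers.

(** * Counting measure and measurability over the natural numbers *)

Section NatMeasurable.
Variable R : realType.
Local Notation C := R[i].

Lemma measurable_natX d d' (T : measurableType d) (T' : measurableType d') (f : nat * T -> T') :
  (forall n, measurable_fun setT (fun t => f (n, t))) -> measurable_fun setT f.
Proof.
move=> h _ Y mY; rewrite setTI.
rewrite (_ : _ @^-1` _ = \bigcup_n ([set n] `*` ((fun t => f (n, t)) @^-1` Y))).
  apply: bigcupT_measurable => n; apply: measurableX => //.
  by rewrite -[X in measurable X]setTI; apply: h.
apply/seteqP; split => [[n t] /= ft|[n t] /= [m _ [/= -> //]]].
by exists n.
Qed.

Lemma measurable_Xnat d d' (T : measurableType d) (T' : measurableType d') (f : T * nat -> T') :
  (forall n, measurable_fun setT (fun t => f (t, n))) -> measurable_fun setT f.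
Proof.
move=> h; rewrite (_ : f = (fun x => f (x.2, x.1)) \o (fun x => (x.2, x.1))).
  by apply: measurableT_comp; [exact: measurable_natX | exact: measurable_swap].
by apply/funext => -[].
Qed.

Lemma cmeas_nat (u : nat -> C) : cmeas u. Proof. by split. Qed.

Lemma cmeas_natX d (T : measurableType d) (f : nat * T -> C) :
  (forall n, cmeas (fun t => f (n, t))) -> cmeas f.
Proof. by move=> h; split; apply: measurable_natX => n; case: (h n). Qed.

Lemma cmeas_Xnat d (T : measurableType d) (f : T * nat -> C) :
  (forall n, cmeas (fun t => f (t, n))) -> cmeas f.
Proof. by move=> h; split; apply: measurable_Xnat => n; case: (h n). Qed.

Lemma cmeas_nat2 (f : nat * nat -> C) : cmeas f.
Proof. by apply: cmeas_natX => n; apply: cmeas_nat. Qed.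
End NatMeasurable.

Section CountingMeasure.
Variable R : realType.
(** Counting measure under its own name, to carry the sigma-finite instance that Fubini requires. *)
Definition cnt : set nat -> \bar R := @counting nat R.
HB.instance Definition _ := Measure.copy cnt (@counting nat R).
HB.instance Definition _ := Measure_isSigmaFinite.Build _ _ _ cnt (sigma_finite_counting R).
End CountingMeasure.

(** * Absolutely convergent series *)

Section ComplexSeries.
Variable R : realType.
Local Notation cnt := (@cnt R).
Local Notation C := R[i].
Implicit Type u v : nat -> C.

(** Series are integrals over [nat], so that exchanging sums with sums, integrals or limits falls
    under the facts already proved for [CI]. *)
Definition CS u : C := CI cnt u.
Definition summ u := cintg cnt u.

Lemma eq_CS u v : u =1 v -> CS u = CS v. Proof. exact: eq_CI. Qed.
Lemma eq_summ u v : u =1 v -> summ u -> summ v. Proof. exact: cintg_ext. Qed.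
Lemma CSZ c u : summ u -> CS (fun n => c * u n) = c * CS u. Proof. exact: CIZ. Qed.
Lemma CSD u v : summ u -> summ v -> CS (fun n => u n + v n) = CS u + CS v. Proof. exact: CID. Qed.
Lemma CSB u v : summ u -> summ v -> CS (fun n => u n - v n) = CS u - CS v. Proof. exact: CIB. Qed.
Lemma summZ c u : summ u -> summ (fun n => c * u n). Proof. exact: cintgZ. Qed.
Lemma summB u v : summ u -> summ v -> summ (fun n => u n - v n). Proof. exact: cintgB. Qed.

Lemma summ_dom u v : (forall n, cabs (u n) <= cabs (v n)) -> summ v -> summ u.
Proof. by move=> h; apply: cintg_dom => //; apply: cmeas_nat. Qed.

Lemma summ_bound u (M : R) : (forall N, \sum_(k < N) cabs (u k) <= M) -> summ u.
Proof.
move=> h; split; first exact: cmeas_nat.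
rewrite ge0_integral_count; last by move=> k; rewrite lee_fin cabs_ge0.
apply: (@le_lt_trans _ _ M%:E); last exact: ltry.
apply: lime_le.
  by apply: is_cvg_nneseries => n _ _; rewrite lee_fin cabs_ge0.
by near=> N; rewrite sumEFin lee_fin big_mkord.
Unshelve. all: by end_near. Qed.

Lemma summ_partial u : summ u -> exists2 M, 0 <= M & forall N, \sum_(k < N) cabs (u k) <= M.
Proof.
move=> [_]; rewrite ge0_integral_count; last by move=> k; rewrite lee_fin cabs_ge0.
set S := (X in (X < _)%E) => hS.
have S0 : (0 <= S)%E by apply: nneseries_ge0 => n _ _; rewrite lee_fin cabs_ge0.
exists (fine S); first exact: fine_ge0.
move=> N; rewrite -lee_fin fineK ?ge0_fin_numE // -sumEFin.
apply: le_trans (nneseries_lim_ge N _); last by move=> n _ _; rewrite lee_fin cabs_ge0.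
by rewrite big_mkord.
Qed.

Lemma CS_single (m : nat) (c : C) : CS (fun k => if k == m then c else 0) = c.
Proof.
have i1 : (\int[cnt]_k (\1_[set m] k)%:E)%E = 1%E :> \bar R.
  rewrite integral_indic // setIT; change (@counting nat R [set m] = 1%E); rewrite /counting asboolT ?finite_set1 //.
  by rewrite fset_set1 finmap.cardfs1.
have h : summ (fun k => (\1_[set m] k : R)%:C).
  split; first exact: cmeas_nat.
  rewrite (_ : (fun x => _) = (fun k => (\1_[set m] k)%:E)) ?i1 ?ltry //.
  by apply/funext => k; rewrite cabsR ger0_norm.
transitivity (CS (fun k => c * (\1_[set m] k : R)%:C)).
  apply: eq_CS => k; rewrite indicE; case: eqP => [->|km]; first by rewrite mem_set ?mulr1.
  by rewrite memNset ?mulr0.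
rewrite CSZ //; rewrite -[RHS]mulr1; congr (_ * _).
rewrite /CS /CI /Rintegral /=; apply: ceqP => /=; first by rewrite i1.
by rewrite integral0.
Qed.

Lemma summ_finsupp u N : (forall k, (N <= k)%N -> u k = 0) -> summ u.
Proof.
move=> h; apply: (@summ_bound _ (\sum_(k < N) cabs (u k))) => M.
have [MN|/ltnW MN] := leqP M N.
  by rewrite (big_ord_widen _ (fun k => cabs (u k)) MN) big_mkcond /= ler_sum // => i _; case: ifP => // _; apply: cabs_ge0.
rewrite (big_ord_widen _ (fun k => cabs (u k)) MN) [in X in _ <= X]big_mkcond /= ler_sum // => i _.
by case: ltnP => // Ni; rewrite h ?cabs0.
Qed.

Lemma CS_finsupp u N : (forall k, (N <= k)%N -> u k = 0) -> CS u = \sum_(k < N) u k.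
Proof.
move=> h; transitivity (CS (fun k => \sum_(i < N) (if k == i :> nat then u i else 0))).
  apply: eq_CS => k; have [kN|kN] := ltnP k N.
    rewrite (bigD1 (Ordinal kN)) //= eqxx big1 ?addr0 // => i; rewrite -val_eqE /= eq_sym.
    by move=> /negbTE ->.
  rewrite h // big1 // => i _; case: eqP => // e; move: (ltn_ord i).
  by rewrite -e ltnNge kN.
rewrite /CS CI_sum; last first.
  by move=> i _; apply: (@summ_finsupp _ i.+1) => k ik; rewrite gtn_eqF.
by apply: eq_bigr => i _; rewrite -/(CS _) CS_single.
Qed.

(** Dominated convergence over [nat], that is, Tannery's theorem; most limits of series below rest
    on it. *)
Lemma CS_dct (F : nat -> nat -> C) f g : (forall k, ccvg (F ^~ k) (f k)) ->
  summ (fun k => (g k)%:C) -> (forall n k, cabs (F n k) <= g k) -> summ f /\ ccvg (fun n => CS (F n)) (CS f).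
Proof.
move=> Ff [_ gi] Fg; have g0 k : 0 <= g k by apply: le_trans (Fg 0%N k); apply: cabs_ge0.
apply: (@CI_dct _ _ _ _ _ _ g) => //; try by move=> *; apply: cmeas_nat.
rewrite (_ : (fun x => (g x)%:E) = (fun k => (cabs (g k)%:C)%:E)) //.
by apply/funext => k; rewrite cabsR ger0_norm.
Qed.

Lemma CS_cvg u : summ u -> ccvg (fun N => \sum_(k < N) u k) (CS u).
Proof.
move=> su; have [] := @CS_dct (fun N k => if (k < N)%N then u k else 0) u (fun k => cabs (u k)).
- move=> k; apply: (@ccvg_near _ (fun=> u k)); last exact: ccvg_cst.
  by near=> N; rewrite ifT //; near: N; exists k.+1.
- by apply: summ_dom su => k; rewrite cabsR ger0_norm ?cabs_ge0.
- by move=> n k; case: ifP => // _; rewrite cabs0 cabs_ge0.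
move=> _; apply: ccvg_ext => N /=; rewrite (@CS_finsupp _ N).
  by apply: eq_bigr => i _; rewrite ltn_ord.
by move=> k; rewrite leqNgt => /negbTE ->.
Unshelve. all: by end_near. Qed.

Lemma CS_unique u l : summ u -> ccvg (fun N => \sum_(k < N) u k) l -> CS u = l.
Proof. by move=> /CS_cvg; exact: ccvg_unique. Qed.

Lemma summ_abs u : summ u -> summ (fun k => (cabs (u k))%:C).
Proof. by apply: summ_dom => k; rewrite cabsR ger0_norm ?cabs_ge0. Qed.

Lemma summ_S u : summ (fun k => u k.+1) -> summ u.
Proof.
move=> /summ_partial[M M0 h]; apply: (@summ_bound _ (cabs (u 0%N) + M)) => -[|N].
  by rewrite big_ord0 addr_ge0 ?cabs_ge0.
by rewrite big_ord_recl lerD2l; apply: h.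
Qed.

Lemma summS u : summ u -> summ (fun k => u k.+1).
Proof.
move=> /summ_partial[M M0 h]; apply: (@summ_bound _ M) => N.
by apply: le_trans (h N.+1); rewrite big_ord_recl lerDr cabs_ge0.
Qed.

Lemma CS_recl u : summ u -> CS u = u 0%N + CS (fun k => u k.+1).
Proof.
move=> su; apply: CS_unique => //; apply: (@ccvg_unshift _ _ _ 1%N).
apply: (@ccvg_ext _ (fun N => u 0%N + \sum_(k < N) u k.+1)).
  by move=> N; rewrite addn1 big_ord_recl.
by apply: ccvgD; [exact: ccvg_cst | apply: CS_cvg; exact: summS].
Qed.

Lemma summ_shift u N : summ u -> summ (fun k => u (k + N)%N).
Proof.
elim: N => [|N IH] su; first by apply: eq_summ su => k; rewrite addn0.
by apply: eq_summ (summS (IH su)) => k; rewrite addSnnS.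
Qed.

Lemma CS_split u N : summ u -> CS u = \sum_(k < N) u k + CS (fun k => u (k + N)%N).
Proof.
elim: N => [|N IH] su.
  by rewrite big_ord0 add0r; apply: eq_CS => k; rewrite addn0.
rewrite IH // CS_recl; last exact: summ_shift.
rewrite big_ord_recr /= -addrA add0n; congr (_ + (_ + _)).
by apply: eq_CS => k; rewrite addSnnS.
Qed.

Lemma CS_tele v l : ccvg v l -> summ (fun k => v k.+1 - v k) -> CS (fun k => v k.+1 - v k) = l - v 0%N.
Proof.
move=> vl sv; apply: CS_unique => //; apply: (@ccvg_ext _ (fun N => v N - v 0%N)).
  by move=> N; rewrite -(big_mkord xpredT (fun k => v k.+1 - v k)) telescope_sumr.
by apply: ccvgB => //; apply: ccvg_cst.
Qed.

Lemma summ_cvg0 u : summ u -> ccvg u 0.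
Proof.
move=> su; have h := CS_cvg su.
apply: (@ccvg_ext _ (fun N => \sum_(k < N.+1) u k - \sum_(k < N) u k)).
  by move=> N; rewrite big_ord_recr /= addrAC subrr add0r.
rewrite -[X in ccvg _ X](subrr (CS u)); apply: ccvgB => //.
by move/(ccvg_shift 1%N): h; apply: ccvg_ext => n; rewrite addn1.
Qed.

Lemma CS_abs u (M : R) : (forall N, \sum_(k < N) cabs (u k) <= M) -> cabs (CS u) <= M.
Proof.
move=> h; have su := summ_bound h; have := CS_cvg su => /ccvg_abs hc.
rewrite -(cvg_lim _ hc) //; apply: limr_le; first by apply/cvg_ex; eexists; exact: hc.
near=> N; apply: le_trans (h N); elim: (N) => [|m IH]; first by rewrite !big_ord0 cabs0.
by rewrite !big_ord_recr /= (le_trans (cabsD _ _)) // lerD2r.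
Unshelve. all: by end_near. Qed.

Lemma summ_real_dom u (g : nat -> R) : (forall n, cabs (u n) <= g n) -> summ (fun n => (g n)%:C) -> summ u.
Proof.
move=> h; apply: summ_dom => n; rewrite cabsR ger0_norm //.
by apply: le_trans (h n); apply: cabs_ge0.
Qed.

Lemma summ_geo (c : R) (q : R) : 0 <= q < 1 -> summ (fun n => (c * q ^+ n)%:C).
Proof.
move=> /andP[q0 q1]; apply: (@summ_bound _ (`|c| / (1 - q))) => N.
under eq_bigr do rewrite cabsR normrM (ger0_norm (exprn_ge0 _ q0)).
rewrite -mulr_sumr ler_wpM2l //.
have := subrX1 q N; rewrite -opprB => /(congr1 -%R); rewrite opprK -mulNr opprB => e.
by rewrite -[leRHS]mul1r ler_pdivlMr ?subr_gt0 // mulrC -e lerBlDr lerDl exprn_ge0.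
Qed.

(** Sums over the fibres of [deg]. With w n = rho^n, an absolutely convergent sum over any index set
    becomes a power series in rho whose coefficients do not depend on rho. *)
Lemma CI_regroup d (S : measurableType d) (ka : {sigma_finite_measure set S -> \bar R})
    (q : S -> C) (deg : S -> nat) (w : nat -> C) : measurable_fun setT deg ->
  (forall n, cabs (w n) <= 1) -> cintg ka q ->
  [/\ summ (fun n => CI ka (fun x => if deg x == n then q x else 0)),
      cintg ka (fun x => q x * w (deg x)) &
      CI ka (fun x => q x * w (deg x)) = CS (fun n => w n * CI ka (fun x => if deg x == n then q x else 0))].
Proof.
move=> md w1 iq; have mq := cintg_meas iq.
have meq n : measurable_fun setT (fun x => deg x == n).
  by apply: (measurableT_comp (f := fun m : nat => m == n)).
have mfib n : cmeas (fun x => if deg x == n then q x else 0).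
  by apply: cmeas_if => //; exact: cmeas_cst.
have mw : cmeas (fun x => w (deg x)) by exact: (cmeas_comp (cmeas_nat w) md).
have tot x : (\int[cnt]_n (cabs (if deg x == n then q x else 0))%:E = (cabs (q x))%:E)%E.
  rewrite ge0_integral_count; last by move=> n; rewrite lee_fin cabs_ge0.
  rewrite (@nneseriesD1 _ _ (deg x)) //= ?eqxx; last by move=> n _; rewrite lee_fin cabs_ge0.
  by rewrite eseries0 ?adde0 // => n _ h; rewrite eq_sym (negbTE h) cabs0.
have c1 : cintg (ka \x cnt)%E (fun z => if deg z.1 == z.2 then q z.1 else 0).
  apply: cintg_fubini; first by apply: cmeas_Xnat => n /=.
  by under eq_integral do rewrite /= tot; case: iq.
have c2 : cintg (ka \x cnt)%E (fun z => w z.2 * (if deg z.1 == z.2 then q z.1 else 0)).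
  apply: (@cintg_dom _ _ _ _ _ (fun z => if deg z.1 == z.2 then q z.1 else 0)) => //.
    by apply: cmeas_Xnat => n /=; apply: cmeasM => //; exact: cmeas_cst.
  by move=> z; rewrite cabsM -[leRHS]mul1r ler_wpM2r ?cabs_ge0.
have e x : CI cnt (fun n => w n * (if deg x == n then q x else 0)) = q x * w (deg x).
  rewrite -/(CS _) -[RHS](CS_single (deg x)); apply: eq_CS => n; rewrite eq_sym.
  by case: eqP => [->|_]; rewrite ?mulr0 // mulrC.
split.
- rewrite /summ; split; first exact: cmeas_nat.
  apply: (@le_lt_trans _ _ (\int[cnt]_n \int[ka]_x (cabs (if deg x == n then q x else 0))%:E)%E).
    apply: ge0_le_integral => //.
    - by move=> n _; rewrite lee_fin cabs_ge0.
    - move=> n _; apply: CI_abs; apply: (cintg_dom (mfib n) _ iq) => x.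
      by case: ifP => // _; rewrite cabs0 cabs_ge0.
  rewrite -(tonelli ka cnt (f := fun x n => (cabs (if deg x == n then q x else 0))%:E)).
  - by under eq_integral do rewrite tot; case: iq.
  - by apply: cmeas_absE; apply: cmeas_Xnat => n /=.
  - by move=> x y; rewrite lee_fin cabs_ge0.
- apply: cintg_dom iq; first exact: cmeasM.
  by move=> x; rewrite cabsM -[leRHS]mulr1 ler_wpM2l ?cabs_ge0.
- under eq_CI do rewrite -e.
  rewrite (CI_swap (f := fun x n => w n * (if deg x == n then q x else 0))).
  - apply: eq_CI => n; rewrite CIZ //; apply: (cintg_dom (mfib n) _ iq) => x.
    by case: ifP => // _; rewrite cabs0 cabs_ge0.
  - by case: c2.
  - case: c2 => m2; rewrite fubini_tonelli1 //; first exact: cmeas_absE.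
    by move=> z; rewrite lee_fin cabs_ge0.
Qed.

Lemma CS_mul u v : summ u -> summ v -> cintg (prodm cnt cnt) (fun p => u p.1 * v p.2) /\
  CI (prodm cnt cnt) (fun p => u p.1 * v p.2) = CS u * CS v.
Proof.
move=> su sv; have c : cintg (cnt \x cnt)%E (fun p : nat * nat => u p.1 * v p.2).
  apply: cintg_fubini; first exact: cmeas_nat2.
  have e n : (\int[cnt]_m (cabs (u n * v m))%:E = (cabs (u n))%:E * \int[cnt]_m (cabs (v m))%:E)%E.
    under eq_integral do rewrite cabsM EFinM.
    by rewrite ge0_intZl // => [m|]; rewrite lee_fin cabs_ge0.
  under eq_integral do rewrite /= e.
  rewrite ge0_intZr; [|by []|by move=> m; rewrite lee_fin cabs_ge0|].
    case: su sv => [_ h1] [_ h2]; apply: lte_mul_pinfty => //.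
      by apply: integral_ge0 => x _; rewrite lee_fin cabs_ge0.
    by rewrite ge0_fin_numE // integral_ge0 // => x _; rewrite lee_fin cabs_ge0.
  by apply: integral_ge0 => x _; rewrite lee_fin cabs_ge0.
split; first exact: c.
transitivity (CI (cnt \x cnt)%E (fun p : nat * nat => u p.1 * v p.2)); first by [].
rewrite -(CI_fubini c) /=; under eq_CI do rewrite CIZ //.
rewrite mulrC -CIZ //; apply: eq_CI => n; exact: mulrC.
Qed.
End ComplexSeries.

(** * Infinite products and comparison series *)

Section InfiniteProducts.
Variable R : realType.
Local Notation C := R[i].
Implicit Type e : nat -> C.

Definition pprod e N : C := \prod_(k < N) (1 + e k).

Lemma pprodS e N : pprod e N.+1 = pprod e N * (1 + e N).
Proof. by rewrite /pprod big_ord_recr. Qed.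

(** Telescoping turns a product into a series, so that limits of products reduce to dominated
    convergence. *)
Lemma pprod_sum e N : pprod e N = 1 + \sum_(k < N) pprod e k * e k.
Proof.
elim: N => [|N IH]; first by rewrite /pprod !big_ord0 addr0.
by rewrite pprodS big_ord_recr /= addrA -IH mulrDr mulr1.
Qed.

Lemma pprod_bound e (g : nat -> R) M : (forall k, cabs (e k) <= g k) ->
  (forall N, \sum_(k < N) g k <= M) -> forall N, cabs (pprod e N) <= expR M.
Proof.
move=> eg gM N; apply: (@le_trans _ _ (expR (\sum_(k < N) g k))); last by rewrite ler_expR.
elim: N => [|N IH]; first by rewrite /pprod !big_ord0 expR0 cabs1.
rewrite pprodS cabsM big_ord_recr /= expRD ler_pM ?cabs_ge0 //.
apply: le_trans (cabsD _ _) _; rewrite cabs1; apply: le_trans (expR_ge1Dx _).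
by rewrite lerD2l.
Qed.

Lemma summ_partial_real (g : nat -> R) : (forall k, 0 <= g k) -> summ (fun k => (g k)%:C) ->
  exists M, forall N, \sum_(k < N) g k <= M.
Proof.
move=> g0 /summ_partial[M _ h]; exists M => N; apply: le_trans (h N).
by apply: ler_sum => k _; rewrite cabsR ler_norm.
Qed.

(** Tannery's theorem for products: the factors and their number both vary with n. It serves for the
    sine product. *)
Lemma pprod_tannery (E : nat -> nat -> C) e (g : nat -> R) (N_ : nat -> nat) :
  (forall k, ccvg (E ^~ k) (e k)) -> summ (fun k => (g k)%:C) ->
  (forall n k, cabs (E n k) <= g k) -> (forall n k, (N_ n <= k)%N -> E n k = 0) ->
  ccvg (fun n => pprod (E n) (N_ n)) (1 + CS (fun k => pprod e k * e k)).
Proof.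
move=> Ee sg Eg E0; have g0 k : 0 <= g k by apply: le_trans (cabs_ge0 _) (Eg 0%N k).
have [M gM] := summ_partial_real g0 sg.
apply: (@ccvg_ext _ (fun n => 1 + CS (fun k => pprod (E n) k * E n k))).
  move=> n; rewrite pprod_sum; congr (1 + _); apply: CS_finsupp => k kN.
  by rewrite E0 ?mulr0.
apply: ccvgD; first exact: ccvg_cst.
have [] := @CS_dct _ (fun n k => pprod (E n) k * E n k) (fun k => pprod e k * e k) (fun k => expR M * g k) => //.
- move=> k; apply: ccvgM => //; rewrite /pprod; elim: k => [|k IH].
    by under [X in ccvg X]eq_fun do rewrite big_ord0; rewrite big_ord0; apply: ccvg_cst.
  under [X in ccvg X]eq_fun do rewrite big_ord_recr; rewrite big_ord_recr /=; apply: ccvgM => //.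
  by apply: ccvgD => //; apply: ccvg_cst.
- apply: eq_summ (summZ (expR M)%:C sg) => k; by rewrite rcM.
- by move=> n k; rewrite cabsM ler_pM ?cabs_ge0 //; apply: pprod_bound gM _.
Qed.

Lemma summ_pprod e : summ e -> summ (fun k => pprod e k * e k).
Proof.
move=> se; have [M _ gM] := summ_partial se.
apply: (@summ_dom _ _ (fun k => (expR M)%:C * e k)); last exact: summZ.
move=> k; rewrite !cabsM ler_wpM2r ?cabs_ge0 // cabsR ger0_norm ?expR_ge0 //.
exact: (pprod_bound (fun k => lexx _) gM).
Qed.

Lemma pprod_cvg e : summ e -> ccvg (pprod e) (1 + CS (fun k => pprod e k * e k)).
Proof.
move=> se; apply: (@ccvg_ext _ (fun N => 1 + \sum_(k < N) pprod e k * e k)).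
  by move=> N; rewrite pprod_sum.
by apply: ccvgD; [exact: ccvg_cst | apply: CS_cvg; exact: summ_pprod].
Qed.

Lemma summ_unshift (u : nat -> C) N : summ (fun k => u (k + N)%N) -> summ u.
Proof.
elim: N => [|N IH] su; first by apply: eq_summ su => k; rewrite addn0.
by apply: IH; apply: summ_S; apply: eq_summ su => k; rewrite addSnnS.
Qed.

Lemma summ_near (u v : nat -> C) : (\forall n \near \oo, cabs (u n) <= cabs (v n)) -> summ v -> summ u.
Proof.
move=> [N _ h] sv; apply: (@summ_unshift _ N); apply: summ_dom (summ_shift N sv) => k.
by apply: h => /=; apply: leq_addl.
Qed.

(** The product of the inverse factors converges as well, and the two limits multiply to 1. *)
Lemma pprod_cvg_neq0 e : summ e -> (forall k, 1 + e k != 0) -> exists2 l, l != 0 & ccvg (pprod e) l.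
Proof.
move=> se e0; pose f k := (1 + e k)^-1 - 1.
have sf : summ f.
  apply: (@summ_near _ (fun k => 2%:R * e k)); last exact: summZ.
  have /ccvg_abs := summ_cvg0 se; rewrite cabs0 => /cvgrPdistC_le/(_ (1 / 2))[]; first by lra.
  move=> N _ h; exists N => // k /h; rewrite subr0 ger0_norm ?cabs_ge0 // => hk.
  have -> : f k = - e k / (1 + e k) by rewrite /f; field; exact: e0.
  rewrite !cabsM cabsN cabsV cabsn mulrC ler_wpM2r ?cabs_ge0 //.
  have : cabs (1 : C) <= cabs (1 + e k) + cabs (e k) by rewrite -{1}(addrK (e k) 1) cabsB.
  rewrite cabs1 => h1; have h2 : 0 < cabs (1 + e k) by lra.
  rewrite -[leRHS]invrK lef_pV2 ?posrE ?invr_gt0 //; lra.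
exists (1 + CS (fun k => pprod e k * e k)); last exact: pprod_cvg.
have := ccvgM (pprod_cvg se) (pprod_cvg sf); have h1 : ccvg (fun n => pprod e n * pprod f n) 1.
  apply: (@ccvg_ext _ (fun=> 1)); last exact: ccvg_cst.
  by move=> n; rewrite /pprod -big_split big1 //= => k _; rewrite /f addrCA subrr addr0 mulfV.
move/(ccvg_unique h1) => h; apply: contra_eq_neq h => ->; rewrite mul0r; exact: oner_neq0.
Qed.

Lemma summ_invsq (c : R) : summ (fun n => (c / n.+1%:R ^+ 2)%:C).
Proof.
apply: summ_S; apply: (@summ_bound _ _ `|c|) => N.
under eq_bigr do rewrite cabsR normrM [X in _ * X]ger0_norm ?invr_ge0 ?exprn_ge0 ?ler0n //.
rewrite -mulr_sumr -[leRHS]mulr1 ler_wpM2l //.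
suff : \sum_(i < N) (i.+2%:R ^+ 2)^-1 <= 1 - (N.+1%:R)^-1 :> R.
  by move/le_trans; apply; rewrite gerBl invr_ge0 ler0n.
elim: N => [|N IH]; first by rewrite big_ord0 invr1 subrr.
rewrite big_ord_recr /=; apply: le_trans (lerD IH (lexx _)) _.
have n0 : (0 : R) < N.+1%:R by rewrite ltr0n.
have n1 : N.+2%:R = N.+1%:R + 1 :> R by rewrite -natr1.
rewrite n1; set n := (N.+1%:R : R) in n0 *.
rewrite -subr_ge0 (_ : _ - _ = (n * (n + 1) ^+ 2)^-1); first by rewrite invr_ge0 mulr_ge0 ?sqr_ge0 // ltW.
by field; rewrite !gt_eqF //; lra.
Qed.

(** Comparison with the telescoping differences n^(-d) - (n + 1)^(-d), which dominate d (n + 1)^(-1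
    - d). *)
Lemma summ_pseries (c d : R) : 0 < d -> summ (fun n => (c * expR (- (1 + d) * ln n.+1%:R))%:C).
Proof.
move=> d0; apply: summ_S; apply: (@summ_bound _ _ (`|c| / d)) => N.
under eq_bigr do rewrite cabsR normrM [X in _ * X]ger0_norm ?expR_ge0 //.
rewrite -mulr_sumr ler_wpM2l //.
suff : d * \sum_(i < N) expR (- (1 + d) * ln i.+2%:R) <= 1 - expR (- d * ln N.+1%:R).
  move=> h; rewrite -[leRHS]mul1r ler_pdivlMr // mulrC; apply: le_trans h _.
  by rewrite gerBl expR_ge0.
elim: N => [|N IH]; first by rewrite big_ord0 ln1 !mulr0 expR0 subrr.
rewrite big_ord_recr /= mulrDr; apply: le_trans (lerD IH (lexx _)) _.
set x := N.+1%:R; set y := N.+2%:R.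
have x0 : 0 < x by rewrite ltr0n.
have y0 : 0 < y by rewrite ltr0n.
have hy : y = x + 1 by rewrite /y -natr1.
have hl : y^-1 <= ln y - ln x.
  have -> : ln y - ln x = - ln (x / y) by rewrite ln_div ?posrE // opprB.
  have -> : x / y = 1 + (- y^-1) by rewrite hy; field; lra.
  rewrite lerNr; apply: le_trans (le_ln1Dx _) _ => //.
  by rewrite ltrNl opprK invf_lt1 // hy; lra.
have e1 : expR (- d * ln x) = expR (- d * ln y) * expR (d * (ln y - ln x)).
  by rewrite -expRD; congr expR; ring.
have e2 : expR (- (1 + d) * ln y) = expR (- d * ln y) * y^-1.
  by rewrite mulNr mulrDl mul1r opprD expRD expRN lnK ?posrE // mulrC mulNr.
rewrite e1 e2; have p := expR_gt0 (- d * ln y); have q := expR_ge1Dx (d * (ln y - ln x)).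
set P := expR _ in p *; set Q := expR _ in q *.
have a1 : d * y^-1 <= Q - 1 by apply: le_trans (ler_wpM2l (ltW d0) hl) _; rewrite lerBrDl.
have a2 := ler_wpM2l (ltW p) a1.
have -> : d * (P / y) = P * (d / y) by ring.
rewrite -addrA lerD2l addrC; apply: le_trans (lerD a2 (lexx _)) _; rewrite mulrBr mulr1; lra.
Qed.
End InfiniteProducts.

(** * Binomial coefficients and Gauss's formula for Gamma *)

Section BinomialCoefficients.
Variable R : realType.
Local Notation C := R[i].
Implicit Type s : C.

(* the coefficients of (1 - x)^(-s) *)
Definition cb s n : C := poch s n / n`!%:R.

Lemma fact_neq0 n : (n`!%:R : C) != 0. Proof. by rewrite pnatr_eq0 -lt0n fact_gt0. Qed.
Lemma natC_neq0 n : (n.+1%:R : C) != 0. Proof. by rewrite pnatr_eq0. Qed.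
Lemma poch0 s : poch s 0 = 1. Proof. by rewrite /poch big_ord0. Qed.
Lemma pochS s n : poch s n.+1 = poch s n * (s + n%:R). Proof. by rewrite /poch big_ord_recr. Qed.
Lemma pochSl s n : poch s n.+1 = s * poch (s + 1) n.
Proof.
rewrite /poch big_ord_recl /= addr0; congr (_ * _); apply: eq_bigr => i _.
by rewrite -addrA -[_%:R in RHS]/(i%:R) nat1r.
Qed.
Lemma cb0 s : cb s 0 = 1. Proof. by rewrite /cb poch0 divr1. Qed.
Lemma cbS s n : n.+1%:R * cb s n.+1 = (s + n%:R) * cb s n.
Proof.
rewrite /cb pochS factS natrM; field; rewrite fact_neq0 /= nat1r natC_neq0 //.
Qed.
Lemma cb1 n : cb (1 : C) n = 1.
Proof.
elim: n => [|n IH]; first exact: cb0.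
by apply: (mulfI (natC_neq0 n)); rewrite cbS IH !mulr1 nat1r.
Qed.
Lemma cb_shift s n : s * cb (s + 1) n = (s + n%:R) * cb s n.
Proof. by rewrite /cb mulrA -pochSl pochS mulrCA mulrA. Qed.
Lemma poch_neq0 s n : (forall k, s + k%:R != 0) -> poch s n != 0.
Proof. by move=> h; rewrite /poch; apply/prodf_neq0 => k _; apply: h. Qed.
Lemma cb_neq0 s n : (forall k, s + k%:R != 0) -> cb s n != 0.
Proof. by move=> h; rewrite mulf_neq0 ?invr_eq0 ?fact_neq0 ?poch_neq0. Qed.
(** The power (n + 1)^w; the shift keeps the logarithm away from 0. *)
Definition npow (w : C) n : C := cexp (w * (ln n.+1%:R)%:C).

Lemma npow_neq0 w n : npow w n != 0. Proof. exact: cexp_neq0. Qed.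
Lemma npow0 n : npow 0 n = 1. Proof. by rewrite /npow mul0r cexp0. Qed.
Lemma npowD w v n : npow (w + v) n = npow w n * npow v n.
Proof. by rewrite /npow mulrDl cexpD. Qed.
Lemma npowN w n : npow (- w) n = (npow w n)^-1.
Proof. by rewrite /npow mulNr cexpN. Qed.
Lemma npow1 n : npow 1 n = n.+1%:R.
Proof. by rewrite /npow mul1r cexpR lnK ?posrE ?ltr0n // rcn. Qed.
Lemma cabs_npow w n : cabs (npow w n) = expR (cre w * ln n.+1%:R).
Proof. exact: cabs_cexp_real. Qed.

(** The consecutive ratios, minus 1, of [cb s n] times (n + 1)^(1 - s). They are O(1 / n^2), which
    makes Gauss's product absolutely convergent. *)
Let cbe s k := (1 + (s - 1) / k.+1%:R) * (npow (- (s - 1)) k.+1 / npow (- (s - 1)) k) - 1.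

Let pprod_cbe s n : pprod (cbe s) n = cb s n * npow (1 - s) n.
Proof.
elim: n => [|n IH]; first by rewrite /pprod big_ord0 cb0 /npow ln1 mulr0 cexp0 mulr1.
rewrite pprodS IH; have -> : 1 + cbe s n = (1 + (s - 1) / n.+1%:R) * (npow (- (s - 1)) n.+1 / npow (- (s - 1)) n) by rewrite /cbe; ring.
rewrite opprB.
have -> : 1 + (s - 1) / n.+1%:R = (s + n%:R) / n.+1%:R by rewrite -nat1r; field; rewrite nat1r natC_neq0.
have -> : cb s n.+1 = (s + n%:R) * cb s n / n.+1%:R by rewrite -cbS mulrC mulKf ?natC_neq0.
by field; rewrite ?(nat1r, natr1) ?natC_neq0 ?npow_neq0.
Qed.

Let cbe_bound s : \forall n \near \oo, cabs (cbe s n) <= 15 * (cabs (s - 1) + cabs (s - 1) ^+ 2) / n.+1%:R ^+ 2.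
Proof.
set w := s - 1; have := near_inv_nat (cabs w); apply: filterS => n.
have W0 := cabs_ge0 w; set W := cabs w in W0 *.
have n0 : (0 : R) < n.+1%:R by rewrite ltr0n.
rewrite ger0_norm ?(divr_ge0 W0 (ltW n0)) // => hn.
set h : R := n.+1%:R^-1; have h0 : 0 < h by rewrite invr_gt0.
have hn' : W * h <= 1 / 2 by [].
set l := ln (1 + h).
have l0 : 0 <= l by apply: ln_ge0; lra.
have lh : l <= h by apply: le_ln1Dx; lra.
(* From ln (1 + h) >= h / (1 + h), which is the usual upper bound of ln taken at 1 / (1 + h). *)
have hl : h - l <= h ^+ 2.
  have : h / (1 + h) <= l.
    have -> : l = - ln (1 + (- (h / (1 + h)))).
      rewrite (_ : 1 + _ = (1 + h)^-1); last by field; lra.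
      by rewrite lnV ?opprK ?posrE //; lra.
    rewrite lerNr; apply: le_ln1Dx; rewrite ltrN2 ltr_pdivrMr ?mul1r; lra.
  move=> H; have : h - h / (1 + h) <= h ^+ 2; last by lra.
  rewrite (_ : _ - _ = h ^+ 2 / (1 + h)); last by field; lra.
  by rewrite ler_pdivrMr ?ler_peMr ?sqr_ge0 //; lra.
have -> : cbe s n = (1 + w * h%:C) * cexp (- (w * l%:C)) - 1.
  rewrite /cbe -/w; congr (_ * _ - 1); first by rewrite rcV rcn.
  rewrite /npow -cexpB -mulrBr -rcB -ln_div ?posrE ?ltr0n // mulNr; congr (cexp (- (w * _%:C))).
  congr ln; rewrite /h -natr1; field; by rewrite nat1r gt_eqF.
set z := w * l%:C; have cz : cabs z = W * l by rewrite cabsM cabsR ger0_norm.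
have zb : cabs (- z) <= 1 / 2 by rewrite cabsN cz; nra.
have := cexp_bound zb; rewrite cabsN; set r := cexp (- z) - 1 - - z => hr.
have -> : cexp (- z) = 1 - z + r by rewrite /r; ring.
have -> : (1 + w * h%:C) * (1 - z + r) - 1 = w * (h - l)%:C - w * h%:C * z + (1 + w * h%:C) * r.
  by rewrite /z rcB; ring.
have ch : cabs (w * h%:C) = W * h by rewrite cabsM cabsR gtr0_norm.
have b1 : cabs (w * (h - l)%:C) <= W * h ^+ 2.
  by rewrite cabsM cabsR ger0_norm ?subr_ge0 // ler_wpM2l.
have b2 : cabs (w * h%:C * z) <= W ^+ 2 * h ^+ 2 by rewrite cabsM ch cz; nra.
(* 1 + w h has modulus at most 2 and [cexp_bound] has constant 7; with the contribution of [b2] this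
   is the 15 of the statement. *)
have b3 : cabs ((1 + w * h%:C) * r) <= 2 * (7 * (W ^+ 2 * h ^+ 2)).
  rewrite cabsM ler_pM ?cabs_ge0 //.
    by apply: le_trans (cabsD _ _) _; rewrite cabs1 ch; lra.
  apply: le_trans hr _; rewrite cz exprMn ler_wpM2l // ler_wpM2l ?sqr_ge0 //.
  by rewrite ler_pXn2r // nnegrE // ltW.
apply: le_trans (cabsD _ _) _; apply: le_trans (lerD (cabsB _ _) b3) _.
apply: le_trans (lerD (lerD b1 b2) (lexx _)) _.
have -> : 15 * (W + W ^+ 2) / n.+1%:R ^+ 2 = 15 * (W + W ^+ 2) * h ^+ 2 by rewrite exprVn.
have := mulr_ge0 W0 (sqr_ge0 h); nra.
Qed.

Let summ_cbe s : summ (cbe s).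
Proof.
pose c := 15 * (cabs (s - 1) + cabs (s - 1) ^+ 2).
apply: (@summ_near _ _ (fun n => (c / n.+1%:R ^+ 2)%:C)); last exact: summ_invsq.
apply: filterS (cbe_bound s) => n h; rewrite cabsR; exact: le_trans h (ler_norm _).
Qed.

Lemma cb_bound s : exists2 M, 0 <= M & forall n, cabs (cb s n) <= M * expR ((cre s - 1) * ln n.+1%:R).
Proof.
have [M [M0 h]] := ccvg_bounded (pprod_cvg (summ_cbe s)); exists M; first exact: ltW.
move=> n; have := h n; rewrite pprod_cbe cabsM cabs_npow => hn.
rewrite -(ler_pM2r (expR_gt0 (cre (1 - s) * ln n.+1%:R))) -mulrA -expRD.
apply: le_trans hn _; rewrite (_ : _ + _ = 0) ?expR0 ?mulr1 //.
by rewrite creB (cre_nat R 1); ring.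
Qed.

Lemma npow_shift w k : ccvg (fun n => npow w (n + k)%N / npow w n) 1.
Proof.
have h1 : ccvg (fun n => npow w n.+1 / npow w n) 1.
  have h (n : nat) : 0 <= ln (n.+2%:R : R) - ln n.+1%:R <= 1 / n.+1%:R.
    have n0 : (0 : R) < n.+1%:R by rewrite ltr0n.
    have -> : ln n.+2%:R - ln n.+1%:R = ln (1 + 1 / n.+1%:R) :> R.
      rewrite -ln_div ?posrE ?ltr0n //; congr ln; rewrite -natr1; field; by rewrite nat1r gt_eqF.
    have p : (0 : R) < 1 / n.+1%:R by rewrite divr_gt0.
    apply/andP; split; first by apply: ln_ge0; rewrite lerDl ltW.
    by apply: le_ln1Dx; apply: lt_trans p; rewrite ltrN10.
  apply: (@ccvg_ext _ (fun n => cexp (w * (ln n.+2%:R - ln n.+1%:R)%:C))).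
    by move=> n; rewrite /npow -cexpB -mulrBr rcB.
  rewrite -(cexp0 R); apply: ccvg_cexp; rewrite -[X in ccvg _ X](mulr0 w).
  apply: ccvgM; first exact: ccvg_cst.
  apply: ccvg_real; apply: (@squeeze_cvgr _ _ _ _ (fun=> 0) (fun n => 1 / n.+1%:R)).
  - by near=> n; apply: h.
  - exact: cvg_cst.
  - exact: cvg_inv_nat.
elim: k => [|k IH].
  apply: (@ccvg_ext _ (fun=> 1)); last exact: ccvg_cst.
  by move=> n; rewrite addn0 divff ?npow_neq0.
have := ccvgM (ccvg_shift k h1) IH; rewrite mulr1; apply: ccvg_ext => n.
by rewrite addnS mulrA divfK ?npow_neq0.
Unshelve. all: by end_near. Qed.

Lemma npow_cvg0 w : cre w < 0 -> ccvg (npow w) 0.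
Proof.
move=> w0; apply: (@ccvg_squeeze _ _ _ (fun n => expR (cre w * ln n.+1%:R))).
  by near=> n; rewrite subr0 cabs_npow.
have h : (fun n : nat => ln n.+1%:R : R) @ \oo --> +oo.
  apply/cvgryPge => A; near=> n.
  rewrite -[A]expRK ler_ln ?posrE ?expR_gt0 ?ltr0n //.
  near: n; exists (Num.truncn (expR A)).+1 => // n /= hn.
  apply: ltW; apply: lt_le_trans (truncnS_gt _) _.
  by rewrite ler_nat ltnW.
have -> : (fun n => expR (cre w * ln n.+1%:R)) = (fun x : R => expR (- x)) \o (fun n => - cre w * ln n.+1%:R).
  by apply/funext => n /=; rewrite mulNr opprK.
apply: cvg_comp; last exact: cvgr_expR.
apply/cvgryPge => A; move/cvgryPge/(_ (A / - cre w)): h; apply: filterS => n.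
by rewrite ler_pdivrMr ?oppr_gt0 // mulrC.
Unshelve. all: by end_near. Qed.

Let gamma_aux s : (forall k, s + k%:R != 0) ->
  exists2 l, l != 0 & ccvg (fun n => cb s n * npow (1 - s) n) l.
Proof.
move=> h; have [|l l0 hl] := pprod_cvg_neq0 (summ_cbe s); last first.
  by exists l => //; apply: ccvg_ext hl => n; rewrite pprod_cbe.
move=> k; rewrite /cbe addrCA subrr addr0; apply: mulf_neq0; last by apply: mulf_neq0; rewrite ?invr_eq0 npow_neq0.
have -> : 1 + (s - 1) / k.+1%:R = (s + k%:R) / k.+1%:R.
  by rewrite -nat1r; field; rewrite nat1r natC_neq0.
by rewrite mulf_neq0 // invr_eq0 natC_neq0.
Qed.

(** The terms are, up to ratios tending to 1, the inverses of those in Gauss's formula. The limit is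
    nonzero because the product converges absolutely and no factor vanishes. *)
Lemma cGamma_cvg s : (forall k, s + k%:R != 0) ->
  cGamma s != 0 /\ ccvg (fun n => cb s n * npow (1 - s) n) (cGamma s)^-1.
Proof.
move=> h; have [l l0 hl] := gamma_aux h.
suff -> : cGamma s = l^-1 by rewrite invr_eq0 l0 invrK.
apply: ccvg_climn; apply: (@ccvg_unshift _ _ _ 1%N).
have h1 : ccvg (fun n => npow 1 n.+1 / npow 1 n) 1.
  by have := npow_shift 1 1; apply: ccvg_ext => n; rewrite addn1.
(* Moving the index of [cGamma] by one replaces n by n + 1, and its denominator then has n + 2
   factors; hence the index n + 2 and the corrections by [npow_shift]. *)
have hs : ccvg (fun n => (npow s (n + 2)%N / npow s n)^-1 * (npow 1 (n + 2)%N / npow 1 n) / (npow 1 n.+1 / npow 1 n)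
   / (cb s (n + 2)%N * npow (1 - s) (n + 2)%N)) l^-1.
  have := ccvgM (ccvg_div (oner_neq0 _) (ccvgM (ccvgV (oner_neq0 _) (npow_shift s 2)) (npow_shift 1 2)) h1) (ccvgV l0 (ccvg_shift 2 hl)).
  by rewrite invr1 !mul1r.
apply: ccvg_ext hs => n; rewrite addn1.
have -> : rpowc n.+1%:R s = npow s n by [].
rewrite -/(poch s n.+2) addn2; have cn0 := cb_neq0 n.+2 h.
have -> : poch s n.+2 = cb s n.+2 * n.+2`!%:R by rewrite /cb divfK ?fact_neq0.
rewrite (npowD 1 (- s)) npowN (factS n.+1) natrM.
have f0 := fact_neq0 n.+1; have n2 := natC_neq0 n.+1.
have -> : n.+2%:R = npow 1 n.+1 by rewrite npow1.
by field; rewrite f0 cn0 !npow_neq0.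
Qed.

Lemma cGamma_neq0 s : (forall k, s + k%:R != 0) -> cGamma s != 0.
Proof. by move=> /cGamma_cvg[]. Qed.

Lemma cGamma1 : cGamma (1 : C) = 1.
Proof.
have h k : (1 : C) + k%:R != 0 by rewrite nat1r natC_neq0.
have [g0 hg] := cGamma_cvg h; apply: invr_inj; rewrite invr1; apply: (ccvg_unique hg).
apply: (@ccvg_ext _ (fun=> 1)); last exact: ccvg_cst.
by move=> n; rewrite cb1 subrr npow0 mulr1.
Qed.

Lemma ccvg_natD_div (a b : C) : ccvg (fun n => (a + n%:R) / (b + n%:R)) 1.
Proof.
have hi (c : C) : ccvg (fun n => (c + n%:R) / n.+1%:R) 1.
  apply: (@ccvg_ext _ (fun n => 1 + (c - 1) * (n.+1%:R^-1 : R)%:C)).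
    by move=> n; rewrite rcV rcn -nat1r; field; rewrite nat1r natC_neq0.
  rewrite -[X in ccvg _ X](addr0 1); apply: ccvgD; first exact: ccvg_cst.
  rewrite -(mulr0 (c - 1)); apply: ccvgM; first exact: ccvg_cst.
  by apply: ccvg_real; exact: cvg_harmonic.
have := ccvg_div (oner_neq0 _) (hi a) (hi b); rewrite divr1; apply: ccvg_ext => n.
by rewrite invf_div mulrA divfK ?natC_neq0.
Qed.

Lemma cGammaS s : (forall k, s + k%:R != 0) -> cGamma (s + 1) = s * cGamma s.
Proof.
move=> h; have s0 : s != 0 by have := h 0%N; rewrite addr0.
have h1 k : s + 1 + k%:R != 0 by rewrite -addrA nat1r.
have [g0 hg] := cGamma_cvg h; have [g1 hg1] := cGamma_cvg h1.
apply: invr_inj; apply: (ccvg_unique hg1); rewrite invfM mulrC.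
apply: (@ccvg_ext _ (fun n => cb s n * npow (1 - s) n * ((s + n%:R) / (1 + n%:R)) * s^-1)).
  move=> n; have -> : cb (s + 1) n = (s + n%:R) * cb s n / s by rewrite -cb_shift mulrC mulKf.
  have -> : 1 - (s + 1) = (1 - s) + (- 1) by ring.
  by rewrite (npowD (1 - s) (- 1)) npowN npow1 -nat1r; field; rewrite s0 nat1r natC_neq0.
apply: ccvgM; last exact: ccvg_cst; rewrite -[X in ccvg _ X]mulr1.
exact: (ccvgM hg (ccvg_natD_div _ _)).
Qed.
End BinomialCoefficients.

(** * Gauss's summation theorem and the beta series *)

Section GaussSum.
Variable R : realType.
Local Notation C := R[i].
Implicit Types a b c s : C.

Lemma cre1 : cre (1 : C) = 1. Proof. exact: (cre_nat R 1). Qed.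

Lemma ccvg_invD c : ccvg (fun N => (c + N%:R)^-1) 0.
Proof.
have := ccvgM (ccvg_natD_div 1 c) (ccvg_real (@cvg_harmonic R)); rewrite mulr0; apply: ccvg_ext => N.
by rewrite nat1r /harmonic rcV rcn mulrAC divff ?natC_neq0 // mul1r.
Qed.

Lemma invD_bound c : exists2 M, 0 <= M & forall n, cabs (c + n%:R)^-1 <= M / n.+1%:R.
Proof.
have [M [M0 h]] := ccvg_bounded (ccvg_natD_div 1 c); exists M; first exact: ltW.
move=> n; rewrite ler_pdivlMr ?ltr0n //; apply: le_trans (h n).
by rewrite cabsM nat1r cabsn mulrC.
Qed.

Lemma cb_inv_bound c : (forall k, c + k%:R != 0) ->
  exists2 M, 0 <= M & forall n, cabs (cb c n)^-1 <= M * expR ((1 - cre c) * ln n.+1%:R).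
Proof.
move=> hc; have [g0 /ccvgV h] := cGamma_cvg hc; move: (h); rewrite invr_eq0 => /(_ g0) {}h.
have [M [M0 hM]] := ccvg_bounded h; exists M; first exact: ltW.
move=> n; have := hM n; rewrite invfM cabsM [X in _ * X]cabsV cabs_npow creB cre1.
by rewrite ler_pdivrMr ?expR_gt0.
Qed.

(** The terms of Gauss's series 2F1(a, b; c; 1). *)
Definition hg a b c k : C := cb a k * poch b k / poch c k.

Lemma hg_cb a b c k : hg a b c k = cb a k * cb b k / cb c k.
Proof. by rewrite /hg /cb invf_div; move: (poch c k)^-1 => P; field; exact: fact_neq0. Qed.

Lemma hgS a b c k : (forall k, c + k%:R != 0) ->
  k.+1%:R * hg a b c k.+1 = (a + k%:R) * (b + k%:R) / (c + k%:R) * hg a b c k.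
Proof.
move=> hc; rewrite /hg !pochS mulrA mulrA cbS.
by field; rewrite hc poch_neq0.
Qed.

Lemma hg_bound a b c : (forall k, c + k%:R != 0) ->
  exists2 M, 0 <= M & forall n, cabs (hg a b c n) <= M * expR (- (1 + cre (c - a - b)) * ln n.+1%:R).
Proof.
move=> hc; have [M1 p1 h1] := cb_bound a; have [M2 p2 h2] := cb_bound b; have [M3 p3 h3] := cb_inv_bound hc.
exists (M1 * M2 * M3); first by rewrite !mulr_ge0.
move=> n; rewrite hg_cb (cabsM (cb a n * cb b n)) (cabsM (cb a n)).
apply: le_trans (ler_pM _ _ (ler_pM _ _ (h1 n) (h2 n)) (h3 n)) _; rewrite ?mulr_ge0 ?cabs_ge0 //.
rewrite !creB le_eqVlt; apply/orP; left; apply/eqP.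
have -> : - (1 + (cre c - cre a - cre b)) * ln n.+1%:R = (cre a - 1) * ln n.+1%:R + (cre b - 1) * ln n.+1%:R + (1 - cre c) * ln n.+1%:R :> R by ring.
by rewrite !expRD; ring.
Qed.

Lemma summ_hg a b c : (forall k, c + k%:R != 0) -> 0 < cre (c - a - b) -> summ (hg a b c).
Proof.
move=> hc h; have [M _ hM] := hg_bound a b hc.
by apply: summ_real_dom hM _; apply: summ_pseries.
Qed.

Lemma hg_tail0 a b c : (forall k, c + k%:R != 0) -> 0 < cre (c - a - b) ->
  ccvg (fun k => k%:R * hg a b c k) 0.
Proof.
move=> hc h; have [M M0 hM] := hg_bound a b hc; set d := cre _ in h hM.
apply: (@ccvg_squeeze _ _ _ (fun n => M * cabs (npow (- d%:C) n))).
  near=> n; rewrite subr0 cabsM cabsn cabs_npow.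
  apply: (@le_trans _ _ (n.+1%:R * (M * expR (- (1 + d) * ln n.+1%:R)))).
    by rewrite ler_pM ?cabs_ge0 // ler_nat.
  rewrite mulrCA ler_wpM2l // opprD mulrDl mulN1r expRD expRN lnK ?posrE ?ltr0n //.
  by rewrite mulrA mulfV ?mul1r ?pnatr_eq0 // creN /=.
have /ccvg_abs : ccvg (npow (- d%:C)) 0 by apply: npow_cvg0; rewrite creN /= oppr_lt0.
by rewrite cabs0 => h0; rewrite -[X in _ --> X](mulr0 M); apply: cvgMr.
Unshelve. all: by end_near. Qed.

(** Gauss's contiguous relation in c. Termwise, the difference of the two sides is the increment of
    c k [hg a b c k], which telescopes to 0. *)
Lemma hg_contig a b c : (forall k, c + k%:R != 0) -> 0 < cre (c - a - b) ->
  (c - a) * (c - b) * CS (hg a b (c + 1)) = c * (c - a - b) * CS (hg a b c).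
Proof.
move=> hc h; have hc1 k : c + 1 + k%:R != 0 by rewrite -addrA nat1r.
have h1 : 0 < cre (c + 1 - a - b).
  rewrite (_ : c + 1 - a - b = (c - a - b) + 1); last by ring.
  by rewrite creD cre1; lra.
have s0 := summ_hg hc h; have s1 := summ_hg hc1 h1.
have e k : (c - a) * (c - b) * hg a b (c + 1) k - c * (c - a - b) * hg a b c k =
    c * (k.+1%:R * hg a b c k.+1 - k%:R * hg a b c k).
  have c0 : c != 0 by have := hc 0%N; rewrite addr0.
  have -> : hg a b (c + 1) k = c / (c + k%:R) * hg a b c k.
    have p1 := poch_neq0 k hc; have p2 := poch_neq0 k hc1.
    rewrite /hg; have := pochS c k; rewrite pochSl => e.
    have -> : poch (c + 1) k = poch c k * (c + k%:R) / c by rewrite -e mulrC mulKf.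
    by field; rewrite c0 hc p1.
  by rewrite hgS //; field; exact: hc.
have c0 : c != 0 by have := hc 0%N; rewrite addr0.
have sT : summ (fun k => k.+1%:R * hg a b c k.+1 - k%:R * hg a b c k).
  have := summZ c^-1 (summB (summZ ((c - a) * (c - b)) s1) (summZ (c * (c - a - b)) s0)).
  by apply: eq_summ => k; rewrite e mulKf.
apply/eqP; rewrite -subr_eq0 -!CSZ // -CSB; [|exact: summZ..].
rewrite (eq_CS e) CSZ // (@CS_tele _ (fun k => k%:R * hg a b c k) 0) //; last exact: hg_tail0.
by rewrite mul0r subr0 mulr0.
Qed.

Lemma hg_lim a b c : (forall k, c + k%:R != 0) -> 0 < cre (c - a - b) ->
  ccvg (fun N => CS (hg a b (c + N%:R))) 1.
Proof.
(* After this shift Re c >= 0, so adding N only increases the moduli of the factors in the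
   denominator, and the terms are dominated by those at N = 0. *)
move=> hc h; pose N0 := (Num.truncn `|cre c|).+1.
have hN0 : 0 <= cre c + N0%:R.
  have := truncnS_gt `|cre c|; have := ler_norm (- cre c); rewrite normrN /N0; lra.
apply: (@ccvg_unshift _ _ _ N0); set c1 := c + N0%:R.
have hc1 k : c1 + k%:R != 0 by rewrite -addrA -natrD.
apply: (@ccvg_ext _ (fun N => CS (hg a b (c1 + N%:R)))).
  by move=> N; congr (CS (hg a b _)); rewrite /c1 natrD; ring.
have h1 : 0 < cre (c1 - a - b).
  rewrite (_ : c1 - a - b = (c - a - b) + N0%:R); last by rewrite /c1; ring.
  by rewrite creD cre_nat ltr_wpDr.
have r1 : 0 <= cre c1 by rewrite creD cre_nat.
have [] := @CS_dct _ (fun N => hg a b (c1 + N%:R)) (fun k => if k == 0%N then 1 else 0) (fun k => cabs (hg a b c1 k)).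
- move=> k; have : ccvg (fun N => (poch (c1 + N%:R) k)^-1) (if k == 0%N then 1 else 0).
    elim: k => [|k _]; first by apply: (@ccvg_ext _ (fun=> 1)); [move=> N; rewrite poch0 invr1|exact: ccvg_cst].
    elim: k => [|k IH].
      apply: (@ccvg_ext _ (fun N => (c1 + N%:R)^-1)); last exact: ccvg_invD.
      by move=> N; rewrite pochS poch0 mul1r addr0.
    have := ccvgM IH (ccvg_invD (c1 + k.+1%:R)); rewrite mulr0; apply: ccvg_ext => N.
    by rewrite (pochS _ k.+1) invfM (addrAC c1).
  move=> /(ccvgM (ccvg_cst (cb a k * poch b k))); congr ccvg.
  by case: k => [|k]; rewrite ?mulr0 // cb0 poch0 !mulr1.
- by apply: summ_abs; apply: summ_hg.
- move=> N k; rewrite /hg [cabs (_ / poch (c1 + _) k)]cabsM [cabs (_ / poch c1 k)]cabsM !cabsV ler_wpM2l ?cabs_ge0 //.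
  have p1 : 0 < cabs (poch c1 k) by rewrite cabs_gt0 poch_neq0.
  suff h2 : cabs (poch c1 k) <= cabs (poch (c1 + N%:R) k) by rewrite lef_pV2 ?posrE // (lt_le_trans p1).
  elim: k {p1} => [|k IH]; first by rewrite !poch0.
  rewrite !pochS !cabsM ler_pM ?cabs_ge0 //.
  rewrite -(@ler_pXn2r _ 2) ?nnegrE ?cabs_ge0 // !cabs_sqr !creD !cimD !cre_nat !cim_nat !addr0 lerD2r.
  have kk : (0 : R) <= k%:R := ler0n _ _; have NN : (0 : R) <= N%:R := ler0n _ _.
  move: kk NN hN0; move: (cre c + N0%:R) (k%:R : R) (N%:R : R) => u v w v0 w0 u0.
  by rewrite ler_pXn2r ?nnegrE //; lra.
by move=> _; rewrite CS_single.
Qed.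

(** The contiguous relation pushes c to c + N, where the series tends to 1; the accumulated factor
    is a quotient of binomial coefficients whose limit is the Gamma quotient. *)
Lemma gauss_sum a b c : (forall k, c + k%:R != 0) -> (forall k, c - a + k%:R != 0) ->
  (forall k, c - b + k%:R != 0) -> 0 < cre (c - a - b) ->
  CS (hg a b c) = cGamma c * cGamma (c - a - b) / (cGamma (c - a) * cGamma (c - b)).
Proof.
move=> hc ha hb h.
have hd k : c - a - b + k%:R != 0.
  apply: contraTneq (h) => e; rewrite (_ : c - a - b = - k%:R); last by apply/eqP; rewrite -addr_eq0 e.
  by rewrite creN cre_nat -leNgt oppr_le0.
have e N : CS (hg a b c) = cb (c - a) N * cb (c - b) N / (cb c N * cb (c - a - b) N) * CS (hg a b (c + N%:R)).
  elim: N => [|N IH]; first by rewrite !cb0 addr0 !mul1r invr1 mul1r.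
  rewrite IH; have hcN k : c + N%:R + k%:R != 0 by rewrite -addrA -natrD.
  have hN : 0 < cre (c + N%:R - a - b).
    by rewrite (_ : _ - _ = (c - a - b) + N%:R); [rewrite creD cre_nat ltr_wpDr|ring].
  have e1 : c + N%:R + 1 = c + N.+1%:R by rewrite -addrA natr1.
  have := hg_contig hcN hN; rewrite e1 => hr.
  have n0 := natC_neq0 R N.
  have q s : cb s N.+1 = (s + N%:R) * cb s N / N.+1%:R by rewrite -cbS mulrC mulKf.
  rewrite !q; have -> : CS (hg a b (c + N%:R)) = (c + N%:R - a) * (c + N%:R - b) * CS (hg a b (c + N.+1%:R)) / ((c + N%:R) * (c - a - b + N%:R)).
    rewrite hr (_ : c + N%:R - a - b = c - a - b + N%:R); last by ring.
    by field; rewrite hc hd.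
  have c1 := cb_neq0 N hc; have c2 := cb_neq0 N hd; have := hc N; have := hd N.
  rewrite -natr1 in n0 *; set D := CS _ => x1 x2.
  by field; rewrite c1 c2 n0 x1 x2.
(* The left side of [e] does not depend on N, so it equals the limit of the right side. *)
apply: (ccvg_unique (ccvg_cst _)).
have [gc lc] := cGamma_cvg hc; have [ga la] := cGamma_cvg ha; have [gb lb] := cGamma_cvg hb; have [gd ld] := cGamma_cvg hd.
have nz : (cGamma c)^-1 * (cGamma (c - a - b))^-1 != 0 := mulf_neq0 (invr_neq0 gc) (invr_neq0 gd).
have := ccvgM (ccvg_div nz (ccvgM la lb) (ccvgM lc ld)) (hg_lim hc h); rewrite mulr1.
have -> : (cGamma (c - a))^-1 * (cGamma (c - b))^-1 / ((cGamma c)^-1 * (cGamma (c - a - b))^-1) =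
  cGamma c * cGamma (c - a - b) / (cGamma (c - a) * cGamma (c - b)).
  by rewrite -!invfM invf_div.
apply: ccvg_ext => N; rewrite [RHS](e N); congr (_ * _).
have -> : npow (1 - (c - a)) N = npow (1 - c) N * npow a N by rewrite -(npowD (1 - c)); congr (npow _ N); ring.
have -> : npow (1 - (c - b)) N = npow (1 - c) N * npow b N by rewrite -(npowD (1 - c)); congr (npow _ N); ring.
have -> : npow (1 - (c - a - b)) N = npow (1 - c) N * npow a N * npow b N by rewrite -(npowD (1 - c)) -(npowD (1 - c + a)); congr (npow _ N); ring.
by field; rewrite !npow_neq0 cb_neq0 ?cb_neq0.
Qed.

Lemma summ_beta a s : 0 < cre s -> summ (fun k => cb (1 - s) k / (a + k%:R)).
Proof.
move=> h; have [M1 p1 h1] := cb_bound (1 - s); have [M2 p2 h2] := invD_bound a.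
apply: (@summ_real_dom _ _ (fun n => (M1 * M2) * expR (- (1 + cre s) * ln n.+1%:R))); last exact: summ_pseries.
move=> n; rewrite cabsM; apply: le_trans (ler_pM _ _ (h1 n) (h2 n)) _; rewrite ?cabs_ge0 //.
rewrite creB cre1 (_ : 1 - cre s - 1 = - cre s); last by ring.
rewrite opprD mulrDl mulN1r expRD expRN lnK ?posrE ?ltr0n //.
by rewrite le_eqVlt; apply/orP; left; apply/eqP; ring.
Qed.

(** Gauss's sum at (1 - s, a; a + 1), because (a)_k / (a + 1)_k = a / (a + k). *)
Lemma beta_series a s : (forall k, a + k%:R != 0) -> (forall k, a + s + k%:R != 0) -> 0 < cre s ->
  CS (fun k => cb (1 - s) k / (a + k%:R)) = cGamma a * cGamma s / cGamma (a + s).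
Proof.
move=> ha hs h; have a0 : a != 0 by have := ha 0%N; rewrite addr0.
have hc k : a + 1 + k%:R != 0 by rewrite -addrA nat1r.
have := @gauss_sum (1 - s) a (a + 1) hc.
rewrite (_ : a + 1 - (1 - s) = a + s); last by ring.
rewrite (_ : a + 1 - a = 1); last by ring.
rewrite (_ : a + s - a = s); last by ring.
move=> /(_ hs) G; have {}G := G (fun k => ltac:(by rewrite nat1r natC_neq0)) h.
rewrite cGamma1 mulr1 cGammaS // in G.
apply: (mulfI a0); rewrite -CSZ; last exact: summ_beta.
rewrite !mulrA -G; apply: eq_CS => k; rewrite /hg.
have := pochS a k; rewrite pochSl => e.
have -> : poch (a + 1) k = poch a k * (a + k%:R) / a by rewrite -e mulrC mulKf.
by field; rewrite a0 ha poch_neq0.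
Qed.
End GaussSum.

(** * Euler's product for the sine and the reflection formula *)

Section SineProduct.
Variable R : realType.
Local Notation C := R[i].
Local Notation Pi := ((pi : R)%:C : C).
Implicit Types s w y : C.

Definition ccos w : C := (cexp ('i * w) + cexp (- ('i * w))) / 2%:R.

Lemma csi_neq0 : ('i : C) != 0. Proof. by rewrite -cabs_gt0 /cabs /= expr0n expr1n add0r sqrtr1. Qed.
Lemma csi2 : ('i * 'i : C) = -1. Proof. by rewrite -expr2 sqr_i. Qed.

Lemma csin2 w : csin (2%:R * w) = 2%:R * csin w * ccos w.
Proof.
rewrite /csin /ccos (_ : 'i * (2%:R * w) = 'i * w + 'i * w); last by ring.
rewrite opprD !cexpD; by field; rewrite csi_neq0.
Qed.

Lemma sqr_div2i w : (w / (2%:R * 'i)) ^+ 2 = - (w / 2%:R) ^+ 2.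
Proof. by rewrite invfM mulrA exprMn exprVn [X in _ / X]expr2 csi2 invrN1 mulrN1. Qed.

Lemma ccos2Dcsin2 w : ccos w ^+ 2 + csin w ^+ 2 = 1.
Proof.
rewrite /csin /ccos; have e0 := cexp_neq0 ('i * w); rewrite cexpN.
rewrite sqr_div2i; by field; rewrite e0.
Qed.

Lemma csin_real (x : R) : csin x%:C = (sin x)%:C :> C.
Proof.
rewrite /csin /cexp; apply: (@mulIf _ (2%:R * 'i)); first by rewrite mulf_neq0 ?csi_neq0 ?natC_neq0.
rewrite divfK ?mulf_neq0 ?csi_neq0 ?natC_neq0 //.
have -> : cre ('i * x%:C) = 0 by rewrite creM /= mul0r mulr0 subr0.
have -> : cim ('i * x%:C) = x by rewrite cimM /= mul1r mulr0 add0r.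
rewrite creN cimN; have -> : cre ('i * x%:C) = 0 by rewrite creM /= mul0r mulr0 subr0.
have -> : cim ('i * x%:C) = x by rewrite cimM /= mul1r mulr0 add0r.
rewrite oppr0 expR0 cosN sinN !mul1r; apply: ceqP; rewrite ?creB ?cimB ?creM ?cimM ?cre_nat ?cim_nat /=; ring.
Qed.

Lemma csinDpi w : csin (w + Pi) = - csin w.
Proof.
have e : cexp ('i * Pi) = -1 :> C.
  rewrite /cexp; have -> : cre ('i * Pi) = 0 by rewrite creM /= mul0r mulr0 subr0.
  have -> : cim ('i * Pi) = pi by rewrite cimM /= mul1r mulr0 add0r.
  by rewrite expR0 cospi sinpi mul1r; apply: ceqP; rewrite ?creN ?cimN /= ?oppr0.
rewrite /csin mulrDr opprD !cexpD (cexpN ('i * Pi)) e invrN1; ring.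
Qed.

Lemma csin_small w : cabs w <= 1 / 2 -> cabs (csin w) <= 5 * cabs w.
Proof.
move=> h; have i1 : cabs ('i : C) = 1 by rewrite /cabs /= expr0n expr1n add0r sqrtr1.
have h1 : cabs ('i * w) <= 1 / 2 by rewrite cabsM i1 mul1r.
have h2 : cabs (- ('i * w)) <= 1 / 2 by rewrite cabsN.
have := cexp_lip h1; have := cexp_lip h2; rewrite cabsN cabsM i1 mul1r => b2 b1.
rewrite /csin cabsM cabsV cabsM i1 mulr1 cabsn ler_pdivrMr //.
rewrite (_ : cexp ('i * w) - cexp (- ('i * w)) = (cexp ('i * w) - 1) - (cexp (- ('i * w)) - 1)); last by ring.
by apply: le_trans (cabsB _ _) _; lra.
Qed.

Lemma ccvg_csin_linear w : ccvg (fun n => n.+1%:R * csin (w / n.+1%:R)) w.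
Proof.
have h1 := ccvg_cexp_linear ('i * w); have h2 := ccvg_cexp_linear (- ('i * w)).
have := ccvgM (ccvgB h1 h2) (ccvg_cst (2%:R * 'i)^-1).
have -> : ('i * w - - ('i * w)) * (2%:R * 'i)^-1 = w by field; rewrite csi_neq0.
by apply: ccvg_ext => n; rewrite /csin mulNr -!mulrA; ring.
Qed.

(** Weaker than Jordan's inequality but sufficient for domination: the cubic bound serves up to 1,
    monotonicity from 1 to pi / 2. *)
Lemma sin_lower (x : R) : 0 <= x <= pi / 2 -> x / 4 <= sin x.
Proof.
move=> /andP[x0 xp].
have small (y : R) : 0 <= y <= 1 -> y / 2 <= sin y.
  move=> /andP[y0 y1]; have := sin_bound y; rewrite (ger0_norm y0) ler_norml => /andP[h _].
  have : y * (y ^+ 2 / 2) <= y * (1 / 2) by rewrite ler_wpM2l // ler_wpM2r ?expr_le1 //; lra.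
  by lra.
have [x1|x1] := leP x 1; first by have := small x; rewrite x0 x1 => /(_ isT); lra.
have p2 : pi / 2 <= 2 :> R by have /andP[_ /ltW] := @pihalf_02 R.
have : sin 1 < sin x.
  rewrite ltr_sin // in_itv /=; apply/andP; split; lra.
have := small 1; rewrite ler01 lexx => /(_ isT); lra.
Qed.

(** Induction by doubling y. Each factor at angle 2t splits into the factors at t and pi / 2 - t,
    that is, at the indices j and 2M - j; the middle index M supplies ccos (2y). *)
Lemma csin_prod n y : csin (2%:R * (2 ^ n)%:R * y) =
  2%:R * (2 ^ n)%:R * csin y * ccos y *
  \prod_(1 <= j < 2 ^ n) (1 - csin y ^+ 2 / ((sin (pi * j%:R / (2 ^ n.+1)%:R)) ^+ 2)%:C).
Proof.
elim: n y => [|n IH] y; first by rewrite expn0 big_geq // !mulr1 csin2.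
set M := (2 ^ n)%N in IH *; have M0 : (0 < M)%N by rewrite expn_gt0.
have e2 : (2 ^ n.+1 = M + M)%N by rewrite expnS mul2n addnn.
rewrite (_ : 2%:R * (2 ^ n.+1)%:R * y = 2%:R * M%:R * (2%:R * y)); last by rewrite expnS natrM; ring.
rewrite IH csin2.
set g := fun j : nat => 1 - csin y ^+ 2 / ((sin (pi * j%:R / (2 ^ n.+2)%:R)) ^+ 2)%:C.
have P0 : (2 ^ n.+2)%:R = 4 * M%:R :> R by rewrite !expnS -/M !natrM; ring.
have P1 : (2 ^ n.+1)%:R = 2 * M%:R :> R by rewrite !expnS -/M !natrM; ring.
have M0r : (0 : R) < M%:R by rewrite ltr0n.
have split3 : \prod_(1 <= j < M + M) g j = (\prod_(1 <= j < M) (g j * g (M + M - j)%N)) * g M.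
  rewrite (@big_cat_nat _ _ _ M) //=; last by rewrite leq_addl.
  rewrite (@big_ltn _ _ _ M) ?ltn_paddl //; last by rewrite -{1}[M]add0n ltn_add2r.
  rewrite big_split /= mulrCA mulrC; congr (_ * _ * _).
  rewrite (_ : \prod_(M.+1 <= i < M + M) g i = \prod_(1 <= i < M) g (i + M)%N); last first.
    by rewrite -{1}add1n big_addn addnK.
  by rewrite [RHS]big_nat_rev; apply: eq_big_nat => j /andP[j1 jM]; congr g; lia.
rewrite e2 split3.
have gM : g M = ccos (2%:R * y).
  rewrite /g P0; have -> : pi * M%:R / (4 * M%:R) = pi / 2 / 2 :> R by field; rewrite gt_eqF.
  have s2 : 2 * sin (pi / 2 / 2 : R) ^+ 2 = 1.
    have := cosD (pi / 2 / 2 : R) (pi / 2 / 2); rewrite (_ : pi / 2 / 2 + pi / 2 / 2 = pi / 2); last by field.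
    rewrite cos_pihalf => h; have := cos2Dsin2 (pi / 2 / 2 : R); rewrite !expr2; lra.
  have -> : sin (pi / 2 / 2 : R) ^+ 2 = 2^-1 by apply: (@mulfI _ 2) => //; rewrite s2 mulfV.
  have -> : ccos (2%:R * y) = ccos y ^+ 2 - csin y ^+ 2.
    rewrite /csin sqr_div2i /ccos (_ : 'i * (2%:R * y) = 'i * y + 'i * y); last by ring.
    rewrite opprD !cexpD (cexpN ('i * y)); have e0 := cexp_neq0 ('i * y).
    by field; rewrite e0.
  have -> : ccos y ^+ 2 = 1 - csin y ^+ 2 by rewrite -(ccos2Dcsin2 y) addrK.
  rewrite rcV invrK rcn; ring.
rewrite gM.
have -> : \prod_(1 <= j < M) (g j * g (M + M - j)%N) =
    \prod_(1 <= j < M) (1 - (2%:R * csin y * ccos y) ^+ 2 / (sin (pi * j%:R / (2 ^ n.+1)%:R) ^+ 2)%:C).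
  apply: eq_big_nat => j /andP[j1 jM].
  have j0 : (0 : R) < j%:R by rewrite ltr0n.
  have jMr : (j%:R : R) < M%:R by rewrite ltr_nat.
  pose t : R := pi * j%:R / (2 ^ n.+2)%:R.
  have tb : 0 < t < pi / 2.
    rewrite divr_gt0 ?mulr_gt0 ?pi_gt0 ?P0 //=; last by rewrite mulr_gt0.
    by rewrite /t P0 ltr_pdivrMr ?mulr_gt0 //; have := @pi_gt0 R; nra.
  have -> : pi * j%:R / (2 ^ n.+1)%:R = t + t by rewrite /t P0 P1; field; rewrite gt_eqF.
  rewrite /g; have -> : pi * (M + M - j)%:R / (2 ^ n.+2)%:R = pi / 2 - t.
    rewrite natrB; last by lia.
    by rewrite natrD /t P0; field; rewrite gt_eqF.
  have -> : sin (pi / 2 - t) = cos t by rewrite -opprB sinN sinBpihalf opprK.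
  rewrite -/t sinD.
  have s0 : sin t != 0 by rewrite gt_eqF // sin_gt0_pihalf.
  have c0 : cos t != 0 by rewrite gt_eqF // cos_gt0_pihalf //; apply/andP; split; case/andP: tb => ? ?; lra.
  have hsc : (cos t)%:C ^+ 2 + (sin t)%:C ^+ 2 = 1 :> C by rewrite -!rcX -rcD cos2Dsin2.
  rewrite !rcX rcD !rcM; move: hsc; have := ccos2Dcsin2 y.
  have s0' : (sin t)%:C != 0 :> C by rewrite -cabs_gt0 cabsR normr_gt0.
  have c0' : (cos t)%:C != 0 :> C by rewrite -cabs_gt0 cabsR normr_gt0.
  move: (csin y) (ccos y) (sin t)%:C (cos t)%:C s0' c0' => A B S T s0' c0' h1 h2.
  have -> : (2%:R * A * B) ^+ 2 / (S * T + T * S) ^+ 2 = A ^+ 2 * B ^+ 2 / (S ^+ 2 * T ^+ 2).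
    rewrite (_ : S * T + T * S = 2%:R * S * T); last by ring.
    field.
    by rewrite s0' c0'.
  have -> : B ^+ 2 = 1 - A ^+ 2 by rewrite -h1; ring.
  have eq1 : (1 - A ^+ 2 / S ^+ 2) * (1 - A ^+ 2 / T ^+ 2) = 1 - (A ^+ 2 * (T ^+ 2 + S ^+ 2) - A ^+ 2 * A ^+ 2) / (S ^+ 2 * T ^+ 2).
    by field; rewrite s0' c0'.
  by rewrite eq1 h2; congr (1 - _ / _); ring.
rewrite -e2; set Q := \prod_(1 <= j < M) _; rewrite e2 natrD; ring.
Qed.

Lemma ccvg_sub (u : nat -> C) l (f : nat -> nat) : (forall n, (n <= f n)%N) -> ccvg u l -> ccvg (fun n => u (f n)) l.
Proof.
move=> hf; have hc : f @ \oo --> \oo by apply/cvgnyPge => A; near=> n; apply: leq_trans (hf n); near: n; exists A.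
by move=> [h1 h2]; split; [exact: (cvg_comp _ _ hc h1)|exact: (cvg_comp _ _ hc h2)].
Unshelve. all: by end_near. Qed.

(** Euler's product, the infinite product being written in the summed form of [pprod_sum]. It is the
    limit of [csin_prod] at y = pi s / 2^(n + 1). *)
Lemma csin_product s : csin (Pi * s) = Pi * s * (1 + CS (fun k => pprod (fun k => - (s ^+ 2 / k.+1%:R ^+ 2)) k * - (s ^+ 2 / k.+1%:R ^+ 2))).
Proof.
pose T n := (2 ^ n.+1)%N; have T0 n : (0 < T n)%N by rewrite expn_gt0.
have TR n : (0 : R) < (T n)%:R by rewrite ltr0n.
have TC n : ((T n)%:R : C) != 0 by rewrite pnatr_eq0 -lt0n.
have nT n : (n <= (T n).-1)%N by rewrite -ltnS prednK //; apply: ltn_trans (ltn_expl _ _) => //; rewrite ltnS.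
pose y n := Pi * s / (T n)%:R.
have lim w : ccvg (fun n => (T n)%:R * csin (w / (T n)%:R)) w.
  have := ccvg_sub nT (ccvg_csin_linear w); apply: ccvg_ext => n /=; by rewrite prednK.
(* Beyond this index [y n] is in the range of [csin_small]; the sequences below are shifted by
   N0. *)
have [N0 hN0] : exists N0, forall n, (N0 <= n)%N -> cabs (y n) <= 1 / 2.
  have [N0 _ h] := near_inv_nat (cabs (Pi * s)); exists N0 => n hn.
  have := h (T n).-1 (leq_trans hn (nT n)); rewrite prednK // ger0_norm ?divr_ge0 ?cabs_ge0 ?ler0n //.
  by rewrite /y [cabs (_ / _)]cabsM cabsV cabsn.
pose E n k : C := if (k.+1 < 2 ^ (n + N0))%N then - (csin (y (n + N0)%N) ^+ 2 / ((sin (pi * k.+1%:R / (T (n + N0)%N)%:R)) ^+ 2)%:C) else 0.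
have cosl : ccvg (fun n => ccos (y n)) 1.
  have y0 : ccvg y 0.
    rewrite -(mulr0 (Pi * s)); apply: ccvgM; first exact: ccvg_cst.
    have := ccvg_sub nT (ccvg_real (@cvg_harmonic R)); apply: ccvg_ext => n.
    by rewrite -[harmonic _]/(((T n).-1.+1%:R : R)^-1) prednK // rcV rcn.
  have -> : (1 : C) = (cexp ('i * 0) + cexp (- ('i * 0))) / 2%:R.
    by rewrite mulr0 oppr0 cexp0; field.
  apply: ccvgM; last exact: ccvg_cst.
  apply: ccvgD; apply: ccvg_cexp; [|apply: ccvgN]; apply: ccvgM => //; exact: ccvg_cst.
have pi0 := @pi_gt0 R.
have ang (n k : nat) : (k.+1 < 2 ^ n)%N -> 0 < (pi : R) * k.+1%:R / (T n)%:R <= pi / 2.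
  move=> h; rewrite divr_gt0 ?mulr_gt0 ?ltr0n //= ler_pdivrMr // /T expnS natrM mulrA divfK //.
  by apply: ler_wpM2l; [exact: ltW|rewrite ler_nat ltnW].
(* The constant 400 is 5^2 times 4^2, from |csin y| <= 5 |y| and sin th >= th / 4. *)
have tan := @pprod_tannery R E (fun k => - (s ^+ 2 / k.+1%:R ^+ 2)) (fun k => 400 * cabs s ^+ 2 / k.+1%:R ^+ 2) (fun n => (2 ^ (n + N0)).-1).
have {}tan := tan _ (summ_invsq _) _ _.
have lim2 : ccvg (fun n => (T n)%:R * csin (y n) * ccos (y n) * \prod_(1 <= j < 2 ^ n) (1 - csin (y n) ^+ 2 / ((sin (pi * j%:R / (2 ^ n.+1)%:R)) ^+ 2)%:C)) (csin (Pi * s)).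
  apply: (@ccvg_ext _ (fun=> csin (Pi * s))); last exact: ccvg_cst.
  move=> n; have := csin_prod n (y n); rewrite -natrM -expnS -/(T n) => <-.
  by rewrite /y mulrCA divff ?mulr1.
apply: (ccvg_unique (ccvg_shift N0 lim2)).
have lim3 := ccvgM (ccvgM (ccvg_shift N0 (lim (Pi * s))) (ccvg_shift N0 cosl)); rewrite mulr1 in lim3.
apply: ccvg_ext (lim3 _ _ (tan _ _ _)).
- move=> n; congr (_ * _); rewrite /pprod -(big_mkord xpredT (fun k => 1 + E n k)).
  rewrite -[in RHS](prednK (expn_gt0 2 (n + N0))) big_add1 /=; apply: eq_big_nat => k /andP[_ hk].
  by rewrite /E -ltn_predRL hk.
- move=> k; apply: (@ccvg_near _ (fun n => - (((T (n + N0)%N)%:R * csin (y (n + N0)%N)) ^+ 2 / ((T (n + N0)%N)%:R * csin ((pi * k.+1%:R)%:C / (T (n + N0)%N)%:R)) ^+ 2))).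
    near=> n; have hk : (k.+1 < 2 ^ (n + N0))%N.
      by apply: (@leq_ltn_trans (n + N0)%N); [rewrite (leq_trans _ (leq_addr _ _)) //; near: n; exists k.+1|rewrite ltn_expl].
    rewrite /E hk; congr (- _); have sq (u v : C) : (u * v) ^+ 2 = u ^+ 2 * v ^+ 2 by rewrite exprMn.
    rewrite (sq _ (csin (y _))) (sq _ (csin (_%:C / _))) -mulf_div divff ?expf_neq0 // mul1r.
    by rewrite -rcn -rcV -rcM csin_real rcX.
  have p0 : ((pi * k.+1%:R)%:C : C) != 0 by rewrite -cabs_gt0 cabsR normr_gt0 mulf_neq0 ?gt_eqF // ltr0n.
  have -> : - (s ^+ 2 / k.+1%:R ^+ 2) = - ((Pi * s) * (Pi * s) / ((pi * k.+1%:R)%:C * (pi * k.+1%:R)%:C)).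
    have pc : Pi != 0 by rewrite -cabs_gt0 cabsR normr_gt0 gt_eqF.
    have n0 := natC_neq0 R k; rewrite rcM rcn; move: (k.+1%:R : C) n0 Pi pc => x x0 P P0'; field; by rewrite x0 P0'.
  apply: ccvgN; under [X in ccvg X]eq_fun do rewrite !expr2.
  have l1 := ccvg_shift N0 (lim (Pi * s)); have l2 := ccvg_shift N0 (lim (pi * k.+1%:R)%:C).
  apply: ccvg_div; [by rewrite mulf_neq0|exact: ccvgM|exact: ccvgM].
- move=> n k; rewrite /E; case: ifP => [hk|_]; last first.
    rewrite cabs0; apply: divr_ge0; last exact: sqr_ge0.
    by apply: mulr_ge0; [exact: ler0n|exact: sqr_ge0].
  set m := (n + N0)%N in hk *; have /andP[a0 a1] := ang _ _ hk; set th := pi * k.+1%:R / _ in a0 a1 *.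
  have sl := @sin_lower th; rewrite (ltW a0) a1 in sl; have {}sl := sl isT.
  have cs := csin_small (hN0 m (leq_addl _ _)).
  have cy : cabs (y m) = pi * cabs s / (T m)%:R by rewrite /y cabsM cabsV cabsn cabsM cabsR gtr0_norm.
  rewrite cabsN cabsM cabsV cabsR cabsX.
  have th4 : 0 < th / 4 by rewrite divr_gt0.
  have sp : 0 < sin th by apply: lt_le_trans sl.
  rewrite ger0_norm ?sqr_ge0 //.
  apply: (@le_trans _ _ ((5 * cabs (y m)) ^+ 2 / (th / 4) ^+ 2)).
    rewrite ler_pM ?exprn_ge0 ?invr_ge0 ?cabs_ge0 ?sqr_ge0 //.
      by rewrite ler_pXn2r ?nnegrE ?cabs_ge0 // (le_trans (cabs_ge0 _) cs).
    rewrite lef_pV2 ?posrE ?exprn_gt0 //.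
    by rewrite ler_pXn2r // nnegrE ltW.
  rewrite cy /th le_eqVlt; apply/orP; left; apply/eqP.
  have k0 : (0 : R) < k.+1%:R by rewrite ltr0n.
  have t0 := TR m; move: (T m)%:R t0 (k.+1%:R : R) k0 => t t0 q q0.
  have := lt0r_neq0 t0; have := lt0r_neq0 q0; have := lt0r_neq0 pi0; move: (pi : R) => x x0 q0' t0'.
  by field; rewrite x0 q0' t0'.
- move=> n k; rewrite -ltnS prednK ?expn_gt0 // => hk; rewrite /E ifF //.
  by apply/negbTE; rewrite -leqNgt.
Unshelve. all: by end_near. Qed.

(** The product of the coefficients of s and 1 - s is exactly a partial Euler product ([id] below),
    so both sides are limits of one sequence. *)
Lemma cGamma_reflect s : ~ isInt s -> cGamma s * cGamma (1 - s) * csin (Pi * s) = Pi.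
Proof.
move=> hs; have h1 k : s + k%:R != 0.
  by apply/eqP => e; apply: hs; have -> : s = - k%:R; [apply/eqP; rewrite -addr_eq0 e|apply: isIntN; exact: isInt_nat].
have h2 k : 1 - s + k%:R != 0.
  apply/eqP => e; apply: hs; have -> : s = k.+1%:R; last exact: isInt_nat.
  by apply/eqP; rewrite eq_sym -subr_eq0 -nat1r -e; apply/eqP; ring.
have [g1 l1] := cGamma_cvg h1; have [g2 l2] := cGamma_cvg h2.
rewrite csin_product; set e := fun k : nat => - (s ^+ 2 / k.+1%:R ^+ 2); set P := 1 + CS _.
have se : summ e.
  have := summ_invsq (R := R) 1 => /(summZ (- s ^+ 2)); apply: eq_summ => k.
  by rewrite /e rcM rcV rcX rcn mulNr mul1r.
have id n : cb s n.+1 * cb (1 - s) n = s / n.+1%:R * pprod e n.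
  have q (a : C) m : cb a m.+1 = (a + m%:R) * cb a m / m.+1%:R by rewrite -cbS mulrC mulKf ?natC_neq0.
  elim: n => [|n IH]; first by rewrite q !cb0 /pprod big_ord0; field; rewrite -?(natC_neq0 R 0).
  rewrite pprodS q (q (1 - s)).
  have -> : (s + n.+1%:R) * cb s n.+1 / n.+2%:R * ((1 - s + n%:R) * cb (1 - s) n / n.+1%:R) = (s + n.+1%:R) * (1 - s + n%:R) / (n.+2%:R * n.+1%:R) * (cb s n.+1 * cb (1 - s) n).
    by rewrite invfM; ring.
  rewrite IH /e; have n1 := natC_neq0 R n; have n2 := natC_neq0 R n.+1.
  have -> : n%:R = n.+1%:R - 1 :> C by rewrite -natr1 addrK.
  by move: (n.+1%:R : C) n1 (n.+2%:R : C) n2 => x x0 z z0; field; rewrite x0 z0.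
have L := ccvgM (ccvg_shift 1 l1) l2.
have L2 := ccvgM (ccvgM (ccvg_cst s) (pprod_cvg se)) (npow_shift (1 - s) 1).
have : (cGamma s)^-1 * (cGamma (1 - s))^-1 = s * P * 1.
  apply: (ccvg_unique L); apply: ccvg_ext L2 => n; rewrite addn1.
  rewrite [RHS]mulrACA id (npowD 1 (- (1 - s))) npow1 npowN.
  by field; rewrite npow_neq0 nat1r natC_neq0.
rewrite mulr1 => eP; have -> : Pi * s * P = Pi * ((cGamma s)^-1 * (cGamma (1 - s))^-1) by rewrite eP mulrA.
by field; rewrite g1 g2.
Qed.

Lemma nonint_add s : ~ isInt s -> forall k, s + k%:R != 0.
Proof.
move=> hs k; apply/eqP => e; apply: hs; have -> : s = - k%:R; last by apply: isIntN; exact: isInt_nat.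
by apply/eqP; rewrite -addr_eq0 e.
Qed.

Lemma nonint_1B s : ~ isInt s -> ~ isInt (1 - s).
Proof.
move=> hs h; apply: hs; rewrite (_ : s = 1 - (1 - s)); last by ring.
by apply: isIntB => //; exact: (isInt_nat R 1).
Qed.

(** Reflection trades the sines for Gamma values; the resulting form is the one that appears as a
    limit in [Kg_frakB_ge]. *)
Lemma frakB_formula (a b a' b' : C) : ~ isInt a' -> ~ isInt b' -> ~ isInt (a' + b') ->
  frakB a b a' b' = Pi * cGamma a * cGamma b * cGamma (1 - a' - b') /
    (cGamma (a + b) * cGamma (1 - a') * cGamma (1 - b')).
Proof.
move=> ha hb hab; rewrite /frakB (_ : 1 - a' - b' = 1 - (a' + b')); last by ring.
have g s : ~ isInt s -> cGamma s != 0 by move=> hs; apply: cGamma_neq0; exact: nonint_add.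
have p0 : Pi != 0 by rewrite -cabs_gt0 cabsR normr_gt0 gt_eqF // pi_gt0.
have sE s : ~ isInt s -> csin (Pi * s) = Pi / (cGamma s * cGamma (1 - s)).
  move=> hs; have := cGamma_reflect hs; have g1 := g _ hs; have g2 := g _ (nonint_1B hs) => e.
  by rewrite -[X in X / _]e; field; rewrite g1 g2.
rewrite !sE //; have g1 := g _ ha; have g2 := g _ hb; have g3 := g _ hab.
have g4 := g _ (nonint_1B ha); have g5 := g _ (nonint_1B hb); have g6 := g _ (nonint_1B hab).
have k (P x y : C) : x != 0 -> x * (P / (x * y)) = P / y by move=> x0; rewrite invfM mulrCA mulVKf.
have m (x y t u v w : C) : x * y / t * (u * v / w) = (x * u) * (y * v) / (t * w).
  by rewrite [in RHS]invfM; move: t^-1 w^-1 => *; ring.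
rewrite -mulrA m !k // [in RHS]invfM [in RHS](invfM (cGamma (a + b))); move: (cGamma (a + b))^-1 => Q.
by move: Pi p0 => P p0; field; rewrite g4 g5 g6 p0.
Qed.
End SineProduct.

(** * Power growth of coefficients *)

Section PowerBounds.
Variable R : realType.
Local Notation C := R[i].
Implicit Types (u v : nat -> C) (x y : R).

(** Exponents add under products, so summability becomes an inequality between real parts. *)
Definition pbd u x := exists2 M, 0 <= M & forall k, cabs (u k) <= M * expR (x * ln k.+1%:R).

Lemma pbdM u v x y : pbd u x -> pbd v y -> pbd (fun k => u k * v k) (x + y).
Proof.
move=> [M M0 h] [N N0 h']; exists (M * N); first exact: mulr_ge0.
move=> k; rewrite cabsM; apply: le_trans (ler_pM _ _ (h k) (h' k)) _; rewrite ?cabs_ge0 //.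
by rewrite mulrDl expRD mulrACA.
Qed.

Lemma pbd_ext u v x : u =1 v -> pbd u x -> pbd v x.
Proof. by move=> e [M M0 h]; exists M => // k; rewrite -e. Qed.

Lemma pbd_eq u x y : x = y -> pbd u x -> pbd u y. Proof. by move=> ->. Qed.

Lemma pbd_summ u x : x < -1 -> pbd u x -> summ u.
Proof.
move=> x1 [M M0 h]; apply: (@summ_real_dom _ _ (fun k => M * expR (- (1 + (- x - 1)) * ln k.+1%:R))).
  by move=> k; rewrite (_ : - (1 + _) = x) //; ring.
by apply: summ_pseries; lra.
Qed.

Lemma pbd_cvg0 u x : x < 0 -> pbd u x -> ccvg u 0.
Proof.
move=> x0 [M M0 h]; apply: (@ccvg_squeeze _ _ _ (fun k => M * expR (x * ln k.+1%:R))).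
  by near=> k; rewrite subr0.
have := ccvg_abs (@npow_cvg0 R x%:C x0); rewrite cabs0 => h0.
rewrite -[X in _ --> X](mulr0 M); apply: cvgMr; move: h0.
by under eq_fun do rewrite cabs_npow.
Unshelve. all: by end_near. Qed.

Lemma pbd_cb s : pbd (cb s) (cre s - 1).
Proof. by have [M M0 h] := cb_bound s; exists M. Qed.

Lemma pbd_inv a : pbd (fun k => (a + k%:R)^-1) (-1).
Proof.
have [M M0 h] := invD_bound a; exists M => // k; rewrite mulN1r expRN lnK ?posrE ?ltr0n //.
Qed.

Lemma pbd_nat : pbd (fun k => k%:R) 1.
Proof.
by exists 1 => // k; rewrite cabsn mul1r mul1r lnK ?posrE ?ltr0n // ler_nat.
Qed.

(* zero-extension of the coefficients to negative indices *)
Definition cz (s : C) (m : int) : C := if m is Posz k then cb s k else 0.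

Lemma czS s m : (m + 1)%:~R * cz s (m + 1) = (s + m%:~R) * cz s m.
Proof.
case: m => [n|[|n]] /=; last 2 first.
- by rewrite mul0r mulr0.
- by rewrite !NegzE -addn1 PoszD opprD addrNK -NegzE /= !mulr0.
rewrite -PoszD /= addn1; exact: cbS.
Qed.

Lemma cz_diff s m : cz (s - 1) m = cz s m - cz s (m - 1).
Proof.
case: m => [[|n]|n] /=.
- by rewrite !cb0 subr0.
- rewrite subn1 /= /cb pochSl subrK pochS factS natrM.
  have f0 := fact_neq0 R n; have n0 := natC_neq0 R n; rewrite -natr1 in n0 *.
  by field; rewrite f0 n0.
- by rewrite subr0.
Qed.

Lemma pbd_cz s (n : int) : pbd (fun k => cz s (k%:Z + n)) (cre s - 1).
Proof.
have [M M0 h] := cb_bound s.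
have npE w k j : cabs (npow w j / npow w k) = expR (cre w * (ln j.+1%:R - ln k.+1%:R)).
  by rewrite cabsM cabsV !cabs_npow -expRN -expRD; congr expR; ring.
case: n => m.
  have [N [N0 hN]] := ccvg_bounded (npow_shift (s - 1) m).
  exists (M * N); first by rewrite mulr_ge0 // ltW.
  move=> k; rewrite -PoszD /=; apply: le_trans (h _) _; rewrite -mulrA ler_wpM2l //.
  have := hN k; rewrite npE creB cre1 mulrBr expRD expRN ler_pdivrMr ?expR_gt0 //.
have [N [N0 hN]] := ccvg_bounded (ccvgV (oner_neq0 _) (npow_shift (s - 1) m.+1)).
exists (M * N); first by rewrite mulr_ge0 // ltW.
move=> k; have [km|km] := leqP m.+1 k; last first.
  rewrite (_ : (k%:Z + Negz m)%R = Negz (m - k)) /=; last by rewrite !NegzE; lia.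
  by rewrite cabs0 !mulr_ge0 ?expR_ge0 // ltW.
rewrite (_ : (k%:Z + Negz m)%R = Posz (k - m.+1)) /=; last by rewrite NegzE; lia.
apply: le_trans (h _) _; rewrite -mulrA ler_wpM2l //.
have := hN (k - m.+1)%N; rewrite subnK // invf_div npE creB cre1 mulrBr expRD expRN.
by rewrite ler_pdivrMr ?expR_gt0.
Qed.
End PowerBounds.

(** * The complex beta function as a bilinear series *)

Section ComplexBeta.
Variable R : realType.
Local Notation C := R[i].
Local Notation Pi := ((pi : R)%:C : C).
Implicit Types a b al be : C.

(** When the beta weight of exponents (a, b) and (a - n, b') is expanded over the unit disc, only
    the terms of index k in t and k + n in its conjugate survive the angular integration; this is
    what remains, up to the factor pi. *)
Definition Sg b b' a (n : int) : C := CS (fun k => cb (1 - b) k * cz (1 - b') (k%:Z + n) / (a + k%:R)).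
(** The inhomogeneous term of the recursion of [Sg] in n; it is independent of a. *)
Definition Eg b b' (n : int) : C := CS (fun k => cb (1 - b) k * cz (- b') (k%:Z + n)).

Lemma summ_Sg b b' a n : 0 < cre (b + b') -> summ (fun k => cb (1 - b) k * cz (1 - b') (k%:Z + n) / (a + k%:R)).
Proof.
rewrite creD => h; apply: pbd_summ (pbdM (pbdM (pbd_cb _) (pbd_cz _ _)) (pbd_inv _)).
by rewrite !creB cre1; lra.
Qed.

Lemma pbd_Eg b b' n : pbd (fun k => cb (1 - b) k * cz (- b') (k%:Z + n)) (- cre (b + b') - 1).
Proof.
apply: pbd_eq (pbdM (pbd_cb (1 - b)) (pbd_cz (- b') n)).
by rewrite creB creN creD cre1; ring.
Qed.

Lemma summ_Eg b b' n : 0 < cre (b + b') -> summ (fun k => cb (1 - b) k * cz (- b') (k%:Z + n)).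
Proof. by move=> h; apply: pbd_summ (pbd_Eg b b' n); lra. Qed.

(** Writing a - n as (a + k) - (k + n) cancels the denominator, after the recursion and the
    difference rule of [cz]. *)
Lemma Sg_rec b b' a (n : int) : (forall k, a + k%:R != 0) -> 0 < cre (b + b') ->
  (a - n%:~R) * Sg b b' a n - (a - n%:~R + b') * Sg b b' a (n - 1) = Eg b b' n.
Proof.
move=> ha h; rewrite /Sg -!CSZ; [|exact: summ_Sg..].
rewrite -CSB; [|apply: summZ; exact: summ_Sg..].
apply: eq_CS => k; set m := (k%:Z + n)%R.
have -> : k%:Z + (n - 1) = m - 1 by rewrite /m addrA.
have hd := cz_diff (1 - b') m; rewrite (_ : 1 - b' - 1 = - b') in hd; last by ring.
have hs := czS (1 - b') (m - 1); rewrite subrK in hs.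
have em : n%:~R = m%:~R - k%:R :> C by rewrite /m intrD addrC addKr.
rewrite hd em; rewrite intrB in hs.
have -> : (a - (m%:~R - k%:R)) * (cb (1 - b) k * cz (1 - b') m / (a + k%:R)) =
    cb (1 - b) k / (a + k%:R) * ((a + k%:R) * cz (1 - b') m - m%:~R * cz (1 - b') m) by ring.
by rewrite hs; field; exact: ha.
Qed.

(** The difference of the two sides is a telescoping sum with certificate [T]. *)
Lemma Eg_rec b b' (n : int) : 0 < cre (b + b') ->
  (n%:~R + b) * Eg b b' (n + 1) = (n%:~R - b') * Eg b b' n.
Proof.
move=> h; apply/eqP; rewrite -subr_eq0 /Eg -!CSZ; [|exact: summ_Eg..].
have sd : summ (fun k => (n%:~R + b) * (cb (1 - b) k * cz (- b') (k%:Z + (n + 1))) - (n%:~R - b') * (cb (1 - b) k * cz (- b') (k%:Z + n))).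
  by apply: summB; apply: summZ; exact: summ_Eg.
rewrite -CSB; [|apply: summZ; exact: summ_Eg..].
pose T k : C := - (k%:R * (cb (1 - b) k * cz (- b') (k%:Z + n))).
have e k : (n%:~R + b) * (cb (1 - b) k * cz (- b') (k%:Z + (n + 1))) - (n%:~R - b') * (cb (1 - b) k * cz (- b') (k%:Z + n)) = T k.+1 - T k.
  rewrite /T; set m := (k%:Z + n)%R.
  have -> : k%:Z + (n + 1) = m + 1 by rewrite addrA.
  have -> : k.+1%:Z + n = m + 1 by rewrite /m -addn1 PoszD addrAC.
  have hs := czS (- b') m; have hc := cbS (1 - b) k; rewrite intrD in hs.
  have em : n%:~R = m%:~R - k%:R :> C by rewrite /m intrD addrC addKr.
  rewrite mulrA hc em.
  have -> : (m%:~R - k%:R + b) * (cb (1 - b) k * cz (- b') (m + 1)) = cb (1 - b) k * (m%:~R * cz (- b') (m + 1)) + (b - k%:R) * (cb (1 - b) k * cz (- b') (m + 1)) by ring.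
  have -> : m%:~R * cz (- b') (m + 1) = (- b' + m%:~R) * cz (- b') m - cz (- b') (m + 1) by rewrite -hs; ring.
  ring.
rewrite (eq_CS e) (@CS_tele _ T 0).
- by rewrite /T mul0r oppr0 subr0.
- rewrite -oppr0; apply: ccvgN; apply: pbd_cvg0 (pbdM (pbd_nat R) (pbd_Eg b b' n)).
  by lra.
- by apply: eq_summ sd => k; rewrite e.
Qed.

Lemma int_ind2 (P : int -> Prop) (m0 : int) : P m0 -> (forall m, P m -> P (m + 1)) -> (forall m, P (m + 1) -> P m) ->
  forall m, P m.
Proof.
move=> h0 hS hP m; rewrite -(subrK m0 m); case: (m - m0) => k.
  elim: k => [|k IH]; first by rewrite add0r.
  by rewrite -addn1 PoszD addrAC; apply: hS.
rewrite NegzE; elim: k.+1 => [|j IH]; first by rewrite oppr0 add0r.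
apply: hP; rewrite (_ : - j.+1%:Z + m0 + 1 = - j%:Z + m0) //; lia.
Qed.

(** The left side satisfies a first-order recursion in n whose coefficients never vanish, so one
    zero suffices. The symmetry n -> 1 - n - nu has a fixed point when nu is odd and swaps two
    neighbours when nu is even; that is where the zero is found. *)
Lemma Eg_refl b b' (nu n : int) : b - b' = nu%:~R -> ~ isInt b -> ~ isInt b' -> 0 < cre (b + b') ->
  Eg b b' n + (-1) ^ nu * Eg b b' (1 - n - nu) = 0.
Proof.
move=> hnu hb hb' h; pose D m := Eg b b' m + (-1) ^ nu * Eg b b' (1 - m - nu).
have nb m : m%:~R + b != 0.
  by apply/eqP => e; apply: hb; exists (- m); rewrite intrN; apply/eqP; rewrite -addr_eq0 addrC e.
have nb' m : m%:~R - b' != 0.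
  by apply/eqP => e; apply: hb'; exists m; apply/eqP; rewrite eq_sym -subr_eq0 e.
have Drec m : (m%:~R + b) * D (m + 1) = (m%:~R - b') * D m.
  have e2 : (m%:~R + b) * Eg b b' (1 - (m + 1) - nu) = (m%:~R - b') * Eg b b' (1 - m - nu).
    have := Eg_rec (- m - nu) h; rewrite (_ : - m - nu + 1 = 1 - m - nu); last by ring.
    rewrite (_ : 1 - (m + 1) - nu = - m - nu); last by ring.
    rewrite intrB intrN -hnu => e; apply: oppr_inj; rewrite -!mulNr.
    rewrite (_ : - (m%:~R + b) = - m%:~R - (b - b') - b'); last by ring.
    by rewrite -e; congr (_ * _); ring.
  rewrite /D; have e1 := Eg_rec m h; move: (Eg _ _ _) (Eg _ _ _) (Eg _ _ _) (Eg _ _ _) e1 e2 => E1 E2 E3 E4 e1 e2.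
  rewrite mulrDr e1 mulrCA e2; ring.
have [m0 hm0] : exists m0, D m0 = 0.
  have [k [ek|ek]] : exists k : int, nu = k + k \/ nu = k + k + 1.
    by exists (nu %/ 2)%Z; lia.
  - exists (- k); rewrite /D (_ : 1 - - k - nu = - k + 1); last by rewrite ek; ring.
    have -> : (-1 : C) ^ nu = 1 by rewrite ek expfzDr ?oppr_eq0 ?oner_eq0 // -expfzMl mulrNN mulr1 exp1rz.
    have e1 := Eg_rec (- k) h; apply: (mulfI (nb (- k))); rewrite mulr0 mul1r mulrDr e1 -mulrDl.
    rewrite (_ : _ + b + _ = 0) ?mul0r //.
    have -> : b = b' + nu%:~R by rewrite -hnu; ring.
    by rewrite ek intrD intrN; ring.
  - exists (- k); rewrite /D (_ : 1 - - k - nu = - k); last by rewrite ek; ring.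
    have -> : (-1 : C) ^ nu = -1.
      by rewrite ek expfzDr ?oppr_eq0 ?oner_eq0 // expr1z expfzDr ?oppr_eq0 ?oner_eq0 // -expfzMl mulrNN mulr1 exp1rz mul1r.
    by rewrite mulN1r subrr.
apply: (int_ind2 (P := fun m => D m = 0) hm0) => m e.
- by apply: (mulfI (nb m)); rewrite Drec e !mulr0.
- by apply: (mulfI (nb' m)); rewrite -Drec e !mulr0.
Qed.

(** The disc |t| < 1 plus the exterior |t| > 1, the latter seen through t -> 1 / t, where the
    exponent a becomes 1 - a - b. *)
Definition Kg b b' (nu : int) a (n : int) : C := Pi * (Sg b b' a n + (-1) ^ nu * Sg b b' (1 - a - b) (- n - nu)).

(** The inhomogeneous terms of the two series are [Eg] at n and (-1)^nu [Eg] at 1 - n - nu, which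
    cancel by [Eg_refl]. *)
Lemma Kg_rec b b' (nu : int) a (n : int) : b - b' = nu%:~R -> ~ isInt b -> ~ isInt b' ->
  ~ isInt a -> ~ isInt (a + b) -> 0 < cre (b + b') ->
  (a - n%:~R + b') * Kg b b' nu a (n - 1) = (a - n%:~R) * Kg b b' nu a n.
Proof.
move=> hnu hb hb' ha hab h.
have hg k : 1 - a - b + k%:R != 0.
  by apply: nonint_add; rewrite (_ : 1 - a - b = 1 - (a + b)); [exact: nonint_1B|ring].
have r1 := Sg_rec n (nonint_add ha) h.
have r2 := Sg_rec (1 - n - nu) hg h.
have := Eg_refl n hnu hb hb' h; rewrite -r1 -r2.
rewrite (_ : 1 - n - nu - 1 = - n - nu); last by ring.
rewrite /Kg (_ : - (n - 1) - nu = 1 - n - nu); last by ring.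
rewrite !intrB -hnu => e; apply/eqP; rewrite eq_sym -subr_eq0; apply/eqP.
rewrite -[RHS](mulr0 Pi) -e; ring.
Qed.

(** Sums over the index of the conjugate factor instead; the terms of negative index vanish through
    [cz]. *)
Lemma Sg_swap b b' a (n : int) : 0 < cre (b + b') -> Sg b b' a n = Sg b' b (a - n%:~R) (- n).
Proof.
have main c c' x (m : nat) : 0 < cre (c + c') -> Sg c c' x m = Sg c' c (x - m%:R) (- m%:Z).
  move=> h; have h' : 0 < cre (c' + c) by rewrite addrC.
  rewrite [RHS](CS_split m (summ_Sg _ _ h')) big1 ?add0r.
    apply: eq_CS => k; rewrite (_ : (k + m)%N%:Z - m%:Z = k%:Z) /=; last by lia.
    rewrite natrD.
    by rewrite mulrAC (_ : x - m%:R + _ = x + k%:R); [ring|ring].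
  move=> k _; rewrite (_ : k%:Z - m%:Z = Negz (m - k.+1)) /=; last by rewrite NegzE; have := ltn_ord k; lia.
  by rewrite mulr0 mul0r.
move=> h; case: n => m; first exact: main.
rewrite (_ : - Negz m = m.+1%:Z); last by rewrite NegzE opprK.
have h' : 0 < cre (b' + b) by rewrite addrC.
rewrite (main b' b (a - (Negz m)%:~R) m.+1 h') NegzE intrN (_ : a - - _ - m.+1%:R = a) //; ring.
Qed.

Lemma csin_int (m : int) a : csin (Pi * (a + m%:~R)) = (-1) ^ m * csin (Pi * a).
Proof.
have N1 : (-1 : C) != 0 by rewrite oppr_eq0 oner_eq0.
have sS (x : C) : csin (Pi * (x + 1)) = - csin (Pi * x) by rewrite mulrDr mulr1 csinDpi.
apply: (int_ind2 (P := fun m => csin (Pi * (a + m%:~R)) = (-1) ^ m * csin (Pi * a)) (m0 := 0)).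
- by rewrite addr0 expr0z mul1r.
- by move=> k e; rewrite intrD addrA sS e expfzDr // expr1z; ring.
- by move=> k; rewrite intrD addrA sS expfzDr // expr1z mulrN1 mulNr => /oppr_inj.
Qed.

(** The three sines change by (-1)^n, (-1)^m and (-1)^(n + m), which cancel. *)
Lemma frakB_swap al be al' be' : isInt (al - al') -> isInt (be - be') ->
  frakB al be al' be' = frakB al' be' al be.
Proof.
move=> [n en] [m em]; rewrite /frakB.
have -> : al = al' + n%:~R by rewrite -en; ring.
have -> : be = be' + m%:~R by rewrite -em; ring.
have -> : al' + n%:~R + (be' + m%:~R) = al' + be' + (n + m)%:~R by rewrite intrD; ring.
rewrite !csin_int.
have N1 : (-1 : C) != 0 by rewrite oppr_eq0 oner_eq0.
have nz k : (-1 : C) ^ k != 0 by rewrite expfz_neq0.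
rewrite expfzDr // [in RHS]invfM [in RHS]invfM.
have := nz n; have := nz m; move: ((-1 : C) ^ n) ((-1) ^ m) => x y y0 x0.
move: (csin _)^-1 => Q; move: (cGamma (_ + _))^-1 (cGamma (_ + be'))^-1 => P1 P2; field; by rewrite x0 y0.
Qed.

Lemma frakB_rec al be al' be' : ~ isInt al' -> ~ isInt (al' + be') ->
  (al' + be') * frakB al be (al' + 1) be' = al' * frakB al be al' be'.
Proof.
move=> ha hab; rewrite /frakB (_ : al' + 1 + be' = al' + be' + 1); last by ring.
have s0 : al' + be' != 0 by have := nonint_add hab 0; rewrite addr0.
rewrite !cGammaS; [|exact: nonint_add..].
rewrite !mulrDr !mulr1 !csinDpi [in LHS]invrN [in LHS]invfM.
move: (csin (Pi * al' + Pi * be'))^-1 => Q; move: (cGamma (al' + be'))^-1 (cGamma (al + be))^-1 => P1 P2.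
by field; exact: s0.
Qed.

Lemma ln_natS_mono (j k : nat) : (j <= k)%N -> ln (j.+1%:R : R) <= ln k.+1%:R.
Proof. by move=> h; rewrite ler_ln ?posrE ?ltr0n // ler_nat. Qed.

Lemma ln_natS_ge0 (k : nat) : 0 <= ln (k.+1%:R : R).
Proof. by rewrite ln_ge0 // ler1n. Qed.

Lemma summ_expR (c x : R) : x < -1 -> summ (fun k => (c * expR (x * ln k.+1%:R))%:C : C).
Proof.
move=> hx; apply: pbd_summ hx _; exists `|c| => // k.
by rewrite cabsR normrM [X in _ * X]ger0_norm // expR_ge0.
Qed.

(** For large M the coefficient of index k + M behaves like (M + 1)^(-b') / Gamma(1 - b'), uniformly
    enough for dominated convergence. *)
Lemma Sg_lim1 b b' a : 0 < cre b -> 0 < cre (b + b') -> (forall k, 1 - b' + k%:R != 0) ->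
  ccvg (fun M => npow b' M * Sg b b' a M%:Z) (CS (fun k => (cGamma (1 - b'))^-1 * (cb (1 - b) k / (a + k%:R)))).
Proof.
rewrite creD => hb hbb hk; have [_ lg] := cGamma_cvg hk.
have [M1 p1 h1] := cb_bound (1 - b'); have [M2 p2 h2] := pbdM (pbd_cb (1 - b)) (pbd_inv a).
(* (k + M + 1) / (M + 1) is at most k + 1, so its power with exponent -Re b' is at most (k +
   1)^x. *)
pose x := Num.max 0 (- cre b').
have x0 : 0 <= x by rewrite le_max lexx.
have xb : - cre b' <= x by rewrite le_max lexx orbT.
have xd : x - cre b - 1 < -1.
  by rewrite /x; case: (leP 0 (- cre b')) => _; lra.
pose F M k := npow b' M * (cb (1 - b) k * cb (1 - b') (k + M) / (a + k%:R)).
apply: (@ccvg_ext _ (fun M => CS (F M))).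
  by move=> M; rewrite /F CSZ //; apply: (summ_Sg a M%:Z (b := b) (b' := b')); rewrite creD.
have [] := @CS_dct _ F (fun k => (cGamma (1 - b'))^-1 * (cb (1 - b) k / (a + k%:R)))
  (fun k => M1 * M2 * expR ((x - cre b - 1) * ln k.+1%:R)) => //.
- move=> k; have h := ccvg_shift k lg; rewrite (_ : 1 - (1 - b') = b') in h; last by ring.
  have := ccvgM (ccvgM h (ccvgV (oner_neq0 _) (npow_shift b' k))) (ccvg_cst (cb (1 - b) k / (a + k%:R))).
  rewrite invr1 mulr1; apply: ccvg_ext => M; rewrite /F addnC invf_div.
  rewrite -[cb _ _ * npow _ _ * _]mulrA [npow b' (k + M)%N * _]mulrCA divff ?npow_neq0 // mulr1; ring.
- exact: summ_expR.
- move=> M k; have e : F M k = npow b' M * cb (1 - b') (k + M) * (cb (1 - b) k / (a + k%:R)) by rewrite /F; ring.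
  rewrite e cabsM; apply: le_trans (ler_pM _ _ (_ : _ <= M1 * expR (x * ln k.+1%:R)) (h2 k)) _; rewrite ?cabs_ge0 //.
    rewrite cabsM cabs_npow; apply: le_trans (ler_wpM2l (expR_ge0 _) (h1 _)) _.
    rewrite mulrCA ler_wpM2l // -expRD ler_expR creB cre1.
    set A := ln M.+1%:R; set B := ln (k + M).+1%:R; set J := ln k.+1%:R.
    have hAB : A <= B by apply: ln_natS_mono; apply: leq_addl.
    have hJ : 0 <= J by apply: ln_natS_ge0.
    have hB : B <= A + J.
      rewrite -lnM ?posrE ?ltr0n // ler_ln ?posrE ?mulr_gt0 ?ltr0n // -natrM ler_nat.
      by rewrite mulSn mulnS addnA; exact: leq_addr.
    have -> : cre b' * A + (1 - cre b' - 1) * B = - cre b' * (B - A) by ring.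
    have : - cre b' * (B - A) <= x * (B - A) by rewrite ler_wpM2r ?subr_ge0.
    have : x * (B - A) <= x * J by rewrite ler_wpM2l //; lra.
    by move=> u v; apply: le_trans v u.
  rewrite mulrACA -expRD creB cre1 le_eqVlt; apply/orP; left; apply/eqP; congr (_ * expR _); ring.
Qed.

(** With shift -M - m the sum starts at k = M + m, so all its terms lie in the decaying tail of the
    first factor. *)
Lemma Sg_lim2 b b' a (m : nat) : 0 < cre b -> cre b' <= cre b -> 0 < cre (b + b') ->
  ccvg (fun M => npow b' M * Sg b b' a (- M%:Z - m%:Z)) 0.
Proof.
rewrite creD => hb hb' hbb.
have b10 : 0 <= cre b + 1 by lra.
have b20 : 0 <= cre b + 1 - cre b' by lra.
have [M1 p1 h1] := cb_bound (1 - b'); have [M2 p2 h2] := pbdM (pbd_cb (1 - b)) (pbd_inv a).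
pose q M := (M + m)%N.
pose F M j := npow b' M * (cb (1 - b) (j + q M) * cb (1 - b') j / (a + (j + q M)%:R)).
have eF M : npow b' M * Sg b b' a (- M%:Z - m%:Z) = CS (F M).
  have h : 0 < cre (b + b') by rewrite creD.
  rewrite /Sg (CS_split (q M) (summ_Sg a _ h)) big1 ?add0r.
    rewrite -CSZ; last exact: (summ_shift (q M) (summ_Sg a _ h)).
    by apply: eq_CS => j; rewrite /F (_ : (j + q M)%N%:Z + _ = j%:Z) //; rewrite /q; lia.
  move=> k _; rewrite (_ : k%:Z + _ = Negz (q M - k.+1)) /=; last by rewrite NegzE; have := ltn_ord k; rewrite /q; lia.
  by rewrite mulr0 mul0r.
apply: (@ccvg_ext _ (fun M => CS (F M))); first by move=> M; rewrite eF.
pose x := - cre b - 1 - Num.min 0 (cre b').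
have m1 : Num.min 0 (cre b') <= 0 by rewrite ge_min lexx.
have m2 : Num.min 0 (cre b') <= cre b' by rewrite ge_min lexx orbT.
have xd : x < -1 by rewrite /x; case: (leP 0 (cre b')) => _; lra.
have bd M j : cabs (F M j) <= M1 * M2 * expR (cre b' * ln M.+1%:R - (cre b + 1) * ln (j + M).+1%:R - cre b' * ln j.+1%:R).
  have e : F M j = npow b' M * (cb (1 - b') j * (cb (1 - b) (j + q M) / (a + (j + q M)%:R))) by rewrite /F; ring.
  have key := ler_pM (cabs_ge0 _) (cabs_ge0 _) (h1 j) (h2 (j + q M)%N); rewrite -cabsM in key.
  rewrite e cabsM cabs_npow; apply: le_trans (ler_wpM2l (expR_ge0 _) key) _.
  rewrite [leLHS](_ : _ = M1 * M2 * (expR (cre b' * ln M.+1%:R) * expR ((cre (1 - b') - 1) * ln j.+1%:R) * expR ((cre (1 - b) - 1 - 1) * ln (j + q M).+1%:R))); last by ring.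
  rewrite -!expRD; apply: ler_wpM2l; [exact: mulr_ge0|rewrite ler_expR !creB cre1].
  have : ln (j + M).+1%:R <= ln (j + q M).+1%:R :> R by apply: ln_natS_mono; rewrite leq_add2l leq_addr.
  set B := ln (j + M).+1%:R; set B' := ln (j + q M).+1%:R => hB.
  have : (cre b + 1) * B <= (cre b + 1) * B' by rewrite ler_wpM2l.
  lra.
have [] := @CS_dct _ F (fun=> 0) (fun k => M1 * M2 * expR (x * ln k.+1%:R)).
- move=> j; apply: (@ccvg_squeeze _ _ _ (fun M => (M1 * M2 * expR (- cre b' * ln j.+1%:R)) / M.+1%:R)); last exact: cvg_inv_nat.
  near=> M; rewrite subr0; apply: le_trans (bd _ _) _.
  rewrite -[X in _ <= X]mulrA ler_wpM2l ?mulr_ge0 //.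
  have -> : (M.+1%:R)^-1 = expR (- ln M.+1%:R) :> R by rewrite expRN lnK ?posrE ?ltr0n.
  rewrite -expRD ler_expR.
  have : ln M.+1%:R <= ln (j + M).+1%:R :> R by apply: ln_natS_mono; rewrite leq_addl.
  set A := ln M.+1%:R; set B := ln (j + M).+1%:R => hAB; have A0 : 0 <= A := ln_natS_ge0 _.
  have : (cre b + 1) * A <= (cre b + 1) * B by rewrite ler_wpM2l.
  have : (cre b' - cre b) * A <= 0 by rewrite mulr_le0_ge0 // subr_le0.
  lra.
- exact: summ_expR.
- move=> M j; apply: le_trans (bd _ _) _; rewrite ler_wpM2l ?mulr_ge0 // ler_expR.
  have : ln M.+1%:R <= ln (j + M).+1%:R :> R by apply: ln_natS_mono; rewrite leq_addl.
  have : ln j.+1%:R <= ln (j + M).+1%:R :> R by apply: ln_natS_mono; rewrite leq_addr.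
  set A := ln M.+1%:R; set B := ln (j + M).+1%:R; set J := ln j.+1%:R => hJB hAB.
  have A0 : 0 <= A := ln_natS_ge0 _; have J0 : 0 <= J := ln_natS_ge0 _.
  rewrite /x; case: (leP 0 (cre b')) => s.
    have : cre b' * A <= cre b' * B by rewrite ler_wpM2l.
    have : (cre b + 1 - cre b') * J <= (cre b + 1 - cre b') * B by rewrite ler_wpM2l.
    lra.
  have : cre b' * A <= 0 by rewrite mulr_le0_ge0 // ltW.
  have : (cre b + 1) * J <= (cre b + 1) * B by rewrite ler_wpM2l.
  lra.
have -> : CS (fun=> 0 : C) = 0 by rewrite (@CS_finsupp _ _ 0) ?big_ord0.
by move=> _.
Unshelve. all: by end_near. Qed.

Lemma cGamma_ne a : ~ isInt a -> cGamma a != 0.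
Proof. by move=> ha; apply: cGamma_neq0; exact: nonint_add. Qed.

Lemma nonint_int a (n : int) : ~ isInt a -> ~ isInt (a + n%:~R).
Proof.
move=> ha h; apply: ha; rewrite (_ : a = a + n%:~R - n%:~R); last by ring.
by apply: isIntB => //; exact: isInt_int.
Qed.

(** Both sides obey the same recursion in n, so n = 0 suffices; there the recursion is run up to M
    and the limit is evaluated by [Sg_lim1], [Sg_lim2] and the beta series. That b - b' is a natural
    number gives Re b > 0 and Re b' <= Re b, on which both limits rely. *)
Lemma Kg_frakB_ge b b' (m : nat) a (n : int) : b - b' = m%:R -> ~ isInt b -> ~ isInt b' ->
  ~ isInt a -> ~ isInt (a + b) -> 0 < cre (b + b') ->
  Kg b b' m%:Z a n = frakB a b (a - n%:~R) b'.
Proof.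
move=> hm hb hb' ha hab h; have hnu : b - b' = (m%:Z)%:~R by rewrite hm.
have hbb : cre b = cre b' + m%:R by rewrite (_ : b = b' + m%:R) ?creD ?cre_nat // -hm; ring.
have m0 : (0 : R) <= m%:R := ler0n _ _.
have rb : 0 < cre b by move: h; rewrite creD; lra.
have hab' : ~ isInt (a + b').
  by rewrite (_ : a + b' = a + b + (- m%:Z)%:~R); [exact: nonint_int|rewrite intrN -hnu; ring].
have nzr k : a - k%:~R + b' != 0.
  have := nonint_add (@nonint_int _ (- k) hab') 0; rewrite addr0 intrN (_ : a + b' - k%:~R = a - k%:~R + b') //; ring.
have nzr' k : a - k%:~R != 0.
  by have := nonint_add (@nonint_int _ (- k) ha) 0; rewrite addr0 intrN.
have rec k := Kg_rec k hnu hb hb' ha hab h.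
have n1 : ~ isInt (1 - a) by apply: nonint_1B.
have n2 : ~ isInt (1 - a - b') by rewrite (_ : 1 - a - b' = 1 - (a + b')); [exact: nonint_1B|ring].
have n3 : ~ isInt (1 - b') by apply: nonint_1B.
have base : Kg b b' m%:Z a 0 = frakB a b a b'.
  have down M : Kg b b' m%:Z a 0 = cb (1 - a) M / cb (1 - a - b') M * Kg b b' m%:Z a M%:Z.
    elim: M => [|M ->]; first by rewrite !cb0 divr1 mul1r.
    have := rec M.+1%:Z; rewrite (_ : M.+1%:Z - 1 = M%:Z); last by lia.
    have := nzr M.+1%:Z; have c1 := cb_neq0 M (nonint_add n2); have d2 := nonint_add n2 M.
    have q (s : C) k : cb s k.+1 = (s + k%:R) * cb s k / k.+1%:R by rewrite -cbS mulrC mulKf ?natC_neq0.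
    rewrite !q; have k0 := natC_neq0 R M.
    rewrite -[(M.+1%:Z)%:~R]/(M.+1%:R : C); rewrite -natr1 in k0 *.
    move: (Kg _ _ _ _ _) (Kg _ _ _ _ _) => K1 K2 z e.
    have -> : K2 = (a - (M%:R + 1)) * K1 / (a - (M%:R + 1) + b') by rewrite -e mulrC mulKf.
    by field; rewrite z c1 k0 d2.
  have [g1 l1] := cGamma_cvg (nonint_add n1); have [g2 l2] := cGamma_cvg (nonint_add n2).
  have L1 := Sg_lim1 a rb h (nonint_add n3).
  have L2 := @Sg_lim2 b b' (1 - a - b) m rb (ltac:(rewrite hbb; lra)) h.
  rewrite CSZ ?beta_series // in L1; [|exact: nonint_add..|exact: summ_beta].
  have L3 := ccvgM (ccvg_cst Pi) (ccvgD L1 (ccvgM (ccvg_cst ((-1) ^ m%:Z)) L2)).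
  have g2' : (cGamma (1 - a - b'))^-1 != 0 by rewrite invr_eq0.
  have L := ccvgM (ccvg_div g2' l1 l2) L3.
  rewrite frakB_formula //; apply: (ccvg_unique (ccvg_cst _)).
  rewrite mulr0 addr0 in L; set v := (X in ccvg _ X) in L.
  have -> : Pi * cGamma a * cGamma b * cGamma (1 - a - b') / (cGamma (a + b) * cGamma (1 - a) * cGamma (1 - b')) = v.
    rewrite /v; have g3 := cGamma_ne n3; have g4 := cGamma_ne hab.
    by field; rewrite g1 g2 g3 g4.
  apply: ccvg_ext L => M; rewrite (down M) /Kg.
  have -> : npow (1 - (1 - a - b')) M = npow (1 - (1 - a)) M * npow b' M by rewrite -npowD; congr (npow _ M); ring.
  have c2 := cb_neq0 M (nonint_add n2).
  by field; rewrite c2 !npow_neq0.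
apply: (int_ind2 (P := fun n => Kg b b' m%:Z a n = frakB a b (a - n%:~R) b') (m0 := 0)).
- by rewrite subr0.
- move=> k e; apply: (mulfI (nzr' (k + 1))); rewrite -rec addrK e.
  have := @frakB_rec a b (a - (k + 1)%:~R) b' _ _; rewrite (_ : a - (k + 1)%:~R + 1 = a - k%:~R); last by rewrite intrD; ring.
  move=> -> //; first by rewrite -intrN; exact: nonint_int.
  by rewrite addrAC -intrN; exact: nonint_int.
- move=> k e; apply: (mulfI (nzr (k + 1))).
  have := rec (k + 1); rewrite addrK => ->; rewrite e.
  have := @frakB_rec a b (a - (k + 1)%:~R) b' _ _; rewrite (_ : a - (k + 1)%:~R + 1 = a - k%:~R); last by rewrite intrD; ring.
  move=> -> //; first by rewrite -intrN; exact: nonint_int.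
  by rewrite addrAC -intrN; exact: nonint_int.
Qed.

(* The left-hand side is what term-by-term integration of the complex beta
   integral over |t| < 1 and |t| > 1 gives. *)
Theorem complex_beta al be al' be' (n nu : int) : al - al' = n%:~R -> be - be' = nu%:~R ->
  ~ isInt al -> ~ isInt be -> ~ isInt (al + be) -> 0 < cre (be + be') ->
  Pi * (Sg be be' al n + (-1) ^ nu * Sg be be' (1 - al - be) (- n - nu)) = frakB al be al' be'.
Proof.
move=> hn hnu ha hb hab h.
have hb' : ~ isInt be' by rewrite (_ : be' = be + (- nu)%:~R); [exact: nonint_int|rewrite intrN -hnu; ring].
have ha' : ~ isInt al' by rewrite (_ : al' = al + (- n)%:~R); [exact: nonint_int|rewrite intrN -hn; ring].
have hab' : ~ isInt (al' + be').
  by rewrite (_ : al' + be' = al + be + (- n - nu)%:~R); [exact: nonint_int|rewrite intrB intrN -hn -hnu; ring].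
case: nu hnu => m hnu.
  have := Kg_frakB_ge n hnu hb hb' ha hab h; rewrite /Kg => ->.
  by have -> : al - n%:~R = al' by rewrite -hn; ring.
(* For [be - be'] negative, the plain and tilde parameters exchange roles. *)
rewrite (Sg_swap _ _ h) (Sg_swap (1 - al - be) (- n - Negz m) h).
have -> : al - n%:~R = al' by rewrite -hn; ring.
have -> : 1 - al - be - (- n - Negz m)%:~R = 1 - al' - be' by rewrite intrB intrN -hn -hnu; ring.
have h' : 0 < cre (be' + be) by rewrite addrC.
have hm : be' - be = m.+1%:R by rewrite -opprB hnu NegzE intrN opprK.
have := Kg_frakB_ge (- n) hm hb' hb ha' hab' h'; rewrite /Kg.
have -> : al' - (- n)%:~R = al by rewrite intrN -hn; ring.
rewrite -frakB_swap; [|by exists n|by exists (Negz m)].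
move=> <-; have -> : - (- n - Negz m) = - - n - m.+1%:Z by rewrite NegzE; lia.
by have -> : (-1 : C) ^ Negz m = (-1) ^ m.+1 by rewrite /exprz -exprVn invrN1.
Qed.
End ComplexBeta.

(** * Binomial series and single-valued powers of 1 - t *)

Section BinomialSeries.
Variable R : realType.
Local Notation C := R[i].
Implicit Types s u t : C.

(** From ln k <= d k - 1 - ln d, with d chosen so that the power of k costs at most e^(L k / 2),
    half of the geometric decay of r^k. *)
Lemma pbd_geo (u : nat -> C) (x : R) t : pbd u x -> cabs t < 1 -> summ (fun k => u k * t ^+ k).
Proof.
move=> [M M0 h] t1; have t0 := cabs_ge0 t.
pose r := (1 + cabs t) / 2; have r0 : 0 < r by rewrite /r; lra.
have r1 : r < 1 by rewrite /r; lra.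
pose L := - ln r; have L0 : 0 < L by rewrite /L oppr_gt0 ln_lt0 // r0 r1.
pose y := Num.max x 1.
have y1 : 1 <= y by rewrite le_max lexx orbT.
have xy : x <= y by rewrite le_max lexx.
have y0 : 0 < y := lt_le_trans ltr01 y1.
pose d := L / (2 * y); have d0 : 0 < d by rewrite divr_gt0 // mulr_gt0.
pose c := y * (- 1 - ln d).
have rE : r = expR (- L) by rewrite /L opprK lnK.
have q1 : expR (- L / 2) < 1 by rewrite expR_lt1; lra.
have sg := @summ_geo R (M * expR (c + L / 2)) (expR (- L / 2)).
rewrite expR_ge0 q1 in sg; apply: summ_real_dom (sg isT) => k.
rewrite cabsM cabsX; have k0 : (0 : R) < k.+1%:R by rewrite ltr0n.
have lk : ln k.+1%:R <= d * k.+1%:R - 1 - ln d.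
  have := @le_ln1Dx R (d * k.+1%:R - 1); rewrite (_ : 1 + (d * k.+1%:R - 1) = d * k.+1%:R); last by ring.
  rewrite lnM ?posrE // => H.
  have : -1 < d * k.+1%:R - 1 by rewrite ltrBDr addNr mulr_gt0.
  by move/H; lra.
have e1 : x * ln k.+1%:R <= L / 2 * k.+1%:R + c.
  apply: le_trans (ler_wpM2r (ln_natS_ge0 R k) xy) _.
  apply: le_trans (ler_wpM2l (ltW y0) lk) _.
  by rewrite le_eqVlt /c /d; apply/orP; left; apply/eqP; field; rewrite gt_eqF.
have e2 : cabs t ^+ k <= r ^+ k by apply: lerXn2r; rewrite ?nnegrE ?(ltW r0) //; rewrite /r; lra.
have e3 : cabs (u k) <= M * expR (L / 2 * k.+1%:R + c).
  by apply: le_trans (h k) _; rewrite ler_wpM2l // ler_expR.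
apply: le_trans (ler_pM (cabs_ge0 _) (exprn_ge0 _ t0) e3 e2) _.
rewrite -!mulrA ler_wpM2l // rE -!expRM_natl -!expRD ler_expR -natr1.
by rewrite le_eqVlt; apply/orP; left; apply/eqP; field.
Qed.

Definition binS s t : C := CS (fun k => cb s k * t ^+ k).

Lemma summ_binS s t : cabs t < 1 -> summ (fun k => cb s k * t ^+ k).
Proof. by apply: pbd_geo; exact: pbd_cb. Qed.

Lemma vandermonde s u n : \sum_(i < n.+1) cb s i * cb u (n - i) = cb (s + u) n.
Proof.
elim: n => [|n IH]; first by rewrite big_ord_recl big_ord0 !cb0 mulr1 addr0.
apply: (mulfI (natC_neq0 R n)); rewrite cbS -IH !mulr_sumr.
transitivity (\sum_(i < n.+2) (i%:R * cb s i) * cb u (n.+1 - i) + \sum_(i < n.+2) cb s i * ((n.+1 - i)%:R * cb u (n.+1 - i))).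
  rewrite -big_split /=; apply: eq_bigr => i _.
  have hi : (i <= n.+1)%N by rewrite -ltnS.
  by rewrite natrB //; ring.
rewrite big_ord_recl mul0r mul0r add0r [X in _ + X]big_ord_recr /= subnn mul0r mulr0 addr0 -big_split /=.
apply: eq_bigr => i _; have hi : (i <= n)%N by rewrite -ltnS.
rewrite /bump /= add1n subSS cbS subSn // cbS natrB //; ring.
Qed.

Lemma cnt2E (f : nat * nat -> C) : cintg (prodm (cnt R) (cnt R)) f ->
  CI (prodm (cnt R) (cnt R)) f = CS (fun n => CS (fun m => f (n, m))).
Proof. by move=> h; rewrite /CS (CI_fubini (m1 := cnt R) (m2 := cnt R) h). Qed.

Lemma measurable_nat2 d (T : measurableType d) (f : nat * nat -> T) : measurable_fun setT f.
Proof. by apply: measurable_natX. Qed.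

Lemma cauchy_product (u v : nat -> C) : summ u -> summ v ->
  CS u * CS v = CS (fun n => \sum_(i < n.+1) u i * v (n - i)%N).
Proof.
move=> su sv; have [c e] := CS_mul su sv; rewrite -e.
have w1 (n : nat) : cabs (1 : C) <= 1 by rewrite cabs1.
have [_ _ h] := CI_regroup (measurable_nat2 (fun p => (p.1 + p.2)%N)) w1 c.
transitivity (CI (prodm (cnt R) (cnt R)) (fun p => u p.1 * v p.2 * 1)); first by apply: eq_CI => p; rewrite mulr1.
rewrite h; apply: eq_CS => n; rewrite mul1r cnt2E; last first.
  apply: cintg_dom c; first exact: cmeas_nat2.
  by move=> p; case: ifP => // _; rewrite cabs0 cabs_ge0.
rewrite (@CS_finsupp _ _ n.+1).
  apply: eq_bigr => i _ /=; have hi : (i <= n)%N by rewrite -ltnS.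
  rewrite -[RHS](CS_single (n - i)%N (u i * v (n - i)%N)); apply: eq_CS => m.
  have -> : (i + m == n)%N = (m == n - i)%N by apply/eqP/eqP; lia.
  by case: eqP => [->|].
move=> k hk /=; rewrite (@CS_finsupp _ _ 0) ?big_ord0 // => m _.
by rewrite ifF //; apply/negbTE; rewrite neq_ltn; apply/orP; right; apply: leq_trans hk (leq_addr _ _).
Qed.

Lemma binSD s u t : cabs t < 1 -> binS s t * binS u t = binS (s + u) t.
Proof.
move=> ht; rewrite /binS cauchy_product; [|exact: summ_binS..].
apply: eq_CS => n; rewrite -vandermonde mulr_suml; apply: eq_bigr => i _.
have hi : (i <= n)%N by rewrite -ltnS.
have -> : t ^+ n = t ^+ i * t ^+ (n - i) by rewrite -exprD subnKC.
ring.
Qed.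

Lemma binS_X s t n : cabs t < 1 -> binS s t ^+ n = binS (s *+ n) t.
Proof.
move=> ht; elim: n => [|n IH]; last by rewrite exprS IH (binSD _ _ ht) mulrS.
rewrite mulr0n expr0 /binS (@CS_finsupp _ _ 1) ?big_ord_recl ?big_ord0 ?cb0 ?mulr1 ?addr0 //.
by case=> // k _; rewrite /cb pochSl !mul0r.
Qed.

(** B n is compared with e^(x / (n + 1)), whose power is exactly e^x; both are bounded by e^(N / (n
    + 1)), which keeps the difference of the powers under control. *)
Lemma ccvg_expn_cexp (B : nat -> C) x : ccvg (fun n => n.+1%:R * (B n - 1)) x ->
  ccvg (fun n => B n ^+ n.+1) (cexp x).
Proof.
move=> h; pose E n := cexp (x / n.+1%:R).
have hE : ccvg (fun n => n.+1%:R * (E n - 1)) x := ccvg_cexp_linear x.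
have [K [K0 hK]] := ccvg_bounded h; have [K' [K0' hK']] := ccvg_bounded hE.
pose N := Num.max K K'.
have KN : K <= N by rewrite le_max lexx.
have KN' : K' <= N by rewrite le_max lexx orbT.
have bd (A : nat -> C) L : (forall n, cabs (n.+1%:R * (A n - 1)) <= L) -> L <= N -> forall n, cabs (A n) <= expR (N / n.+1%:R).
  move=> hA LN n; apply: le_trans (expR_ge1Dx _).
  have := hA n; rewrite cabsM cabsn mulrC -ler_pdivlMr ?ltr0n // => hA'.
  have := cabsD (A n - 1) 1; rewrite subrK cabs1 => hB.
  have : L / n.+1%:R <= N / n.+1%:R by rewrite ler_wpM2r // invr_ge0 ler0n.
  by move=> hC; apply: le_trans hB _; rewrite addrC lerD2l; exact: le_trans hA' hC.
have powdiff (a b : C) (M : R) n : 0 <= M -> cabs a <= M -> cabs b <= M ->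
    cabs (a ^+ n.+1 - b ^+ n.+1) <= n.+1%:R * M ^+ n * cabs (a - b).
  move=> M0 ha hb; rewrite subrXX cabsM mulrC ler_wpM2r ?cabs_ge0 //.
  apply: (@le_trans _ _ (\sum_(i < n.+1) M ^+ n)); last by rewrite sumr_const card_ord mulr_natl.
  elim/big_rec2: _ => [|i y z _ hz]; first by rewrite cabs0.
  apply: le_trans (cabsD _ _) _; apply: lerD hz.
  rewrite cabsM !cabsX; have hi : (i <= n)%N by rewrite -ltnS.
  have -> : M ^+ n = M ^+ (n - i) * M ^+ i by rewrite -exprD subnK.
  by apply: ler_pM; rewrite ?exprn_ge0 ?cabs_ge0 //; apply: lerXn2r; rewrite ?nnegrE ?cabs_ge0.
have EX n : E n ^+ n.+1 = cexp x.
  by rewrite -cexpMn -[x / _ *+ _]mulr_natr divfK // natC_neq0.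
apply: (@ccvg_squeeze _ _ _ (fun n => expR N * cabs (n.+1%:R * (B n - 1) - n.+1%:R * (E n - 1)))).
  near=> n; rewrite -(EX n).
  apply: le_trans (powdiff _ _ _ n (expR_ge0 (N / n.+1%:R)) (bd B K hK KN n) (bd E K' hK' KN' n)) _.
  rewrite -mulrBr cabsM cabsn (_ : B n - 1 - (E n - 1) = B n - E n); last by ring.
  rewrite mulrCA -mulrA ler_wpM2l ?ler0n // ler_wpM2r ?cabs_ge0 //.
  rewrite -expRM_natl ler_expR mulrCA ler_piMr //; first by apply: le_trans KN; exact: ltW.
  by rewrite ler_pdivrMr ?ltr0n // mul1r ler_nat.
have := ccvg_abs (ccvgB h hE); rewrite subrr cabs0 => h0.
by rewrite -[X in _ --> X](mulr0 (expR N)); apply: cvgMr.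
Unshelve. all: by end_near. Qed.

(** The power series of -ln (1 - t). *)
Definition lam t : C := CS (fun k => t ^+ k.+1 / k.+1%:R).

Lemma summ_expn t : cabs t < 1 -> summ (fun k => t ^+ k).
Proof.
by move=> h; apply: eq_summ (summ_binS 1 h) => k; rewrite cb1 mul1r.
Qed.

Lemma summ_lam t : cabs t < 1 -> summ (fun k => t ^+ k.+1 / k.+1%:R).
Proof.
move=> h; apply: summ_dom (summ_expn h) => k; rewrite cabsM exprS cabsM cabsV cabsn -mulrA mulrCA.
rewrite ler_piMr ?cabs_ge0 // mulr_ile1 ?cabs_ge0 ?invr_ge0 ?ler0n ?(ltW h) //.
by rewrite invf_le1 ?ltr0n // ler1n.
Qed.

Lemma cabs_poch_le a (b : R) n : cabs a <= b -> cabs (poch a n) <= cabs (poch b%:C n).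
Proof.
move=> h; have b0 : 0 <= b by apply: le_trans (cabs_ge0 a) h.
elim: n => [|n IH]; first by rewrite !poch0.
rewrite !pochS !cabsM ler_pM ?cabs_ge0 // -rcn -rcD cabsR ger0_norm ?addr_ge0 ?ler0n //.
by apply: le_trans (cabsD _ _) _; rewrite cabsR ger0_norm ?ler0n // lerD2r.
Qed.

(** The binomial series is multiplicative in s, hence the n-th power of the series at s / n, and n
    times (that series minus 1) tends to s lam(t). *)
Lemma binS_cexp s t : cabs t < 1 -> binS s t = cexp (s * lam t).
Proof.
move=> ht; apply: (ccvg_unique (ccvg_cst _)).
apply: (@ccvg_ext _ (fun n => binS (s / n.+1%:R) t ^+ n.+1)).
  by move=> n; rewrite binS_X // -[s / _ *+ _]mulr_natr divfK // natC_neq0.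
apply: ccvg_expn_cexp; rewrite /lam -CSZ; last exact: summ_lam.
pose F n k := s * poch (s / n.+1%:R + 1) k / (k.+1)`!%:R * t ^+ k.+1.
apply: (@ccvg_ext _ (fun n => CS (F n))).
  move=> n; have -> : binS (s / n.+1%:R) t = 1 + CS (fun k => cb (s / n.+1%:R) k.+1 * t ^+ k.+1).
    by rewrite {1}/binS CS_recl ?cb0 ?expr0 ?mulr1 //; exact: summ_binS.
  rewrite addrAC subrr add0r -CSZ; last exact: summS (summ_binS _ ht).
  apply: eq_CS => k; rewrite /F /cb pochSl.
  have e : n.+1%:R * (s / n.+1%:R) = s by rewrite mulrC divfK ?natC_neq0.
  rewrite -{1}e; ring.
have [] := @CS_dct _ F (fun k => s * (t ^+ k.+1 / k.+1%:R)) (fun k => cabs s * cabs (cb (cabs s + 1)%:C k * t ^+ k)).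
- move=> k; have hp : ccvg (fun n => poch (s / n.+1%:R + 1) k) (poch 1 k).
    elim: k => [|k IH]; first by apply: (@ccvg_ext _ (fun=> 1)); [move=> n; rewrite poch0|rewrite poch0; exact: ccvg_cst].
    rewrite pochS; under [X in ccvg X]eq_fun do rewrite pochS.
    apply: ccvgM => //; apply: ccvgD; last exact: ccvg_cst.
    rewrite -[X in ccvg _ X]add0r; apply: ccvgD; last exact: ccvg_cst.
    rewrite -(mulr0 s); apply: ccvgM; first exact: ccvg_cst.
    have := ccvg_real (@cvg_harmonic R); apply: ccvg_ext => n; by rewrite /harmonic rcV rcn.
  have -> : s * (t ^+ k.+1 / k.+1%:R) = s * poch 1 k / (k.+1)`!%:R * t ^+ k.+1.
    have := cb1 R k; rewrite /cb => e; have f0 := fact_neq0 R k.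
    have -> : poch (1 : C) k = k`!%:R by rewrite -[LHS](divfK f0) e mul1r.
    by rewrite factS natrM; field; rewrite nat1r natC_neq0 f0.
  by apply: ccvgM; [apply: ccvgM; [apply: ccvgM => //; exact: ccvg_cst|exact: ccvg_cst]|exact: ccvg_cst].
- apply: eq_summ (summZ (cabs s)%:C (summ_abs (summ_binS (cabs s + 1)%:C ht))) => k.
  by rewrite -rcM.
- move=> n k; rewrite /F /cb !cabsM !cabsV !cabsn -!mulrA ler_wpM2l ?cabs_ge0 //.
  rewrite ler_pM ?cabs_ge0 ?mulr_ge0 ?invr_ge0 ?cabs_ge0 ?ler0n //.
    apply: cabs_poch_le; apply: le_trans (cabsD _ _) _; rewrite cabs1 lerD2r cabsM cabsV cabsn.
    by rewrite ler_piMr ?cabs_ge0 // invf_le1 ?ltr0n // ler1n.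
  rewrite ler_pM ?cabs_ge0 ?invr_ge0 ?ler0n //.
    by rewrite lef_pV2 ?posrE ?ltr0n ?fact_gt0 // ler_nat factS leq_pmull.
  by rewrite !cabsX exprS ler_piMl ?exprn_ge0 ?cabs_ge0 // ltW.
by [].
Qed.

Lemma CS_conj (u : nat -> C) : summ u -> CS (fun k => conjc (u k)) = conjc (CS u).
Proof.
move=> su; apply: CS_unique; first by apply: summ_dom su => k; rewrite cabs_conj.
have := ccvg_conj (CS_cvg su); apply: ccvg_ext => N; elim: N => [|N IH]; first by rewrite !big_ord0 conjc0.
by rewrite !big_ord_recr /= -IH rmorphD.
Qed.

Lemma lam_conj t : cabs t < 1 -> lam (conjc t) = conjc (lam t).
Proof.
move=> ht; rewrite /lam -CS_conj; last exact: summ_lam.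
apply: eq_CS => k; rewrite -(rcn R k.+1) -rcV.
rewrite [RHS](_ : _ = conjc (t ^+ k.+1) * conjc (k.+1%:R^-1)%:C); last exact: rmorphM.
by rewrite conjc_real; congr (_ * _); rewrite -[RHS]/(_ (t ^+ k.+1)) rmorphXn.
Qed.

Lemma CS_geo t : cabs t < 1 -> CS (fun k => t ^+ k) = (1 - t)^-1.
Proof.
move=> ht; have t1 : 1 - t != 0.
  by rewrite subr_eq0; apply: contraTneq ht => <-; rewrite cabs1 ltxx.
apply: (mulIf t1); rewrite mulVf // mulrBr mulr1 [X in X - _]CS_recl; last exact: summ_expn.
rewrite expr0 mulrC -CSZ; last exact: summ_expn.
by rewrite -addrA (_ : _ - _ = 0) ?addr0 //; apply/eqP; rewrite subr_eq0; apply/eqP/eq_CS => k; rewrite exprS.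
Qed.

(** Integrality of [s - s'] makes every logarithm u as good as the principal one. *)
Lemma ppow_cexp u s s' : isInt (s - s') -> ppow (cexp u) s s' = cexp (s * u + s' * conjc u).
Proof.
move=> [n e]; rewrite (ppowE (cexp_neq0 _) e) cabs_cexp expRK.
rewrite -cexpR -cexpB -cexpMz -e -cexpD; congr cexp.
by apply: ceqP; rewrite !(creD, cimD, creM, cimM, creB, cimB) /=; case: u => a b /=; ring.
Qed.

(** The case s = 1 of [binS_cexp] reads 1 / (1 - t) = e^lam(t), so [lam] supplies a logarithm for
    [ppow_cexp]. *)
Lemma ppow_binomial s s' t : cabs t < 1 -> isInt (s - s') ->
  ppow (1 - t) (- s) (- s') = binS s t * binS s' (conjc t).
Proof.
move=> ht i; have ht' : cabs (conjc t) < 1 by rewrite cabs_conj.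
rewrite !binS_cexp // lam_conj // -cexpD -ppow_cexp //.
have -> : cexp (lam t) = (1 - t)^-1.
  rewrite -CS_geo // -[lam t]mul1r -binS_cexp //; apply: eq_CS => k; by rewrite cb1 mul1r.
rewrite ppowV // subr_eq0; apply: contraTneq ht => <-; by rewrite cabs1 ltxx.
Qed.
End BinomialSeries.

Section AlmostEverywhere.
Variable R : realType.
Local Notation C := R[i].
Local Notation dA := (mA R).
Local Notation plane := (measurableTypeR R * measurableTypeR R)%type.

Lemma cintg_ae_dom d (T : measurableType d) (mu : {measure set T -> \bar R}) (f g : T -> C) :
  cmeas f -> aeM mu (fun x => cabs (f x) <= cabs (g x)) -> cintg mu g -> cintg mu f.
Proof.
move=> mf h [mg gi]; split => //; apply: le_lt_trans gi.
apply: ae_ge0_le_integral => //.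
- by move=> x _; rewrite lee_fin cabs_ge0.
- exact: cmeas_absE.
- by move=> x _; rewrite lee_fin cabs_ge0.
- exact: cmeas_absE.
- change (aeM mu (fun x => [set: T] x -> ((cabs (f x))%:E <= (cabs (g x))%:E)%E)).
  by apply: (aeM_imp h) => x hx _; rewrite lee_fin.
Qed.

Lemma cintg_ae_eq d (T : measurableType d) (mu : {measure set T -> \bar R}) (f g : T -> C) :
  cmeas f -> aeM mu (fun x => f x = g x) -> cintg mu g -> cintg mu f.
Proof. by move=> mf h; apply: cintg_ae_dom => //; apply: (aeM_imp h) => x ->. Qed.

Lemma cintg_abs d (T : measurableType d) (mu : {measure set T -> \bar R}) (f : T -> C) :
  cintg mu f -> cintg mu (fun x => (cabs (f x))%:C).
Proof.
move=> hf; have mf := cintg_meas hf; apply: cintg_dom hf; first by apply: cmeas_real; apply: cmeas_abs.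
by move=> x; rewrite cabsR ger0_norm // cabs_ge0.
Qed.

(** The circle lies in the annulus 1 <= |t| < 1 + dd, of area at most 3 pi dd when dd <= 1. *)
Lemma ae_circle : aeM dA (fun x => cabs (toC x) != 1).
Proof.
have mI r X : measurable_fun setT (fun x : plane => (inA r X (toC x))%:R%:E : \bar R).
  by apply: measurable_ind; apply: measurable_inA; apply: cmeas_toC.
have mC : measurable_fun setT (fun x : plane => cabs (toC x) == 1).
  by apply: measurable_fun_eqr => //; exact/cmeas_abs/cmeas_toC.
pose A : set plane := [set x | cabs (toC x) == 1].
have mA' : measurable A by rewrite -[A]setTI; exact: (mC measurableT [set true]).
exists A; split => //; last by move=> x /= /negP; rewrite negbK.
apply/eqP; rewrite eq_le measure_ge0 andbT; apply/lee_addgt0Pr => e e0; rewrite add0e.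
pose dd := Num.min 1 (e / (3 * pi)).
have p0 := @pi_gt0 R.
have d0 : 0 < dd by rewrite lt_min ltr01 divr_gt0 // mulr_gt0.
have d1 : dd <= 1 by rewrite ge_min lexx.
have d2 : dd <= e / (3 * pi) by rewrite ge_min lexx orbT.
apply: (@le_trans _ _ (areaA 1 (1 + dd))); last first.
  have h1 : 1 <= 1 + dd by rewrite lerDl ltW.
  rewrite (areaA_rX ltr01 h1) kappa_pi lee_fin.
  move: d2; rewrite ler_pdivlMr ?mulr_gt0 // => d2.
  have : dd * dd <= dd by rewrite ler_piMr // ltW.
  have -> : pi * ((1 + dd) ^+ 2 - 1 ^+ 2) = pi * (2 * dd + dd * dd) by ring.
  move=> q; apply: (@le_trans _ _ (pi * (3 * dd))); last by move: d2; lra.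
  apply: ler_wpM2l; first exact: ltW.
  by rewrite (_ : 3 * dd = 2 * dd + dd) ?lerD2l //; ring.
apply: (@le_trans _ _ (\int[dA]_x (\1_A x)%:E)%E); first by rewrite integral_indic // setIT.
rewrite /areaA; apply: le_int => //.
- by apply/measurable_EFinP; apply: measurable_indic.
- move=> x; rewrite lee_fin indicE; case: (boolP (x \in A)) => [|_]; last exact: ler0n.
  by rewrite inE /A /= => /eqP h; rewrite /inA h lexx ltrDl d0.
Qed.
End AlmostEverywhere.

(** * Term-by-term integration of products of power series *)

Section Expansion.
Variable R : realType.
Local Notation C := R[i].
Local Notation dA := (mA R).
Local Notation plane := (measurableTypeR R * measurableTypeR R)%type.
Local Notation cnt2 := (prodm (cnt R) (cnt R)).

(** On the region |w| <= rho, so the double series is dominated by |g| times a convergent constant,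
    and Fubini applies to the integral and the sum over pairs. *)
Lemma CI_expand (P : C -> bool) (g w : C -> C) (q q' : nat -> C) (rho : R) :
  measurable_fun setT (fun x : plane => P (toC x)) -> cmeasC w -> cintg dA (onP P g) ->
  (forall t, P t -> cabs (w t) <= rho) -> 0 <= rho ->
  summ (fun k => q k * (rho%:C) ^+ k) -> summ (fun k => q' k * (rho%:C) ^+ k) ->
  let f p := onP P (fun t => g t * (w t ^+ p.1 * conjc (w t) ^+ p.2)) in
  [/\ cintg dA (onP P (fun t => g t * (CS (fun k => q k * w t ^+ k) * CS (fun k => q' k * conjc (w t) ^+ k)))),
      cintg cnt2 (fun p => q p.1 * q' p.2 * CI dA (f p)) &
      CI dA (onP P (fun t => g t * (CS (fun k => q k * w t ^+ k) * CS (fun k => q' k * conjc (w t) ^+ k)))) =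
      CI cnt2 (fun p => q p.1 * q' p.2 * CI dA (f p))].
Proof.
move=> mP mw ig hw r0 sq sq' f; have mg := cintg_meas ig.
pose F (x : plane) (p : nat * nat) := q p.1 * q' p.2 * f p x.
pose u k := cabs (q k * (rho%:C) ^+ k); pose u' k := cabs (q' k * (rho%:C) ^+ k).
have Fle x p : cabs (F x p) <= cabs (onP P g x) * (u p.1 * u' p.2).
  rewrite /F /f /onP; case: ifP => Px; last by rewrite mulr0 cabs0 mul0r.
  rewrite (_ : q p.1 * q' p.2 * _ = g (toC x) * ((q p.1 * w (toC x) ^+ p.1) * (q' p.2 * conjc (w (toC x)) ^+ p.2))); last by ring.
  rewrite cabsM ler_wpM2l ?cabs_ge0 // cabsM /u /u'.
  have hb (c v : C) n : cabs v <= rho -> cabs (c * v ^+ n) <= cabs (c * rho%:C ^+ n).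
    move=> hv; rewrite !cabsM !cabsX cabsR ger0_norm // ler_wpM2l ?cabs_ge0 //.
    by apply: lerXn2r; rewrite ?nnegrE ?cabs_ge0.
  by apply: ler_pM; [exact: cabs_ge0|exact: cabs_ge0|apply: hb; exact: hw|apply: hb; rewrite cabs_conj; exact: hw].
have mx : cmeas (fun z : plane * (nat * nat) => onP P g z.1).
  by apply: (cmeas_comp mg); apply: measurable_fst.
have mpow (v : C -> C) : cmeasC v -> cmeas (fun z : plane * nat => v (toC z.1) ^+ z.2).
  move=> mv; apply: cmeas_Xnat => n /=; exact: cmeas_exp.
have mP2 : measurable_fun setT (fun z : plane * (nat * nat) => P (toC z.1)).
  by apply: (measurableT_comp (f := fun x : plane => P (toC x)) mP); apply: measurable_fst.
have mF : cmeas (fun z : plane * (nat * nat) => F z.1 z.2).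
  rewrite (_ : (fun z => _) = (fun z : plane * (nat * nat) => q z.2.1 * q' z.2.2 * (onP P g z.1 * (w (toC z.1) ^+ z.2.1 * conjc (w (toC z.1)) ^+ z.2.2)))); last first.
    by apply/funext => z; rewrite /F /f /onP; case: ifP => // _; rewrite !mul0r.
  apply: cmeasM.
    by apply: (cmeas_comp (cmeas_nat2 (fun p => q p.1 * q' p.2))); apply: measurable_snd.
  apply: (cmeasM mx); apply: cmeasM.
    apply: (cmeas_comp (g := fun z : plane * (nat * nat) => (z.1, z.2.1)) (mpow w mw)).
    by apply: measurable_fun_pair; [exact: measurable_fst|apply: (measurableT_comp (f := fst))].
  apply: (cmeas_comp (g := fun z : plane * (nat * nat) => (z.1, z.2.2)) (mpow (fun t => conjc (w t)) _)).
    exact: cmeas_conj.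
  by apply: measurable_fun_pair; [exact: measurable_fst|apply: (measurableT_comp (f := snd))].
have [su2 _] := CS_mul (summ_abs sq) (summ_abs sq').
have fin : (\int[dA]_x \int[cnt2]_p (cabs (F x p))%:E < +oo)%E.
  set W := (\int[cnt2]_p (u p.1 * u' p.2)%:E)%E.
  have W1 : (W < +oo)%E.
    case: su2 => _; apply: le_lt_trans; rewrite le_eqVlt; apply/orP; left; apply/eqP; apply: eq_integral => p _.
    by rewrite -rcM cabsR ger0_norm // mulr_ge0 // cabs_ge0.
  have u0 p : (0 <= (u p.1 * u' p.2)%:E)%E by rewrite lee_fin mulr_ge0 // cabs_ge0.
  have W0 : (0 <= W)%E by apply: integral_ge0 => p _.
  apply: (@le_lt_trans _ _ (\int[dA]_x ((cabs (onP P g x))%:E * W))%E).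
    apply: le_int.
    - apply: measurable_int2; first exact: cmeas_absE.
      by move=> x p; rewrite lee_fin cabs_ge0.
    - by apply: emeasurable_funM => //; exact: cmeas_absE.
    - by move=> x; apply: integral_ge0 => p _; rewrite lee_fin cabs_ge0.
    - move=> x; rewrite /W -ge0_intZl; [|exact: measurable_nat2|by []|by rewrite lee_fin cabs_ge0].
      apply: le_int; [exact: measurable_nat2|exact: measurable_nat2|by move=> p; rewrite lee_fin cabs_ge0|].
      by move=> p; rewrite -EFinM lee_fin.
  rewrite ge0_intZr //; [|exact: cmeas_absE|by move=> x; rewrite lee_fin cabs_ge0].
  apply: lte_mul_pinfty => //; first by apply: integral_ge0 => x _; rewrite lee_fin cabs_ge0.
  by rewrite ge0_fin_numE; [case: ig|apply: integral_ge0 => x _; rewrite lee_fin cabs_ge0].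
have inner x : CI cnt2 (F x) = onP P (fun t => g t * (CS (fun k => q k * w t ^+ k) * CS (fun k => q' k * conjc (w t) ^+ k))) x.
  rewrite /F /f /onP; case: ifP => Px; last by under eq_CI do rewrite mulr0; rewrite CI0.
  have s1 : summ (fun k => q k * w (toC x) ^+ k).
    apply: summ_dom sq => k; rewrite !cabsM !cabsX cabsR ger0_norm // ler_wpM2l ?cabs_ge0 //.
    by apply: lerXn2r; rewrite ?nnegrE ?cabs_ge0 // hw.
  have s2 : summ (fun k => q' k * conjc (w (toC x)) ^+ k).
    apply: summ_dom sq' => k; rewrite !cabsM !cabsX cabsR cabs_conj ger0_norm // ler_wpM2l ?cabs_ge0 //.
    by apply: lerXn2r; rewrite ?nnegrE ?cabs_ge0 // hw.
  have [c e] := CS_mul s1 s2; rewrite -e -CIZ //; apply: eq_CI => p; ring.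
have outer p : cintg dA (f p).
  have [c hc] : exists c : C, forall x, cabs (f p x) <= cabs (c * onP P g x).
    exists (rho ^+ p.1 * rho ^+ p.2)%:C => x; rewrite /f /onP; case: ifP => Px; last by rewrite mulr0 cabs0.
    rewrite mulrC !cabsM !cabsX cabs_conj cabsR ger0_norm ?mulr_ge0 ?exprn_ge0 // ler_wpM2r ?cabs_ge0 //.
    by apply: ler_pM; rewrite ?exprn_ge0 ?cabs_ge0 //; apply: lerXn2r; rewrite ?nnegrE ?cabs_ge0 // hw.
  apply: cintg_dom hc (cintgZ c ig); rewrite /f.
  rewrite (_ : onP _ _ = (fun x => onP P g x * (w (toC x) ^+ p.1 * conjc (w (toC x)) ^+ p.2))); last first.
    by apply/funext => x; rewrite /onP; case: ifP => // _; rewrite mul0r.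
  exact: (cmeasM mg (cmeasM (cmeas_exp _ mw) (cmeas_exp _ (cmeas_conj mw)))).
have outerE p : CI dA (fun x => F x p) = q p.1 * q' p.2 * CI dA (f p) by rewrite /F CIZ.
have c1 : cintg (dA \x cnt2)%E (fun z => F z.1 z.2) by apply: cintg_fubini.
have c2 : cintg (cnt2 \x dA)%E (fun z => F z.2 z.1).
  apply: (cintg_fubini_flip _ fin); apply: (cmeas_comp (g := fun z : (nat * nat) * plane => (z.2, z.1)) mF).
  exact: measurable_swap.
split.
- by apply: cintg_ext (cintg_CI c1) => x; rewrite -inner.
- by apply: cintg_ext (cintg_CI c2) => p; rewrite -outerE.
- under eq_CI do rewrite -inner; rewrite (CI_swap mF fin); apply: eq_CI => p; exact: outerE.
Qed.

Lemma CI_diagonal (f : nat -> nat -> C) (N : int) (I : nat * nat -> C) :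
  (forall k l, I (k, l) = if k%:Z + N == l%:Z then f k l else 0) -> cintg cnt2 I ->
  summ (fun k => if (k%:Z + N)%R is Posz l then f k l else 0) /\
  CI cnt2 I = CS (fun k => if (k%:Z + N)%R is Posz l then f k l else 0).
Proof.
move=> hI cI; have e k : CS (fun l => I (k, l)) = if (k%:Z + N)%R is Posz l then f k l else 0.
  case h : (k%:Z + N) => [l|l]; last first.
    rewrite (@CS_finsupp _ _ 0) ?big_ord0 // => m _; by rewrite hI h.
  rewrite -[RHS](CS_single l (f k l)); apply: eq_CS => m; rewrite hI h eq_sym eqz_nat.
  by case: eqP => [->|].
split; last by rewrite cnt2E //; apply: eq_CS.
have := cintg_CI (m1 := cnt R) (m2 := cnt R) cI; apply: cintg_ext => k; exact: e.
Qed.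
End Expansion.

(** * The complex beta integral over a disc *)

Section BetaIntegral.
Variable R : realType.
Local Notation C := R[i].
Local Notation dA := (mA R).
Local Notation plane := (measurableTypeR R * measurableTypeR R)%type.
Local Notation Pi := ((pi : R)%:C : C).

Definition bint (a b a' b' t : C) : C := ppow t (a - 1) (a' - 1) * ppow (1 - t) (b - 1) (b' - 1).

Lemma eq_ppow (w s s' u u' : C) : s = u -> s' = u' -> ppow w s s' = ppow w u u'.
Proof. by move=> -> ->. Qed.

Lemma cmeasC_id : cmeasC (fun t : C => t). Proof. exact: cmeas_toC. Qed.

Lemma cmeasC_1B (F : C -> C) : cmeasC F -> cmeasC (fun t => F (1 - t)).
Proof. by move=> mF; apply: (cmeasC_comp mF); apply: cmeasB; [exact: cmeas_cst|exact: cmeas_toC]. Qed.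

Lemma isInt_sub1 (s s' : C) : isInt (s - s') -> isInt (s - 1 - (s' - 1)).
Proof. by rewrite (_ : s - 1 - _ = s - s') //; ring. Qed.

Lemma cmeasC_bint a b a' b' : isInt (a - a') -> isInt (b - b') -> cmeasC (bint a b a' b').
Proof.
move=> ia ib; apply: cmeasM; first by apply: cmeasC_ppow; exact: isInt_sub1.
by apply: (@cmeasC_1B (fun t => ppow t (b - 1) (b' - 1))); apply: cmeasC_ppow; exact: isInt_sub1.
Qed.

Lemma powR_between (r x X c : R) : 0 < r -> r <= x -> x <= X -> x `^ c <= r `^ c + X `^ c.
Proof.
move=> r0 rx xX; have x0 : 0 < x by apply: lt_le_trans rx.
have X0 : 0 < X by apply: lt_le_trans xX.
have [c0|c0] := leP 0 c.
  apply: (@le_trans _ _ (X `^ c)); last by rewrite lerDr powR_ge0.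
  by apply: ge0_ler_powR; rewrite ?nnegrE // ltW.
apply: (@le_trans _ _ (r `^ c)); last by rewrite lerDl powR_ge0.
rewrite -[c]opprK !(powRN _ (- c)) lef_pV2 ?posrE ?powR_gt0 //.
by apply: ge0_ler_powR; rewrite ?nnegrE ?oppr_ge0 // ltW.
Qed.

Lemma cabs_ppow1 (t s s' : C) : t != 0 -> isInt (s - s') -> cabs (ppow t (s - 1) (s' - 1)) = cabs t `^ (cre (s + s') - 2).
Proof.
move=> t0 i; rewrite cabs_ppow //; last exact: isInt_sub1.
by rewrite (_ : s - 1 + (s' - 1) = s + s' - 2%:R) ?creB ?cre_nat //; ring.
Qed.

(** For |t| < 1 / 2 the factor in 1 - t is bounded, elsewhere the factor in t is; each case is
    dominated by a radial power centred at 0 or at 1. *)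
Lemma bint_intg a b a' b' T : 0 < T -> isInt (a - a') -> isInt (b - b') -> 0 < cre (a + a') -> 0 < cre (b + b') ->
  cintg dA (onP (fun t => cabs t < T) (bint a b a' b')).
Proof.
move=> T0 ia ib ra rb; have mF := cmeasC_bint ia ib; have h12 : (0 : R) < 1 / 2 by lra.
have mP (X : R) : measurable_fun setT (fun x : plane => cabs (toC x) < X) by apply: measurable_cabs_ltr; exact: cmeas_toC.
have T1 : 0 < T + 1 by lra.
have h1 := disc_ppow_intg T0 ia ra; have h2 := disc_ppow_intg T1 ib rb.
have h3 : cintg dA (fun x => onP (inD (T + 1)) (fun t => ppow t (b - 1) (b' - 1)) (ofC (1 - toC x))).
  have m3 : cmeasC (fun t => onP (inD (T + 1)) (fun t => ppow t (b - 1) (b' - 1)) (ofC t)).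
    by rewrite /cmeasC; under eq_fun do rewrite toCK; exact: (cintg_meas h2).
  split; first exact: (cmeasC_1B m3).
  rewrite (@dA_reflect _ 1 (fun t => (cabs (onP (inD (T + 1)) (fun t => ppow t (b - 1) (b' - 1)) (ofC t)))%:E)).
  - by under eq_integral do rewrite toCK; case: h2.
  - by apply: (cmeas_absE m3).
  - by move=> x; rewrite lee_fin cabs_ge0.
pose C1 := (1 / 2 : R) `^ (cre (b + b') - 2) + (2 : R) `^ (cre (b + b') - 2).
pose C2 := (1 / 2 : R) `^ (cre (a + a') - 2) + (T + 1) `^ (cre (a + a') - 2).
have C10 : 0 <= C1 by rewrite addr_ge0 ?powR_ge0.
have C20 : 0 <= C2 by rewrite addr_ge0 ?powR_ge0.
have hg := cintgD (cintgZ C1%:C (cintg_abs h1)) (cintgZ C2%:C (cintg_abs h3)).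
apply: cintg_ae_dom hg; first exact: cmeas_onP.
apply: (aeM_imp (aeM_and (ae_toC_neq (0 : C)) (ae_toC_neq (1 : C)))) => x [t0 t1]; set t := toC x in t0 t1 *.
have eabs (x1 x2 y1 y2 : R) : cabs (x1%:C * x2%:C + y1%:C * y2%:C : C) = `|x1 * x2 + y1 * y2| by rewrite -!rcM -rcD cabsR.
rewrite eabs ger0_norm; last exact: addr_ge0 (mulr_ge0 C10 (cabs_ge0 _)) (mulr_ge0 C20 (cabs_ge0 _)).
rewrite {1}/onP -/t; case: ifP => tT; last first.
  by rewrite cabs0; exact: addr_ge0 (mulr_ge0 C10 (cabs_ge0 _)) (mulr_ge0 C20 (cabs_ge0 _)).
have t1' : 1 - t != 0 by rewrite subr_eq0 eq_sym.
have b1 : cabs (1 - t) < T + 1 by apply: le_lt_trans (cabsB _ _) _; rewrite cabs1 addrC ltrD2r.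
rewrite /bint cabsM /onP -/t ofCK /inD t0 tT t1' b1 /=.
set A := cabs (ppow t _ _); set B := cabs (ppow (1 - t) _ _).
have A0 : 0 <= A by apply: cabs_ge0. have B0 : 0 <= B by apply: cabs_ge0.
have [th|th] := ltP (cabs t) (1 / 2).
  have : B <= C1.
    rewrite /B (cabs_ppow1 t1' ib); apply: (powR_between _ h12).
      have := cabsD (1 - t) t; rewrite subrK cabs1; move: th; clear => *; lra.
    by apply: le_trans (cabsB _ _) _; rewrite cabs1; move: th; clear => *; lra.
  by move=> BC; rewrite mulrC; apply: (le_trans (ler_wpM2r A0 BC)); rewrite lerDl; exact: mulr_ge0 C20 B0.
have AC : A <= C2.
  rewrite /A (cabs_ppow1 t0 ia); apply: (powR_between _ h12 th).
  by apply: ltW; apply: (lt_trans tT); rewrite ltrDl ltr01.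
by apply: (le_trans (ler_wpM2r B0 AC)); rewrite lerDr; exact: mulr_ge0 C10 A0.
Qed.

Lemma sum_ppow (t a a' : C) (k l : nat) : t != 0 ->
  ppow t (a - 1) (a' - 1) * (t ^+ k * conjc t ^+ l) = ppow t (a + k%:R - 1) (a' + l%:R - 1).
Proof. by move=> t0; rewrite -ppow_nat // -ppowD; apply: eq_ppow; ring. Qed.

Section Fixed.
Variables (a b a' b' : C) (n nu : int).
Hypotheses (hn : a - a' = n%:~R) (hnu : b - b' = nu%:~R) (ra : 0 < cre (a + a')) (rb : 0 < cre (b + b')).
Let ia : isInt (a - a'). Proof. by exists n. Qed.
Let ib : isInt (b - b'). Proof. by exists nu. Qed.
Let c k : C := cb (1 - b) k.
Let c' k : C := cb (1 - b') k.
Let ib1 : isInt (1 - b - (1 - b')).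
Proof. by rewrite (_ : _ - _ = - (b - b')); [exact: isIntN|ring]. Qed.

Let summ_c (s : C) (rho : R) : 0 <= rho < 1 -> summ (fun k => cb s k * rho%:C ^+ k).
Proof. by move=> /andP[r0 r1]; apply: summ_binS; rewrite cabsR ger0_norm. Qed.

Let bin1 t : cabs t < 1 -> ppow (1 - t) (b - 1) (b' - 1) = CS (fun k => c k * t ^+ k) * CS (fun k => c' k * conjc t ^+ k).
Proof.
move=> t1; have := ppow_binomial t1 ib1; rewrite /binS => <-; apply: eq_ppow; ring.
Qed.

Let diagval (E : nat -> C) (I : nat * nat -> C) (m : int) : cintg (prodm (cnt R) (cnt R)) I ->
  (forall k l, I (k, l) = if k%:Z + m == l%:Z then c k * c' l * E k else 0) ->
  summ (fun k => c k * cz (1 - b') (k%:Z + m) * E k) /\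
  CI (prodm (cnt R) (cnt R)) I = CS (fun k => c k * cz (1 - b') (k%:Z + m) * E k).
Proof.
move=> cI hI; have [s e] := CI_diagonal hI cI.
have ee k : c k * cz (1 - b') (k%:Z + m) * E k = if (k%:Z + m)%R is Posz l then c k * c' l * E k else 0.
  by case: (k%:Z + m) => l //=; rewrite mulr0 mul0r.
by rewrite e; split; [apply: eq_summ s => k|apply: eq_CS => k]; rewrite ee.
Qed.

Let eqidx (al al' : C) (m : int) k l : al - al' = m%:~R -> (al + k%:R == al' + l%:R) = (k%:Z + m == l%:Z).
Proof.
move=> h; apply/eqP/eqP => e.
  apply: (@intC_inj R); rewrite intrD -h.
  by rewrite -[RHS](addKr al') -e; ring.
have e2 : k%:R + m%:~R = l%:R :> C by rewrite -[l%:R]/((l%:Z)%:~R) -e intrD.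
by rewrite -e2 -h; ring.
Qed.

Lemma bint_disc rho : 0 < rho < 1 ->
  CI dA (onP (inD rho) (bint a b a' b')) =
  CS (fun k => c k * cz (1 - b') (k%:Z + n) * (Pi * cexp ((a + k%:R + (a + k%:R)) * (ln rho)%:C) / (a + k%:R))).
Proof.
move=> /andP[r0 r1]; have r01 : 0 <= rho < 1 by rewrite ltW.
have mP : measurable_fun setT (fun x : plane => inD rho (toC x)) by apply: measurable_inD; exact: cmeas_toC.
have [|_ cI e] := CI_expand mP cmeasC_id (disc_ppow_intg r0 ia ra) _ (ltW r0) (summ_c (1 - b) r01) (summ_c (1 - b') r01).
  by move=> t /andP[_ /ltW].
rewrite (_ : onP (inD rho) (bint a b a' b') = onP (inD rho) (fun t => ppow t (a - 1) (a' - 1) * (CS (fun k => c k * t ^+ k) * CS (fun k => c' k * conjc t ^+ k)))); last first.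
  apply/funext => x; rewrite /onP; case: ifP => // /andP[_ h]; rewrite /bint bin1 //; exact: lt_trans r1.
rewrite e; apply: (proj2 (diagval cI _)) => k l /=.
rewrite -(eqidx k l hn) (_ : onP _ _ = onP (inD rho) (fun t => ppow t (a + k%:R - 1) (a' + l%:R - 1))); last first.
  by apply/funext => x; rewrite /onP; case: ifP => // /andP[t0 _]; rewrite sum_ppow.
rewrite disc_ppow //.
- case: eqP => [<-|_]; by rewrite ?mulr0.
- rewrite (_ : _ - _ = a - a' + (k%:Z - l%:Z)%:~R); last by rewrite intrB; ring.
  by apply: isIntD => //; exact: isInt_int.
- rewrite (_ : _ + _ = a + a' + (k + l)%:R); last by rewrite natrD; ring.
  by rewrite creD cre_nat ltr_wpDr.
Qed.

(** The exponent at infinity: the integrand behaves there like t^(-ga - 1) and the conjugate power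
    with ga'. *)
Let ga : C := 1 - a - b.
Let ga' : C := 1 - a' - b'.
Let hga : ga - ga' = (- n - nu)%:~R. Proof. by rewrite /ga /ga' intrB intrN -hn -hnu; ring. Qed.

(** 1 - t = -t (1 - 1 / t), and the factor -1 contributes (-1)^nu. *)
Lemma bint_far t : t != 0 -> 1 < cabs t -> bint a b a' b' t = (-1) ^ nu * ppow t (a + b - 2%:R) (a' + b' - 2%:R) * (CS (fun k => cb (1 - b) k * t^-1 ^+ k) * CS (fun k => cb (1 - b') k * conjc t^-1 ^+ k)).
Proof.
move=> t0 t1; have iv : cabs t^-1 < 1 by rewrite cabsV invf_lt1 // cabs_gt0.
have v0 : 1 - t^-1 != 0 by rewrite subr_eq0; apply: contraTneq iv => <-; rewrite cabs1 ltxx.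
have -> : (-1 : C) ^ nu = ppow (-1) (b - 1) (b' - 1).
  have n0 : (-1 : C) != 0 by rewrite oppr_eq0 oner_eq0.
  have e : b - 1 - (b' - 1) = nu%:~R by rewrite -hnu; ring.
  by rewrite (ppowE n0 e) cabsN cabs1 ln1 mulr0 cexp0 mul1r divr1.
have := bin1 iv; rewrite /c /c' => <-; rewrite /bint.
have -> : 1 - t = -1 * (t * (1 - t^-1)) by rewrite mulrBr mulfV // mulN1r; ring.
have i1 : isInt (b - 1 - (b' - 1)) by exact: isInt_sub1.
rewrite ppowM ?oppr_eq0 ?oner_eq0 ?mulf_neq0 // (ppowM t0 v0) //.
have -> : ppow t (a + b - 2%:R) (a' + b' - 2%:R) = ppow t (a - 1) (a' - 1) * ppow t (b - 1) (b' - 1).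
  by rewrite -ppowD; apply: eq_ppow; ring.
ring.
Qed.

Lemma bint_annul (sg T : R) : ~ isInt ga -> 1 < sg -> sg < T ->
  annul sg T (bint a b a' b') =
  (-1) ^ nu * CS (fun k => c k * cz (1 - b') (k%:Z + (- n - nu)) *
    (- (Pi * (cexp (- (ga + k%:R + (ga + k%:R)) * (ln T)%:C) - cexp (- (ga + k%:R + (ga + k%:R)) * (ln sg)%:C)) / (ga + k%:R)))).
Proof.
move=> nga s1 sT; have s0 : 0 < sg by apply: lt_trans s1.
have mP : measurable_fun setT (fun x : plane => inA sg T (toC x)) by apply: measurable_inA; exact: cmeas_toC.
have mV : cmeasC (fun t : C => t^-1) by apply: cmeasV; exact: cmeas_toC.
have nz t : inA sg T t -> t != 0 by move=> /andP[h _]; rewrite -cabs_gt0; apply: lt_le_trans h.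
have ig' : isInt (- ga - 1 - (- ga' - 1)).
  rewrite (_ : _ - _ = - (ga - ga')); last by ring.
  by apply: isIntN; rewrite hga; exact: isInt_int.
have ci : cintg dA (onP (inA sg T) (fun t => (-1) ^ nu * ppow t (- ga - 1) (- ga' - 1))).
  have := cintgZ ((-1) ^ nu) (annul_ppow_intg T s0 ig'); apply: cintg_ext => x; rewrite /onP.
  by case: ifP; rewrite ?mulr0.
have iv0 : 0 <= sg^-1 by rewrite invr_ge0 ltW.
have iv1 : 0 <= sg^-1 < 1 by rewrite iv0 invf_lt1.
have [|_ cI e] := CI_expand mP mV ci _ iv0 (summ_c (1 - b) iv1) (summ_c (1 - b') iv1).
  by move=> t /andP[h _]; rewrite cabsV lef_pV2 ?posrE // (lt_le_trans s0).
rewrite /annul (_ : (fun x => _) = onP (inA sg T) (fun t => (-1) ^ nu * ppow t (- ga - 1) (- ga' - 1) * (CS (fun k => c k * t^-1 ^+ k) * CS (fun k => c' k * conjc t^-1 ^+ k)))); last first.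
  apply/funext => x; rewrite /onP; case: ifP => // h.
  have h1 : 1 < cabs (toC x) by case/andP: h => h _; apply: lt_le_trans h.
  rewrite bint_far ?nz //; congr (_ * _ * _); apply: eq_ppow; rewrite /ga /ga'; ring.
rewrite e; pose E k := (-1) ^ nu * - (Pi * (cexp (- (ga + k%:R + (ga + k%:R)) * (ln T)%:C) - cexp (- (ga + k%:R + (ga + k%:R)) * (ln sg)%:C)) / (ga + k%:R)).
have [|sE ->] := @diagval E _ (- n - nu) cI; last first.
  have N1 : (-1 : C) ^ nu != 0 by rewrite expfz_neq0 // oppr_eq0 oner_eq0.
  rewrite -CSZ; first by apply: eq_CS => k; rewrite /E; ring.
  have := summZ ((-1) ^ nu)^-1 sE; apply: eq_summ => k; rewrite /E.
  by rewrite [c k * _ * (_ * _)]mulrCA mulKf.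
move=> k l /=; rewrite -(eqidx k l hga).
rewrite (_ : onP _ _ = (fun x => (-1) ^ nu * onP (inA sg T) (fun t => ppow t (- (ga + k%:R) - 1) (- (ga' + l%:R) - 1)) x)); last first.
  apply/funext => x; rewrite /onP; case: ifP => [h|_]; last by rewrite mulr0.
  have t0 := nz _ h; rewrite -mulrA; congr (_ * _).
  rewrite fmorphV !exprVn -invfM -(ppow_nat k l t0) -ppowN -ppowD; apply: eq_ppow; ring.
have il : isInt (- (ga + k%:R) - (- (ga' + l%:R))).
  rewrite (_ : _ - _ = - (ga - ga') + (l%:Z - k%:Z)%:~R); last by rewrite intrB; ring.
  by apply: isIntD; [apply: isIntN; rewrite hga|]; exact: isInt_int.
have c2 := annul_ppow_intg T s0 (isInt_sub1 il).
rewrite CIZ //; case: eqP => [<-|kl].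
  have := annul_ppow_radial (- (ga + k%:R)) s0 sT; rewrite kappa_pi /annul /E => h.
  have g0 := nonint_add nga k.
  have -> : CI dA (onP (inA sg T) (fun t => ppow t (- (ga + k%:R) - 1) (- (ga + k%:R) - 1))) =
    Pi * (cexp ((- (ga + k%:R) + - (ga + k%:R)) * (ln T)%:C) - cexp ((- (ga + k%:R) + - (ga + k%:R)) * (ln sg)%:C)) / - (ga + k%:R).
    by rewrite -h mulfK // oppr_eq0.
  by rewrite -opprD /c /c'; field.
rewrite (@radial_ppow_angular _ (inA sg T)) ?mulr0 //.
- by move=> d t d1; rewrite /inA cabsM d1 mul1r.
- by rewrite /inA cabs0 leNgt s0.
- by apply/eqP => /oppr_inj.
Qed.

Lemma onP_sub (P Q : C -> bool) (F : C -> C) : (forall t, P t -> Q t) ->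
  measurable_fun setT (fun x : plane => P (toC x)) -> cmeasC F -> cintg dA (onP Q F) -> cintg dA (onP P F).
Proof.
move=> PQ mP mF; apply: cintg_dom; first exact: cmeas_onP.
by move=> x; rewrite /onP; case h : (P _); [rewrite PQ|rewrite cabs0 cabs_ge0].
Qed.

(** On the diagonal a + k = a' + l, so Re (a + k) is half of Re (a + a') + k + l. This bounds the
    radial factors by 1 in the limit of radius 1. *)
Let rpos k l : k%:Z + n = l%:Z -> 0 <= cre (a + k%:R).
Proof.
move=> e; have : a + k%:R = a' + l%:R by apply/eqP; rewrite (eqidx k l hn) e.
move/(congr1 (@cre R)); rewrite !creD !cre_nat => e2; move: ra; rewrite creD.
have k0 : (0 : R) <= k%:R := ler0n _ _; have l0 : (0 : R) <= l%:R := ler0n _ _.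
by lra.
Qed.

Let cvg_inv2 (x : R) : (fun N => x / N.+2%:R : R) @ \oo --> (0 : R).
Proof. by have := cvg_inv_nat x; rewrite -(cvg_shiftS (fun N => x / N.+1%:R)). Qed.

Let cvg_ln1 (u : nat -> R) : u @ \oo --> (1 : R) -> ccvg (fun N => (ln (u N))%:C : C) 0.
Proof.
move=> h; rewrite -[0]/((0 : R)%:C) -(@ln1 R); apply: ccvg_real.
by apply: continuous_cvg h; apply: continuous_ln.
Qed.

Let disc_limit : CI dA (onP (inD 1) (bint a b a' b')) = Pi * Sg b b' a n.
Proof.
pose r N : R := 1 - 1 / N.+2%:R.
have r01 N : 0 < r N < 1.
  have N0 : (0 : R) < N.+2%:R by rewrite ltr0n.
  apply/andP; split; last by rewrite gtrBl divr_gt0.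
  by rewrite subr_gt0 ltr_pdivrMr // mul1r ltr1n.
have rl : r @ \oo --> (1 : R).
  by rewrite -[X in _ --> X]subr0; apply: cvgB; [exact: cvg_cst|exact: cvg_inv2].
have i1 := bint_intg ltr01 ia ib ra rb; have mF := cmeasC_bint ia ib.
have mD X : measurable_fun setT (fun x : plane => inD X (toC x)) by apply: measurable_inD; exact: cmeas_toC.
have pt x : ccvg (fun N => onP (inD (r N)) (bint a b a' b') x) (onP (inD 1) (bint a b a' b') x).
  rewrite /onP /inD; case: eqP => [_|/eqP t0] /=; first exact: ccvg_cst.
  case: (ltP (cabs (toC x)) 1) => h.
    apply: (@ccvg_near _ (fun=> bint a b a' b' (toC x))); last exact: ccvg_cst.
    by near=> N; rewrite ifT //; near: N; exact: (cvgr_gt _ rl _ h).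
  apply: (@ccvg_ext _ (fun=> 0)); last exact: ccvg_cst.
  by move=> N; rewrite ifF //; apply/negbTE; rewrite -leNgt (le_trans _ h) //; case/andP: (r01 N) => _ /ltW.
have dom N x : cabs (onP (inD (r N)) (bint a b a' b') x) <= cabs (onP (fun t => cabs t < 1) (bint a b a' b') x).
  rewrite /onP /inD; case: ifP => [/andP[_ h]|_]; last by rewrite cabs0 cabs_ge0.
  by rewrite (lt_trans h) //; case/andP: (r01 N).
have [_ L] := CI_dct (fun N => cmeas_onP (mD (r N)) mF) (cmeas_onP (mD 1) mF) pt (cmeas_abs (cintg_meas i1)) (proj2 i1) dom.
apply: (ccvg_unique L).
apply: (@ccvg_ext _ (fun N => CS (fun k => c k * cz (1 - b') (k%:Z + n) * (Pi * cexp ((a + k%:R + (a + k%:R)) * (ln (r N))%:C) / (a + k%:R))))).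
  by move=> N; rewrite bint_disc.
have sS := summ_Sg a n rb.
rewrite /Sg -CSZ //.
have [] := @CS_dct _ (fun N k => c k * cz (1 - b') (k%:Z + n) * (Pi * cexp ((a + k%:R + (a + k%:R)) * (ln (r N))%:C) / (a + k%:R)))
  (fun k => Pi * (c k * cz (1 - b') (k%:Z + n) / (a + k%:R))) (fun k => cabs (Pi * (c k * cz (1 - b') (k%:Z + n) / (a + k%:R)))) _ (summ_abs (summZ Pi sS)) _.
- move=> k; have -> : Pi * (c k * cz (1 - b') (k%:Z + n) / (a + k%:R)) = c k * cz (1 - b') (k%:Z + n) * (Pi * cexp ((a + k%:R + (a + k%:R)) * 0) / (a + k%:R)).
    by rewrite mulr0 cexp0; ring.
  apply: ccvgM; first exact: ccvg_cst.
  apply: ccvgM; last exact: ccvg_cst.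
  apply: ccvgM; first exact: ccvg_cst.
  by apply: ccvg_cexp; apply: ccvgM; [exact: ccvg_cst|exact: cvg_ln1].
- move=> N k; have -> : c k * cz (1 - b') (k%:Z + n) * (Pi * cexp ((a + k%:R + (a + k%:R)) * (ln (r N))%:C) / (a + k%:R)) =
    Pi * (c k * cz (1 - b') (k%:Z + n) / (a + k%:R)) * cexp ((a + k%:R + (a + k%:R)) * (ln (r N))%:C) by ring.
  rewrite [cabs (_ * cexp _)]cabsM.
  case e : (k%:Z + n) => [l|l]; last by rewrite /= mulr0 mul0r mulr0 cabs0 mul0r.
  rewrite ler_piMr ?cabs_ge0 // cabs_cexp_real -expR0 ler_expR mulr_ge0_le0 //.
    by have := rpos e; rewrite [cre (_ + (a + _))]creD; lra.
  by apply: ln_le0; case/andP: (r01 N) => _ /ltW.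
by [].
Unshelve. all: by end_near. Qed.

(** T^(-2 (ga + k)), the boundary contribution at |t| = T of the k-th exterior term. *)
Let tail T k : C := cexp (- (ga + k%:R + (ga + k%:R)) * (ln T)%:C).

Let tail_bound (X T : R) k : 1 <= X -> X <= T -> cabs (tail X k) <= expR (2 * `|cre ga| * ln T).
Proof.
move=> X1 XT; have eR : cre (- (ga + k%:R + (ga + k%:R))) = - 2 * (cre ga + k%:R).
  by rewrite creN (creD (ga + k%:R)) (creD ga) cre_nat; ring.
rewrite cabs_cexp_real ler_expR eR.
have l0 : 0 <= ln X by apply: ln_ge0.
have lT : ln X <= ln T by rewrite ler_ln ?posrE //; lra.
have k0 : (0 : R) <= k%:R := ler0n _ _.
have h1 := ler_norm (- cre ga); rewrite normrN in h1.
apply: (@le_trans _ _ (2 * `|cre ga| * ln X)); last by rewrite ler_wpM2l // mulr_ge0.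
by rewrite ler_wpM2r //; lra.
Qed.

Lemma summ_tail T : 1 <= T -> summ (fun k => c k * cz (1 - b') (k%:Z + (- n - nu)) / (ga + k%:R) * tail T k).
Proof.
move=> T1; apply: (@summ_dom _ _ (fun k => (expR (2 * `|cre ga| * ln T))%:C * (c k * cz (1 - b') (k%:Z + (- n - nu)) / (ga + k%:R)))).
  move=> k; rewrite [X in cabs X <= _]mulrC [leLHS]cabsM [leRHS]cabsM ler_wpM2r ?cabs_ge0 // cabsR ger0_norm ?expR_ge0 //.
  exact: tail_bound.
by apply: summZ; exact: summ_Sg.
Qed.

Let annul_limit T : ~ isInt ga -> 1 < T ->
  CI dA (onP (fun t => (1 < cabs t) && (cabs t < T)) (bint a b a' b')) =
  (-1) ^ nu * Pi * (Sg b b' ga (- n - nu) - CS (fun k => c k * cz (1 - b') (k%:Z + (- n - nu)) / (ga + k%:R) * tail T k)).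
Proof.
move=> nga T1; have T0 : 0 < T by lra.
pose r N : R := 1 + (T - 1) / N.+2%:R.
have r01 N : 1 < r N < T.
  have N0 : (0 : R) < N.+2%:R by rewrite ltr0n.
  have N1 : (1 : R) < N.+2%:R by rewrite ltr1n.
  have Tp : 0 < T - 1 by lra.
  rewrite /r ltrDl divr_gt0 //= -ltrBrDl ltr_pdivrMr // ltr_pMr //.
have rl : r @ \oo --> (1 : R).
  by rewrite -[X in _ --> X]addr0; apply: cvgD; [exact: cvg_cst|exact: cvg_inv2].
have i1 := bint_intg T0 ia ib ra rb; have mF := cmeasC_bint ia ib.
have mI X : measurable_fun setT (fun x : plane => inA X T (toC x)) by apply: measurable_inA; exact: cmeas_toC.
have mJ : measurable_fun setT (fun x : plane => (1 < cabs (toC x)) && (cabs (toC x) < T)).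
  by apply: measurable_and; [apply: measurable_cabs_gtr|apply: measurable_cabs_ltr]; exact: cmeas_toC.
have pt x : ccvg (fun N => onP (inA (r N) T) (bint a b a' b') x) (onP (fun t => (1 < cabs t) && (cabs t < T)) (bint a b a' b') x).
  rewrite /onP /inA; case: (ltP (cabs (toC x)) T) => hT; last first.
    by apply: (@ccvg_ext _ (fun=> 0)); [move=> N; rewrite andbF|rewrite andbF; exact: ccvg_cst].
  rewrite andbT; case: (ltP 1 (cabs (toC x))) => h.
    apply: (@ccvg_near _ (fun=> bint a b a' b' (toC x))); last exact: ccvg_cst.
    by near=> N; rewrite andbT ifT //; apply: ltW; near: N; exact: (cvgr_lt _ rl _ h).
  apply: (@ccvg_ext _ (fun=> 0)); last exact: ccvg_cst.
  by move=> N; rewrite andbT ifF //; apply/negbTE; rewrite -ltNge (le_lt_trans h) //; case/andP: (r01 N).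
have dom N x : cabs (onP (inA (r N) T) (bint a b a' b') x) <= cabs (onP (fun t => cabs t < T) (bint a b a' b') x).
  by rewrite /onP /inA; case: ifP => [/andP[_ ->] //|_]; rewrite cabs0 cabs_ge0.
have [_ L] := CI_dct (fun N => cmeas_onP (mI (r N)) mF) (cmeas_onP mJ mF) pt (cmeas_abs (cintg_meas i1)) (proj2 i1) dom.
apply: (ccvg_unique L).
have sT := summ_tail (ltW T1); have sS := summ_Sg ga (- n - nu) rb.
pose q k := c k * cz (1 - b') (k%:Z + (- n - nu)) / (ga + k%:R).
apply: (@ccvg_ext _ (fun N => (-1) ^ nu * Pi * (CS (fun k => q k * tail (r N) k) - CS (fun k => q k * tail T k)))).
  move=> N; have /andP[h1 h2] := r01 N.
  have sr : summ (fun k => q k * tail (r N) k) := summ_tail (ltW h1).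
  have sT' : summ (fun k => q k * tail T k) := sT.
  rewrite -/(annul (r N) T _) bint_annul // -mulrA; congr (_ * _).
  rewrite -(CSB sr sT') -(CSZ _ (summB sr sT')).
  by apply: eq_CS => k; rewrite /q /tail; ring.
apply: ccvgM; first exact: ccvg_cst.
apply: ccvgB; last exact: ccvg_cst.
have [] := @CS_dct _ (fun N k => q k * tail (r N) k) q (fun k => cabs ((expR (2 * `|cre ga| * ln T))%:C * q k)) _ (summ_abs (summZ _ sS)) _.
- move=> k; rewrite -[X in ccvg _ X]mulr1; apply: ccvgM; first exact: ccvg_cst.
  rewrite -(cexp0 R) -(mulr0 (- (ga + k%:R + (ga + k%:R)))); apply: ccvg_cexp; apply: ccvgM; first exact: ccvg_cst.
  exact: cvg_ln1.
- move=> N k; rewrite [X in cabs X <= _]mulrC [leLHS]cabsM [leRHS]cabsM ler_wpM2r ?cabs_ge0 // cabsR ger0_norm ?expR_ge0 //.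
  by have /andP[h1 h2] := r01 N; apply: tail_bound; exact: ltW.
by [].
Unshelve. all: by end_near. Qed.

(** The subtracted series stands for the exterior |t| >= T; it keeps a meaning when the integral
    over the plane diverges. *)
Lemma beta_partial T : ~ isInt a -> ~ isInt b -> ~ isInt (a + b) -> 1 < T ->
  CI dA (onP (fun t => cabs t < T) (bint a b a' b')) =
  frakB a b a' b' - (-1) ^ nu * Pi * CS (fun k => cb (1 - b) k * cz (1 - b') (k%:Z + (- n - nu)) / (1 - a - b + k%:R) *
    cexp (- (1 - a - b + k%:R + (1 - a - b + k%:R)) * (ln T)%:C)).
Proof.
move=> na nb nab T1; have T0 : 0 < T by lra.
have nga : ~ isInt ga by rewrite /ga (_ : 1 - a - b = 1 - (a + b)); [exact: nonint_1B|ring].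
have i1 := bint_intg T0 ia ib ra rb; have mF := cmeasC_bint ia ib.
have mD : measurable_fun setT (fun x : plane => inD 1 (toC x)) by apply: measurable_inD; exact: cmeas_toC.
have mJ : measurable_fun setT (fun x : plane => (1 < cabs (toC x)) && (cabs (toC x) < T)).
  by apply: measurable_and; [apply: measurable_cabs_gtr|apply: measurable_cabs_ltr]; exact: cmeas_toC.
have s1 : cintg dA (onP (inD 1) (bint a b a' b')).
  by apply: onP_sub i1 => // t /andP[_ h]; apply: lt_trans T1.
have s2 : cintg dA (onP (fun t => (1 < cabs t) && (cabs t < T)) (bint a b a' b')).
  by apply: onP_sub i1 => // t /andP[].
have := complex_beta hn hnu na nb nab rb; rewrite mulrDr mulrA (mulrC Pi ((-1) ^ nu)) => <-.
rewrite -disc_limit; have e2 := annul_limit nga T1.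
have -> : CI dA (onP (fun t => cabs t < T) (bint a b a' b')) = CI dA (onP (inD 1) (bint a b a' b')) + CI dA (onP (fun t => (1 < cabs t) && (cabs t < T)) (bint a b a' b')).
  rewrite -CID //; apply: ae_eq_CI; [exact: (cintg_meas i1)|exact: cintg_meas (cintgD s1 s2)|].
  change (aeM dA (fun x => onP (fun t => cabs t < T) (bint a b a' b') x = onP (inD 1) (bint a b a' b') x + onP (fun t => (1 < cabs t) && (cabs t < T)) (bint a b a' b') x)).
  (* Cutting the disc at radius 1 loses two null sets, the origin and the unit circle. *)
  apply: (aeM_imp (aeM_and (ae_toC_neq (0 : C)) (@ae_circle R))) => x [t0 t1].
  rewrite /onP /inD t0 /=; case: (ltgtP (cabs (toC x)) 1) => h /=; last by rewrite h eqxx in t1.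
    by rewrite (lt_trans h T1) addr0.
  by rewrite add0r.
by rewrite e2 mulrBr addrA.
Qed.
End Fixed.
End BetaIntegral.

Lemma int_halfP (n : int) : exists q : int, n = q + q \/ n = q + q + 1.
Proof. by exists (n %/ 2)%Z; lia. Qed.

(** * Uniqueness of expansions with nonresonant exponents *)

Section ExponentUniqueness.
Variable R : realType.
Local Notation C := R[i].

(** With r = e^x, this is o(r^sg) as r tends to 0. *)
Let small (sg : R) (f : R -> C) := forall e : R, 0 < e -> exists M : R, forall x, x < M -> cabs (f x) <= e * expR (sg * x).

Lemma cexp_neq1 (dl : C) : dl != 0 -> exists2 h : R, 0 < h & cexp (- (dl * h%:C)) != 1.
Proof.
move=> d0; have dp : 0 < cabs dl by rewrite cabs_gt0.
(* This makes the exponent of modulus 1 / 8, where [cexp_bound] excludes the value 1. *)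
exists (1 / (8 * cabs dl)); first by rewrite divr_gt0 // mulr_gt0.
set u := - (dl * _); have cu : cabs u = 1 / 8.
  by rewrite /u cabsN cabsM cabsR ger0_norm ?divr_ge0 ?mulr_ge0 ?cabs_ge0 //; field; rewrite gt_eqF.
have := @cexp_bound R u; rewrite cu => H; have {}H := H (ltac:(lra)).
apply/eqP => e; move: H; rewrite e subrr sub0r cabsN cu; lra.
Qed.

(** Induction on the number of exponentials: f(x - h) - E(w_k) f(x) loses the exponential of w_k,
    keeps the decay, and multiplies [d1] by a factor that is nonzero for a suitable h. *)
Let cexp_elim (s : seq nat) (w d : nat -> C) (w1 d1 : C) (sg : R) : cre w1 <= sg -> (forall j, j \in s -> w j != w1) ->
  small sg (fun x => d1 * cexp (w1 * x%:C) + \sum_(j <- s) d j * cexp (w j * x%:C)) -> d1 = 0.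
Proof.
move=> w1s; elim: s d d1 => [|k s IH] d d1 hs hf.
  apply/eqP; rewrite -cabs_eq0 eq_le cabs_ge0 andbT; apply/ler_addgt0Pr => e e0; rewrite add0r.
  have [M hM] := hf e e0; pose x := Num.min (M - 1) (-1).
  have xM : x < M by rewrite gt_min ltrBlDr ltrDl ltr01.
  have x1 : x <= -1 by rewrite ge_min lexx orbT.
  have := hM x xM; rewrite big_nil addr0 cabsM cabs_cexp_real => h.
  have h2 : expR (sg * x) <= expR (cre w1 * x) by rewrite ler_expR; nra.
  have p := expR_gt0 (cre w1 * x).
  by rewrite -(ler_pM2r p); apply: le_trans h _; rewrite ler_wpM2l // ltW.
have w12 : w1 - w k != 0.
  by rewrite subr_eq0 eq_sym; apply: hs; rewrite mem_head.
have [h h0 hne] := cexp_neq1 w12.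
pose E v : C := cexp (- (v * h%:C)).
have EN : E w1 - E (w k) != 0.
  rewrite subr_eq0; apply: contra hne => /eqP e.
  have -> : - ((w1 - w k) * h%:C) = - (w1 * h%:C) - - (w k * h%:C) by ring.
  by rewrite cexpB -/(E w1) e divff // cexp_neq0.
apply: (mulIf EN); rewrite mul0r.
apply: (IH (fun j => d j * (E (w j) - E (w k)))); first by move=> q hq; apply: hs; rewrite in_cons hq orbT.
have shift v x : cexp (v * (x - h)%:C) = E v * cexp (v * x%:C).
  by rewrite /E -cexpD; congr cexp; rewrite rcB; ring.
pose F x := d1 * cexp (w1 * x%:C) + \sum_(j <- k :: s) d j * cexp (w j * x%:C).
have eF x : d1 * (E w1 - E (w k)) * cexp (w1 * x%:C) + \sum_(j <- s) d j * (E (w j) - E (w k)) * cexp (w j * x%:C) = F (x - h) - E (w k) * F x.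
  rewrite /F !big_cons !shift ![E (w k) * (_ + _)]mulrDr mulr_sumr.
  have -> : \sum_(j <- s) d j * cexp (w j * (x - h)%:C) = \sum_(j <- s) d j * (E (w j) - E (w k)) * cexp (w j * x%:C) + \sum_(j <- s) E (w k) * (d j * cexp (w j * x%:C)).
    by rewrite -big_split /=; apply: eq_bigr => j _; rewrite shift; ring.
  ring.
move=> e e0; pose K := expR (- sg * h) + cabs (E (w k)).
have K0 : 0 < K by rewrite ltr_pwDl ?expR_gt0 ?cabs_ge0.
have [M hM] := hf (e / K) (divr_gt0 e0 K0); exists M => x xM.
rewrite eF; apply: le_trans (cabsB _ _) _; rewrite cabsM.
have h1 : x - h < M by lra.
apply: le_trans (lerD (hM _ h1) (ler_wpM2l (cabs_ge0 _) (hM _ xM))) _.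
rewrite le_eqVlt; apply/orP; left; apply/eqP.
have -> : expR (sg * (x - h)) = expR (sg * x) * expR (- sg * h) by rewrite -expRD; congr expR; ring.
transitivity (e / K * (K * expR (sg * x))); last by rewrite mulrA divfK // gt_eqF.
by set q := e / K; rewrite /K; ring.
Qed.

Let min_on (v : nat -> R) (L : seq nat) j : j \in L -> exists2 j0, j0 \in L & forall k, k \in L -> v j0 <= v k.
Proof.
elim: L j => // i L IH j _; case: L IH => [|i' L] IH.
  by exists i; rewrite ?mem_head // => k; rewrite inE => /eqP ->.
have [j0 hj0 h] := IH i' (mem_head _ _).
have [ij|ij] := leP (v i) (v j0).
  exists i; rewrite ?mem_head // => k; rewrite in_cons => /orP[/eqP -> //|hk]; exact: le_trans ij (h k hk).
exists j0; first by rewrite in_cons hj0 orbT.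
by move=> k; rewrite in_cons => /orP[/eqP ->|hk]; [exact: ltW|exact: h].
Qed.

(** Otherwise take the first nonzero term of each nonzero series, and let v be the least real part
    among these. The sum of the leading terms is O(r^(v + 1)), so [cexp_elim] kills a coefficient
    chosen to be nonzero. *)
Let series_unique_pos (L : seq nat) (s : nat -> C) (d : nat -> nat -> C) : uniq L ->
  (forall j, j \in L -> summ (d j)) ->
  (forall j k n m, j \in L -> k \in L -> j != k -> d j n != 0 -> d k m != 0 -> s j + n%:R != s k + m%:R) ->
  (forall r : R, 0 < r <= 1 -> \sum_(j <- L) cexp (s j * (ln r)%:C) * CS (fun n => d j n * r%:C ^+ n) = 0) ->
  forall j n, j \in L -> d j n = 0.
Proof.
move=> uL sd dis hz.
pose nz j := `[< exists n, d j n != 0 >].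
suff no j : j \in L -> ~~ nz j.
  by move=> j n /no /asboolPn h; apply/eqP/negPn/negP => h1; apply: h; exists n.
move=> jL; apply/negP => nzj.
have ex1 k : exists n, nz k -> d k n != 0 /\ forall m, (m < n)%N -> d k m = 0.
  case: (boolP (nz k)) => [/asboolP hk|]; last by exists 0%N.
  pose P n := d k n != 0; have [n Pn mn] := ex_minnP (P := P) hk; exists n => _; split=> // m mlt.
  by apply/eqP/negPn/negP => hm; have := mn m hm; rewrite leqNgt mlt.
have [N hN] : exists N : nat -> nat, forall k, nz k -> d k (N k) != 0 /\ forall m, (m < N k)%N -> d k m = 0.
  by have [N hN] := boolp.choice ex1; exists N.
pose L1 := [seq k <- L | nz k].
have jL1 : j \in L1 by rewrite mem_filter nzj.
pose v k : R := cre (s k) + (N k)%:R.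
have [j0 hj0 hmin] := min_on v jL1.
have /andP[nz0 j0L] : nz j0 && (j0 \in L) by rewrite -mem_filter.
have := (hN _ nz0).1; apply/negP; rewrite negbK; apply/eqP.
pose w k : C := s k + (N k)%:R.
have uL1 : uniq L1 by apply: filter_uniq.
apply: (@cexp_elim (rem j0 L1) w (fun k => d k (N k)) (w j0) _ (v j0)).
- by rewrite /w creD cre_nat.
- move=> k; rewrite mem_rem_uniq // inE => /andP[kj]; rewrite mem_filter => /andP[nzk kL].
  by apply: dis => //; [exact: (hN _ nzk).1|exact: (hN _ nz0).1].
have sumE (f : nat -> C) : f j0 + \sum_(k <- rem j0 L1) f k = \sum_(k <- L1) f k by rewrite [RHS](big_rem j0 hj0).
pose tl k (r : R) := CS (fun n => d k (n + (N k).+1)%N * r%:C ^+ n).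
have sk k : k \in L1 -> summ (d k) by rewrite mem_filter => /andP[_ /sd].
have sr k (r : R) : k \in L1 -> 0 < r <= 1 -> summ (fun n => d k n * r%:C ^+ n).
  move=> kL /andP[r0 r1]; apply: summ_dom (sk k kL) => n; rewrite cabsM cabsX cabsR gtr0_norm //.
  by rewrite ler_piMr ?cabs_ge0 // exprn_ile1 // ltW.
have dec k r : k \in L1 -> 0 < r <= 1 -> CS (fun n => d k n * r%:C ^+ n) = d k (N k) * r%:C ^+ N k + r%:C ^+ (N k).+1 * tl k r.
  move=> kL hr; rewrite (CS_split (N k).+1 (sr k r kL hr)) big_ord_recr /= big1 ?add0r.
    congr (_ + _); rewrite -CSZ; first by apply: eq_CS => n; rewrite exprD; ring.
    have hsh := summ_shift (N k).+1 (sk k kL); case/andP: hr => r0 r1; apply: summ_dom hsh => n.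
    by rewrite cabsM cabsX cabsR gtr0_norm // ler_piMr ?cabs_ge0 // exprn_ile1 // ltW.
  move=> i _; move: kL; rewrite mem_filter => /andP[nzk _].
  by rewrite (hN _ nzk).2 ?mul0r.
have [M M0 hM] : exists2 M, 0 < M & forall r, 0 < r <= 1 -> \sum_(k <- L1) cabs (tl k r) <= M.
  have : forall S : seq nat, {subset S <= L1} -> exists2 M, 0 < M & forall r, 0 < r <= 1 -> \sum_(k <- S) cabs (tl k r) <= M.
    elim=> [|k S IH] hS; first by exists 1 => // r _; rewrite big_nil.
    have [M1 M10 h1] := IH (fun i hi => hS i (ltac:(by rewrite in_cons hi orbT))).
    have [M2 M20 h2] := summ_partial (summ_shift (N k).+1 (sk k (hS k (mem_head _ _)))).
    exists (M2 + M1); first by rewrite ltr_wpDl.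
    move=> r hr; rewrite big_cons; apply: lerD; last exact: h1.
    apply: CS_abs => n; apply: le_trans (h2 n); apply: ler_sum => i _.
    case/andP: hr => r0 r1; rewrite cabsM cabsX cabsR gtr0_norm // ler_piMr ?cabs_ge0 // exprn_ile1 // ltW //.
  by apply.
move=> e e0; exists (Num.min 0 (ln (e / M))) => x; rewrite lt_min => /andP[x0 xe].
pose r := expR x; have hr : 0 < r <= 1 by rewrite expR_gt0 -[X in _ <= X]expR0 ler_expR ltW.
have lr : ln r = x by rewrite expRK.
have rX n : (r%:C : C) ^+ n = cexp (n%:R * x%:C) by rewrite -rcn -rcM cexpR -rcX expRM_natl.
rewrite (sumE (fun k => d k (N k) * cexp (w k * x%:C))).
have := hz r hr; rewrite lr (bigID nz) /= [X in _ + X]big1 ?addr0; last first.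
  move=> k /asboolPn hk; rewrite (@CS_finsupp _ _ 0) ?big_ord0 ?mulr0 // => n _.
  have -> : d k n = 0 by apply/eqP/negPn/negP => h1; apply: hk; exists n.
  by rewrite mul0r.
rewrite -big_filter -/L1 => e1.
have e2 : \sum_(k <- L1) d k (N k) * cexp (w k * x%:C) = - \sum_(k <- L1) cexp ((w k + 1) * x%:C) * tl k r.
  apply/eqP; rewrite -addr_eq0 -big_split /= -[X in _ == X]e1; apply/eqP.
  apply: eq_big_seq => k kL; rewrite dec // !rX mulrDr; congr (_ + _).
    by rewrite [RHS]mulrCA -cexpD /w; congr (_ * cexp _); ring.
  by rewrite mulrA -cexpD /w; congr (cexp _ * _); rewrite -[in RHS]natr1; ring.
rewrite e2 cabsN; apply: (@le_trans _ _ (\sum_(k <- L1) expR ((v j0 + 1) * x) * cabs (tl k r))).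
  have ineq k : k \in L1 -> cabs (cexp ((w k + 1) * x%:C) * tl k r) <= expR ((v j0 + 1) * x) * cabs (tl k r).
    move=> kL; rewrite cabsM ler_wpM2r ?cabs_ge0 // cabs_cexp_real ler_expR /w !creD cre_nat cre1.
    have := hmin k kL; rewrite /v; nra.
  elim: (L1) ineq => [|k S IH] ineq; first by rewrite !big_nil cabs0.
  rewrite !big_cons; apply: le_trans (cabsD _ _) _; apply: lerD; first by apply: ineq; rewrite mem_head.
  by apply: IH => i hi; apply: ineq; rewrite in_cons hi orbT.
rewrite -mulr_sumr mulrDl mul1r expRD; have h3 := hM r hr.
apply: (@le_trans _ _ (expR (v j0 * x) * expR x * M)); first by rewrite ler_wpM2l // mulr_ge0 ?expR_ge0.
rewrite -mulrA mulrC ler_wpM2r ?expR_ge0 // -ler_pdivlMr //.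
have eM : 0 < e / M by rewrite divr_gt0.
by rewrite -[leRHS]lnK ?posrE // ler_expR ltW.
Qed.

(* Both signs of r are used: they separate the parities of the exponents. *)
Lemma series_unique (L : seq nat) (e e' : nat -> C) (h : nat -> nat -> C) : uniq L ->
  (forall j, j \in L -> isInt (e j - e' j)) ->
  (forall j k, j \in L -> k \in L -> j != k -> ~ isInt (e j - e k)) ->
  (forall j, j \in L -> summ (h j)) ->
  (forall r : R, `|r| <= 1 -> r != 0 -> \sum_(j <- L) ppow r%:C (e j) (e' j) * CS (fun n => h j n * r%:C ^+ n) = 0) ->
  forall j n, j \in L -> h j n = 0.
Proof.
move=> uL hi hne sh hz.
have [nu hnu] : exists nu : nat -> int, forall j, j \in L -> e j - e' j = (nu j)%:~R.
  have ex j : exists n : int, j \in L -> e j - e' j = n%:~R.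
    by case: (boolP (j \in L)) => [/hi[n hn]|_]; [exists n|exists 0].
  by have [nu hnu] := boolp.choice ex; exists nu.
(* Adding or subtracting the identity at -r projects onto the terms with [nu j + n] of one parity; c
   selects which. *)
pose sgn (c : bool) j n : C := (-1) ^+ c * ((-1) ^ (nu j) * (-1) ^+ n).
have N1 : (-1 : C) != 0 by rewrite oppr_eq0 oner_eq0.
have sgnE (c : bool) j n : sgn c j n = (-1) ^ (c%:Z + nu j + n%:Z) by rewrite /sgn !expfzDr // mulrA.
have m1z (k : int) : (-1 : C) ^ k = 1 \/ (-1 : C) ^ k = -1.
  have even (q : int) : (-1 : C) ^ (q + q) = 1 by rewrite expfzDr // -expfzMl mulrNN mulr1 exp1rz.
  have [q [->|->]] : exists q : int, k = q + q \/ k = q + q + 1 by exists (k %/ 2)%Z; lia.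
    by left; apply: even.
  by right; rewrite expfzDr // even expr1z mul1r.
have m1odd (q : int) : (-1 : C) ^ (q + q + 1) = -1.
  by rewrite expfzDr // expfzDr // -expfzMl mulrNN mulr1 exp1rz expr1z mul1r.
pose d (c : bool) j n := h j n * (1 + sgn c j n).
have dz c j n : j \in L -> d c j n = 0.
  move=> jL; apply: (@series_unique_pos L (fun j => e j + e' j) (d c)) => //.
  - move=> k kL; apply: (@summ_dom _ _ (fun n => 2%:R * h k n)); last by apply: summZ; exact: sh.
    move=> m; rewrite /d mulrC !cabsM ler_wpM2r ?cabs_ge0 // cabsn.
    apply: le_trans (cabsD _ _) _; rewrite cabs1 sgnE cabs_exprz cabsN cabs1 exp1rz; lra.
  - move=> k1 k2 n1 n2 k1L k2L k12 h1 h2; apply/eqP => es.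
    have sg1 k m : d c k m != 0 -> sgn c k m = 1.
      rewrite /d mulf_eq0 negb_or => /andP[_]; rewrite sgnE; have [->//|->] := m1z (c%:Z + nu k + m%:Z).
      by rewrite subrr eqxx.
    (* Both terms survived the projection, so their indices have the same parity; equality of the
       summed exponents then makes [e k1 - e k2] an integer. *)
    have e1 : (-1 : C) ^ (nu k1 + n1%:Z - (nu k2 + n2%:Z)) = 1.
      have := sg1 _ _ h1; have := sg1 _ _ h2; rewrite !sgnE => q2 q1.
      have -> : nu k1 + n1%:Z - (nu k2 + n2%:Z) = (c%:Z + nu k1 + n1%:Z) - (c%:Z + nu k2 + n2%:Z) by ring.
      by rewrite expfzDr // q1 mul1r -invr_expz q2 invr1.
    have [q [eq|eq]] : exists q : int, nu k1 + n1%:Z - (nu k2 + n2%:Z) = q + q \/ nu k1 + n1%:Z - (nu k2 + n2%:Z) = q + q + 1.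
      exact: int_halfP.
      apply: (hne _ _ k1L k2L k12); exists (q - n1%:Z + n2%:Z).
      apply: (@mulfI _ 2%:R); first by rewrite pnatr_eq0.
      have b1 : e' k1 = e k1 - (nu k1)%:~R by rewrite -hnu //; ring.
      have b2 : e' k2 = e k2 - (nu k2)%:~R by rewrite -hnu //; ring.
      have eqC : (nu k1)%:~R + n1%:R - ((nu k2)%:~R + n2%:R) = q%:~R + q%:~R :> C.
        by have := congr1 (fun z : int => z%:~R : C) eq; rewrite !(intrD, intrN).
      rewrite b1 b2 in es; rewrite intrD intrB.
      have -> : (n1%:Z)%:~R = n1%:R :> C by []. have -> : (n2%:Z)%:~R = n2%:R :> C by [].
      have -> : 2%:R * (e k1 - e k2) = (e k1 + (e k1 - (nu k1)%:~R) + n1%:R) - (e k2 + (e k2 - (nu k2)%:~R) + n2%:R) + ((nu k1)%:~R + n1%:R - ((nu k2)%:~R + n2%:R)) - 2%:R * n1%:R + 2%:R * n2%:R by ring.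
      by rewrite es subrr eqC; ring.
    move: e1; rewrite eq m1odd => /eqP; rewrite eq_sym -subr_eq0 opprK => /eqP e1.
    by have := @natC_neq0 R 1; rewrite -natr1 e1 eqxx.
  - move=> r /andP[r0 r1]; have rn : `|r| <= 1 by rewrite gtr0_norm.
    have rn' : `|- r| <= 1 by rewrite normrN.
    have e1 := hz r rn (lt0r_neq0 r0).
    have e2 := hz (- r) rn' (ltac:(by rewrite oppr_eq0 gt_eqF)).
    have rc0 : (r%:C : C) != 0 by rewrite -cabs_gt0 cabsR normr_gt0 gt_eqF.
    have ca : cabs (r%:C : C) = r by rewrite cabsR gtr0_norm.
    have e3 : 0 = (\sum_(j <- L) ppow r%:C (e j) (e' j) * CS (fun n => h j n * r%:C ^+ n)) +
      (-1 : C) ^+ (c : nat) * (\sum_(j <- L) ppow (- r)%:C (e j) (e' j) * CS (fun n => h j n * (- r)%:C ^+ n)).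
      by rewrite [X in _ = X + _]e1 [X in _ = _ + _ * X]e2 mulr0 addr0.
    rewrite [RHS]e3.
    rewrite mulr_sumr -big_split /=; apply: eq_big_seq => k kL.
    have p1 : ppow r%:C (e k) (e' k) = cexp ((e k + e' k) * (ln r)%:C).
      by rewrite (ppowE rc0 (hnu k kL)) ca divff // exp1rz mulr1.
    have p2 : ppow (- r)%:C (e k) (e' k) = (-1) ^ (nu k) * cexp ((e k + e' k) * (ln r)%:C).
      have rm0 : ((- r)%:C : C) != 0 by rewrite rcN oppr_eq0.
      by rewrite (ppowE rm0 (hnu k kL)) rcN cabsN ca mulNr divff // mulrC.
    rewrite p1 p2.
    have s1 : summ (fun n => h k n * r%:C ^+ n).
      by apply: summ_dom (sh k kL) => m; rewrite cabsM cabsX ca ler_piMr ?cabs_ge0 // exprn_ile1 // ltW.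
    have s2 : summ (fun n => h k n * (- r)%:C ^+ n).
      by apply: summ_dom (sh k kL) => m; rewrite cabsM cabsX rcN cabsN ca ler_piMr ?cabs_ge0 // exprn_ile1 // ltW.
    have [sg hsg] : exists sg : C, sg = (-1) ^+ (c : nat) * (-1) ^ (nu k) by eexists.
    have eD : CS (fun m => d c k m * r%:C ^+ m) = CS (fun m => h k m * r%:C ^+ m) + sg * CS (fun m => h k m * (- r)%:C ^+ m).
      rewrite -(CSZ sg s2) -(CSD s1 (summZ sg s2)); apply: eq_CS => m.
      rewrite /d /sgn rcN [in RHS]exprNn hsg.
      have dist (x y q u v : C) : u * (1 + x * (y * q)) * v = u * v + x * y * (u * (q * v)) by ring.
      exact: dist.
    have dist (s t u v w x y : C) : s = v * w -> t = x + s * y -> u * t = u * x + v * (w * u * y) by move=> -> ->; ring.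
    exact: dist hsg eD.
move=> j n jL; have := dz false j n jL; have := dz true j n jL; rewrite /d /sgn expr1 expr0.
set x := _ * _ ^+ n => q1 q2.
have : 2%:R * h j n = 0 by rewrite -(addr0 0) -{1}q1 -q2; ring.
by move/eqP; rewrite mulf_eq0 pnatr_eq0 /= => /eqP.
Qed.
End ExponentUniqueness.

(** * Iterated integrals and lower bounds for them *)

Section IteratedIntegrals.
Variable R : realType.
Local Notation C := R[i].
Local Notation dA := (mA R).
Local Notation plane := (measurableTypeR R * measurableTypeR R)%type.
Variables a B a' B' : nat -> C.

Definition hb i : C -> C := bint (a i) (B i - a i) (a' i) (B' i - a' i).

(** The product of the variables already fixed travels in the argument z; the head of the list is
    the outermost variable. *)
Fixpoint Gi (l : seq nat) (z : C) : C :=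
  if l is x :: l' then CI dA (fun t => hb x (toC t) * Gi l' (z * toC t)) else ppow (1 - z) (- a 0%N) (- a' 0%N).

(** The absolute version, extended-valued so as to make sense before any convergence is known. *)
Fixpoint Ji (l : seq nat) (z : C) : \bar R :=
  if l is x :: l' then (\int[dA]_t ((cabs (hb x (toC t)))%:E * Ji l' (z * toC t)%R))%E
  else (cabs (ppow (1 - z) (- a 0%N) (- a' 0%N)))%:E.

Definition ints (K : seq nat) := forall i, i \in K -> isInt (a i - a' i) /\ isInt (B i - B' i).

Lemma ints_behead x l : ints [:: 0%N, x & l] -> ints (0%N :: l).
Proof. by move=> h i; rewrite in_cons => /orP[/eqP ->|il]; apply: h; rewrite !in_cons ?eqxx // il !orbT. Qed.

Lemma isInt_hb x : isInt (a x - a' x) -> isInt (B x - B' x) -> isInt (B x - a x - (B' x - a' x)).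
Proof. by move=> h1 h2; rewrite (_ : _ - _ = (B x - B' x) - (a x - a' x)); [exact: isIntB|ring]. Qed.

Lemma ints_hb x l : ints [:: 0%N, x & l] -> isInt (a x - a' x) /\ isInt (B x - a x - (B' x - a' x)).
Proof.
move=> h; have [h1 h2] := h x (ltac:(by rewrite !in_cons eqxx orbT)).
by split => //; exact: isInt_hb.
Qed.

Lemma cmeasC_hb x : isInt (a x - a' x) -> isInt (B x - a x - (B' x - a' x)) -> cmeasC (hb x).
Proof. exact: cmeasC_bint. Qed.

Lemma cmeas_scaleC d (T : measurableType d) (f g : T -> C) (F : C -> C) : cmeasC F -> cmeas f -> cmeas g ->
  cmeas (fun x => F (f x * g x)).
Proof. by move=> mF mf mg; apply: (cmeasC_comp mF); exact: cmeasM. Qed.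

Lemma cmeasC_Gi l : ints (0%N :: l) -> cmeasC (Gi l).
Proof.
elim: l => [|x l IH] h.
  apply: (@cmeasC_1B _ (fun t => ppow t (- a 0%N) (- a' 0%N))); apply: cmeasC_ppow.
  have [h1 _] := h 0%N (mem_head _ _); rewrite (_ : _ - _ = - (a 0%N - a' 0%N)); [exact: isIntN|ring].
have [i1 i2] := ints_hb h; rewrite /cmeasC /=.
apply: (@cmeas_CI _ _ _ _ _ dA (fun z : plane * plane => hb x (toC z.2) * Gi l (toC z.1 * toC z.2))).
apply: cmeasM; first by apply: (cmeas_comp (cmeasC_hb i1 i2)); exact: measurable_snd.
apply: cmeas_scaleC (IH (ints_behead h)) _ _; apply: (cmeas_comp (@cmeas_toC R)); [exact: measurable_fst|exact: measurable_snd].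
Qed.

Lemma Ji_ge0 l z : (0 <= Ji l z)%E.
Proof.
elim: l z => [|x l IH] z /=; first by rewrite lee_fin cabs_ge0.
by apply: integral_ge0 => t _; rewrite mule_ge0 // lee_fin cabs_ge0.
Qed.

Lemma meC_Ji l : ints (0%N :: l) -> meC (Ji l).
Proof.
elim: l => [|x l IH] h.
  by have := cmeas_absE (cmeasC_Gi h).
have [i1 i2] := ints_hb h; rewrite /meC /=.
apply: (@measurable_int2 _ _ _ _ _ dA (fun z t : plane => ((cabs (hb x (toC t)))%:E * Ji l (toC z * toC t)%R)%E)); last first.
  by move=> z t; rewrite mule_ge0 ?Ji_ge0 // lee_fin cabs_ge0.
apply: emeasurable_funM; first by apply: (measurableT_comp (cmeas_absE (cmeasC_hb i1 i2))); exact: measurable_snd.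
apply: (meC_comp (IH (ints_behead h))); apply: cmeasM; apply: (cmeas_comp (@cmeas_toC R)); [exact: measurable_fst|exact: measurable_snd].
Qed.

Lemma meC_hbJ x l (c : C) : ints [:: 0%N, x & l] -> meC (fun v => ((cabs (hb x (v * c)))%:E * Ji l v)%E).
Proof.
move=> h; have [i1 i2] := ints_hb h; apply: emeasurable_funM; last exact: (meC_Ji (ints_behead h)).
apply: cmeas_absE; apply: cmeas_scaleC; [exact: cmeasC_hb|exact: cmeas_toC|exact: cmeas_cst].
Qed.

Lemma hbJ_ge0 x l (s v : C) : (0 <= (cabs (hb x s))%:E * Ji l v)%E.
Proof. by rewrite mule_ge0 ?Ji_ge0 // lee_fin cabs_ge0. Qed.

(** The substitution v = w t moves w into the explicit weight and leaves [Ji l v] free of w. *)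
Lemma Ji_scale x l w : ints [:: 0%N, x & l] -> w != 0 ->
  Ji (x :: l) w = ((cabs w ^- 2)%:E * \int[dA]_v ((cabs (hb x (toC v * w^-1)))%:E * Ji l (toC v)))%E.
Proof.
move=> h w0; rewrite -(dA_scale w0 (meC_hbJ _ h)); last by move=> t; exact: hbJ_ge0.
by apply: eq_integral => t _ /=; rewrite [w * _]mulrC mulfK.
Qed.

Lemma Gi_le l z : ints (0%N :: l) -> ((cabs (Gi l z))%:E <= Ji l z)%E.
Proof.
elim: l z => [|x l IH] z h //=; have [i1 i2] := ints_hb h.
have [fin|] := ltP (\int[dA]_t ((cabs (hb x (toC t)))%:E * Ji l (z * toC t)%R))%E +oo%E; last by apply: le_trans; rewrite leey.
have m1 : cmeas (fun t : plane => hb x (toC t) * Gi l (z * toC t)).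
  apply: cmeasM; first exact: (cmeasC_hb i1 i2).
  by apply: cmeas_scaleC; [exact: (cmeasC_Gi (ints_behead h))|exact: cmeas_cst|exact: cmeas_toC].
have m2 : measurable_fun setT (fun t : plane => ((cabs (hb x (toC t)))%:E * Ji l (z * toC t)%R)%E).
  apply: emeasurable_funM; first exact: (cmeas_absE (cmeasC_hb i1 i2)).
  by apply: (meC_comp (meC_Ji (ints_behead h))); apply: cmeasM; [exact: cmeas_cst|exact: cmeas_toC].
have le t : ((cabs (hb x (toC t) * Gi l (z * toC t)))%:E <= (cabs (hb x (toC t)))%:E * Ji l (z * toC t)%R)%E.
  rewrite cabsM EFinM; apply: lee_wpmul2l; first by rewrite lee_fin cabs_ge0.
  exact: IH (ints_behead h).
have ci := cintg_le m1 m2 le fin.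
apply: le_trans (CI_abs ci) _; apply: le_int => //.
- exact: cmeas_absE.
- by move=> t; rewrite lee_fin cabs_ge0.
Qed.

Definition cre_a i : R := cre (a i + a' i).
Definition cre_ba i : R := cre (B i - a i + (B' i - a' i)).
Definition cre_B i : R := cre (B i + B' i).

Lemma cre_aDba i : cre_a i + cre_ba i = cre_B i.
Proof. by rewrite /cre_a /cre_ba /cre_B -creD; congr cre; ring. Qed.

Lemma powR_bnd (r X c : R) : 0 < r -> exists2 k, 0 < k & forall x, r <= x -> x <= X -> k <= x `^ c /\ x `^ c <= k^-1.
Proof.
move=> r0; have [rX|Xr] := leP r X; last by exists 1 => // x h1 h2; move: (le_trans h1 h2); rewrite leNgt Xr.
have X0 : 0 < X by apply: lt_le_trans rX.
pose S := (r `^ c + X `^ c) + (r `^ (- c) + X `^ (- c)).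
have S0 : 0 < S by rewrite /S !addr_gt0 // powR_gt0.
exists S^-1; first by rewrite invr_gt0.
move=> x rx xX; have x0 : 0 < x by apply: lt_le_trans rx.
rewrite invrK; split; last first.
  by apply: le_trans (powR_between c r0 rx xX) _; rewrite lerDl addr_ge0 // powR_ge0.
rewrite -[x `^ c]invrK -powRN lef_pV2 ?posrE ?powR_gt0 //.
by apply: le_trans (powR_between _ r0 rx xX) _; rewrite lerDr addr_ge0 // powR_ge0.
Qed.

Lemma cabs_hb x t : isInt (a x - a' x) -> isInt (B x - a x - (B' x - a' x)) -> t != 0 -> t != 1 ->
  cabs (hb x t) = cabs t `^ (cre_a x - 2) * cabs (1 - t) `^ (cre_ba x - 2).
Proof.
move=> i1 i2 t0 t1; rewrite /hb /bint cabsM cabs_ppow1 // cabs_ppow1 //.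
by rewrite subr_eq0 eq_sym.
Qed.

Lemma cabs_ne1 (t : C) : cabs t != 1 -> t != 1.
Proof. by apply: contraNneq => ->; rewrite cabs1. Qed.

Lemma hb_near0 x : isInt (a x - a' x) -> isInt (B x - a x - (B' x - a' x)) ->
  exists2 k, 0 < k & forall t, t != 0 -> cabs t <= 1 / 2 ->
    k * cabs t `^ (cre_a x - 2) <= cabs (hb x t) /\ cabs (hb x t) <= k^-1 * cabs t `^ (cre_a x - 2).
Proof.
move=> i1 i2; have [k k0 hk] := @powR_bnd (1 / 2) (3 / 2) (cre_ba x - 2) (ltac:(lra)).
exists k => // t t0 th; have t1 : t != 1 by apply: cabs_ne1; rewrite lt_eqF //; lra.
rewrite (cabs_hb i1 i2 t0 t1).
have h1 : 1 / 2 <= cabs (1 - t) by have := cabsD (1 - t) t; rewrite subrK cabs1; lra.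
have h2 : cabs (1 - t) <= 3 / 2 by apply: le_trans (cabsB _ _) _; rewrite cabs1; lra.
have [h3 h4] := hk _ h1 h2.
by rewrite [_ `^ _ * _]mulrC; split; [exact: (ler_wpM2r (powR_ge0 _ _) h3)|exact: (ler_wpM2r (powR_ge0 _ _) h4)].
Qed.

Lemma hb_near1 x : isInt (a x - a' x) -> isInt (B x - a x - (B' x - a' x)) ->
  exists2 k, 0 < k & forall t, t != 1 -> cabs (1 - t) <= 1 / 2 -> k * cabs (1 - t) `^ (cre_ba x - 2) <= cabs (hb x t).
Proof.
move=> i1 i2; have [k k0 hk] := @powR_bnd (1 / 2) (3 / 2) (cre_a x - 2) (ltac:(lra)).
exists k => // t t1 th.
have h1 : 1 / 2 <= cabs t by have := cabsD (1 - t) t; rewrite subrK cabs1; lra.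
have h2 : cabs t <= 3 / 2.
  have -> : t = 1 - (1 - t) by ring.
  by apply: le_trans (cabsB _ _) _; rewrite cabs1; lra.
have t0 : t != 0 by rewrite -cabs_gt0; lra.
have [h3 _] := hk _ h1 h2.
by rewrite cabs_hb //; exact: (ler_wpM2r (powR_ge0 _ _) h3).
Qed.

(** After 1 - t = -t (1 - 1 / t) the exponents add up: (cre_a - 2) + (cre_ba - 2) = cre_B - 4. *)
Lemma hb_far x tau : isInt (a x - a' x) -> isInt (B x - a x - (B' x - a' x)) -> 1 < tau ->
  exists2 k, 0 < k & forall t, tau <= cabs t ->
    k * cabs t `^ (cre_B x - 4) <= cabs (hb x t) /\ cabs (hb x t) <= k^-1 * cabs t `^ (cre_B x - 4).
Proof.
move=> i1 i2 tau1; have tau0 : 0 < tau by lra.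
have r0 : 0 < 1 - tau^-1 by rewrite subr_gt0 invf_lt1.
have [k k0 hk] := @powR_bnd (1 - tau^-1) 2 (cre_ba x - 2) r0.
exists k => // t th; have ct : 1 < cabs t by apply: lt_le_trans th.
have c0 : 0 < cabs t by lra.
have t0 : t != 0 by rewrite -cabs_gt0.
have t1 : t != 1 by apply: cabs_ne1; rewrite gt_eqF.
rewrite (cabs_hb i1 i2 t0 t1).
have -> : 1 - t = - (t * (1 - t^-1)) by rewrite mulrBr mulfV //; ring.
have iv : cabs t^-1 <= tau^-1 by rewrite cabsV lef_pV2 ?posrE.
have h1 : 1 - tau^-1 <= cabs (1 - t^-1) by have := cabsD (1 - t^-1) t^-1; rewrite subrK cabs1; lra.
have h2 : cabs (1 - t^-1) <= 2.
  apply: le_trans (cabsB _ _) _; rewrite cabs1.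
  have : tau^-1 < 1 by rewrite invf_lt1.
  by lra.
have [h3 h4] := hk _ h1 h2.
rewrite cabsN cabsM powRM ?cabs_ge0 // mulrA -powRD; last by rewrite (gt_eqF c0) implybT.
rewrite (_ : cre_a x - 2 + (cre_ba x - 2) = cre_B x - 4); last by rewrite -cre_aDba; ring.
by rewrite [_ `^ _ * _]mulrC; split; [exact: (ler_wpM2r (powR_ge0 _ _) h3)|exact: (ler_wpM2r (powR_ge0 _ _) h4)].
Qed.

Lemma int_lower (r X c : R) (F : C -> \bar R) : meC F -> (forall t, 0 <= F t)%E -> 0 <= c ->
  (forall t, inA r X t -> (c%:E <= F t)%E) -> (c%:E * areaA r X <= \int[dA]_t F (toC t))%E.
Proof.
move=> mF F0 c0 h.
have mI : measurable_fun setT (fun t : plane => ((inA r X (toC t))%:R%:E : \bar R)).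
  by apply: measurable_ind; apply: measurable_inA; exact: cmeas_toC.
rewrite /areaA -ge0_intZl //.
apply: le_int => //.
- exact: emeasurable_funM.
- by move=> t; rewrite -EFinM lee_fin mulr_ge0 ?ler0n.
- by move=> t; case: (boolP (inA r X (toC t))) => ht; rewrite ?mule1 ?mule0 //; exact: h.
Qed.

Lemma areaA_pos (r X : R) : 0 < r -> r < X -> exists2 k, 0 < k & areaA r X = k%:E.
Proof.
move=> r0 rX; exists (pi * (X ^+ 2 - r ^+ 2)); last by rewrite (areaA_rX r0 (ltW rX)) kappa_pi.
rewrite mulr_gt0 ?pi_gt0 // subr_gt0 ltrXn2r // ?nnegrE; lra.
Qed.

Hypotheses (B0 : B 0%N = 1) (B0' : B' 0%N = 1).

Let rB0 : cre_B 0%N = 2. Proof. by rewrite /cre_B B0 B0' creD -[1]/(1%:R) cre_nat; ring. Qed.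

(** Every exponent of the expansion to come is already a lower bound. For the new index x, restrict
    v = w t to a fixed annulus, where t is large; for the others, restrict t to a fixed annulus and
    use the inner bound. *)
Lemma Ji_lower l j r : ints (0%N :: l) -> j \in 0%N :: l -> 0 < r < 1 ->
  exists2 c, 0 < c & forall w, w != 0 -> cabs w <= r -> ((c * cabs w `^ (2 - cre_B j))%:E <= Ji l w)%E.
Proof.
elim: l j r => [|x l IH] j r h jl /andP[r0 r1].
  move: jl; rewrite inE => /eqP ->; rewrite rB0 subrr.
  have [h1 _] := h 0%N (mem_head _ _).
  have i1 : isInt (- a 0%N - - a' 0%N) by rewrite (_ : _ - _ = - (a 0%N - a' 0%N)); [exact: isIntN|ring].
  have [k k0 hk] := @powR_bnd (1 - r) 2 (cre (- a 0%N + - a' 0%N)) (ltac:(lra)).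
  exists k => // w w0 wr; rewrite powRr0 mulr1 lee_fin.
  have h2 : 1 - r <= cabs (1 - w) by have := cabsD (1 - w) w; rewrite subrK cabs1; lra.
  have h3 : cabs (1 - w) <= 2 by apply: le_trans (cabsB _ _) _; rewrite cabs1; lra.
  rewrite cabs_ppow //; first by have [] := hk _ h2 h3.
  by rewrite -cabs_gt0; lra.
have [i1 i2] := ints_hb h; have h' := ints_behead h.
have [jx|jx] := boolP (j \in 0%N :: l); last first.
  have {jl jx} -> : j = x by move: jl jx; rewrite !in_cons; case: (j == 0%N) => //=; case: eqP => //= _ ->.
  (* r < r1' < r2 < 1, so that |w| <= r and |v| >= r1' keep |t| above r1' / r > 1. *)
  pose r1' := (2 * r + 1) / 3; pose r2 := (r + 2) / 3.
  have q1 : r < r1' by rewrite /r1'; lra.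
  have q2 : r1' < r2 by rewrite /r1' /r2; lra.
  have q3 : r2 < 1 by rewrite /r2; lra.
  have [c c0 hc] := IH 0%N r2 h' (mem_head _ _) (ltac:(lra)).
  have tau1 : 1 < r1' / r by rewrite ltr_pdivlMr // mul1r.
  have [k k0 hk] := hb_far i1 i2 tau1.
  have [k2 k20 hk2] := @powR_bnd r1' r2 (cre_B x - 4) (ltac:(lra)).
  have r10 : 0 < r1' := lt_trans r0 q1.
  have [ar ar0 har] := areaA_pos r10 q2.
  exists (k * k2 * c * ar); first by rewrite !mulr_gt0.
  move=> w w0 wr; have cw : 0 < cabs w by rewrite cabs_gt0.
  rewrite (Ji_scale h w0).
  pose D := k * k2 * cabs w `^ (4 - cre_B x) * c.
  have D0 : 0 <= D by rewrite /D !mulr_ge0 ?powR_ge0 // ltW.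
  have low := @int_lower r1' r2 D (fun v => ((cabs (hb x (v * w^-1)))%:E * Ji l v)%E) (meC_hbJ _ h) (fun v => hbJ_ge0 _ _ _ _) D0.
  apply: le_trans (lee_wpmul2l _ (low _)).
  - rewrite har -!EFinM lee_fin /D; rewrite le_eqVlt; apply/orP; left; apply/eqP.
    have -> : cabs w `^ (2 - cre_B x) = cabs w ^- 2 * cabs w `^ (4 - cre_B x).
      rewrite -powR_mulrn ?cabs_ge0 // -powRN -powRD ?(gt_eqF cw) ?implybT //; congr (_ `^ _); ring.
    ring.
  - by rewrite lee_fin invr_ge0 exprn_ge0 // cabs_ge0.
  - move=> v /andP[v1 v2].
    have v0 : v != 0 by rewrite -cabs_gt0; exact: lt_le_trans r10 v1.
    have t1 : r1' / r <= cabs (v * w^-1).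
      by rewrite cabsM cabsV; apply: (ler_pM (ltW r10) _ v1); [rewrite invr_ge0 ltW|rewrite lef_pV2 ?posrE].
    have [b1 _] := hk _ t1; have [b2 _] := hk2 _ v1 (ltW v2).
    have b3 := hc _ v0 (ltW v2); rewrite rB0 subrr powRr0 mulr1 in b3.
    have iw : 0 <= (cabs w)^-1 by rewrite invr_ge0 cabs_ge0.
    rewrite /D EFinM; apply: lee_pmul; [| | |exact: b3].
    + by rewrite lee_fin; apply: mulr_ge0; [rewrite ltW // mulr_gt0|exact: powR_ge0].
    + by rewrite lee_fin ltW.
    + rewrite lee_fin; apply: le_trans b1; rewrite -mulrA (ler_pM2l k0) cabsM cabsV (powRM _ (cabs_ge0 v) iw).
      rewrite -powR_inv1 ?cabs_ge0 // -powRrM (_ : -1 * (cre_B x - 4) = 4 - cre_B x); last by ring.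
      exact: (ler_wpM2r (powR_ge0 _ _) b2).
have [c c0 hc] := IH j r h' jx (ltac:(lra)).
have [k k0 hk] := hb_near0 i1 i2.
have [k2 k20 hk2] := @powR_bnd (1 / 4) (1 / 2) (cre_a x - 2) (ltac:(lra)).
have [k3 k30 hk3] := @powR_bnd (1 / 4) (1 / 2) (2 - cre_B j) (ltac:(lra)).
have [ar ar0 har] := @areaA_pos (1 / 4) (1 / 2) (ltac:(lra)) (ltac:(lra)).
exists (k * k2 * c * k3 * ar); first by rewrite !mulr_gt0.
move=> w w0 wr; have cw : 0 < cabs w by rewrite cabs_gt0.
pose D := k * k2 * (c * (cabs w `^ (2 - cre_B j) * k3)).
have D0 : 0 <= D by rewrite /D !mulr_ge0 ?powR_ge0 // ltW.
have mF : meC (fun t => ((cabs (hb x t))%:E * Ji l (w * t)%R)%E).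
  apply: emeasurable_funM; first exact: (cmeas_absE (cmeasC_hb i1 i2)).
  by apply: (meC_comp (meC_Ji h')); apply: cmeasM; [exact: cmeas_cst|exact: cmeas_toC].
have low := @int_lower (1 / 4) (1 / 2) D _ mF (fun v => hbJ_ge0 _ _ _ _) D0.
apply: le_trans (low _).
- by rewrite har -!EFinM lee_fin /D; rewrite le_eqVlt; apply/orP; left; apply/eqP; ring.
- move=> t /andP[t1 t2].
  have t0 : t != 0 by rewrite -cabs_gt0; apply: lt_le_trans t1; rewrite divr_gt0 ?ltr0n.
  have [b1 _] := hk _ t0 (ltW t2); have [b2 _] := hk2 _ t1 (ltW t2); have [b3 _] := hk3 _ t1 (ltW t2).
  rewrite /D EFinM; apply: lee_pmul.
  + by rewrite lee_fin !mulr_ge0 // ltW.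
  + by rewrite lee_fin !mulr_ge0 ?powR_ge0 // ltW.
  + by rewrite lee_fin; apply: le_trans b1; rewrite ler_pM2l.
  have wt0 : w * t != 0 by rewrite mulf_neq0.
  have wtr : cabs (w * t) <= r by rewrite cabsM; apply: le_trans wr; apply: (ler_piMr (cabs_ge0 w)); apply: (le_trans (ltW t2)); rewrite ler_pdivrMr ?mul1r ?ler1n ?ltr0n.
  apply: le_trans (hc _ wt0 wtr); rewrite lee_fin (ler_pM2l c0) cabsM (powRM _ (cabs_ge0 w) (cabs_ge0 t)).
  exact: (ler_wpM2l (powR_ge0 _ _) b3).
Qed.
End IteratedIntegrals.

(** * Consequences of absolute convergence *)

Section Finiteness.
Variable R : realType.
Local Notation C := R[i].
Local Notation dA := (mA R).
Local Notation plane := (measurableTypeR R * measurableTypeR R)%type.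
Variables a B a' B' : nat -> C.
Local Notation hb := (hb a B a' B').
Local Notation Gi := (Gi a B a' B').
Local Notation Ji := (Ji a B a' B').
Local Notation ints := (ints a B a' B').
Local Notation ra := (cre_a a a').
Local Notation rb := (cre_ba a B a' B').
Local Notation rB := (cre_B B B').

Lemma pwD_dom (X sg c : R) (F : C -> \bar R) : 0 < X -> 0 < c -> meC F -> (forall t, 0 <= F t)%E ->
  (forall t, inD X t -> ((c * cabs t `^ (sg - 2))%:E <= F t)%E) -> (\int[dA]_t F (toC t) < +oo)%E -> 0 < sg.
Proof.
move=> X0 c0 mF F0 h fin; apply: (pwD_pos X0).
have mI : measurable_fun setT (fun x : plane => (if inD X (toC x) then cabs (toC x) `^ (sg - 2) else 0)%:E : \bar R).
  by apply: measurable_pw; apply: measurable_inD; exact: cmeas_toC.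
have : (c%:E * pwD X sg <= \int[dA]_t F (toC t))%E.
  rewrite /pwD -ge0_intZl; [|exact: mI|by move=> t; exact: pw_ge0|by rewrite lee_fin ltW].
  apply: le_int => //.
  - exact: emeasurable_funM.
  - by move=> t; rewrite mule_ge0 ?lee_fin ?(ltW c0) //; case: ifP => // _; rewrite powR_ge0.
  - by move=> t; case: (boolP (inD X (toC t))) => ht; rewrite ?mule0 // -EFinM; exact: h.
move=> /le_lt_trans/(_ fin); rewrite !ltNge; apply: contra; rewrite leye_eq => /eqP ->.
by rewrite gt0_muley // lte_fin.
Qed.

Hypotheses (B0 : B 0%N = 1) (B0' : B' 0%N = 1).

Let rB0 : rB 0%N = 2. Proof. by rewrite /cre_B B0 B0' creD -[1]/(1%:R) cre_nat; ring. Qed.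

Let meF x l z : ints [:: 0%N, x & l] -> meC (fun t => ((cabs (hb x t))%:E * Ji l (z * t)%R)%E).
Proof.
move=> h; have [i1 i2] := ints_hb h.
apply: emeasurable_funM; first exact: (cmeas_absE (cmeasC_hb i1 i2)).
by apply: (meC_comp (meC_Ji (ints_behead h))); apply: cmeasM; [exact: cmeas_cst|exact: cmeas_toC].
Qed.

(** If the inner integral were infinite on the whole punctured disc, so would be the outer one,
    already over 1 / 4 <= |t| < 1 / 2. *)
Lemma Ji_point x l z : ints [:: 0%N, x & l] -> 0 < cabs z < 1 -> (Ji (x :: l) z < +oo)%E ->
  exists2 w, 0 < cabs w < 1 & (Ji l w < +oo)%E.
Proof.
move=> h /andP[z0 z1] fin; apply: contrapT => no; move: (fin); apply/negP; rewrite -leNgt leye_eq; apply/eqP.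
have inf w : 0 < cabs w < 1 -> Ji l w = +oo%E.
  by move=> hw; apply/eqP; rewrite -leye_eq leNgt; apply/negP => hj; apply: no; exists w.
have [i1 i2] := ints_hb h; have [k k0 hk] := hb_near0 i1 i2.
have [ar ar0 har] := @areaA_pos R (1 / 4) (1 / 2) (ltac:(lra)) (ltac:(lra)).
have low c : 0 <= c -> ((c * ar)%:E <= Ji (x :: l) z)%E.
  move=> c0; rewrite EFinM -har; apply: (int_lower (meF z h) _ c0).
    by move=> t; exact: hbJ_ge0.
  move=> t /andP[t1 t2]; have t0 : t != 0 by rewrite -cabs_gt0; lra.
  have [b _] := hk _ t0 (ltW t2).
  rewrite inf; last by rewrite cabsM mulr_gt0 ?cabs_gt0 //=; [nra|rewrite -cabs_gt0].
  rewrite gt0_muley ?leey // lte_fin; apply: lt_le_trans b.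
  by rewrite mulr_gt0 // powR_gt0 // cabs_gt0.
have J0 : (0 <= Ji (x :: l) z)%E by exact: Ji_ge0.
move: fin low J0; case: (Ji (x :: l) z) => //= r _ low r0; exfalso.
have := low ((r + 1) / ar); rewrite divfK ?gt_eqF // lee_fin => H.
have {H} : r + 1 <= r by apply: H; rewrite divr_ge0 ?ltW //; move: r0; rewrite lee_fin => ?; lra.
by lra.
Qed.

(** Finiteness is read off locally: by [Ji_lower] the integrand dominates |t|^(ra x - rB j) near 0
    for every j, and |1 - t|^(rb x - 2) near 1; [pwD_dom] turns each into positivity. *)
Lemma Ji_re x l z : ints [:: 0%N, x & l] -> 0 < cabs z < 1 -> (Ji (x :: l) z < +oo)%E ->
  (forall j, j \in 0%N :: l -> 0 < ra x + 2 - rB j) /\ 0 < rb x.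
Proof.
move=> h /andP[z0 z1] fin; have [i1 i2] := ints_hb h; have h' := ints_behead h.
have zn : z != 0 by rewrite -cabs_gt0.
have [k k0 hk] := hb_near0 i1 i2; split.
  move=> j jl; have [c c0 hc] := Ji_lower B0 B0' h' jl (ltac:(lra) : 0 < 1 / 2 < 1).
  apply: (@pwD_dom (1 / 2) _ (k * (c * cabs z `^ (2 - rB j))) _ _ _ (meF z h) _ _ fin).
  - lra.
  - by rewrite !mulr_gt0 // powR_gt0.
  - by move=> t; exact: hbJ_ge0.
  move=> t /andP[t0 t1]; have [b _] := hk _ t0 (ltW t1).
  have ct : 0 < cabs t by rewrite cabs_gt0.
  have -> : k * (c * cabs z `^ (2 - rB j)) * cabs t `^ (ra x + 2 - rB j - 2) =
    k * cabs t `^ (ra x - 2) * (c * (cabs z `^ (2 - rB j) * cabs t `^ (2 - rB j))).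
    rewrite (_ : ra x + 2 - rB j - 2 = (ra x - 2) + (2 - rB j)); last by ring.
    rewrite powRD; last by rewrite (gt_eqF ct) implybT.
    move: (cabs z `^ _) (cabs t `^ (ra x - 2)) (cabs t `^ (2 - rB j)) => *; ring.
  rewrite EFinM; apply: lee_pmul.
  + by rewrite lee_fin mulr_ge0 ?powR_ge0 // ltW.
  + by rewrite lee_fin !mulr_ge0 ?powR_ge0 // ltW.
  + by rewrite lee_fin.
  have zt : cabs (z * t) <= 1 / 2 by rewrite cabsM; nra.
  apply: le_trans (hc _ _ zt); last by rewrite mulf_neq0.
  by rewrite lee_fin (ler_pM2l c0) cabsM (powRM _ (cabs_ge0 z) (cabs_ge0 t)).
(* Chosen so that |1 - t| < dl keeps |z t| <= r < 1. *)
pose r := (1 + cabs z) / 2; pose dl := (1 - cabs z) / 2.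
have [c c0 hc] := Ji_lower B0 B0' h' (mem_head _ _) (ltac:(rewrite /r; lra) : 0 < r < 1).
have [k1 k10 hk1] := hb_near1 i1 i2.
pose F t := ((cabs (hb x t))%:E * Ji l (z * t)%R)%E.
have mF1 : meC (fun s => F (1 - s)).
  by apply: (meC_comp (meF z h)); apply: cmeasB; [exact: cmeas_cst|exact: cmeas_toC].
apply: (@pwD_dom dl _ (k1 * c) (fun s => F (1 - s)) _ _ mF1).
- by rewrite /dl; lra.
- by rewrite mulr_gt0.
- by move=> t; exact: hbJ_ge0.
- move=> s /andP[s0 s1]; rewrite /F.
  have s1' : cabs s <= 1 / 2 by move: s1; rewrite /dl; lra.
  have t1 : 1 - s != 1 by rewrite -subr_eq0 addrAC subrr add0r oppr_eq0.
  have := hk1 _ t1; rewrite opprB addrC subrK => b; have {}b := b s1'.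
  rewrite mulrAC EFinM; apply: lee_pmul.
  + by rewrite lee_fin mulr_ge0 ?powR_ge0 // ltW.
  + by rewrite lee_fin ltW.
  + by rewrite lee_fin.
  have t0 : 1 - s != 0.
    by rewrite subr_eq0; apply: contraTneq s1' => <-; rewrite cabs1; lra.
  have := hc (z * (1 - s)) (mulf_neq0 zn t0); rewrite rB0 subrr powRr0 mulr1; apply.
  rewrite cabsM; have h3 : cabs (1 - s) <= 1 + dl by apply: le_trans (cabsB _ _) _; rewrite cabs1; lra.
  apply: le_trans (ler_wpM2l (ltW z0) h3) _; rewrite /r /dl; nra.
- by rewrite (dA_reflect 1 (meF z h)) // => t; exact: hbJ_ge0.
Qed.

Lemma powR_ratio (u v w c : R) : 0 <= u -> 0 <= v -> 0 < w -> u = v * w -> u `^ c = v `^ c * w `^ c.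
Proof. by move=> u0 v0 w0 ->; rewrite powRM // ltW. Qed.

(** Finiteness at one point spreads. After v = w t the weights at w and at w0 are comparable for |v|
    small or large; in between, [Ji l v] is bounded by induction and the weight is integrable by
    [bint_intg]. *)
Lemma Ji_bounded l w0 : ints (0%N :: l) -> 0 < cabs w0 < 1 -> (Ji l w0 < +oo)%E ->
  forall ep r, 0 < ep -> r < 1 -> exists2 M, 0 <= M & forall w, ep <= cabs w -> cabs w <= r -> (Ji l w <= M%:E)%E.
Proof.
elim: l w0 => [|x l IH] w0 h /andP[w00 w01] fin ep r ep0 r1.
  have [h1 _] := h 0%N (mem_head _ _).
  have i1 : isInt (- a 0%N - - a' 0%N) by rewrite (_ : _ - _ = - (a 0%N - a' 0%N)); [exact: isIntN|ring].
  have [k k0 hk] := @powR_bnd R (1 - r) 2 (cre (- a 0%N + - a' 0%N)) (ltac:(lra)).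
  exists k^-1; first by rewrite invr_ge0 ltW.
  move=> w _ wr; rewrite lee_fin.
  have h2 : 1 - r <= cabs (1 - w) by have := cabsD (1 - w) w; rewrite subrK cabs1; lra.
  have h3 : cabs (1 - w) <= 2 by apply: le_trans (cabsB _ _) _; rewrite cabs1; lra.
  rewrite cabs_ppow //; first by have [] := hk _ h2 h3.
  by rewrite -cabs_gt0; lra.
have [re|er] := ltP r ep.
  by exists 0 => // w e1 e2; move: (le_trans e1 e2); rewrite leNgt re.
have [i1 i2] := ints_hb h; have h' := ints_behead h.
have z01 : 0 < cabs w0 < 1 by rewrite w00.
have [re1 re2] := Ji_re h z01 fin.
have {}re1 : 0 < ra x by have := re1 0%N (mem_head _ _); rewrite rB0; lra.
have [w1 w1b w1f] := Ji_point h z01 fin.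
pose m := Num.max r (cabs w0).
have m1 : m < 1 by rewrite gt_max r1.
have mr : r <= m by rewrite le_max lexx.
have mw : cabs w0 <= m by rewrite le_max lexx orbT.
pose r1' := (m + 1) / 2; have q1 : m < r1' by rewrite /r1'; lra.
have q2 : r1' < 1 by rewrite /r1'; lra.
(* For |v| below e1 both v / w and v / w0 have modulus at most 1 / 2, the range of [hb_near0]. *)
pose e1 := Num.min ep (cabs w0) / 2.
have e0 : 0 < Num.min ep (cabs w0) by rewrite lt_min ep0.
have e1e : e1 <= ep / 2 by rewrite /e1 ler_pM2r ?invr_gt0 // ge_min lexx.
have e1w : e1 <= cabs w0 / 2 by rewrite /e1 ler_pM2r ?invr_gt0 // ge_min lexx orbT.
have e10 : 0 < e1 by rewrite /e1 divr_gt0.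
have [M M0 hM] := IH w1 h' w1b w1f e1 r1' e10 q2.
have r0 : 0 < r by apply: lt_le_trans er.
have m0 : 0 < m by apply: lt_le_trans mr.
have r10 : 0 < r1' by apply: lt_trans q1.
have [k1 k10 hk1] := hb_near0 i1 i2.
have tau1 : 1 < r1' / m by rewrite ltr_pdivlMr ?mul1r // (lt_le_trans r0).
have [k2 k20 hk2] := hb_far i1 i2 tau1.
have lo0 : 0 < cabs w0 / r by rewrite divr_gt0.
have [k3 k30 hk3] := @powR_bnd R (cabs w0 / r) (cabs w0 / ep) (ra x - 2) lo0.
have [k4 k40 hk4] := @powR_bnd R (cabs w0 / r) (cabs w0 / ep) (rB x - 4) lo0.
pose K := 1 + k1^-1 * k1^-1 * k3^-1 + k2^-1 * k2^-1 * k4^-1.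
have v1 : 0 <= k1^-1 * k1^-1 * k3^-1 by rewrite !mulr_ge0 // invr_ge0 ltW.
have v2 : 0 <= k2^-1 * k2^-1 * k4^-1 by rewrite !mulr_ge0 // invr_ge0 ltW.
have v3 : 0 <= 1 + k2^-1 * k2^-1 * k4^-1 by rewrite addr_ge0.
have v4 : 0 <= 1 + k1^-1 * k1^-1 * k3^-1 by rewrite addr_ge0.
have K0 : 0 <= K by exact: addr_ge0 v4 v2.
have ratio w v : ep <= cabs w -> cabs w <= r -> cabs (v * w^-1) = cabs (v * w0^-1) * (cabs w0 / cabs w) /\
   cabs w0 / r <= cabs w0 / cabs w /\ cabs w0 / cabs w <= cabs w0 / ep.
  move=> ew wr; have cw : 0 < cabs w by apply: lt_le_trans ew.
  split; first by rewrite !cabsM !cabsV; field; rewrite !gt_eqF.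
  by split; rewrite (ler_pM2l w00) lef_pV2 ?posrE.
have comp w v : ep <= cabs w -> cabs w <= r -> (cabs v < e1) || (r1' <= cabs v) ->
   cabs (hb x (v * w^-1)) <= K * cabs (hb x (v * w0^-1)).
  move=> ew wr; have cw : 0 < cabs w by apply: lt_le_trans ew.
  have [eqr [rl ru]] := ratio w v ew wr.
  have p0 : 0 < cabs w0 / cabs w by rewrite divr_gt0.
  have [->|vn] := eqVneq v 0.
    by rewrite !mul0r => _; rewrite -[leLHS]mul1r; apply: ler_wpM2r; rewrite ?cabs_ge0 // /K -addrA lerDl; exact: addr_ge0 v1 v2.
  have iwn : w^-1 != 0 by rewrite invr_eq0 -cabs_gt0.
  have iw0n : w0^-1 != 0 by rewrite invr_eq0 -cabs_gt0.
  case/orP=> hv.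
    have half (u : R) : u / 2 = 1 / 2 * u by rewrite [RHS]mulrC mul1r.
    have s1 : cabs (v * w^-1) <= 1 / 2.
      rewrite cabsM cabsV (ler_pdivrMr _ _ cw); apply: le_trans (ltW hv) (le_trans e1e _).
      by rewrite half ler_pM2l.
    have s2 : cabs (v * w0^-1) <= 1 / 2.
      rewrite cabsM cabsV (ler_pdivrMr _ _ w00); apply: le_trans (ltW hv) (le_trans e1w _).
      by rewrite half.
    have [_ b1] := hk1 _ (mulf_neq0 vn iwn) s1; have [b2 _] := hk1 _ (mulf_neq0 vn iw0n) s2.
    have [_ b3] := hk3 _ rl ru.
    rewrite (powR_ratio _ (cabs_ge0 _) (cabs_ge0 (v * w0^-1)) p0 eqr) in b1.
    apply: le_trans b1 _; apply: (@le_trans _ _ (k1^-1 * k1^-1 * k3^-1 * cabs (hb x (v * w0^-1)))); last first.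
      by apply: ler_wpM2r; [exact: cabs_ge0|rewrite /K (addrC 1) -addrA lerDl; exact: v3].
    rewrite -!mulrA; apply: ler_wpM2l; first by rewrite invr_ge0 ltW.
    rewrite [k3^-1 * _]mulrC mulrA; apply: (ler_pM (powR_ge0 _ _) (powR_ge0 _ _) _ b3).
    by rewrite [leRHS]mulrC ler_pdivlMr // [leLHS]mulrC.
  have s1 : r1' / m <= cabs (v * w^-1).
    rewrite cabsM cabsV; apply: (ler_pM (ltW r10) _ hv); first by rewrite invr_ge0 ltW.
    by rewrite lef_pV2 ?posrE //; exact: le_trans wr mr.
  have s2 : r1' / m <= cabs (v * w0^-1).
    rewrite cabsM cabsV; apply: (ler_pM (ltW r10) _ hv); first by rewrite invr_ge0 ltW.
    by rewrite lef_pV2 ?posrE //; exact: mw.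
  have [_ b1] := hk2 _ s1; have [b2 _] := hk2 _ s2.
  have [_ b3] := hk4 _ rl ru.
  rewrite (powR_ratio _ (cabs_ge0 _) (cabs_ge0 (v * w0^-1)) p0 eqr) in b1.
  apply: le_trans b1 _; apply: (@le_trans _ _ (k2^-1 * k2^-1 * k4^-1 * cabs (hb x (v * w0^-1)))); last first.
    by apply: ler_wpM2r; [exact: cabs_ge0|rewrite /K lerDr; exact: v4].
  rewrite -!mulrA; apply: ler_wpM2l; first by rewrite invr_ge0 ltW.
  rewrite [k4^-1 * _]mulrC mulrA; apply: (ler_pM (powR_ge0 _ _) (powR_ge0 _ _) _ b3).
  by rewrite [leRHS]mulrC ler_pdivlMr // [leLHS]mulrC.
pose T := r1' / ep.
have T0 : 0 < T by rewrite divr_gt0 //; lra.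
have [_ bi] := bint_intg T0 i1 i2 re1 re2.
set Q := (\int[_]_x _)%E in bi.
have Q0 : (0 <= Q)%E by apply: integral_ge0 => t _; rewrite lee_fin cabs_ge0.
pose J0 := (\int[dA]_v ((cabs (hb x (toC v * w0^-1)))%:E * Ji l (toC v)))%E.
have J00 : (0 <= J0)%E by apply: integral_ge0 => t _; exact: hbJ_ge0.
have J0f : (J0 < +oo)%E.
  move: fin; rewrite (Ji_scale h) -?cabs_gt0 // -/J0; move: J00.
  have gen (e : \bar R) : (0 <= e -> (cabs w0 ^- 2)%:E * e < +oo -> e < +oo)%E.
    case: e => [e| |]; [by move=> _ _; exact: ltry| |by []].
    by move=> _; rewrite gt0_muley // lte_fin invr_gt0 exprn_gt0.
  exact: gen.
(* The middle annulus, with [Ji l v] replaced by its bound M. *)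
pose Fm w v := (if inA e1 r1' v then M * cabs (hb x (v * w^-1)) else 0).
have mFm w : measurable_fun setT (fun v : plane => (Fm w (toC v))%:E : \bar R).
  apply/measurable_EFinP; apply: measurable_fun_ifT.
  - by apply: measurable_inA; exact: cmeas_toC.
  - apply: measurable_funM => //; apply: cmeas_abs; apply: cmeas_scaleC; [exact: cmeasC_hb|exact: cmeas_toC|exact: cmeas_cst].
  - by [].
have intFm w : ep <= cabs w -> cabs w <= r -> (\int[dA]_v (Fm w (toC v))%:E <= (M * cabs w ^+ 2)%:E * Q)%E.
  move=> ew wr; have cw : 0 < cabs w by apply: lt_le_trans ew.
  have wn : w != 0 by rewrite -cabs_gt0.
  pose G t := (M%:E * (cabs (if cabs t < T then hb x t else 0))%:E : \bar R)%E.
  have mG : meC G.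
    apply: emeasurable_funM => //; apply: cmeas_absE; apply: cmeas_if; [|exact: cmeasC_hb|exact: cmeas_cst].
    by apply: measurable_cabs_ltr; exact: cmeas_toC.
  have G0 t : (0 <= G t)%E by rewrite mule_ge0 // lee_fin ?cabs_ge0.
  have e2 : (M%:E * Q = \int[dA]_t G (toC t))%E.
    rewrite /Q /G ge0_intZl //; [|by move=> t; rewrite lee_fin cabs_ge0].
    by apply: (cmeas_absE (f := onP (fun t => cabs t < T) (hb x))); apply: cmeas_onP; [apply: measurable_cabs_ltr; exact: cmeas_toC|exact: cmeasC_hb].
  have e3 := @dA_scale R w^-1 G (ltac:(by rewrite invr_eq0)) mG G0.
  have e4 : cabs w^-1 ^- 2 = cabs w ^+ 2 by rewrite cabsV exprVn invrK.
  have {}e3 := etrans e3 (etrans (congr1 (fun u => u%:E * _)%E e4) (congr1 (fun u => (cabs w ^+ 2)%:E * u)%E (esym e2))).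
  rewrite [M * _]mulrC EFinM -muleA -e3; apply: le_int.
  - exact: mFm.
  - by apply: (meC_comp mG); apply: cmeasM; [exact: cmeas_cst|exact: cmeas_toC].
  - by move=> v; rewrite lee_fin /Fm; case: ifP => // _; rewrite mulr_ge0 // cabs_ge0.
  - move=> v; rewrite /Fm; case: ifP => [/andP[_ hv]|_]; last exact: G0.
    rewrite /G ifT ?(mulrC _ (toC v)) // cabsM cabsV /T.
    apply: (@lt_le_trans _ _ (r1' / cabs w)); first by rewrite ltr_pM2r ?invr_gt0.
    by rewrite ler_pM2l ?lef_pV2 ?posrE //; lra.
have Qf : Q \is a fin_num by rewrite ge0_fin_numE.
have Jf : J0 \is a fin_num by rewrite ge0_fin_numE.
exists ((ep ^+ 2)^-1 * (K * fine J0 + M * r ^+ 2 * fine Q)).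
  by rewrite mulr_ge0 ?invr_ge0 ?exprn_ge0 ?(ltW ep0) // addr_ge0 // !mulr_ge0 ?fine_ge0 ?exprn_ge0 // ltW.
move=> w ew wr; have cw : 0 < cabs w by apply: lt_le_trans ew.
rewrite (Ji_scale h) -?cabs_gt0 //.
have step : (\int[dA]_v ((cabs (hb x (toC v * w^-1)))%:E * Ji l (toC v)) <= K%:E * J0 + (M * cabs w ^+ 2)%:E * Q)%E.
  apply: le_trans (leeD (le_refl _) (intFm w ew wr)).
  rewrite /J0 -ge0_intZl //; [|exact: (meC_hbJ _ h)|by move=> v; exact: hbJ_ge0].
  rewrite -ge0_integralD //.
  - apply: le_int.
    + exact: (meC_hbJ _ h).
    + apply: emeasurable_funD => //; apply: emeasurable_funM => //; exact: (meC_hbJ _ h).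
    + by move=> v; exact: hbJ_ge0.
    move=> v; rewrite /Fm; have [hin|hout] := boolP (inA e1 r1' (toC v)).
      case/andP: hin => h1 h2; apply: (@le_trans _ _ (M * cabs (hb x (toC v * w^-1)))%:E); last first.
        by rewrite leeDr // mule_ge0 // ?lee_fin //; exact: hbJ_ge0.
      rewrite [M * _]mulrC EFinM; apply: lee_wpmul2l; first by rewrite lee_fin cabs_ge0.
      exact: hM h1 (ltW h2).
    rewrite adde0 muleA -EFinM; apply: lee_wpmul2r; first exact: Ji_ge0.
    rewrite lee_fin; apply: comp => //; move: hout; rewrite /inA negb_and -ltNge -leNgt //.
  - by move=> v _; rewrite mule_ge0 //; exact: hbJ_ge0.
  - by apply: emeasurable_funM => //; exact: (meC_hbJ _ h).
  - by move=> v _; rewrite lee_fin /Fm; case: ifP => // _; rewrite mulr_ge0 // cabs_ge0.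
apply: le_trans (lee_wpmul2l _ step) _; first by rewrite lee_fin invr_ge0 exprn_ge0 // cabs_ge0.
have [j [ej1 ej2]] : exists j, J0 = j%:E /\ fine J0 = j by exists (fine J0); rewrite fineK.
have [q [eq1 eq2]] : exists q, Q = q%:E /\ fine Q = q by exists (fine Q); rewrite fineK.
rewrite ej2 eq2 ej1 eq1.
rewrite -EFinM lee_fin.
have fJ : 0 <= j by rewrite -ej2; exact: fine_ge0.
have fQ : 0 <= q by rewrite -eq2; exact: fine_ge0.
apply: ler_pM.
- by rewrite invr_ge0 exprn_ge0 // ltW.
- by rewrite addr_ge0 // mulr_ge0 // mulr_ge0 // exprn_ge0 // ltW.
- by rewrite lef_pV2 ?posrE ?exprn_gt0 //; apply: lerXn2r; rewrite ?nnegrE // ltW.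
- rewrite lerD2l; apply: ler_wpM2r => //; apply: ler_wpM2l => //.
  by apply: lerXn2r; rewrite ?nnegrE // ltW.
Qed.
End Finiteness.

(** * Shifts of the beta values and regrouping of series *)

Section Coefficients.
Variable R : realType.
Local Notation C := R[i].

Lemma inv_int_bound (c : C) : exists2 M, 0 <= M & forall n : int, cabs ((c + n%:~R)^-1) <= M.
Proof.
have [M1 M10 h1] := invD_bound c; have [M2 M20 h2] := invD_bound (- c).
exists (M1 + M2); first by rewrite addr_ge0.
have le (M : R) k : 0 <= M -> M / k.+1%:R <= M by move=> M0; rewrite ler_pdivrMr ?ltr0n // ler_peMr // ler1n.
case=> n.
  by apply: le_trans (h1 n) _; apply: le_trans (le _ n M10) _; rewrite lerDl.
rewrite NegzE intrN (_ : c + - _ = - (- c + n.+1%:R)); last by rewrite -[(n.+1%:Z)%:~R]/(n.+1%:R); ring.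
by rewrite invrN cabsN; apply: le_trans (h2 n.+1) _; apply: le_trans (le _ _ M20) _; rewrite lerDr.
Qed.

Lemma pbd_pochratio (s c : C) : (forall k, c + k%:R != 0) -> exists x, pbd (fun m => poch s m / poch c m) x.
Proof.
move=> hc; have [M M0 hM] := cb_inv_bound hc.
have p2 : pbd (fun m => (cb c m)^-1) (1 - cre c) by exists M.
exists (cre s - 1 + (1 - cre c)); apply: pbd_ext (pbdM (pbd_cb s) p2) => m.
have f0 := fact_neq0 R m; have c0 := poch_neq0 m hc.
by rewrite /cb; field; rewrite f0 c0.
Qed.

Lemma pbd_prod (I : eqType) (K : seq I) (f : I -> nat -> C) : (forall i, i \in K -> exists x, pbd (f i) x) ->
  exists x, pbd (fun m => \prod_(i <- K) f i m) x.
Proof.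
elim: K => [|i K IH] h.
  exists 0; exists 1 => // k; rewrite big_nil cabs1 mul0r expR0 mulr1 //.
have [x px] := h i (mem_head _ _); have [y py] := IH (fun j hj => h j (ltac:(by rewrite in_cons hj orbT))).
by exists (x + y); apply: pbd_ext (pbdM px py) => m; rewrite big_cons.
Qed.

Lemma nonint_shift (s s' : C) : isInt (s - s') -> ~ isInt s -> ~ isInt s'.
Proof. by move=> h1 h2 h3; apply: h2; rewrite -(subrK s' s); exact: isIntD. Qed.

Lemma frakB_shiftr (al be al' be' : C) m : ~ isInt al' -> ~ isInt (al' + be') ->
  frakB al be (al' + m%:R) be' = frakB al be al' be' * (poch al' m / poch (al' + be') m).
Proof.
move=> n1 n2; elim: m => [|m IH]; first by rewrite !poch0 addr0 divr1 mulr1.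
have n3 := nonint_int (n := m%:Z) n1; have n4 := nonint_int (n := m%:Z) n2.
rewrite -[(m%:Z)%:~R]/(m%:R) in n3 n4.
have e4 : al' + be' + m%:R = al' + m%:R + be' by ring.
have h4 : al' + be' + m%:R != 0 by apply: nonint_add.
rewrite e4 in n4; have := frakB_rec al be n3 n4; rewrite IH (_ : al' + m%:R + 1 = al' + m.+1%:R) -?e4; last by rewrite -natr1 addrA.
move=> e.
apply: (mulfI h4); rewrite e !pochS.
have h5 := poch_neq0 m (nonint_add n2).
by field; rewrite h5 h4.
Qed.

(** The shifts produce exactly the Pochhammer quotients of the hypergeometric coefficients; the
    plain half follows from the tilde half through [frakB_swap]. *)
Lemma frakB_shift (al be al' be' : C) m m' : isInt (al - al') -> isInt (be - be') -> ~ isInt al -> ~ isInt (al + be) ->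
  frakB (al + m%:R) be (al' + m'%:R) be' =
  frakB al be al' be' * (poch al m / poch (al + be) m) * (poch al' m' / poch (al' + be') m').
Proof.
move=> i1 i2 n1 n2.
have n1' := nonint_shift i1 n1.
have i3 : isInt (al + be - (al' + be')) by rewrite (_ : _ - _ = (al - al') + (be - be')); [exact: isIntD|ring].
have n2' := nonint_shift i3 n2.
have i4 : isInt (al + m%:R - al').
  by rewrite (_ : _ - _ = (al - al') + m%:R); [apply: isIntD => //; exact: isInt_nat|ring].
by rewrite frakB_shiftr // frakB_swap // frakB_shiftr // frakB_swap // -opprB; exact: isIntN.
Qed.

Lemma cintg_mul d1 d2 (T1 : measurableType d1) (T2 : measurableType d2)
    (m1 : {sigma_finite_measure set T1 -> \bar R}) (m2 : {sigma_finite_measure set T2 -> \bar R}) (f : T1 -> C) (g : T2 -> C) :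
  cintg m1 f -> cintg m2 g -> cintg (prodm m1 m2) (fun p => f p.1 * g p.2).
Proof.
move=> cf cg; have mf := cintg_meas cf; have mg := cintg_meas cg.
apply: cintg_fubini.
  by apply: cmeasM; [apply: (cmeas_comp mf); exact: measurable_fst|apply: (cmeas_comp mg); exact: measurable_snd].
have e x : (\int[m2]_y (cabs (f x * g y))%:E = (cabs (f x))%:E * \int[m2]_y (cabs (g y))%:E)%E.
  under eq_integral do rewrite cabsM EFinM.
  rewrite ge0_intZl //; [exact: cmeas_absE|by move=> y; rewrite lee_fin cabs_ge0|by rewrite lee_fin cabs_ge0].
under eq_integral do rewrite /= e.
have g0 : (0 <= \int[m2]_y (cabs (g y))%:E)%E by apply: integral_ge0 => y _; rewrite lee_fin cabs_ge0.
rewrite ge0_intZr //; [|exact: cmeas_absE|by move=> x; rewrite lee_fin cabs_ge0].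
case: cf cg => [_ h1] [_ h2]; apply: lte_mul_pinfty => //.
  by apply: integral_ge0 => x _; rewrite lee_fin cabs_ge0.
by rewrite ge0_fin_numE // integral_ge0 // => x _; rewrite lee_fin cabs_ge0.
Qed.

(** Along w = rho z with rho real, the series in w and in its conjugate are power series in the same
    rho; their product is regrouped by total degree. *)
Lemma CS_prod_regroup (u u' : nat -> C) : summ u -> summ u' -> exists2 h, summ h &
  forall rho : C, cabs rho <= 1 -> CS (fun m => u m * rho ^+ m) * CS (fun m => u' m * rho ^+ m) = CS (fun n => h n * rho ^+ n).
Proof.
move=> su su'; have [cq _] := CS_mul su su'.
pose deg (p : nat * nat) := (p.1 + p.2)%N.
exists (fun n => CI (prodm (cnt R) (cnt R)) (fun p => if deg p == n then u p.1 * u' p.2 else 0)).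
  have [] := @CI_regroup _ _ _ (prodm (cnt R) (cnt R)) (fun p => u p.1 * u' p.2) deg (fun=> 0) _ _ cq => //.
    exact: measurable_nat2.
  by move=> n; rewrite cabs0.
move=> rho r1; have w1 n : cabs (rho ^+ n) <= 1 by rewrite cabsX exprn_ile1 // cabs_ge0.
have [|_ _ e] := @CI_regroup _ _ _ (prodm (cnt R) (cnt R)) (fun p => u p.1 * u' p.2) deg (fun n => rho ^+ n) _ w1 cq.
  exact: measurable_nat2.
have s1 : summ (fun m => u m * rho ^+ m) by apply: summ_dom su => m; rewrite cabsM -[leRHS]mulr1 ler_wpM2l ?cabs_ge0.
have s2 : summ (fun m => u' m * rho ^+ m) by apply: summ_dom su' => m; rewrite cabsM -[leRHS]mulr1 ler_wpM2l ?cabs_ge0.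
have [_ <-] := CS_mul s1 s2.
transitivity (CI (prodm (cnt R) (cnt R)) (fun p => u p.1 * u' p.2 * rho ^+ deg p)).
  by apply: eq_CI => p; rewrite /deg exprD; ring.
by rewrite e; apply: eq_CS => n; rewrite mulrC.
Qed.
End Coefficients.

(** * The inner disc: main values and tails *)

Section InnerDisc.
Variable R : realType.
Local Notation C := R[i].
Local Notation dA := (mA R).
Local Notation Pi := ((pi : R)%:C : C).
Local Notation plane := (measurableTypeR R * measurableTypeR R)%type.
Local Notation cnt2 := (prodm (cnt R) (cnt R)).
Local Notation cnt3 := (prodm (prodm (cnt R) (cnt R)) (cnt R)).
Variables (al be al' be' : C) (n nu : int) (u u' : nat -> C) (z : C) (r : R).
Hypotheses (hn : al - al' = n%:~R) (hnu : be - be' = nu%:~R) (ral : 0 < cre (al + al')) (rbe : 0 < cre (be + be')).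
Hypotheses (nal : ~ isInt al) (nbe : ~ isInt be) (nab : ~ isInt (al + be)).
Hypotheses (z0 : 0 < cabs z) (zr : cabs z < r) (r1 : r < 1).
Hypotheses (pu : exists x, pbd u x) (pu' : exists x, pbd u' x).
Let ga : C := 1 - al - be.
Let ga' : C := 1 - al' - be'.
Let T1 : R := r / cabs z.
Let N (p : nat * nat) : int := - (n + p.1%:Z - p.2%:Z) - nu.
Let s (x : (nat * nat) * nat) : C := ga - x.1.1%:R + x.2%:R.
(** The tail terms of [beta_partial] for all monomials at once, taken at w = z: x.1 is the pair of
    degrees, x.2 the tail index, and [N] the shift of the exterior series for that pair. *)
Let q3 (x : (nat * nat) * nat) : C := (-1) ^ nu * Pi * (u x.1.1 * z ^+ x.1.1 * (u' x.1.2 * conjc z ^+ x.1.2)) *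
  (cb (1 - be) x.2 * cz (1 - be') (x.2%:Z + N x.1) / s x) * cexp (- (s x + s x) * (ln T1)%:C).
(** [q3] vanishes unless x.2 + N >= 0, and then x.2 + (x.2 + N) is the power of rho that comes out;
    the absolute value only makes the degree total. *)
Let deg (x : (nat * nat) * nat) := (x.2 + absz (x.2%:Z + N x.1)%R)%N.

Let r0 : 0 < r. Proof. by apply: lt_trans zr. Qed.
Let T11 : 1 < T1. Proof. by rewrite ltr_pdivlMr // mul1r. Qed.
Let T10 : 0 < T1. Proof. by apply: lt_trans T11. Qed.
Let iT : 0 < T1^-1. Proof. by rewrite invr_gt0. Qed.
Let iT1 : T1^-1 < 1. Proof. by rewrite invf_lt1. Qed.

(** Where the term is nonzero, its exponent has a second expression in the tilde parameters; this is
    what makes a single-valued power with exponents [ga], [ga'] appear. *)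
Let s_dual (x : (nat * nat) * nat) l : x.2%:Z + N x.1 = l%:Z -> s x = ga' - x.1.2%:R + l%:R.
Proof.
move=> e; have : (x.2%:Z + N x.1)%:~R = l%:R :> C by rewrite e.
rewrite /N !(intrD, intrN) -hn -hnu => <-.
rewrite -[(x.1.1%:Z)%:~R]/(x.1.1%:R : C) -[(x.1.2%:Z)%:~R]/(x.1.2%:R : C) -[(x.2%:Z)%:~R]/(x.2%:R : C).
rewrite /s /ga /ga'; ring.
Qed.

Let summ_u (v : nat -> C) (t : R) : (exists x, pbd v x) -> 0 <= t < 1 -> summ (fun m => v m * t%:C ^+ m).
Proof. by move=> [x px] /andP[t0 t1]; apply: pbd_geo px _; rewrite cabsR ger0_norm. Qed.

(** The tail factor splits into T1^(-k - l), which gives the decay, and T1^(p1 + p2), which turns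
    powers of |z| into powers of r, still inside the radius of convergence. *)
Let q3_intg : cintg cnt3 q3.
Proof.
have sW : summ (fun k => cb (1 - be) k * (T1^-1)%:C ^+ k) by apply: summ_u; [exists (cre (1 - be) - 1); exact: pbd_cb|rewrite ltW].
have sW' : summ (fun k => cb (1 - be') k * (T1^-1)%:C ^+ k) by apply: summ_u; [exists (cre (1 - be') - 1); exact: pbd_cb|rewrite ltW].
have sU : summ (fun m => u m * r%:C ^+ m) by apply: summ_u => //; rewrite ltW.
have sU' : summ (fun m => u' m * r%:C ^+ m) by apply: summ_u => //; rewrite ltW.
have [M M0 hM] := summ_partial sW'.
have {}hM l : cabs (cb (1 - be') l) * T1^-1 ^+ l <= M.
  apply: le_trans (hM l.+1); rewrite big_ord_recr /= cabsM cabsX cabsR gtr0_norm // lerDr.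
  by apply: sumr_ge0 => i _; exact: cabs_ge0.
have [M2 M20 hM2] := inv_int_bound ga.
have {}hM2 x : cabs ((s x)^-1) <= M2.
  have := hM2 (x.2%:Z - x.1.1%:Z); rewrite intrB; congr (cabs (_ ^-1) <= _); rewrite /s.
  rewrite -[(x.1.1%:Z)%:~R]/(x.1.1%:R : C) -[(x.2%:Z)%:~R]/(x.2%:R : C); ring.
pose A := expR (- cre (ga + ga') * ln T1).
have A0 : 0 <= A by exact: expR_ge0.
have [cUU _] := CS_mul sU sU'.
have cG := cintgZ (pi * A * (M * M2))%:C (cintg_mul cUU sW).
apply: cintg_dom cG; first by apply: cmeas_Xnat => k; exact: cmeas_nat2.
move=> [[p1 p2] k]; rewrite /q3; case e : (k%:Z + N (p1, p2)) => [l|l]; last first.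
  by rewrite /= mulr0 mul0r mulr0 mul0r cabs0 cabs_ge0.
have e1 : s ((p1, p2), k) = ga - p1%:R + k%:R by [].
have e2 : s ((p1, p2), k) = ga' - p2%:R + l%:R by apply: s_dual.
have rS : cre (- (s ((p1, p2), k) + s ((p1, p2), k))) = - cre (ga + ga') - k%:R - l%:R + p1%:R + p2%:R.
  by rewrite {1}e1 e2 creN !(creD, creN, cre_nat); ring.
have eT m : expR (m%:R * ln T1) = T1 ^+ m by rewrite expRM_natl lnK.
have eN m : expR (- m%:R * ln T1) = T1^-1 ^+ m by rewrite mulNr expRN eT exprVn.
have eE : cabs (cexp (- (s ((p1, p2), k) + s ((p1, p2), k)) * (ln T1)%:C)) = A * T1^-1 ^+ k * T1^-1 ^+ l * T1 ^+ p1 * T1 ^+ p2.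
  by rewrite cabs_cexp_real rS !mulrDl !expRD !eN !eT.
have rE m : r ^+ m = T1 ^+ m * cabs z ^+ m by rewrite -exprMn /T1 divfK // gt_eqF.
have pE : 0 <= pi :> R by rewrite ltW // pi_gt0.
rewrite [cabs (_ * cexp _)]cabsM eE.
rewrite /cz; have := hM2 ((p1, p2), k); have := hM l.
move: (s _) (cb (1 - be') l) (cb (1 - be) k) => S0 W0 V0 WM SM.
rewrite !(cabsM, cabsX, cabs_exprz, cabs_conj, cabs1, cabsN, exp1rz, mul1r) !cabsR /=.
rewrite (ger0_norm pE) (ger0_norm (ltW r0)) (ger0_norm (ltW iT)) [`|pi * A * _|]ger0_norm; last by rewrite !mulr_ge0.
rewrite !rE; move: WM SM.
have := cabs_ge0 S0^-1; set S := cabs S0^-1.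
have : 0 <= cabs W0 * T1^-1 ^+ l by rewrite mulr_ge0 ?cabs_ge0 // exprn_ge0 // ltW.
set W := cabs W0; set V := cabs V0.
have V1 : 0 <= V by exact: cabs_ge0.
have zz0 := cabs_ge0 z; have u0 := cabs_ge0 (u p1); have u0' := cabs_ge0 (u' p2).
move=> W1 S1 WM SM.
have -> : pi * (cabs (u p1) * cabs z ^+ p1 * (cabs (u' p2) * cabs z ^+ p2)) * (V * W * S) * (A * T1^-1 ^+ k * T1^-1 ^+ l * T1 ^+ p1 * T1 ^+ p2) =
  pi * A * (W * T1^-1 ^+ l * S) * (cabs (u p1) * (T1 ^+ p1 * cabs z ^+ p1) * (cabs (u' p2) * (T1 ^+ p2 * cabs z ^+ p2)) * (V * T1^-1 ^+ k)) by ring.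
apply: ler_wpM2r; first by rewrite !mulr_ge0 // exprn_ge0 // ltW.
by apply: ler_wpM2l; [rewrite mulr_ge0|exact: ler_pM].
Qed.

(** |rho|^(2 s) times the powers of rho from the monomial is the fixed single-valued power times
    rho^deg, so all tails share one exponent. *)
Let q3_rho (rho : R) x : rho != 0 -> let w := rho%:C * z in
  (-1) ^ nu * Pi * (u x.1.1 * w ^+ x.1.1 * (u' x.1.2 * conjc w ^+ x.1.2)) *
  (cb (1 - be) x.2 * cz (1 - be') (x.2%:Z + N x.1) / s x) * cexp (- (s x + s x) * (ln (r / cabs w))%:C) =
  ppow rho%:C ga ga' * (q3 x * rho%:C ^+ deg x).
Proof.
move=> rho0 w; rewrite /q3 /deg; case e : (x.2%:Z + N x.1) => [l|l]; last first.
  by rewrite /= !(mulr0, mul0r).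
have rc0 : (rho%:C : C) != 0 by rewrite -cabs_gt0 cabsR normr_gt0.
have key : rho%:C ^+ x.1.1 * rho%:C ^+ x.1.2 * cexp ((s x + s x) * (ln (cabs rho%:C))%:C) = ppow rho%:C ga ga' * rho%:C ^+ (x.2 + l).
  have cr : conjc (rho%:C : C) = rho%:C by rewrite conjc_real.
  rewrite -ppow_radial exprD.
  have pn m k : rho%:C ^+ m * rho%:C ^+ k = ppow rho%:C m%:R k%:R by rewrite (ppow_nat _ _ rc0) cr.
  rewrite !pn -!ppowD.
  by apply: eq_ppow; [rewrite /s; ring|rewrite (s_dual e); ring].
have ew : ln (r / cabs w) = ln T1 - ln (cabs rho%:C).
  rewrite /T1 -ln_div ?posrE ?cabs_gt0 //; congr ln; rewrite /w cabsM; field.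
  by rewrite !gt_eqF // cabs_gt0.
have eE : cexp (- (s x + s x) * (ln (r / cabs w))%:C) = cexp (- (s x + s x) * (ln T1)%:C) * cexp ((s x + s x) * (ln (cabs rho%:C))%:C).
  by rewrite -cexpD ew rcB; congr cexp; ring.
have ec : conjc w = rho%:C * conjc z by transitivity (conjc (rho%:C) * conjc z); [exact: rmorphM|rewrite conjc_real].
rewrite eE ec /w !exprMn absz_nat /=; move: key.
set E := cexp ((s x + s x) * _); set F := cexp _; set P := ppow _ _ _; set Q := rho%:C ^+ (_ + _).
set S := (s x)^-1; set r1' := rho%:C ^+ _; set r2' := rho%:C ^+ _ => key.
transitivity ((-1) ^ nu * Pi * (u x.1.1 * z ^+ x.1.1 * (u' x.1.2 * conjc z ^+ x.1.2)) * (cb (1 - be) x.2 * cb (1 - be') l * S) * F * (r1' * r2' * E)).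
  move: ((-1) ^ nu * Pi) (u _) (u' _) (z ^+ _) (conjc z ^+ _) (cb _ _) (cb _ _) => x1 x2 x3 x4 x5 x6 x7; ring.
rewrite key; move: ((-1) ^ nu * Pi) (u _) (u' _) (z ^+ _) (conjc z ^+ _) (cb _ _) (cb _ _) => x1 x2 x3 x4 x5 x6 x7; ring.
Qed.

(** By [frakB_shift] the main values add up to a product of two series; the tails, regrouped by
    degree, form the last one. *)
Lemma inner_term : exists2 h, summ h & forall rho : R, rho != 0 -> `|rho| <= 1 -> let w := rho%:C * z in
  let F := onP (fun t => cabs t < r / cabs w)
    (fun t => bint al be al' be' t * (CS (fun m => u m * (w * t) ^+ m) * CS (fun m => u' m * conjc (w * t) ^+ m))) in
  cintg dA F /\
  CI dA F = frakB al be al' be' * (CS (fun m => u m * (poch al m / poch (al + be) m) * w ^+ m) *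
      CS (fun m => u' m * (poch al' m / poch (al' + be') m) * conjc w ^+ m))
    - ppow rho%:C ga ga' * CS (fun k => h k * rho%:C ^+ k).
Proof.
have md : measurable_fun setT deg by apply: measurable_Xnat => k; exact: measurable_nat2.
exists (fun k => CI cnt3 (fun x => if deg x == k then q3 x else 0)).
  by have [] := @CI_regroup _ _ _ cnt3 q3 deg (fun=> 0) md (ltac:(by move=> m; rewrite cabs0)) q3_intg.
move=> rho rho0 rho1 w F.
have rc0 : (rho%:C : C) != 0 by rewrite -cabs_gt0 cabsR normr_gt0.
have zn : z != 0 by rewrite -cabs_gt0.
have wn : w != 0 by rewrite mulf_neq0.
have cw : 0 < cabs w by rewrite cabs_gt0.
have wz : cabs w <= cabs z by rewrite cabsM cabsR ler_piMl // cabs_ge0.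
have wr : cabs w < r by apply: le_lt_trans zr.
have w1 : cabs w < 1 by apply: lt_trans r1.
have T_1 : 1 < r / cabs w by rewrite ltr_pdivlMr // mul1r.
have T_0 : 0 < r / cabs w by apply: lt_trans T_1.
have ia : isInt (al - al') by exists n. have ib : isInt (be - be') by exists nu.
have mP : measurable_fun setT (fun x : plane => cabs (toC x) < r / cabs w) by apply: measurable_cabs_ltr; exact: cmeas_toC.
have mw : cmeasC (fun t : C => w * t) by apply: cmeasM; [exact: cmeas_cst|exact: cmeas_toC].
have hw t : cabs t < r / cabs w -> cabs (w * t) <= r by rewrite ltr_pdivlMr // mulrC cabsM => /ltW.
have rr : 0 <= r < 1 by rewrite ltW.
have [c1 c2 e] := CI_expand mP mw (bint_intg T_0 ia ib ral rbe) hw (ltW r0) (summ_u pu rr) (summ_u pu' rr).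
split; first exact: c1.
rewrite [LHS]e {e c1}.
pose X p k : C := cb (1 - be) k * cz (1 - be') (k%:Z + N p) / (ga - p.1%:R + k%:R) *
    cexp (- (ga - p.1%:R + k%:R + (ga - p.1%:R + k%:R)) * (ln (r / cabs w))%:C).
have shiftI (p : nat * nat) : al + p.1%:R - (al' + p.2%:R) = (n + p.1%:Z - p.2%:Z)%:~R.
  rewrite !(intrD, intrN) -hn -[(p.1%:Z)%:~R]/(p.1%:R : C) -[(p.2%:Z)%:~R]/(p.2%:R : C); ring.
have shiftR (p : nat * nat) : 0 < cre (al + p.1%:R + (al' + p.2%:R)).
  rewrite (_ : _ + _ = al + al' + (p.1 + p.2)%:R); last by rewrite natrD; ring.
  by rewrite creD cre_nat ltr_wpDr.
have eX (p : nat * nat) k : cb (1 - be) k * cz (1 - be') (k%:Z + (- (n + p.1%:Z - p.2%:Z) - nu)) / (1 - (al + p.1%:R) - be + k%:R) *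
    cexp (- (1 - (al + p.1%:R) - be + k%:R + (1 - (al + p.1%:R) - be + k%:R)) * (ln (r / cabs w))%:C) = X p k.
  by rewrite /X /ga (_ : 1 - (al + p.1%:R) - be = 1 - al - be - p.1%:R); last ring.
have sX p : summ (X p).
  exact: (eq_summ (eX p) (summ_tail (al + p.1%:R) (n + p.1%:Z - p.2%:Z) nu rbe (ltW T_1))).
have eqf (p : nat * nat) : CI dA (onP (fun t => cabs t < r / cabs w) (fun t => bint al be al' be' t * ((w * t) ^+ p.1 * conjc (w * t) ^+ p.2))) =
   w ^+ p.1 * conjc w ^+ p.2 * (frakB (al + p.1%:R) be (al' + p.2%:R) be' - (-1) ^ nu * Pi * CS (X p)).
  have na1 : ~ isInt (al + p.1%:R) by have := nonint_int (n := p.1%:Z) nal.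
  have na2 : ~ isInt (al + p.1%:R + be).
    by rewrite (_ : _ + _ + _ = al + be + (p.1%:Z)%:~R); [exact: nonint_int|rewrite -[(p.1%:Z)%:~R]/(p.1%:R : C); ring].
  have := beta_partial (shiftI p) hnu (shiftR p) rbe na1 nbe na2 T_1.
  rewrite (eq_CS (eX p)) => <-.
  have i1 : isInt (al + p.1%:R - (al' + p.2%:R)) by rewrite shiftI; exact: isInt_int.
  have cb1 := bint_intg T_0 i1 ib (shiftR p) rbe.
  rewrite -CIZ //; apply: ae_eq_CI.
  - apply: (cmeas_onP mP); apply: (cmeasM (cmeasC_bint ia ib)).
    exact: (cmeasM (cmeas_exp _ mw) (cmeas_exp _ (cmeas_conj mw))).
  - exact: cintg_meas (cintgZ _ cb1).
  change (aeM dA (fun x => onP (fun t => cabs t < r / cabs w) (fun t => bint al be al' be' t * ((w * t) ^+ p.1 * conjc (w * t) ^+ p.2)) x =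
    w ^+ p.1 * conjc w ^+ p.2 * onP (fun t => cabs t < r / cabs w) (bint (al + p.1%:R) be (al' + p.2%:R) be') x)).
  apply: (aeM_imp (ae_toC_neq (0 : C))) => x t0; rewrite /onP; case: ifP => _; last by rewrite mulr0.
  rewrite /bint -(sum_ppow al al' p.1 p.2 t0) rmorphM !exprMn; ring.
pose good (p : nat * nat) := frakB al be al' be' * ((u p.1 * (poch al p.1 / poch (al + be) p.1) * w ^+ p.1) * (u' p.2 * (poch al' p.2 / poch (al' + be') p.2) * conjc w ^+ p.2)).
pose G (x : (nat * nat) * nat) := ppow rho%:C ga ga' * (q3 x * rho%:C ^+ deg x).
have rX m : cabs ((rho%:C : C) ^+ m) <= 1 by rewrite cabsX cabsR exprn_ile1.
have [_ cq eq3] := @CI_regroup _ _ _ cnt3 q3 deg (fun m => rho%:C ^+ m) md rX q3_intg.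
have cG : cintg cnt3 G by apply: cintgZ.
have split_ p : u p.1 * u' p.2 * CI dA (onP (fun t => cabs t < r / cabs w) (fun t => bint al be al' be' t * ((w * t) ^+ p.1 * conjc (w * t) ^+ p.2))) = good p - CI (cnt R) (fun k => G (p, k)).
  rewrite eqf frakB_shift //.
  have -> : CI (cnt R) (fun k => G (p, k)) = (-1) ^ nu * Pi * (u p.1 * w ^+ p.1 * (u' p.2 * conjc w ^+ p.2)) * CS (X p).
    rewrite -CSZ //; apply: eq_CS => k; rewrite /G -q3_rho // /X /s /=.
    by rewrite [RHS]mulrA.
  rewrite /good; move: (frakB _ _ _ _) (CS (X p)) ((-1) ^ nu) => x1 x2 x3; ring.
have pr (a0 b0 : C) (v : nat -> C) (w' : C) : (exists x, pbd v x) -> ~ isInt b0 -> cabs w' < 1 -> summ (fun m => v m * (poch a0 m / poch b0 m) * w' ^+ m).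
  by move=> [x px] nb hw'; have [y py] := pbd_pochratio a0 (nonint_add nb); exact: (pbd_geo (pbdM px py)).
have i3 : isInt (al + be - (al' + be')) by rewrite (_ : _ - _ = (al - al') + (be - be')); [exact: isIntD|ring].
have s1 := pr al _ u w pu nab w1.
have s2 := pr al' _ u' (conjc w) pu' (nonint_shift i3 nab) (ltac:(by rewrite cabs_conj)).
have [cg eg] := CS_mul s1 s2.
rewrite (eq_CI _ split_) CIB; [|exact: cintgZ|exact: (cintg_CI (m1 := cnt2) (m2 := cnt R) cG)].
rewrite CIZ // eg; congr (_ - _).
have -> : CI cnt2 (fun p => CI (cnt R) (fun k => G (p, k))) = CI cnt3 G by exact: (CI_fubini (m1 := cnt2) (m2 := cnt R) cG).
transitivity (ppow rho%:C ga ga' * CI cnt3 (fun x => q3 x * rho%:C ^+ deg x)); first exact: (CIZ _ cq).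
by rewrite eq3; congr (_ * _); apply: eq_CS => k; exact: mulrC.
Qed.
End InnerDisc.

(** * Adding one variable to the expansion *)

Section ExpansionStep.
Variable R : realType.
Local Notation C := R[i].
Local Notation dA := (mA R).
Local Notation plane := (measurableTypeR R * measurableTypeR R)%type.
Local Notation cnt2 := (prodm (cnt R) (cnt R)).

Lemma cintg_scale (c : C) (F : C -> C) : c != 0 -> cmeasC F -> cintg dA (fun x => F (toC x)) ->
  cintg dA (fun x => F (c * toC x)).
Proof.
move=> c0 mF [_ fin]; split; first by apply: cmeas_scaleC => //; exact: cmeas_toC.
have := @dA_scale R c (fun t => (cabs (F t))%:E) c0 (cmeas_absE mF) (fun t => ltac:(by rewrite lee_fin cabs_ge0)).
move=> ->; apply: lte_mul_pinfty => //; first by rewrite lee_fin invr_ge0 exprn_ge0 // cabs_ge0.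
Qed.

Lemma ppow_m1 (w : C) : w != 0 -> ppow w (-1) (-1) = (cabs w ^- 2)%:C.
Proof.
move=> w0; rewrite ppowN -[X in ppow _ X _]/(1%:R) -[X in ppow _ _ X]/(1%:R) ppow_nat // !expr1 mulcJ.
by rewrite -fmorphV.
Qed.

Lemma CI_onP_split (P : C -> bool) (F : plane -> C) :
  cintg dA (fun x => if P (toC x) then F x else 0) -> cintg dA (fun x => if ~~ P (toC x) then F x else 0) ->
  CI dA F = CI dA (fun x => if P (toC x) then F x else 0) + CI dA (fun x => if ~~ P (toC x) then F x else 0).
Proof. by move=> h1 h2; rewrite -CID //; apply: eq_CI => x; case: (P _); rewrite ?addr0 ?add0r. Qed.

Lemma bint_ppow (al be al' be' s s' t : C) :
  bint al be al' be' t * ppow t s s' = bint (al + s) be (al' + s') be' t.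
Proof. by rewrite /bint mulrAC -ppowD; congr (_ * _); apply: eq_ppow; ring. Qed.

Variables a B a' B' : nat -> C.
Local Notation hb := (hb a B a' B').
Local Notation Gi := (Gi a B a' B').
Local Notation Ji := (Ji a B a' B').
Local Notation ints := (ints a B a' B').
Local Notation ra := (cre_a a a').
Local Notation rb := (cre_ba a B a' B').
Local Notation rB := (cre_B B B').

Lemma hb_far_expand x t nu : B x - a x - (B' x - a' x) = nu%:~R -> 1 < cabs t ->
  hb x t = (-1) ^ nu * ppow t (B x - 2%:R) (B' x - 2%:R) *
    (CS (fun k => cb (1 - (B x - a x)) k * t^-1 ^+ k) * CS (fun k => cb (1 - (B' x - a' x)) k * conjc t^-1 ^+ k)).
Proof.
move=> hnu t1; have t0 : t != 0 by rewrite -cabs_gt0; apply: lt_trans t1.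
rewrite /hb (bint_far (a x) (a' x) hnu t0 t1); congr (_ * _ * _); apply: eq_ppow; ring.
Qed.

Lemma hbG_intg x l z : ints [:: 0%N, x & l] -> z != 0 -> (Ji (x :: l) z < +oo)%E ->
  cintg dA (fun v => hb x (toC v * z^-1) * Gi l (toC v)).
Proof.
move=> h z0 fin; have [i1 i2] := ints_hb h.
have z2 : 0 < cabs z ^- 2 by rewrite invr_gt0 exprn_gt0 // cabs_gt0.
apply: (cintg_le (g := fun v : plane => ((cabs (hb x (toC v * z^-1)))%:E * Ji l (toC v))%E)).
- apply: cmeasM; last exact: (cmeasC_Gi (ints_behead h)).
  by apply: cmeas_scaleC; [exact: cmeasC_hb|exact: cmeas_toC|exact: cmeas_cst].
- exact: (meC_hbJ _ h).
- move=> v; rewrite cabsM EFinM; apply: lee_wpmul2l; first by rewrite lee_fin cabs_ge0.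
  exact: Gi_le (ints_behead h).
move: fin; rewrite (Ji_scale h z0).
have gen (e : \bar R) : (0 <= e -> (cabs z ^- 2)%:E * e < +oo -> e < +oo)%E.
  case: e => [e| |]; [by move=> _ _; exact: ltry| |by []].
  by move=> _; rewrite gt0_muley // lte_fin.
by apply: gen; apply: integral_ge0 => v _; exact: hbJ_ge0.
Qed.

(* On |t| >= r / |w| the weight is expanded in powers of 1 / t; after t = v / w
   only the factor [ppow w (1 - B x) (1 - B' x)] and powers of w are left. *)
Lemma outer_term x l z r : ints [:: 0%N, x & l] -> 0 < cabs z -> cabs z < r -> (Ji (x :: l) z < +oo)%E ->
  exists2 h, summ h & forall rho : R, rho != 0 -> `|rho| <= 1 -> let w := rho%:C * z in
  let F := onP (fun t => r / cabs w <= cabs t) (fun t => hb x t * Gi l (w * t)) in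
  cintg dA F /\ CI dA F = ppow rho%:C (1 - B x) (1 - B' x) * CS (fun k => h k * rho%:C ^+ k).
Proof.
move=> h z0 zr fin; have [i1 i2] := ints_hb h; have h' := ints_behead h.
have [_ iB] : isInt (a x - a' x) /\ isInt (B x - B' x) by apply: h; rewrite !in_cons eqxx orbT.
have [nu hnu] := i2.
have zn : z != 0 by rewrite -cabs_gt0.
have r0 : 0 < r by apply: lt_trans zr.
pose P (v : C) := r <= cabs v.
pose g v := ppow v (B x - 2%:R) (B' x - 2%:R) * Gi l v.
have iB2 : isInt (B x - 2%:R - (B' x - 2%:R)) by rewrite (_ : _ - _ = B x - B' x) //; ring.
have mP : measurable_fun setT (fun v : plane => P (toC v)) by apply: measurable_fun_ler => //; exact/cmeas_abs/cmeas_toC.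
have mg : cmeasC g by apply: cmeasM; [exact: cmeasC_ppow|exact: cmeasC_Gi h'].
have ci_g : cintg dA (onP P g).
  (* Integrability of g on |v| >= r is inherited from finiteness at z, since there the weight at v /
     z is at least D |v|^(rB x - 4). *)
  have tau : 1 < r / cabs z by rewrite ltr_pdivlMr // mul1r.
  have [k k0 hk] := hb_far i1 i2 tau.
  pose D := k * cabs z^-1 `^ (rB x - 4).
  have D0 : 0 < D by rewrite mulr_gt0 // powR_gt0 // cabs_gt0 invr_eq0.
  apply: cintg_dom (cintgZ (D^-1)%:C (hbG_intg h zn fin)); first exact: cmeas_onP.
  move=> v; rewrite /onP /P; case: ifP => hv; last by rewrite cabs0 cabs_ge0.
  have vn : toC v != 0 by rewrite -cabs_gt0; apply: lt_le_trans hv.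
  have vt : r / cabs z <= cabs (toC v * z^-1) by rewrite cabsM cabsV ler_pM2r // invr_gt0.
  have [b _] := hk _ vt.
  rewrite /g (cabsM (ppow _ _ _)) (cabsM _ (hb _ _ * _)) (cabsM (hb _ _)) cabsR gtr0_norm ?invr_gt0 // [leRHS]mulrA.
  apply: ler_wpM2r; first exact: cabs_ge0.
  rewrite mulrC ler_pdivlMr // cabs_ppow // (_ : cre _ = rB x - 4); last first.
    rewrite (_ : _ + _ = B x + B' x - 4%:R); first by rewrite creB cre_nat.
    by rewrite -[4%N]/(2 + 2)%N natrD; ring.
  apply: le_trans b; rewrite cabsM (powRM _ (cabs_ge0 _) (cabs_ge0 _)) /D le_eqVlt; apply/orP; left; apply/eqP.
  move: (cabs _ `^ _) (cabs _ `^ _) => *; ring.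
have mw : cmeasC (fun v : C => z * v^-1) by apply: cmeasM; [exact: cmeas_cst|apply: cmeasV; exact: cmeas_toC].
pose rho0 := cabs z / r.
have rho00 : 0 <= rho0 by rewrite divr_ge0 // ltW.
have rho01 : rho0 < 1 by rewrite ltr_pdivrMr // mul1r.
have hw v : P v -> cabs (z * v^-1) <= rho0.
  by rewrite /P => hv; rewrite cabsM cabsV ler_pM2l // lef_pV2 ?posrE // (lt_le_trans r0).
pose c k : C := cb (1 - (B x - a x)) k. pose c' k : C := cb (1 - (B' x - a' x)) k.
have sc (s : C) (rho : R) : `|rho| <= 1 -> summ (fun k => cb s k * rho%:C ^+ k * rho0%:C ^+ k).
  move=> rho1; have : summ (fun k => cb s k * rho0%:C ^+ k) by apply: summ_binS; rewrite cabsR ger0_norm.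
  have le1 (x1 x2 x3 : C) : cabs x2 <= 1 -> cabs (x1 * x2 * x3) <= cabs (x1 * x3).
    by move=> h1; rewrite !cabsM -mulrA; apply: ler_wpM2l; [exact: cabs_ge0|apply: ler_piMl; [exact: cabs_ge0|]].
  by apply: summ_dom => k; apply: le1; rewrite cabsX cabsR exprn_ile1.
have ex rho (rho1 : `|rho| <= 1) := CI_expand mP mw ci_g hw rho00 (sc (1 - (B x - a x)) rho rho1) (sc (1 - (B' x - a' x)) rho rho1).
pose f (p : nat * nat) := onP P (fun v => g v * ((z * v^-1) ^+ p.1 * conjc (z * v^-1) ^+ p.2)).
pose K0 : C := (-1) ^ nu * ppow z (1 - B x) (1 - B' x).
pose q (p : nat * nat) := K0 * (c p.1 * c' p.2 * CI dA (f p)).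
pose deg (p : nat * nat) := (p.1 + p.2)%N.
have md : measurable_fun setT deg by exact: measurable_nat2.
have cq : cintg cnt2 q.
  have [_ c2 _] := ex 1 (ltac:(by rewrite normr1)).
  by apply: cintgZ; apply: cintg_ext c2 => p; rewrite !expr1n !mulr1.
exists (fun k => CI cnt2 (fun p => if deg p == k then q p else 0)).
  by have [] := @CI_regroup _ _ _ cnt2 q deg (fun=> 0) md (ltac:(by move=> m; rewrite cabs0)) cq.
move=> rho rn rho1 w F.
have rc0 : (rho%:C : C) != 0 by rewrite -cabs_gt0 cabsR normr_gt0.
have wn : w != 0 by rewrite mulf_neq0.
have cw : 0 < cabs w by rewrite cabs_gt0.
have wz : cabs w <= cabs z by rewrite cabsM cabsR ler_piMl // cabs_ge0.
have [c1 c2 e] := ex rho rho1.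
pose H v : C := if P v then g v * (CS (fun k => c k * rho%:C ^+ k * (z * v^-1) ^+ k) * CS (fun k => c' k * rho%:C ^+ k * conjc (z * v^-1) ^+ k)) else 0.
have mH : cmeasC H := cintg_meas c1.
pose Kw : C := (-1) ^ nu * ppow w (2%:R - B x) (2%:R - B' x).
have iB3 : isInt (B' x - B x) by rewrite -opprB; exact: isIntN.
have eF t : F t = Kw * H (w * toC t).
  rewrite /F /onP /H /P cabsM -(ler_pdivrMl _ _ cw) mulrC.
  case: ifP => ht; last by rewrite mulr0.
  have t1 : 1 < cabs (toC t).
    by apply: lt_le_trans ht; rewrite mulrC ltr_pdivlMr // mul1r; apply: le_lt_trans zr.
  have tn : toC t != 0 by rewrite -cabs_gt0; apply: lt_trans t1.
  rewrite (hb_far_expand hnu t1) /g /Kw ppowM // -/(c _).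
  have -> : ppow w (2%:R - B x) (2%:R - B' x) = (ppow w (B x - 2%:R) (B' x - 2%:R))^-1.
    by rewrite -ppowN; apply: eq_ppow; ring.
  have et : rho%:C * (z * (w * toC t)^-1) = (toC t)^-1 by rewrite /w; field; rewrite tn rc0 zn.
  have cr : conjc (rho%:C : C) = rho%:C by rewrite conjc_real.
  have cM (x1 y1 : C) : conjc (x1 * y1) = conjc x1 * conjc y1 by exact: rmorphM.
  have e1 : CS (fun k => c k * rho%:C ^+ k * (z * (w * toC t)^-1) ^+ k) = CS (fun k => c k * (toC t)^-1 ^+ k).
    by apply: eq_CS => k; rewrite -mulrA -exprMn et.
  have e2 : CS (fun k => c' k * rho%:C ^+ k * conjc (z * (w * toC t)^-1) ^+ k) = CS (fun k => c' k * conjc (toC t)^-1 ^+ k).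
    by apply: eq_CS => k; rewrite -mulrA -exprMn -[in RHS]et [in RHS]cM [in RHS]cr.
  have p0 := ppow_neq0 w (B x - 2%:R) (B' x - 2%:R).
  have id4 (x1 x2 x3 x4 x4' x5 x5' x6 : C) : x1 != 0 -> x4' = x4 -> x5' = x5 ->
      x3 * x2 * (x4 * x5) * x6 = x3 / x1 * (x1 * x2 * x6 * (x4' * x5')) by move=> h1 -> ->; field.
  exact: id4 p0 e1 e2.
have cH := cintg_scale wn mH c1.
split; first by apply: cintg_ext (cintgZ Kw cH) => t; rewrite eF.
rewrite (eq_CI _ eF) CIZ // (CI_scale wn mH).
have -> : CI dA (fun x0 => H (toC x0)) = CI cnt2 (fun p => c p.1 * rho%:C ^+ p.1 * (c' p.2 * rho%:C ^+ p.2) * CI dA (f p)) := e.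
have rX m : cabs ((rho%:C : C) ^+ m) <= 1 by rewrite cabsX cabsR exprn_ile1.
have [_ cq2 eq3] := @CI_regroup _ _ _ cnt2 q deg (fun m => rho%:C ^+ m) md rX cq.
have K00 : K0 != 0 by rewrite mulf_neq0 ?ppow_neq0 // expfz_neq0 // oppr_eq0 oner_eq0.
(* The Jacobian |w|^-2 is [ppow w (-1) (-1)], which lowers the exponents from 2 - B x to 1 - B x. *)
have eK : Kw * (cabs w ^- 2)%:C = ppow rho%:C (1 - B x) (1 - B' x) * K0.
  transitivity ((-1) ^ nu * ppow w (1 - B x) (1 - B' x)).
    rewrite -ppow_m1 // /Kw -mulrA -ppowD; congr (_ * _); apply: eq_ppow; ring.
  have i4 : isInt (1 - B x - (1 - B' x)) by rewrite (_ : _ - _ = B' x - B x) //; ring.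
  by rewrite /w (ppowM rc0 zn i4) /K0 mulrCA.
rewrite mulrA eK -mulrA; congr (_ * _).
have -> : CS (fun k => CI cnt2 (fun p => if deg p == k then q p else 0) * rho%:C ^+ k) = CI cnt2 (fun p => q p * rho%:C ^+ deg p).
  by rewrite eq3; apply: eq_CS => k; rewrite mulrC.
rewrite -CIZ //; first by apply: eq_CI => p; rewrite /q /deg exprD; ring.
Qed.

(** The coefficients of u_0 and F_j in uniform notation: with B_0 = 1 among the lower parameters,
    the index i = j supplies the factorial, and i = 0 supplies 2 - B_j when j is not 0. *)
Definition useq (al Be : nat -> C) (K : seq nat) j m : C :=
  \prod_(i <- K) (poch (al i - Be j + 1) m / poch (Be i - Be j + 1) m).
Definition base j : C := minus1pow (B j - B' j - a j + a' j) * frakB (B j - 1) (1 - a 0%N) (B' j - 1) (1 - a' 0%N).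
(** The constants lambda_0 and lambda_j in a form that grows by one beta value per variable. *)
Definition muj l j : C := (if j == 0%N then 1 else base j) *
  \prod_(i <- l | i != j) frakB (a i - B j + 1) (B i - a i) (a' i - B' j + 1) (B' i - a' i).
Definition term K l j z : C := muj l j * ppow z (1 - B j) (1 - B' j) *
  (CS (fun m => useq a B K j m * z ^+ m) * CS (fun m => useq a' B' K j m * conjc z ^+ m)).

Definition nonres (K : seq nat) :=
  (forall i j, i \in K -> j \in K -> ~ isInt (a i - B j)) /\
  (forall i j, i \in K -> j \in K -> i != j -> ~ isInt (B i - B j)).

Lemma nonint_p1 (s : C) : ~ isInt s -> ~ isInt (s + 1).
Proof. by move=> h; have := nonint_int (n := 1) h. Qed.

Lemma pbd_useq (al Be : nat -> C) K j : (forall i, i \in K -> i != j -> ~ isInt (Be i - Be j)) ->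
  exists x, pbd (useq al Be K j) x.
Proof.
move=> h; apply: pbd_prod => i iK; apply: pbd_pochratio => k.
have [->|ij] := eqVneq i j; last by apply: nonint_add; apply: nonint_p1; exact: h.
by rewrite subrr add0r nat1r natC_neq0.
Qed.

Hypotheses (B0 : B 0%N = 1) (B0' : B' 0%N = 1).

(** The tail for the exponent of j carries the power (1 - B j) + (B j - B x) = 1 - B x, the same for
    every j; so all tails merge with the outer part into the one unidentified series [h]. *)
Lemma Gi_step x l z : x \notin 0%N :: l -> ints [:: 0%N, x & l] -> nonres [:: 0%N, x & l] ->
  (forall w, 0 < cabs w < 1 -> Gi l w = \sum_(j <- 0%N :: l) term (0%N :: l) l j w) ->
  0 < cabs z < 1 -> (Ji (x :: l) z < +oo)%E ->
  exists2 h, summ h & forall rho : R, rho != 0 -> `|rho| <= 1 ->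
    Gi (x :: l) (rho%:C * z) = \sum_(j <- 0%N :: l) term [:: 0%N, x & l] (x :: l) j (rho%:C * z) +
      ppow rho%:C (1 - B x) (1 - B' x) * CS (fun k => h k * rho%:C ^+ k).
Proof.
move=> xl h [nr1 nr2] IH zb fin; have /andP[z0 z1] := zb.
have [i1 i2] := ints_hb h; have h' := ints_behead h.
have [re1 re2] := Ji_re B0 B0' h zb fin.
pose r := (1 + cabs z) / 2; have zr : cabs z < r by rewrite /r; lra.
have r1 : r < 1 by rewrite /r; lra.
have zn : z != 0 by rewrite -cabs_gt0.
have [ho sho hho] := outer_term h z0 zr fin.
have memx j : j \in 0%N :: l -> j \in [:: 0%N, x & l].
  by rewrite !in_cons => /orP[->//|->]; rewrite !orbT.
have xm : x \in [:: 0%N, x & l] by rewrite !in_cons eqxx orbT.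
pose al j := a x - B j + 1. pose al' j := a' x - B' j + 1.
pose be := B x - a x. pose be' := B' x - a' x.
have iB j : j \in 0%N :: l -> isInt (B j - B' j) by move=> /memx /h [].
have ial j : j \in 0%N :: l -> isInt (al j - al' j).
  move=> jl; rewrite (_ : _ - _ = (a x - a' x) - (B j - B' j)); last by rewrite /al /al'; ring.
  by apply: isIntB => //; exact: iB.
have [nu hnu] := i2.
have inner j : exists hj, j \in 0%N :: l -> summ hj /\ forall rho : R, rho != 0 -> `|rho| <= 1 -> let w := rho%:C * z in
  let F := onP (fun t => cabs t < r / cabs w) (fun t => bint (al j) be (al' j) be' t *
    (CS (fun m => useq a B (0%N :: l) j m * (w * t) ^+ m) * CS (fun m => useq a' B' (0%N :: l) j m * conjc (w * t) ^+ m))) in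
  cintg dA F /\
  CI dA F = frakB (al j) be (al' j) be' * (CS (fun m => useq a B (0%N :: l) j m * (poch (al j) m / poch (al j + be) m) * w ^+ m) *
      CS (fun m => useq a' B' (0%N :: l) j m * (poch (al' j) m / poch (al' j + be') m) * conjc w ^+ m))
    - ppow rho%:C (1 - al j - be) (1 - al' j - be') * CS (fun k => hj k * rho%:C ^+ k).
  case: (boolP (j \in 0%N :: l)) => jl; last by exists (fun=> 0).
  have jm := memx j jl; have jx : x != j by apply: contraNneq xl => ->.
  have [n hn] := ial j jl.
  have ral : 0 < cre (al j + al' j).
    have := re1 j jl; rewrite /cre_a /cre_B /al /al'.
    rewrite (_ : a x - B j + 1 + _ = a x + a' x + 2%:R - (B j + B' j)); last by rewrite -[2%:R]/(1 + 1); ring.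
    by rewrite (creB (a x + a' x + 2%:R)) (creD (a x + a' x)) cre_nat.
  have nal : ~ isInt (al j) by apply: nonint_p1; exact: nr1.
  have nbe : ~ isInt be.
    by move=> hbe; apply: (nr1 x x xm xm); rewrite -opprB; exact: isIntN.
  have nab : ~ isInt (al j + be).
    rewrite (_ : _ + _ = B x - B j + 1); last by rewrite /al /be; ring.
    by apply: nonint_p1; exact: nr2.
  have p1 : exists y, pbd (useq a B (0%N :: l) j) y.
    by apply: pbd_useq => i il ij; apply: nr2 => //; exact: memx.
  have p2 : exists y, pbd (useq a' B' (0%N :: l) j) y.
    apply: pbd_useq => i il ij; apply: (@nonint_shift _ (B i - B j)); last by apply: nr2 => //; exact: memx.
    by rewrite (_ : _ - _ = (B i - B' i) - (B j - B' j)); [apply: isIntB; exact: iB|ring].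
  have [hj s1 s2] := inner_term hn hnu ral re2 nal nbe nab z0 zr r1 p1 p2.
  by exists hj.
have [hj Hj] := boolp.choice inner.
pose cj j := muj l j * ppow z (1 - B j) (1 - B' j) : C.
(* The tails enter with the minus sign of [beta_partial]. *)
exists (fun k => ho k - \sum_(j <- 0%N :: l) cj j * hj j k).
  apply: summB => //; rewrite (_ : (fun k => _) = (fun k => \sum_(j <- 0%N :: l | j \in 0%N :: l) cj j * hj j k)); last first.
    by apply/funext => k; rewrite big_seq_cond; apply: eq_bigl => j; rewrite andbT.
  by apply: cintg_sum => j jl; apply: summZ; have [] := Hj j jl.
move=> rho rn rho1; set w := rho%:C * z.
have rc0 : (rho%:C : C) != 0 by rewrite -cabs_gt0 cabsR normr_gt0.
have wn : w != 0 by rewrite mulf_neq0.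
have cw : 0 < cabs w by rewrite cabs_gt0.
have wz : cabs w <= cabs z by rewrite cabsM cabsR ler_piMl // cabs_ge0.
pose P (t : C) := cabs t < r / cabs w.
have mP : measurable_fun setT (fun t : plane => P (toC t)) by apply: measurable_cabs_ltr; exact: cmeas_toC.
have [co eo] := hho rho rn rho1.
pose Fj j := onP P (fun t => bint (al j) be (al' j) be' t *
    (CS (fun m => useq a B (0%N :: l) j m * (w * t) ^+ m) * CS (fun m => useq a' B' (0%N :: l) j m * conjc (w * t) ^+ m))).
pose dj j := muj l j * ppow w (1 - B j) (1 - B' j) : C.
pose S x := \sum_(j <- 0%N :: l | j \in 0%N :: l) dj j * Fj j x.
have cS : cintg dA S by apply: cintg_sum => j jl; apply: cintgZ; have [_ /(_ rho rn rho1)[]] := Hj j jl.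
have mI : cmeas (fun t : plane => if P (toC t) then hb x (toC t) * Gi l (w * toC t) else 0).
  apply: cmeas_if; [exact: mP| |exact: cmeas_cst].
  apply: cmeasM; first exact: cmeasC_hb.
  by apply: cmeas_scaleC; [exact: (cmeasC_Gi h')|exact: cmeas_cst|exact: cmeas_toC].
(* On the inner disc |w t| < r < 1, so off t = 0 the known expansion of the inner integral applies
   to [Gi l (w t)]. *)
have ae : aeM dA (fun t => (if P (toC t) then hb x (toC t) * Gi l (w * toC t) else 0) = S t).
  apply: (aeM_imp (ae_toC_neq (0 : C))) => t tn; rewrite /S /Fj /onP; case: ifP => Pt; last first.
    by rewrite big1 // => j _; rewrite mulr0.
  have wt : 0 < cabs (w * toC t) < 1.
    rewrite cabs_gt0 mulf_neq0 //= cabsM mulrC.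
    by apply: lt_trans r1; move: Pt; rewrite /P ltr_pdivlMr.
  rewrite IH // mulr_sumr big_seq; apply: eq_bigr => j jl.
  rewrite /term /dj ppowM //; last first.
    by rewrite (_ : _ - _ = - (B j - B' j)); [apply: isIntN; exact: iB|ring].
  have -> : bint (al j) be (al' j) be' (toC t) = hb x (toC t) * ppow (toC t) (1 - B j) (1 - B' j).
    rewrite (_ : al j = a x + (1 - B j)); last by rewrite /al; ring.
    rewrite (_ : al' j = a' x + (1 - B' j)); last by rewrite /al'; ring.
    by rewrite -bint_ppow.
  move: (muj _ _) (hb _ _) (ppow w _ _) (ppow (toC t) _ _) (CS _) (CS _) => x1 x2 x3 x4 x5 x6; ring.
have cI := cintg_ae_eq mI ae cS.
have eout t : (if ~~ P (toC t) then hb x (toC t) * Gi l (w * toC t) else 0) = onP (fun t => r / cabs w <= cabs t) (fun t => hb x t * Gi l (w * t)) t.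
  by rewrite /onP /P -leNgt.
rewrite [LHS](CI_onP_split cI); last by apply: cintg_ext co => t; rewrite eout.
transitivity (CI dA S + ppow rho%:C (1 - B x) (1 - B' x) * CS (fun k => ho k * rho%:C ^+ k)).
  congr (_ + _); first exact: (ae_eq_CI mI (cintg_meas cS) ae).
  by rewrite -eo; apply: eq_CI => t; rewrite eout.
rewrite /S CI_sum; last first.
  by move=> j jl; apply: cintgZ; have [_ /(_ rho rn rho1)[]] := Hj j jl.
have -> : CS (fun k => (ho k - \sum_(j <- 0%N :: l) cj j * hj j k) * rho%:C ^+ k) =
  CS (fun k => ho k * rho%:C ^+ k) - \sum_(j <- 0%N :: l) cj j * CS (fun k => hj j k * rho%:C ^+ k).
  have s1 (v : nat -> C) : summ v -> summ (fun k => v k * rho%:C ^+ k).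
    by apply: summ_dom => k; rewrite cabsM -[leRHS]mulr1; apply: ler_wpM2l; [exact: cabs_ge0|rewrite cabsX cabsR exprn_ile1].
  have sj j : j \in 0%N :: l -> summ (fun k => cj j * (hj j k * rho%:C ^+ k)).
    by move=> jl; apply: summZ; apply: s1; have [] := Hj j jl.
  have e1 : CS (fun k => \sum_(j <- 0%N :: l | j \in 0%N :: l) cj j * (hj j k * rho%:C ^+ k)) = \sum_(j <- 0%N :: l) cj j * CS (fun k => hj j k * rho%:C ^+ k).
    rewrite [RHS]big_seq /CS CI_sum // ; apply: eq_bigr => j jl; rewrite CIZ //.
    by apply: s1; have [] := Hj j jl.
  rewrite -e1 -CSB; [|exact: s1|exact: cintg_sum].
  apply: eq_CS => k; rewrite mulrBl; congr (_ - _); rewrite mulr_suml big_seq.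
  by apply: eq_bigr => j _; rewrite mulrA.
rewrite -big_seq mulrBr mulr_sumr [RHS]addrCA [LHS]addrC; congr (_ + _).
rewrite -sumrB; apply: eq_big_seq => j jl.
have [_ /(_ rho rn rho1)[_ ej]] := Hj j jl.
rewrite CIZ; last by have [_ /(_ rho rn rho1)[]] := Hj j jl.
rewrite [CI dA _]ej mulrBr; congr (_ - _).
  rewrite /dj /term.
  have jx : x != j by apply: contraNneq xl => ->.
  have -> : muj (x :: l) j = muj l j * frakB (al j) be (al' j) be'.
    by rewrite /muj big_cons jx /al /be /al' /be'; ring.
  have eu (aa BB : nat -> C) m : useq aa BB (0%N :: l) j m * (poch (aa x - BB j + 1) m / poch (aa x - BB j + 1 + (BB x - aa x)) m) = useq aa BB [:: 0%N, x & l] j m.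
    rewrite /useq !big_cons (_ : aa x - BB j + 1 + (BB x - aa x) = BB x - BB j + 1); last by ring.
    by rewrite mulrAC -mulrA; congr (_ * _); rewrite mulrC.
  rewrite (eq_CS (v := fun m => useq a B [:: 0%N, x & l] j m * w ^+ m)); last by move=> m; rewrite eu.
  rewrite [X in _ * (_ * (_ * X))](eq_CS (v := fun m => useq a' B' [:: 0%N, x & l] j m * conjc w ^+ m)); last by move=> m; rewrite eu.
  move: (muj _ _) (frakB _ _ _ _) (ppow _ _ _) (CS _) (CS _) => x1 x2 x3 x4 x5; ring.
rewrite /dj /cj /w ppowM //; last first.
  by rewrite (_ : _ - _ = - (B j - B' j)); [apply: isIntN; exact: iB|ring].
have -> : ppow rho%:C (1 - B x) (1 - B' x) = ppow rho%:C (1 - B j) (1 - B' j) * ppow rho%:C (1 - al j - be) (1 - al' j - be').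
  by rewrite -ppowD; apply: eq_ppow; rewrite /al /be /al' /be'; ring.
move: (muj _ _) (ppow _ _ _) (ppow _ _ _) (ppow _ _ _) (CS _) => x1 x2 x3 x4 x5; ring.
Qed.
End ExpansionStep.

(** * A reflection symmetry of the beta values *)

Section BetaSymmetry.
Variable R : realType.
Local Notation C := R[i].
Local Notation Pi := ((pi : R)%:C : C).

Lemma minus1pow_int (k : int) : minus1pow (k%:~R : C) = (-1) ^ k.
Proof.
rewrite /minus1pow mulrC cexpMz; congr (_ ^ k).
rewrite /cexp; have -> : cre ('i * Pi) = 0 by rewrite creM /= mul0r mulr0 subr0.
have -> : cim ('i * Pi) = pi by rewrite cimM /= mul1r mulr0 add0r.
by rewrite expR0 cospi sinpi mul1r; apply: ceqP; rewrite ?creN ?cimN /= ?oppr0.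
Qed.

Lemma ppow_neg1 (s s' : C) (k : int) : s - s' = k%:~R -> ppow (-1) s s' = (-1) ^ k.
Proof.
move=> h; have n0 : (-1 : C) != 0 by rewrite oppr_eq0 oner_eq0.
by rewrite (ppowE n0 h) cabsN cabs1 ln1 mulr0 cexp0 mul1r divr1.
Qed.

(** Serves to recognise [base] after inversion, which replaces an argument al by 1 - al - be. It is
    the Gamma reflection formula at al and 1 - al - be, plain and tilde; the sign comes from integer
    shifts of the sines. *)
Lemma frakB_reflect (al be al' be' : C) (k : int) : isInt (al - al') -> be - be' = k%:~R ->
  ~ isInt al -> ~ isInt be -> ~ isInt (al + be) ->
  frakB (1 - al - be) be (1 - al' - be') be' = (-1) ^ k * frakB al be al' be'.
Proof.
move=> [n hn] hk na nb nab.
have e1 : al' = al - n%:~R by rewrite -hn; ring.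
have e2 : be' = be - k%:~R by rewrite -hk; ring.
have na' : ~ isInt al' by apply: nonint_shift na; exists n.
have nb' : ~ isInt be' by apply: nonint_shift nb; exists k.
have nab' : ~ isInt (al' + be').
  by apply: nonint_shift nab; rewrite (_ : _ - _ = (al - al') + (be - be')); [rewrite hn hk; apply: isIntD; exact: isInt_int|ring].
have ng : ~ isInt (1 - al - be) by rewrite (_ : _ - be = 1 - (al + be)); [exact: nonint_1B|ring].
have ng' : ~ isInt (1 - al' - be') by rewrite (_ : _ - be' = 1 - (al' + be')); [exact: nonint_1B|ring].
have ngb : ~ isInt (1 - al' - be' + be') by rewrite subrK; exact: nonint_1B.
rewrite !frakB_formula // !subrK.
have -> : 1 - (1 - al' - be') - be' = al' by ring.
have -> : al + be = 1 - (1 - al - be) by ring.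
have r1 := cGamma_reflect na; have r2 := cGamma_reflect na'.
have r3 := cGamma_reflect ng; have r4 := cGamma_reflect ng'.
have s1 : csin (Pi * al) = (-1) ^ n * csin (Pi * al') by rewrite -csin_int e1 subrK.
have s2 : csin (Pi * (1 - al' - be')) = (-1) ^ (n + k) * csin (Pi * (1 - al - be)).
  by rewrite -csin_int e1 e2 intrD; congr (csin (_ * _)); ring.
have P0 : Pi != 0 by rewrite -cabs_gt0 cabsR normr_gt0 gt_eqF // pi_gt0.
have nz (s : C) : ~ isInt s -> cGamma s != 0 /\ cGamma (1 - s) != 0.
  by move=> h; split; apply: cGamma_ne => //; exact: nonint_1B.
have [g1 g2] := nz _ na; have [g3 g4] := nz _ na'; have [g5 g6] := nz _ ng; have [g7 g8] := nz _ ng'.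
have [g9 g10] := nz _ nb; have [g11 g12] := nz _ nb'.
rewrite s1 in r1; rewrite s2 in r4.
have N1 : (-1 : C) != 0 by rewrite oppr_eq0 oner_eq0.
have sq : ((-1 : C) ^ n) * (-1) ^ n = 1 by rewrite -expfzMl mulrNN mulr1 exp1rz.
rewrite expfzDr // in r4.
move: P0 g1 g2 g3 g4 g5 g6 g7 g8 g9 g10 g11 g12 r1 r2 r3 r4 sq.
move: (cGamma al) (cGamma (1 - al)) (cGamma al') (cGamma (1 - al')) => A1 A2 A3 A4.
move: (cGamma (1 - al - be)) (cGamma (1 - (1 - al - be))) (cGamma (1 - al' - be')) (cGamma (1 - (1 - al' - be'))) => G1 G2 G3 G4.
move: (cGamma be) (cGamma (1 - be')) (cGamma be') (cGamma (1 - be)) => D1 D2 D3 D4.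
move: (csin (Pi * al')) (csin (Pi * (1 - al - be))) ((-1) ^ n) ((-1) ^ k) => S1 S2 X Y.
move: Pi => P P0 g1 g2 g3 g4 g5 g6 g7 g8 g9 g10 g11 g12 r1 r2 r3 r4 sq.
have S10 : S1 != 0 by apply: contraNneq P0 => e; rewrite -r2 e mulr0.
have S20 : S2 != 0 by apply: contraNneq P0 => e; rewrite -r3 e mulr0.
have X0 : X != 0 by apply: contraTneq isT => e; move/eqP: sq; rewrite e mul0r eq_sym oner_eq0.
(* The four reflection identities, multiplied so that the sines cancel. *)
have key : G1 * G2 * A3 * A4 = Y * (A1 * A2 * G3 * G4).
  apply: (mulIf S10); apply: (mulIf S20).
  transitivity (G1 * G2 * S2 * (A3 * A4 * S1)); first ring.
  rewrite r3 r2 -{1}r1 -r4.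
  by transitivity (Y * (A1 * A2 * G3 * G4) * S1 * S2 * (X * X)); [ring|rewrite sq mulr1].
transitivity (P * D1 / D2 * (G1 * G2 * A3 * A4) / (A2 * G4 * G2 * A4)).
  by field; rewrite g2 g8 g12 g6 g4.
by rewrite key; field; rewrite g2 g8 g12 g6 g4.
Qed.
End BetaSymmetry.

(** * One variable: the substitution t -> 1 / (w t) *)

Section Inversion.
Variable R : realType.
Local Notation C := R[i].
Local Notation dA := (mA R).
Local Notation plane := (measurableTypeR R * measurableTypeR R)%type.
Variables (a B a' B' : nat -> C) (x : nat).
Hypotheses (x0 : x != 0%N) (B0 : B 0%N = 1) (B0' : B' 0%N = 1).
Hypothesis hI : ints a B a' B' [:: 0%N; x].

(* parameters of the integral after the substitution t -> 1 / (w t) *)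
Definition inva (al Be : nat -> C) (i : nat) : C := if i == 0%N then al x - Be x + 1 else al 0%N - Be x + 1.
Definition invB (Be : nat -> C) (i : nat) : C := if i == 0%N then 1 else 2%:R - Be x.
Local Notation a2 := (inva a B).
Local Notation B2 := (invB B).
Local Notation a2' := (inva a' B').
Local Notation B2' := (invB B').

Let iax : isInt (a x - a' x). Proof. by have [] := hI (ltac:(by rewrite !in_cons eqxx orbT) : x \in [:: 0%N; x]). Qed.
Let iBx : isInt (B x - B' x). Proof. by have [] := hI (ltac:(by rewrite !in_cons eqxx orbT) : x \in [:: 0%N; x]). Qed.
Let ia0 : isInt (a 0%N - a' 0%N). Proof. by have [] := hI (mem_head _ _). Qed.

Lemma inv_ints : ints a2 B2 a2' B2' [:: 0%N; x].
Proof.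
move=> i; rewrite !in_cons in_nil orbF => /orP[/eqP ->|/eqP ->]; rewrite /inva /invB /= ?(negbTE x0).
  split; last by rewrite subrr; exact: (isInt_nat R 0).
  by rewrite (_ : _ - _ = (a x - a' x) - (B x - B' x)); [exact: isIntB|ring].
split.
  by rewrite (_ : _ - _ = (a 0%N - a' 0%N) - (B x - B' x)); [exact: isIntB|ring].
by rewrite (_ : _ - _ = - (B x - B' x)); [exact: isIntN|ring].
Qed.

(** The sign from extracting -1 out of 1 - t and out of 1 - w t after t = 1 / (w s). *)
Definition inveps : C := ppow (-1) (B x - a x - 1) (B' x - a' x - 1) * ppow (-1) (- a 0%N) (- a' 0%N).

(** Up to monomials, 1 - t becomes 1 - w s and 1 - w t becomes 1 - s, so the two factors exchange
    roles. *)
Let pw (w s : C) : w != 0 -> s != 0 -> s != 1 -> w * s != 1 ->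
  (cabs w ^- 2)%:C * ((cabs s ^- 4)%:C * (hb a B a' B' x (w^-1 * s^-1) * ppow (1 - w * (w^-1 * s^-1)) (- a 0%N) (- a' 0%N))) =
  inveps * ppow w (1 - B x) (1 - B' x) * (hb a2 B2 a2' B2' x s * ppow (1 - w * s) (- a2 0%N) (- a2' 0%N)).
Proof.
move=> w0 s0 s1 ws1; pose t := w^-1 * s^-1.
have t0 : t != 0 by rewrite mulf_neq0 ?invr_neq0.
have n0 : (-1 : C) != 0 by rewrite oppr_eq0 oner_eq0.
have d1 : 1 - s != 0 by rewrite subr_eq0 eq_sym.
have d2 : 1 - w * s != 0 by rewrite subr_eq0 eq_sym.
have et1 : 1 - t = -1 * ((1 - w * s) * t) by rewrite /t; field; rewrite w0 s0.
have et2 : 1 - w * t = -1 * ((1 - s) * s^-1) by rewrite /t; field; rewrite w0 s0.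
have iN (u v : C) : isInt (u - v) -> isInt (- u - - v) by move=> h; rewrite (_ : _ - _ = - (u - v)); [exact: isIntN|ring].
have ih : isInt (B x - a x - 1 - (B' x - a' x - 1)).
  by rewrite (_ : _ - _ = (B x - B' x) - (a x - a' x)); [exact: isIntB|ring].
have ia1 := isInt_sub1 iax.
have pt (u v : C) : isInt (u - v) -> ppow t u v = ppow w (- u) (- v) * ppow s (- u) (- v).
  by move=> h; rewrite /t ppowM ?invr_neq0 // !ppowV.
have w2 : (cabs w ^- 2)%:C = ppow w (-1) (-1) by rewrite ppow_m1.
have s4 : (cabs s ^- 4)%:C = ppow s (-2%:R) (-2%:R).
  by rewrite (_ : -2%:R = -1 + -1 :> C) ?ppowD ?ppow_m1 -?rcM -?exprVn -?exprD //; ring.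
rewrite -/t w2 s4 /hb /bint et1 et2 /inveps.
rewrite !ppowM ?mulf_neq0 ?invr_neq0 // ?pt //; try exact: iN.
rewrite !ppowV //; try exact: iN.
rewrite /inva /invB /= (negbTE x0).
have ew : ppow w (1 - B x) (1 - B' x) = ppow w (-1) (-1) * ppow w (- (a x - 1)) (- (a' x - 1)) * ppow w (- (B x - a x - 1)) (- (B' x - a' x - 1)).
  by rewrite -!ppowD; apply: eq_ppow; ring.
have es : ppow s (a 0%N - B x + 1 - 1) (a' 0%N - B' x + 1 - 1) = ppow s (-2%:R) (-2%:R) * ppow s (- (a x - 1)) (- (a' x - 1)) * ppow s (- (B x - a x - 1)) (- (B' x - a' x - 1)) * ppow s (- - a 0%N) (- - a' 0%N).
  by rewrite -!ppowD; apply: eq_ppow; ring.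
have e1 : ppow (1 - s) (2%:R - B x - (a 0%N - B x + 1) - 1) (2%:R - B' x - (a' 0%N - B' x + 1) - 1) = ppow (1 - s) (- a 0%N) (- a' 0%N).
  by apply: eq_ppow; ring.
have e2 : ppow (1 - w * s) (- (a x - B x + 1)) (- (a' x - B' x + 1)) = ppow (1 - w * s) (B x - a x - 1) (B' x - a' x - 1).
  by apply: eq_ppow; ring.
rewrite ew es e1 e2.
move: (ppow w _ _) (ppow w _ _) (ppow w _ _) (ppow s _ _) (ppow s _ _) (ppow s _ _) (ppow s _ _) => x1 x2 x3 x4 x5 x6 x7.
move: (ppow (-1) _ _) (ppow (-1) _ _) (ppow (1 - s) _ _) (ppow (1 - w * s) _ _) => y1 y2 y3 y4; ring.
Qed.

Let aeW (w : C) : w != 0 -> aeM dA (fun t : plane => [/\ toC t != 0, toC t != 1 & w * toC t != 1]).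
Proof.
move=> w0; apply: (aeM_imp (aeM_and (ae_toC_neq (0 : C)) (aeM_and (ae_toC_neq (1 : C)) (ae_toC_neq w^-1)))) => t [h0 [h1 h2]].
by split => //; apply: contra h2 => /eqP e; rewrite -[toC t](mulKf w0) e mulr1.
Qed.

Let F (w t : C) : C := hb a B a' B' x t * ppow (1 - w * t) (- a 0%N) (- a' 0%N).
Let F2 (w t : C) : C := hb a2 B2 a2' B2' x t * ppow (1 - w * t) (- a2 0%N) (- a2' 0%N).

Let mF w : cmeasC (F w).
Proof.
have [i1 i2] := ints_hb hI; apply: cmeasM; first exact: (cmeasC_hb i1 i2).
apply: (cmeasC_comp (cmeasC_Gi (l := [::]) (a := a) (B := B) (a' := a') (B' := B') _)).
  by move=> i; rewrite in_cons in_nil orbF => /eqP ->; exact: hI (mem_head _ _).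
by apply: cmeasM; [exact: cmeas_cst|exact: cmeas_toC].
Qed.

Let mF2 w : cmeasC (F2 w).
Proof.
have [i1 i2] := ints_hb inv_ints; apply: cmeasM; first exact: (cmeasC_hb i1 i2).
apply: (cmeasC_comp (cmeasC_Gi (l := [::]) (a := a2) (B := B2) (a' := a2') (B' := B2') _)).
  by move=> i; rewrite in_cons in_nil orbF => /eqP ->; exact: inv_ints (mem_head _ _).
by apply: cmeasM; [exact: cmeas_cst|exact: cmeas_toC].
Qed.

Let mFi w : cmeasC (fun t => F w (w^-1 * t)).
Proof. by apply: (cmeasC_comp (mF w)); apply: cmeasM; [exact: cmeas_cst|exact: cmeas_toC]. Qed.

Let cK (w : C) : w != 0 -> cabs w^-1 ^- 2 = cabs w ^+ 2.
Proof. by move=> w0; rewrite cabsV exprVn invrK. Qed.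

Let m4r : measurable_fun setT (fun t : plane => cabs (toC t) ^- 4).
Proof.
rewrite (_ : (fun t : plane => _) = (fun t : plane => cabs ((toC t)^-1 ^+ 4))).
  by apply: cmeas_abs; apply: cmeas_exp; apply: cmeasV; exact: cmeas_toC.
by apply/funext => t; rewrite cabsX cabsV exprVn.
Qed.

(** Scaling by 1 / w followed by inversion; the pointwise identity [pw] is used off the three points
    0, 1 and 1 / w. *)
Lemma Ji_inversion (w : C) : w != 0 ->
  (Ji a2 B2 a2' B2' [:: x] w * (cabs (inveps * ppow w (1 - B x) (1 - B' x)))%:E = Ji a B a' B' [:: x] w)%E.
Proof.
move=> w0; pose G t := (cabs (F w (w^-1 * t)))%:E : \bar R.
have mG : meC G by exact: cmeas_absE (mFi w).
have G0 t : (0 <= G t)%E by rewrite lee_fin cabs_ge0.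
have iw0 : w^-1 != 0 by rewrite invr_neq0.
have eJ (aa BB aa' BB' : nat -> C) : Ji aa BB aa' BB' [:: x] w = (\int[dA]_t (cabs (hb aa BB aa' BB' x (toC t) * ppow (1 - w * toC t) (- aa 0%N) (- aa' 0%N)))%:E)%E.
  by apply: eq_integral => t _; rewrite /= [cabs (_ * ppow _ _ _)]cabsM EFinM.
rewrite !eJ muleC -ge0_intZl; [|exact: (cmeas_absE (mF2 w))|by move=> t; rewrite lee_fin cabs_ge0|by rewrite lee_fin cabs_ge0].
have sc := @dA_scale R w^-1 (fun t => (cabs (F w t))%:E) iw0 (cmeas_absE (mF w)) (fun t => ltac:(by rewrite lee_fin cabs_ge0)).
rewrite cK // in sc.
have inv := dA_inv mG G0.
transitivity ((cabs w ^- 2)%:E * ((cabs w ^+ 2)%:E * \int[dA]_t (cabs (F w (toC t)))%:E))%E; last first.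
  by rewrite muleA -EFinM mulVf ?mul1e // expf_neq0 // gt_eqF // cabs_gt0.
have m4 : measurable_fun setT (fun t : plane => ((cabs (toC t) ^- 4)%:E * G (toC t)^-1%R : \bar R)%E).
  apply: emeasurable_funM.
    by apply/measurable_EFinP; exact: m4r.
  by apply: (meC_comp mG); apply: cmeasV; exact: cmeas_toC.
have p4 (t : C) : 0 <= cabs t ^- 4 by rewrite invr_ge0 exprn_ge0 // cabs_ge0.
rewrite -sc.
have -> : (\int[dA]_t (cabs (F w (w^-1 * toC t)))%:E = \int[dA]_t ((cabs (toC t) ^- 4)%:E * G (toC t)^-1%R))%E.
  rewrite inv; apply: ae_eq_integral => //.
    by apply: measurable_fun_ifT => //; exact: measurable_ceq0 (@cmeas_toC R).
  change (aeM dA (fun t => [set: plane] t -> (cabs (F w (w^-1 * toC t)))%:E = (if toC t == 0 then 0%E else G (toC t)))).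
  by apply: (aeM_imp (ae_toC_neq (0 : C))) => t /negbTE t0 _; rewrite t0.
rewrite -ge0_intZl //; [|by move=> t; rewrite mule_ge0 // lee_fin|by rewrite lee_fin invr_ge0 exprn_ge0 // cabs_ge0].
apply: ae_eq_integral => //.
- by apply: emeasurable_funM => //; exact: (cmeas_absE (mF2 w)).
- exact: emeasurable_funM.
change (aeM dA (fun t => [set: plane] t -> ((cabs (inveps * ppow w (1 - B x) (1 - B' x)))%:E * (cabs (F2 w (toC t)))%:E)%E = ((cabs w ^- 2)%:E * ((cabs (toC t) ^- 4)%:E * G (toC t)^-1%R))%E)).
apply: (aeM_imp (aeW w0)) => t [t0 t1 t2] _.
rewrite -EFinM -cabsM -(pw w0 t0 t1 t2) /G /F -!EFinM [cabs ((cabs w ^- 2)%:C * _)]cabsM [cabs ((cabs (toC t) ^- 4)%:C * _)]cabsM !cabsR.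
by rewrite (ger0_norm (p4 _)) ger0_norm // invr_ge0 exprn_ge0 // cabs_ge0.
Qed.

Lemma Gi_inversion (w : C) : w != 0 -> (Ji a B a' B' [:: x] w < +oo)%E ->
  Gi a B a' B' [:: x] w = inveps * ppow w (1 - B x) (1 - B' x) * Gi a2 B2 a2' B2' [:: x] w.
Proof.
move=> w0 fin; have iw0 : w^-1 != 0 by rewrite invr_neq0.
have sc := CI_scale iw0 (mF w); rewrite (cK w0) in sc.
have inv := CI_inv (mFi w).
have k1 : (cabs w ^- 2)%:C * (cabs w ^+ 2)%:C = 1 :> C.
  by rewrite -rcM mulVf // expf_neq0 // gt_eqF // cabs_gt0.
have K0 : inveps * ppow w (1 - B x) (1 - B' x) != 0 by exact: (mulf_neq0 (mulf_neq0 (ppow_neq0 _ _ _) (ppow_neq0 _ _ _)) (ppow_neq0 _ _ _)).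
have c2 : cintg dA (fun t => F2 w (toC t)).
  split; first exact: mF2.
  move: fin; rewrite -Ji_inversion // muleC.
  have <- : (\int[dA]_t (cabs (F2 w (toC t)))%:E = Ji a2 B2 a2' B2' [:: x] w)%E.
    by apply: eq_integral => t _; rewrite /= /F2 [cabs (_ * ppow _ _ _)]cabsM EFinM.
  have gen (k : R) (e : \bar R) : 0 < k -> (0 <= e -> k%:E * e < +oo -> e < +oo)%E.
    move=> k0; case: e => [e| |]; [by move=> _ _; exact: ltry| |by []].
    by move=> _; rewrite gt0_muley // lte_fin.
  apply: gen; first by rewrite cabs_gt0.
  by apply: integral_ge0 => t _; rewrite lee_fin cabs_ge0.
change (CI dA (fun t => F w (toC t)) = inveps * ppow w (1 - B x) (1 - B' x) * CI dA (fun t => F2 w (toC t))).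
have mm : cmeas (fun t : plane => (cabs (toC t) ^- 4)%:C * F w (w^-1 * (toC t)^-1)).
  apply: cmeasM; last by apply: (cmeasC_comp (mFi w)); apply: cmeasV; exact: cmeas_toC.
  by apply: cmeas_real; exact: m4r.
have wn : ((cabs w ^- 2)%:C : C) != 0.
  by rewrite -cabs_gt0 cabsR normr_gt0 invr_neq0 // expf_neq0 // gt_eqF // cabs_gt0.
have main : CI dA (fun t => (cabs (toC t) ^- 4)%:C * F w (w^-1 * (toC t)^-1)) = (cabs w ^- 2)%:C^-1 * (inveps * ppow w (1 - B x) (1 - B' x)) * CI dA (fun t => F2 w (toC t)).
  rewrite -(CIZ _ c2); apply: (ae_eq_CI mm (cintg_meas (cintgZ _ c2))).
  change (aeM dA (fun t => (cabs (toC t) ^- 4)%:C * F w (w^-1 * (toC t)^-1) = (cabs w ^- 2)%:C^-1 * (inveps * ppow w (1 - B x) (1 - B' x)) * F2 w (toC t))).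
  apply: (aeM_imp (aeW w0)) => t [t0 t1 t2].
  by rewrite -[RHS]mulrA /F2 -(pw w0 t0 t1 t2) mulKf.
have e := etrans (etrans (esym main) inv) sc.
move: e wn k1; set A := CI dA (fun t => F w (toC t)); set G := CI dA (fun t => F2 w (toC t)).
move: (inveps * _) (_ ^- 2)%:C (_ ^+ 2)%:C => K k k2 e k0 k1.
by rewrite -[A]mul1r -k1 -mulrA -e -mulrA mulVKf.
Qed.
End Inversion.

(** * Exchange of variables and the expansion of the iterated integral *)

Section Induction.
Variable R : realType.
Local Notation C := R[i].
Local Notation dA := (mA R).
Local Notation plane := (measurableTypeR R * measurableTypeR R)%type.

(** For two expansions with the same remaining terms, each with one unidentified series and at
    different exponents: uniqueness forces the unknown [h1] to be the expected [hx]. *)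
Lemma split_unique (x y : nat) (e e' : nat -> C) (h1 h2 hx hy : nat -> C) : x != y ->
  isInt (e x - e' x) -> isInt (e y - e' y) -> ~ isInt (e x - e y) ->
  summ h1 -> summ h2 -> summ hx -> summ hy ->
  (forall rho : R, rho != 0 -> `|rho| <= 1 ->
     ppow rho%:C (e y) (e' y) * CS (fun n => hy n * rho%:C ^+ n) + ppow rho%:C (e x) (e' x) * CS (fun n => h1 n * rho%:C ^+ n) =
     ppow rho%:C (e x) (e' x) * CS (fun n => hx n * rho%:C ^+ n) + ppow rho%:C (e y) (e' y) * CS (fun n => h2 n * rho%:C ^+ n)) ->
  forall n, h1 n = hx n.
Proof.
move=> xy ix iy nxy s1 s2 sx sy H n.
pose h j n : C := if j == x then h1 n - hx n else hy n - h2 n.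
have nyx : ~ isInt (e y - e x) by move=> hyx; apply: nxy; rewrite -opprB; exact: isIntN.
have yx : (y == x) = false by rewrite eq_sym (negbTE xy).
suff : h x n = 0 by rewrite /h eqxx => /eqP; rewrite subr_eq0 => /eqP.
apply: (@series_unique _ [:: x; y] e e' h); last by rewrite mem_head.
- by rewrite /= inE xy.
- by move=> j; rewrite !inE => /orP[/eqP ->|/eqP ->].
- by move=> j k; rewrite !inE => /orP[/eqP ->|/eqP ->] /orP[/eqP ->|/eqP ->]; rewrite ?eqxx.
- by move=> j; rewrite !inE /h => /orP[/eqP ->|/eqP ->]; rewrite ?eqxx ?yx; exact: summB.
move=> rho rho1 rho0; have := H rho rho0 rho1; rewrite !big_cons big_nil addr0.
have sr (v : nat -> C) : summ v -> summ (fun n => v n * rho%:C ^+ n).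
  by apply: summ_dom => k; rewrite cabsM -[leRHS]mulr1; apply: ler_wpM2l; [exact: cabs_ge0|rewrite cabsX cabsR exprn_ile1].
have -> : CS (fun n => h x n * rho%:C ^+ n) = CS (fun n => h1 n * rho%:C ^+ n) - CS (fun n => hx n * rho%:C ^+ n).
  by rewrite -CSB; [|exact: sr|exact: sr]; apply: eq_CS => k; rewrite /h eqxx mulrBl.
have -> : CS (fun n => h y n * rho%:C ^+ n) = CS (fun n => hy n * rho%:C ^+ n) - CS (fun n => h2 n * rho%:C ^+ n).
  by rewrite -CSB; [|exact: sr|exact: sr]; apply: eq_CS => k; rewrite /h yx mulrBl.
move: (ppow _ _ _) (ppow _ _ _) (CS _) (CS _) (CS _) (CS _) => p q c1 c2 c3 c4 /eqP.
by rewrite -subr_eq0 => /eqP E; rewrite -[RHS]E; ring.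
Qed.

Lemma nonres_dual (a B a' B' : nat -> C) K i j : ints a B a' B' K -> nonres a B K -> i \in K -> j \in K -> i != j -> ~ isInt (B' i - B' j).
Proof.
move=> hI [_ h2] iK jK ij; apply: (@nonint_shift _ (B i - B j)); last exact: h2.
have [_ h3] := hI i iK; have [_ h4] := hI j jK.
by rewrite (_ : _ - _ = (B i - B' i) - (B j - B' j)); [exact: isIntB|ring].
Qed.

Lemma term_series (a B a' B' : nat -> C) K l j z : ints a B a' B' K -> nonres a B K -> j \in K -> 0 < cabs z < 1 ->
  exists2 h, summ h & forall rho : R, rho != 0 -> `|rho| <= 1 ->
    term a B a' B' K l j (rho%:C * z) = ppow rho%:C (1 - B j) (1 - B' j) * CS (fun n => h n * rho%:C ^+ n).
Proof.
move=> hI nr jK /andP[z0 z1]; have zn : z != 0 by rewrite -cabs_gt0.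
have [x1 p1] : exists x, pbd (useq a B K j) x by apply: pbd_useq => i iK ij; exact: nr.2.
have [x2 p2] : exists x, pbd (useq a' B' K j) x by apply: pbd_useq => i iK ij; exact: (nonres_dual hI nr).
have s1 : summ (fun m => useq a B K j m * z ^+ m) by exact: pbd_geo p1 z1.
have s2 : summ (fun m => useq a' B' K j m * conjc z ^+ m) by apply: pbd_geo p2 _; rewrite cabs_conj.
have [h sh hh] := CS_prod_regroup s1 s2.
pose c : C := muj a B a' B' l j * ppow z (1 - B j) (1 - B' j).
exists (fun n => c * h n); first exact: summZ.
move=> rho rho0 rho1; have rc0 : (rho%:C : C) != 0 by rewrite -cabs_gt0 cabsR normr_gt0.
have [_ iB] := hI j jK.
have iB1 : isInt (1 - B j - (1 - B' j)) by rewrite (_ : _ - _ = - (B j - B' j)); [exact: isIntN|ring].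
have cr : cabs (rho%:C : C) <= 1 by rewrite cabsR.
have sr : summ (fun n => h n * rho%:C ^+ n).
  by apply: summ_dom sh => k; rewrite cabsM -[leRHS]mulr1; apply: ler_wpM2l; [exact: cabs_ge0|rewrite cabsX exprn_ile1 ?cabs_ge0].
have -> : CS (fun n => c * h n * rho%:C ^+ n) = c * CS (fun n => h n * rho%:C ^+ n).
  by rewrite -CSZ //; apply: eq_CS => k; rewrite mulrA.
rewrite -hh // /term (ppowM rc0 zn iB1).
have ec : conjc (rho%:C * z) = conjc z * rho%:C.
  by transitivity (conjc (rho%:C : C) * conjc z); [exact: rmorphM|rewrite conjc_real mulrC].
rewrite ec (eq_CS (v := fun m => useq a B K j m * z ^+ m * rho%:C ^+ m)); last by move=> m; rewrite exprMn [_ ^+ m * _]mulrC mulrA.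
rewrite [X in _ * (_ * X) = _](eq_CS (v := fun m => useq a' B' K j m * conjc z ^+ m * rho%:C ^+ m)); last by move=> m; rewrite exprMn mulrA.
rewrite /c; move: (muj _ _ _ _ _ _) (ppow _ _ _) (ppow _ _ _) (CS _) (CS _) => x3 x4 x5 x6 x7; ring.
Qed.

Lemma eq_term (a B a' B' : nat -> C) K K' l l' j z : perm_eq K K' -> perm_eq l l' ->
  term a B a' B' K l j z = term a B a' B' K' l' j z.
Proof.
move=> pK pl; rewrite /term /muj (perm_big _ pl) /=; congr (_ * (_ * _)).
  by apply: eq_CS => m; rewrite /useq (perm_big _ pK).
by apply: eq_CS => m; rewrite /useq (perm_big _ pK).
Qed.

Lemma Ji_all (a B a' B' : nat -> C) l w0 w : B 0%N = 1 -> B' 0%N = 1 -> ints a B a' B' (0%N :: l) -> 0 < cabs w0 < 1 ->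
  (Ji a B a' B' l w0 < +oo)%E -> 0 < cabs w < 1 -> (Ji a B a' B' l w < +oo)%E.
Proof.
move=> B0 B0' h h0 fin /andP[w1 w2].
have [M _ hM] := Ji_bounded B0 B0' h h0 fin w1 w2.
by apply: le_lt_trans (hM w (lexx _) (lexx _)) _; exact: ltry.
Qed.

Lemma hb_neq0 (a B a' B' : nat -> C) x t : hb a B a' B' x t != 0.
Proof. exact: (mulf_neq0 (ppow_neq0 _ _ _) (ppow_neq0 _ _ _)). Qed.

Section Swap.
Variables (a B a' B' : nat -> C) (x y : nat) (l : seq nat) (z : C).
Hypothesis h : ints a B a' B' [:: 0%N, x, y & l].
Local Notation hb := (hb a B a' B').
Local Notation Gi := (Gi a B a' B').
Local Notation Ji := (Ji a B a' B').

Let hx : ints a B a' B' [:: 0%N, x & l].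
Proof. by move=> i; rewrite !in_cons => /or3P[] e; apply: h; rewrite !in_cons e ?orbT. Qed.
Let hy : ints a B a' B' [:: 0%N, y & l]. Proof. exact: (ints_behead h). Qed.
Let hl : ints a B a' B' (0%N :: l). Proof. exact: (ints_behead hy). Qed.

Let mhb i : i = x \/ i = y -> cmeasC (hb i).
Proof. by case=> ->; [have [i1 i2] := ints_hb hx|have [i1 i2] := ints_hb hy]; exact: (cmeasC_hb i1 i2). Qed.

Let mprod d (T : measurableType d) (f g : T -> plane) : measurable_fun setT f -> measurable_fun setT g ->
  cmeas (fun p => z * (toC (f p) * toC (g p))).
Proof.
move=> mf mg; apply: cmeasM; first exact: cmeas_cst.
by apply: cmeasM; [exact: (cmeas_comp (@cmeas_toC R) mf)|exact: (cmeas_comp (@cmeas_toC R) mg)].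
Qed.

Let JF (t s : plane) : \bar R := ((cabs (hb x (toC t)))%:E * ((cabs (hb y (toC s)))%:E * Ji l (z * (toC t * toC s))%R))%E.

Let mJF : measurable_fun setT (fun p : plane * plane => JF p.1 p.2).
Proof.
apply: emeasurable_funM.
  by apply: (measurableT_comp (cmeas_absE (mhb (or_introl erefl)))); exact: measurable_fst.
apply: emeasurable_funM.
  by apply: (measurableT_comp (cmeas_absE (mhb (or_intror erefl)))); exact: measurable_snd.
by apply: (meC_comp (meC_Ji hl)); apply: mprod; [exact: measurable_fst|exact: measurable_snd].
Qed.

Let mJy (t : plane) : measurable_fun setT (fun s : plane => ((cabs (hb y (toC s)))%:E * Ji l (z * (toC t * toC s))%R)%E).
Proof.
apply: emeasurable_funM; first exact: (cmeas_absE (mhb (or_intror erefl))).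
apply: (meC_comp (meC_Ji hl)); apply: cmeasM; first exact: cmeas_cst.
by apply: cmeasM; [exact: cmeas_cst|exact: cmeas_toC].
Qed.

Let mJx (s : plane) : measurable_fun setT (fun t : plane => ((cabs (hb x (toC t)))%:E * Ji l (z * (toC t * toC s))%R)%E).
Proof.
apply: emeasurable_funM; first exact: (cmeas_absE (mhb (or_introl erefl))).
apply: (meC_comp (meC_Ji hl)); apply: cmeasM; first exact: cmeas_cst.
by apply: cmeasM; [exact: cmeas_toC|exact: cmeas_cst].
Qed.

Let JFE : (Ji [:: x, y & l] z = \int[dA]_t \int[dA]_s JF t s)%E.
Proof.
apply: eq_integral => t _ /=; rewrite /JF ge0_intZl; [|exact: mJy|by move=> s; exact: hbJ_ge0|by rewrite lee_fin cabs_ge0].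
by congr (_ * _)%E; apply: eq_integral => s _; rewrite mulrA.
Qed.

Lemma Ji_swap : Ji [:: x, y & l] z = Ji [:: y, x & l] z.
Proof.
rewrite JFE (tonelli dA dA (f := JF)); [|exact: mJF|by move=> t s; apply: mule_ge0; [rewrite lee_fin cabs_ge0|exact: hbJ_ge0]].
apply: eq_integral => s _.
transitivity ((cabs (hb y (toC s)))%:E * \int[dA]_t ((cabs (hb x (toC t)))%:E * Ji l (z * (toC t * toC s))%R))%E; last first.
  by congr (_ * _)%E; apply: eq_integral => t _; rewrite -/Ji [in RHS]mulrAC -[in RHS]mulrA.
rewrite -ge0_intZl; [|exact: (mJx s)|by move=> t; exact: hbJ_ge0|by rewrite lee_fin cabs_ge0].
by apply: eq_integral => t _; rewrite /JF muleCA.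
Qed.
End Swap.

Section Swap2.
Variables (a B a' B' : nat -> C) (x y : nat) (l : seq nat) (z : C).
Hypothesis h : ints a B a' B' [:: 0%N, x, y & l].
Local Notation hb := (hb a B a' B').
Local Notation Gi := (Gi a B a' B').
Local Notation Ji := (Ji a B a' B').
Hypothesis fin : (Ji [:: x, y & l] z < +oo)%E.

Let hx : ints a B a' B' [:: 0%N, x & l].
Proof. by move=> i; rewrite !in_cons => /or3P[] e; apply: h; rewrite !in_cons e ?orbT. Qed.
Let hy : ints a B a' B' [:: 0%N, y & l]. Proof. exact: (ints_behead h). Qed.
Let hl : ints a B a' B' (0%N :: l). Proof. exact: (ints_behead hy). Qed.
Let mhx : cmeasC (hb x). Proof. by have [i1 i2] := ints_hb hx; exact: (cmeasC_hb i1 i2). Qed.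
Let mhy : cmeasC (hb y). Proof. by have [i1 i2] := ints_hb hy; exact: (cmeasC_hb i1 i2). Qed.

Let F (t s : plane) : C := hb x (toC t) * (hb y (toC s) * Gi l (z * (toC t * toC s))).

Let mF : cmeas (fun p : plane * plane => F p.1 p.2).
Proof.
apply: cmeasM; first by apply: (cmeas_comp mhx); exact: measurable_fst.
apply: cmeasM; first by apply: (cmeas_comp mhy); exact: measurable_snd.
apply: (cmeasC_comp (cmeasC_Gi hl)); apply: cmeasM; first exact: cmeas_cst.
by apply: cmeasM; apply: (cmeas_comp (@cmeas_toC R)); [exact: measurable_fst|exact: measurable_snd].
Qed.

Let finF : (\int[dA]_t \int[dA]_s (cabs (F t s))%:E < +oo)%E.
Proof.
apply: le_lt_trans fin.
have mJ t : measurable_fun setT (fun s : plane => ((cabs (hb y (toC s)))%:E * Ji l (z * toC t * toC s)%R)%E).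
  apply: emeasurable_funM; first exact: (cmeas_absE mhy).
  by apply: (meC_comp (meC_Ji hl)); apply: cmeasM; [exact: cmeas_cst|exact: cmeas_toC].
have mFs t : cmeas (F t).
  apply: cmeasM; first exact: cmeas_cst.
  apply: cmeasM; first exact: mhy.
  apply: (cmeasC_comp (cmeasC_Gi hl)); apply: cmeasM; first exact: cmeas_cst.
  by apply: cmeasM; [exact: cmeas_cst|exact: cmeas_toC].
apply: le_int.
- by apply: measurable_int2; [exact: cmeas_absE|move=> t s; rewrite lee_fin cabs_ge0].
- apply: emeasurable_funM; first exact: (cmeas_absE mhx).
  by apply: (meC_comp (meC_Ji hy)); apply: cmeasM; [exact: cmeas_cst|exact: cmeas_toC].
- by move=> t; apply: integral_ge0 => s _; rewrite lee_fin cabs_ge0.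
move=> t /=; rewrite -ge0_intZl; [|exact: mJ|by move=> s; exact: hbJ_ge0|by rewrite lee_fin cabs_ge0].
apply: le_int.
- exact: (cmeas_absE (mFs t)).
- by apply: emeasurable_funM => //; exact: mJ.
- by move=> s; rewrite lee_fin cabs_ge0.
move=> s; rewrite /F (cabsM (hb x _)) (cabsM (hb y _)) !EFinM; apply: lee_wpmul2l; first by rewrite lee_fin cabs_ge0.
apply: lee_wpmul2l; first by rewrite lee_fin cabs_ge0.
by rewrite mulrA; exact: Gi_le.
Qed.

(** Since c is nonzero, integrability of [f] follows from that of the multiple by dividing. *)
Let pull (c : C) (f : plane -> C) : c != 0 -> cintg dA (fun s => c * f s) -> CI dA (fun s => c * f s) = c * CI dA f.
Proof.
move=> c0 ci; rewrite CIZ //; apply: cintg_ext (cintgZ c^-1 ci) => s; exact: mulKf.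
Qed.

Lemma Gi_swap : Gi [:: x, y & l] z = Gi [:: y, x & l] z.
Proof.
have c1 : cintg (dA \x dA)%E (fun p : plane * plane => F p.1 p.2) by apply: cintg_fubini.
have mF' : cmeas (fun p : plane * plane => F p.2 p.1) by apply: (cmeas_comp (g := fun p : plane * plane => (p.2, p.1)) mF); exact: measurable_swap.
have c2 : cintg (dA \x dA)%E (fun p : plane * plane => F p.2 p.1) by apply: cintg_fubini_flip.
have a1 := cintg_section c1; have a2 := cintg_section c2.
have mGx : cmeas (fun t : plane => hb x (toC t) * Gi (y :: l) (z * toC t)).
  apply: cmeasM; first exact: mhx.
  by apply: (cmeasC_comp (cmeasC_Gi hy)); apply: cmeasM; [exact: cmeas_cst|exact: cmeas_toC].
have mGy : cmeas (fun t : plane => hb y (toC t) * Gi (x :: l) (z * toC t)).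
  apply: cmeasM; first exact: mhy.
  by apply: (cmeasC_comp (cmeasC_Gi hx)); apply: cmeasM; [exact: cmeas_cst|exact: cmeas_toC].
have e1 : Gi [:: x, y & l] z = CI dA (fun t => CI dA (F t)).
  have mI : cmeas (fun t : plane => CI dA (F t)) := cmeas_CI dA mF.
  (* The outer weight can be pulled out of the inner integral only where the section is integrable,
     that is, for almost every t. *)
  suff ae : aeM dA (fun t => hb x (toC t) * Gi (y :: l) (z * toC t) = CI dA (F t)) by exact: (ae_eq_CI mGx mI ae).
  have eF s t : F s t = hb x (toC s) * (hb y (toC t) * Gi l (z * toC s * toC t)).
    by rewrite /F; congr (_ * (_ * Gi _ _)); ring.
  apply: (aeM_imp a1) => t ct.
  have ct' : cintg dA (fun s => hb x (toC t) * (hb y (toC s) * Gi l (z * toC t * toC s))).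
    by apply: cintg_ext ct => s; exact: eF.
  exact: (etrans (esym (pull (hb_neq0 _ _ _ _ _ _) ct')) (esym (eq_CI dA (eF t)))).
have e2 : Gi [:: y, x & l] z = CI dA (fun s => CI dA (fun t => F t s)).
  have mI : cmeas (fun s : plane => CI dA (fun t => F t s)) := cmeas_CI dA mF'.
  suff ae : aeM dA (fun s => hb y (toC s) * Gi (x :: l) (z * toC s) = CI dA (fun t => F t s)) by exact: (ae_eq_CI mGy mI ae).
  have eF s t : F t s = hb y (toC s) * (hb x (toC t) * Gi l (z * toC s * toC t)).
    by rewrite /F mulrCA; congr (_ * (_ * Gi _ _)); ring.
  apply: (aeM_imp a2) => s cs.
  have cs' : cintg dA (fun t => hb y (toC s) * (hb x (toC t) * Gi l (z * toC s * toC t))).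
    by apply: cintg_ext cs => t; exact: eF.
  exact: (etrans (esym (pull (hb_neq0 _ _ _ _ _ _) cs')) (esym (eq_CI dA (eF s)))).
exact: (etrans e1 (etrans (CI_swap mF finF) (esym e2))).
Qed.
End Swap2.

Lemma poch1 n : poch (1 : C) n = n`!%:R.
Proof.
have := cb1 R n; rewrite /cb => /(congr1 (fun v => v * n`!%:R)).
by rewrite divfK ?fact_neq0 // mul1r.
Qed.

Lemma Gi_nil (a B a' B' : nat -> C) z : B 0%N = 1 -> B' 0%N = 1 -> ints a B a' B' [:: 0%N] -> cabs z < 1 ->
  Gi a B a' B' [::] z = term a B a' B' [:: 0%N] [::] 0%N z.
Proof.
move=> B0 B0' h z1; have [h1 _] := h 0%N (mem_head _ _).
rewrite /= ppow_binomial // /term /muj big_nil B0 B0' !subrr ppow00 !mul1r /binS.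
have eu (aa BB : nat -> C) m : BB 0%N = 1 -> useq aa BB [:: 0%N] 0%N m = cb (aa 0%N) m.
  by move=> e; rewrite /useq big_seq1 e subrK subrr add0r poch1.
by congr (_ * _); apply: eq_CS => m; rewrite eu.
Qed.

(** The inverted integral plays the part of the second variable: after the prefactor w^(1 - B x),
    its known term is the one wanted for x, and its unknown series has exponent 0. *)
Lemma Gi_single (a B a' B' : nat -> C) x z : B 0%N = 1 -> B' 0%N = 1 -> x != 0%N -> ints a B a' B' [:: 0%N; x] -> nonres a B [:: 0%N; x] ->
  0 < cabs z < 1 -> (Ji a B a' B' [:: x] z < +oo)%E ->
  Gi a B a' B' [:: x] z = \sum_(j <- [:: 0%N; x]) term a B a' B' [:: 0%N; x] [:: x] j z.
Proof.
move=> B0 B0' x0 hI nr zb fin; have /andP[z0 z1] := zb; have zn : z != 0 by rewrite -cabs_gt0.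
have [nr1 nr2] := nr.
have m0 : 0%N \in [:: 0%N; x] := mem_head _ _.
have mx : x \in [:: 0%N; x] by rewrite !in_cons eqxx orbT.
have xn : x \notin [:: 0%N] by rewrite inE.
have [iax iBx] := hI x mx; have [ia0 _] := hI 0%N m0.
have base_ (aa BB aa' BB' : nat -> C) : BB 0%N = 1 -> BB' 0%N = 1 -> ints aa BB aa' BB' [:: 0%N; x] ->
   forall w, 0 < cabs w < 1 -> Gi aa BB aa' BB' [::] w = \sum_(j <- [:: 0%N]) term aa BB aa' BB' [:: 0%N] [::] j w.
  move=> e e' hh w /andP[_ w1]; rewrite big_seq1; apply: Gi_nil => //.
  by move=> i; rewrite inE => /eqP ->; exact: hh m0.
have [h1 sh1 H1] := Gi_step B0 B0' xn hI nr (base_ _ _ _ _ B0 B0' hI) zb fin.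
pose a2 := inva x a B; pose B2 := invB x B; pose a2' := inva x a' B'; pose B2' := invB x B'.
have hI2 : ints a2 B2 a2' B2' [:: 0%N; x] by exact: inv_ints.
have eB (BB : nat -> C) : invB x BB 0%N = 1 by [].
have eB2 : B2 0%N = 1 by [].
have eB2' : B2' 0%N = 1 by [].
have e2x : B2 x = 2%:R - B x by rewrite /B2 /invB (negbTE x0).
have e2x' : B2' x = 2%:R - B' x by rewrite /B2' /invB (negbTE x0).
have ax2 : a2 x = a 0%N - B x + 1 by rewrite /a2 /inva (negbTE x0).
have ax2' : a2' x = a' 0%N - B' x + 1 by rewrite /a2' /inva (negbTE x0).
have a02 : a2 0%N = a x - B x + 1 by [].
have a02' : a2' 0%N = a' x - B' x + 1 by [].
have nax : ~ isInt (a x - B x) by exact: nr1.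
have na0 : ~ isInt (a 0%N - B x) by exact: nr1.
have nax1 : ~ isInt (a x - 1) by rewrite -B0; exact: nr1.
have na01 : ~ isInt (a 0%N - 1) by rewrite -B0; exact: nr1.
have nBx : ~ isInt (B x - 1) by rewrite -B0; exact: nr2.
have i1 : isInt (1 : C) := isInt_nat R 1.
have nr' : nonres a2 B2 [:: 0%N; x].
  have neg (u v : C) : v = - u -> ~ isInt u -> ~ isInt v.
    by move=> -> hu hv; apply: hu; rewrite -[u]opprK; exact: isIntN.
  have sh (u v : C) : isInt (u - v) -> ~ isInt u -> ~ isInt v by exact: nonint_shift.
  split=> i j; rewrite !inE => /orP[/eqP ->|/eqP ->] /orP[/eqP ->|/eqP ->]; rewrite ?eqxx //= ?e2x ?ax2 ?a02 ?(eB B).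
  - by rewrite addrK.
  - by apply: sh nax1; rewrite (_ : _ - _ = 0); [exact: (isInt_nat R 0)|ring].
  - by rewrite addrK.
  - by apply: sh na01; rewrite (_ : _ - _ = 0); [exact: (isInt_nat R 0)|ring].
  - by move=> _; apply: sh nBx; rewrite (_ : _ - _ = 0); [exact: (isInt_nat R 0)|ring].
  - by move=> _; apply: neg nBx; ring.
have fin2 : (Ji a2 B2 a2' B2' [:: x] z < +oo)%E.
  have := fin; rewrite -(Ji_inversion x0 hI zn) muleC.
  have K0 : inveps a B a' B' x * ppow z (1 - B x) (1 - B' x) != 0 by exact: (mulf_neq0 (mulf_neq0 (ppow_neq0 _ _ _) (ppow_neq0 _ _ _)) (ppow_neq0 _ _ _)).
  have gen (k : R) (e : \bar R) : 0 < k -> (0 <= e -> k%:E * e < +oo -> e < +oo)%E.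
    move=> k0; case: e => [e| |]; [by move=> _ _; exact: ltry| |by []].
    by move=> _; rewrite gt0_muley // lte_fin.
  by apply: gen; [rewrite cabs_gt0|exact: Ji_ge0].
have [h2 sh2 H2] := Gi_step (eB B) (eB B') xn hI2 nr' (base_ _ _ _ _ (eB B) (eB B') hI2) zb fin2.
have [hx shx Hx] := term_series [:: x] hI nr mx zb.
have [h0 sh0 H0] := term_series [:: x] hI nr m0 zb.
(* the leading term of the transformed integral is the term of exponent 1 - B x *)
have lead w : w != 0 -> inveps a B a' B' x * ppow w (1 - B x) (1 - B' x) * term a2 B2 a2' B2' [:: 0%N; x] [:: x] 0%N w = term a B a' B' [:: 0%N; x] [:: x] x w.
  move=> w0; rewrite /term eB2 eB2' !subrr ppow00 mulr1.
  have eu (aa BB : nat -> C) m : BB 0%N = 1 -> useq (inva x aa BB) (invB x BB) [:: 0%N; x] 0%N m = useq aa BB [:: 0%N; x] x m.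
    move=> e; rewrite /useq !big_cons !big_nil /inva /invB /= (negbTE x0) e !subrr !add0r !mulr1.
    rewrite (_ : aa x - BB x + 1 - 1 + 1 = aa x - BB x + 1); last ring.
    rewrite (_ : aa 0%N - BB x + 1 - 1 + 1 = aa 0%N - BB x + 1); last ring.
    rewrite (_ : 2%:R - BB x - 1 + 1 = 1 - BB x + 1); last by rewrite -[2%:R]/(1 + 1); ring.
    move: (poch _ _) (poch _ _) (poch _ _) (poch _ _) => x1 x2 x3 x4.
    exact: mulrC.
  have -> : CS (fun m => useq a2 B2 [:: 0%N; x] 0%N m * w ^+ m) = CS (fun m => useq a B [:: 0%N; x] x m * w ^+ m).
    by apply: eq_CS => m; rewrite eu.
  have -> : CS (fun m => useq a2' B2' [:: 0%N; x] 0%N m * conjc w ^+ m) = CS (fun m => useq a' B' [:: 0%N; x] x m * conjc w ^+ m).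
    by apply: eq_CS => m; rewrite eu.
  suff em : inveps a B a' B' x * muj a2 B2 a2' B2' [:: x] 0%N = muj a B a' B' [:: x] x.
    rewrite -em; move: (inveps _ _ _ _ _) (muj _ _ _ _ _ _) (ppow _ _ _) (CS _) (CS _) => x1 x2 x3 x4 x5; ring.
  rewrite /muj !big_cons !big_nil (negbTE x0) !eqxx /= mul1r !mulr1 /base eB2 eB2'.
  have [n hn] := iax; have [nB hnB] := iBx; have [n0 hn0] := ia0.
  have k1 : B x - a x - 1 - (B' x - a' x - 1) = (nB - n)%:~R by rewrite intrB -hn -hnB; ring.
  have k2 : - a 0%N - - a' 0%N = (- n0)%:~R by rewrite intrN -hn0; ring.
  have k3 : B x - B' x - a x + a' x = (nB - n)%:~R by rewrite intrB -hn -hnB; ring.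
  have k4 : 1 - a 0%N - (1 - a' 0%N) = (- n0)%:~R by rewrite intrN -hn0; ring.
  rewrite /inveps (ppow_neg1 k1) (ppow_neg1 k2) k3 minus1pow_int.
  have iB1 : isInt (B x - 1 - (B' x - 1)) by rewrite (_ : _ - _ = B x - B' x) //; ring.
  have nb : ~ isInt (1 - a 0%N) by move=> hh; apply: na01; rewrite -opprB; exact: isIntN.
  have nab : ~ isInt (B x - 1 + (1 - a 0%N)).
    by move=> hh; apply: na0; rewrite -opprB; apply: isIntN; move: hh; congr isInt; ring.
  have := frakB_reflect iB1 k4 nBx nb nab.
  have -> : 1 - (B x - 1) - (1 - a 0%N) = a2 x - 1 + 1 by rewrite ax2; ring.
  have -> : 1 - (B' x - 1) - (1 - a' 0%N) = a2' x - 1 + 1 by rewrite ax2'; ring.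
  have -> : B2 x - a2 x = 1 - a 0%N by rewrite e2x ax2 -[2%:R]/(1 + 1); ring.
  have -> : B2' x - a2' x = 1 - a' 0%N by rewrite e2x' ax2' -[2%:R]/(1 + 1); ring.
  move=> ->; have sq : ((-1 : C) ^ (- n0)) * (-1) ^ (- n0) = 1 by rewrite -expfzMl mulrNN mulr1 exp1rz.
  by rewrite -mulrA; congr (_ * _); rewrite mulrA sq mul1r.
pose cc : C := inveps a B a' B' x * ppow z (1 - B x) (1 - B' x).
have iB1 : isInt (1 - B x - (1 - B' x)) by rewrite (_ : _ - _ = - (B x - B' x)); [exact: isIntN|ring].
have key (rho : R) : rho != 0 -> `|rho| <= 1 ->
   ppow rho%:C (1 - B 0%N) (1 - B' 0%N) * CS (fun n => h0 n * rho%:C ^+ n) + ppow rho%:C (1 - B x) (1 - B' x) * CS (fun n => h1 n * rho%:C ^+ n) =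
   ppow rho%:C (1 - B x) (1 - B' x) * CS (fun n => hx n * rho%:C ^+ n) + ppow rho%:C (1 - B 0%N) (1 - B' 0%N) * CS (fun n => cc * h2 n * rho%:C ^+ n).
  move=> rho0 rho1; have rc0 : (rho%:C : C) != 0 by rewrite -cabs_gt0 cabsR normr_gt0.
  have wn : rho%:C * z != 0 by rewrite mulf_neq0.
  have wb : 0 < cabs (rho%:C * z) < 1.
    rewrite cabs_gt0 wn /= cabsM cabsR; apply: le_lt_trans z1; by rewrite ler_piMl // cabs_ge0.
  have finw := Ji_all B0 B0' hI zb fin wb.
  have := H1 rho rho0 rho1; rewrite big_seq1 H0 // => <-.
  rewrite (Gi_inversion x0 hI wn finw) H2 // big_seq1 mulrDr lead // Hx //; congr (_ + _).
  have sr : summ (fun n => h2 n * rho%:C ^+ n).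
    by apply: summ_dom sh2 => k; rewrite cabsM -[leRHS]mulr1; apply: ler_wpM2l; [exact: cabs_ge0|rewrite cabsX cabsR exprn_ile1].
  have -> : CS (fun n => cc * h2 n * rho%:C ^+ n) = cc * CS (fun n => h2 n * rho%:C ^+ n).
    by rewrite -CSZ //; apply: eq_CS => k; rewrite mulrA.
  rewrite (ppowM rc0 zn iB1) /cc.
  have -> : ppow rho%:C (1 - B 0%N) (1 - B' 0%N) = ppow rho%:C (1 - B x) (1 - B' x) * ppow rho%:C (1 - B2 x) (1 - B2' x).
    by rewrite -ppowD; apply: eq_ppow; rewrite ?B0 ?B0' ?e2x ?e2x' -[2%:R]/(1 + 1); ring.
  move: (inveps _ _ _ _ _) (ppow _ _ _) (ppow _ _ _) (ppow _ _ _) (CS _) => x1 x2 x3 x4 x5; ring.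
have iB0 : isInt (1 - B 0%N - (1 - B' 0%N)) by rewrite B0 B0' subrr; exact: (isInt_nat R 0).
have nB : ~ isInt (1 - B x - (1 - B 0%N)).
  rewrite B0 subrr subr0 => hh; apply: nBx; rewrite -opprB; exact: isIntN.
have eh := @split_unique x 0%N (fun j => 1 - B j) (fun j => 1 - B' j) h1 (fun n => cc * h2 n) hx h0 x0 iB1 iB0 nB sh1 (summZ _ sh2) shx sh0 key.
have one0 : (1 : R) != 0 by rewrite oner_eq0. have one1 : `|1 : R| <= 1 by rewrite normr1.
have := H1 1 one0 one1; rewrite (eq_CS (v := fun n => hx n * (1%:C : C) ^+ n)); last by move=> k; rewrite eh.
rewrite -Hx // !mul1r => ->.
by rewrite [in RHS]big_cons !big_seq1.
Qed.

Theorem Gi_expansion (a B a' B' : nat -> C) : B 0%N = 1 -> B' 0%N = 1 -> forall l z, uniq (0%N :: l) -> ints a B a' B' (0%N :: l) ->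
  nonres a B (0%N :: l) -> 0 < cabs z < 1 -> (Ji a B a' B' l z < +oo)%E ->
  Gi a B a' B' l z = \sum_(j <- 0%N :: l) term a B a' B' (0%N :: l) l j z.
Proof.
(* Induction on the length, because after the exchange the step is applied to a list with another
   head. *)
move=> B0 B0' l; move: {2}(size l) (erefl (size l)) => n; elim: n l => [|n IH] [|x l] //= sz z uq hI nr zb fin.
  by rewrite big_seq1; apply: Gi_nil => //; case/andP: zb.
case: sz => sz; case: l sz uq hI nr fin => [|y l] sz uq hI nr fin.
  move: uq; rewrite !inE andbT eq_sym => x0; exact: Gi_single.
have sub K K' : {subset K <= K'} -> ints a B a' B' K' -> nonres a B K' -> ints a B a' B' K /\ nonres a B K.
  move=> s h1 [h2 h3]; split; first by move=> i /s; exact: h1.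
  by split=> i j /s i1 /s j1; [exact: h2|exact: h3].
(* Finiteness of the smaller integral holds at one point by [Ji_point] and spreads over the
   punctured disc by [Ji_all]. *)
have IHl K : size K = n -> uniq (0%N :: K) -> forall x', {subset x' :: 0%N :: K <= [:: 0%N, x, y & l]} -> (Ji a B a' B' (x' :: K) z < +oo)%E ->
  forall w, 0 < cabs w < 1 -> Gi a B a' B' K w = \sum_(j <- 0%N :: K) term a B a' B' (0%N :: K) K j w.
  move=> sK uK x' sb finK w wb.
  have sb1 : {subset 0%N :: K <= [:: 0%N, x, y & l]} by move=> i iK; apply: sb; rewrite in_cons iK orbT.
  have sb2 : {subset [:: 0%N, x' & K] <= [:: 0%N, x, y & l]}.
    move=> i; rewrite !in_cons => iK; apply: sb; rewrite !in_cons; case/or3P: iK => ->; by rewrite ?orbT.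
  have [hI1 nr1] := sub _ _ sb1 hI nr; have [hI2 _] := sub _ _ sb2 hI nr.
  have [w0 w0b w0f] := Ji_point hI2 zb finK.
  by apply: IH => //; exact: (Ji_all B0 B0' hI1 w0b w0f wb).
have hI' : ints a B a' B' [:: 0%N, y, x & l] by move=> i ii; apply: hI; move: ii; rewrite !in_cons => /or4P[] ->; rewrite ?orbT.
have sK : {subset [:: 0%N, y, x & l] <= [:: 0%N, x, y & l]} by move=> i; rewrite !in_cons => /or4P[] ->; rewrite ?orbT.
have [_ nr'] := sub _ _ sK hI nr.
have fin' : (Ji a B a' B' [:: y, x & l] z < +oo)%E by rewrite -Ji_swap.
move: (uq); rewrite !cons_uniq !in_cons !negb_or => /and4P[/and3P[x0 y0 l0] /andP[xy xl] yl ul].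
have xn : x \notin [:: 0%N, y & l] by rewrite !in_cons !negb_or eq_sym x0 xy.
have yn : y \notin [:: 0%N, x & l] by rewrite !in_cons !negb_or eq_sym y0 eq_sym xy.
have u1 : uniq [:: 0%N, y & l] by rewrite !cons_uniq in_cons negb_or y0 l0 yl.
have u2 : uniq [:: 0%N, x & l] by rewrite !cons_uniq in_cons negb_or x0 l0 xl.
have s1 : {subset [:: x, 0%N, y & l] <= [:: 0%N, x, y & l]} by move=> i; rewrite !in_cons => /or4P[] ->; rewrite ?orbT.
have s2 : {subset [:: y, 0%N, x & l] <= [:: 0%N, x, y & l]} by move=> i; rewrite !in_cons => /or4P[] ->; rewrite ?orbT.
have [h1 sh1 H1] := Gi_step B0 B0' xn hI nr (IHl _ sz u1 x s1 fin) zb fin.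
have [h2 sh2 H2] := Gi_step B0 B0' yn hI' nr' (IHl (x :: l) sz u2 y s2 fin') zb fin'.
have mx : x \in [:: 0%N, x, y & l] by rewrite !in_cons eqxx orbT.
have my : y \in [:: 0%N, x, y & l] by rewrite !in_cons eqxx !orbT.
have [hx shx Hx] := term_series [:: x, y & l] hI nr mx zb.
have [hy shy Hy] := term_series [:: x, y & l] hI nr my zb.
have p1 : perm_eq [:: 0%N, y, x & l] [:: 0%N, x, y & l] by rewrite perm_cons; apply/permPl; exact: (perm_catCA [:: y] [:: x] l).
have p2 : perm_eq [:: y, x & l] [:: x, y & l] by apply/permPl; exact: (perm_catCA [:: y] [:: x] l).
have et j w : term a B a' B' [:: 0%N, y, x & l] [:: y, x & l] j w = term a B a' B' [:: 0%N, x, y & l] [:: x, y & l] j w by exact: eq_term.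
have key (rho : R) : rho != 0 -> `|rho| <= 1 ->
   ppow rho%:C (1 - B y) (1 - B' y) * CS (fun n => hy n * rho%:C ^+ n) + ppow rho%:C (1 - B x) (1 - B' x) * CS (fun n => h1 n * rho%:C ^+ n) =
   ppow rho%:C (1 - B x) (1 - B' x) * CS (fun n => hx n * rho%:C ^+ n) + ppow rho%:C (1 - B y) (1 - B' y) * CS (fun n => h2 n * rho%:C ^+ n).
  move=> rho0 rho1; have rc0 : (rho%:C : C) != 0 by rewrite -cabs_gt0 cabsR normr_gt0.
  have wb : 0 < cabs (rho%:C * z) < 1.
    case/andP: zb => z0 z1; rewrite cabs_gt0 mulf_neq0 //= -?cabs_gt0 // cabsM cabsR; apply: le_lt_trans z1; by rewrite ler_piMl // cabs_ge0.
  have finw := Ji_all B0 B0' hI zb fin wb.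
  have := H1 rho rho0 rho1; rewrite (Gi_swap hI finw) H2 //.
  rewrite -(Hx rho rho0 rho1) -(Hy rho rho0 rho1) !big_cons !et (eq_bigr _ (fun j _ => et j _)).
  set t0 := term _ _ _ _ _ _ 0%N _; set tx := term _ _ _ _ _ _ x _; set ty := term _ _ _ _ _ _ y _; set sl := \sum_(j <- l) _.
  set q1 := ppow _ _ _ * _; set q2 := ppow _ _ _ * _ => e.
  apply: (addrI (t0 + sl)); transitivity (t0 + (ty + sl) + q2); first by move: t0 tx ty sl q1 q2 {e} => *; ring.
  by rewrite -e; move: t0 tx ty sl q1 q2 {e} => *; ring.
have iexp j : j \in [:: 0%N, x, y & l] -> isInt (1 - B j - (1 - B' j)).
  by move=> /hI[_ iB]; rewrite (_ : _ - _ = - (B j - B' j)); [exact: isIntN|ring].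
have nB : ~ isInt (1 - B x - (1 - B y)).
  move=> hh; apply: (nr.2 _ _ my mx); first by rewrite eq_sym.
  by move: hh; congr isInt; ring.
have eh := @split_unique x y (fun j => 1 - B j) (fun j => 1 - B' j) h1 h2 hx hy xy (iexp x mx) (iexp y my) nB sh1 sh2 shx shy key.
(* At rho = 1 the identified series is the missing term itself. *)
have one0 : (1 : R) != 0 by rewrite oner_eq0. have one1 : `|1 : R| <= 1 by rewrite normr1.
have := H1 1 one0 one1; rewrite (eq_CS (v := fun n => hx n * (1%:C : C) ^+ n)); last by move=> k; rewrite eh.
rewrite -Hx // !mul1r => e; apply: (etrans e).
rewrite !big_cons.
set t0 := term _ _ _ _ _ _ 0%N _; set tx := term _ _ _ _ _ _ x _; set ty := term _ _ _ _ _ _ y _; set sl := \sum_(j <- l) _.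
by move: t0 tx ty sl => *; ring.
Qed.
End Induction.

(** * From the stated integral to the iterated one *)

Section Matching.
Variable R : realType.
Local Notation C := R[i].
Local Notation mA := (mA R).
Local Notation plane := (measurableTypeR R * measurableTypeR R)%type.
Variables a B a' B' : nat -> C.
Local Notation hb := (hb a B a' B').
Local Notation Gi := (Gi a B a' B').
Local Notation Ji := (Ji a B a' B').
Local Notation ints := (ints a B a' B').

(* the integrand in the variables of indices m, ..., m + k - 1, the others being
   absorbed in the constants c and w *)
Definition partial_integrand k m (c w : C) (s : seq C) : C :=
  c * (\prod_(i < k) hb (m + i)%N (nth 0 s i)) * ppow (1 - w * \prod_(i < k) nth 0 s i) (- a 0%N) (- a' 0%N).

Lemma partial_integrand_cons k m c w t : (fun s => partial_integrand k.+1 m c w (t :: s)) = partial_integrand k m.+1 (c * hb m t) (w * t).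
Proof.
apply/funext => s; rewrite /partial_integrand !big_ord_recl /= addn0 (mulrA c) (mulrA w); congr (_ * _ * _).
by apply: eq_bigr => i _; rewrite /bump /= add1n addnS addSn.
Qed.

Lemma cint_abs_Ji k m c w : ints (0%N :: iota m k) ->
  cint_abs k (partial_integrand k m c w) = ((cabs c)%:E * Ji (iota m k) w)%E.
Proof.
elim: k m c w => [|k IH] m c w h.
  by rewrite /= /partial_integrand !big_ord0 !mulr1 [cabs (c * _)]cabsM EFinM.
have [i1 i2] := ints_hb h.
transitivity (\int[mA]_t cint_abs k (fun s => partial_integrand k.+1 m c w (toC t :: s)))%E; first by [].
under eq_integral do rewrite partial_integrand_cons (IH _ _ _ (ints_behead h)) (cabsM c) EFinM -muleA.
rewrite ge0_intZl //; last by rewrite lee_fin cabs_ge0.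
  apply: emeasurable_funM; first exact: (cmeas_absE (cmeasC_hb i1 i2)).
  by apply: (meC_comp (meC_Ji (ints_behead h))); apply: cmeasM; [exact: cmeas_cst|exact: cmeas_toC].
by move=> t; exact: hbJ_ge0.
Qed.

Lemma cmeas_cint k m d (T : measurableType d) (c w : T -> C) : ints (0%N :: iota m k) -> cmeas c -> cmeas w ->
  cmeas (fun t => cint k (partial_integrand k m (c t) (w t))).
Proof.
elim: k m d T c w => [|k IH] m d T c w h mc mw.
  rewrite (_ : (fun t => _) = (fun t => c t * Gi [::] (w t))); last first.
    by apply/funext => t; rewrite /= /partial_integrand !big_ord0 !mulr1.
  apply: (cmeasM mc); apply: cmeasC_comp mw; apply: cmeasC_Gi.
  by move=> i; rewrite inE => /eqP ->; exact: h (mem_head _ _).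
have [i1 i2] := ints_hb h.
rewrite (_ : (fun t => _) = (fun t => CI mA (fun x => cint k (partial_integrand k m.+1 (c t * hb m (toC x)) (w t * toC x))))); last first.
  apply/funext => t; transitivity (CI mA (fun x => cint k (fun s => partial_integrand k.+1 m (c t) (w t) (toC x :: s)))); first by [].
  by apply: eq_CI => x; rewrite partial_integrand_cons.
apply: (@cmeas_CI _ _ _ _ _ mA (fun z : T * plane => cint k (partial_integrand k m.+1 (c z.1 * hb m (toC z.2)) (w z.1 * toC z.2)))).
apply: IH; first exact: (ints_behead h).
- apply: cmeasM; first by apply: (cmeas_comp mc); exact: measurable_fst.
  by apply: (cmeas_comp (cmeasC_hb i1 i2)); exact: measurable_snd.
- apply: cmeasM; first by apply: (cmeas_comp mw); exact: measurable_fst.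
  by apply: (cmeas_comp (@cmeas_toC R)); exact: measurable_snd.
Qed.

(** At each level the equality is only available where the inner absolute integral is finite, which
    is almost everywhere since the total is finite. *)
Lemma cint_Gi k m c w : ints (0%N :: iota m k) -> (Ji (iota m k) w < +oo)%E ->
  cint k (partial_integrand k m c w) = c * Gi (iota m k) w.
Proof.
elim: k m c w => [|k IH] m c w h fin.
  by rewrite /= /partial_integrand !big_ord0 !mulr1.
have [i1 i2] := ints_hb h; have h' := ints_behead h.
have mJ : measurable_fun setT (fun t : plane => ((cabs (hb m (toC t)))%:E * Ji (iota m.+1 k) (w * toC t)%R)%E).
  apply: emeasurable_funM; first exact: (cmeas_absE (cmeasC_hb i1 i2)).
  by apply: (meC_comp (meC_Ji h')); apply: cmeasM; [exact: cmeas_cst|exact: cmeas_toC].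
have mG : cmeas (fun t : plane => hb m (toC t) * Gi (iota m.+1 k) (w * toC t)).
  apply: cmeasM; first exact: (cmeasC_hb i1 i2).
  by apply: cmeas_scaleC; [exact: (cmeasC_Gi h')|exact: cmeas_cst|exact: cmeas_toC].
have cG : cintg mA (fun t => hb m (toC t) * Gi (iota m.+1 k) (w * toC t)).
  apply: (cintg_le mG mJ _ fin) => t; rewrite (cabsM (hb _ _)) EFinM; apply: lee_wpmul2l; first by rewrite lee_fin cabs_ge0.
  exact: Gi_le.
have mc : cmeas (fun t : plane => cint k (partial_integrand k m.+1 (c * hb m (toC t)) (w * toC t))).
  apply: (cmeas_cint h'); first by apply: cmeasM; [exact: cmeas_cst|exact: (cmeasC_hb i1 i2)].
  by apply: cmeasM; [exact: cmeas_cst|exact: cmeas_toC].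
have ae : aeM mA (fun t => cint k (partial_integrand k m.+1 (c * hb m (toC t)) (w * toC t)) = c * (hb m (toC t) * Gi (iota m.+1 k) (w * toC t))).
  have ij : (mA).-integrable setT (fun t : plane => ((cabs (hb m (toC t)))%:E * Ji (iota m.+1 k) (w * toC t)%R)%E).
    apply/integrableP; split; first exact: mJ.
    by under eq_integral do rewrite gee0_abs ?hbJ_ge0 //.
  have := integrable_ae measurableT ij.
  change (aeM mA (fun t : plane => [set: plane] t -> ((cabs (hb m (toC t)))%:E * Ji (iota m.+1 k) (w * toC t)%R)%E \is a fin_num) -> aeM mA (fun t => cint k (partial_integrand k m.+1 (c * hb m (toC t)) (w * toC t)) = c * (hb m (toC t) * Gi (iota m.+1 k) (w * toC t)))).
  move=> aefin; apply: (aeM_imp aefin) => t /(_ I) ft.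
  rewrite IH ?mulrA //.
  (* The weight never vanishes, so finiteness of its product with [Ji] gives finiteness of [Ji]. *)
  have := Ji_ge0 a B a' B' (iota m.+1 k) (w * toC t); move: ft; case: (Ji _ _) => [r'| |] //; first by rewrite ltry.
  by rewrite gt0_muley // lte_fin cabs_gt0 hb_neq0.
transitivity (CI mA (fun t => cint k (fun s => partial_integrand k.+1 m c w (toC t :: s)))); first by [].
exact: (etrans (eq_CI mA (fun t => congr1 (cint k) (partial_integrand_cons k m c w (toC t))))
  (etrans (ae_eq_CI mc (cintg_meas (cintgZ c cG)) ae) (CIZ c cG))).
Qed.
End Matching.

(** * Identification of the hypergeometric series *)

Section Hypergeometric.
Variable R : realType.
Local Notation C := R[i].

(** Supplies B_0 = 1, the hidden lower parameter whose Pochhammer symbol is the factorial. *)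
Definition with_one (b : nat -> C) i : C := if i == 0%N then 1 else b i.

Lemma hypF_CS (as_ bs : seq C) (x : C) (u : nat -> C) : summ u ->
  (forall n, (\prod_(al <- as_) poch al n) / (\prod_(be <- bs) poch be n) * x ^+ n / n`!%:R = u n) -> hypF as_ bs x = CS u.
Proof.
move=> su e; apply: ccvg_climn; apply: ccvg_ext (CS_cvg su) => N.
by apply: eq_bigr => i _; rewrite e.
Qed.

Lemma u0_CS p (a b : nat -> C) x : summ (fun m => useq a (with_one b) (iota 0 p.+1) 0%N m * x ^+ m) ->
  u0 p a b x = CS (fun m => useq a (with_one b) (iota 0 p.+1) 0%N m * x ^+ m).
Proof.
move=> s; apply: hypF_CS s _ => n; rewrite !big_map /useq prodf_div.
have -> : \prod_(i <- iota 0 p.+1) poch (a i - with_one b 0%N + 1) n = \prod_(i <- iota 0 p.+1) poch (a i) n.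
  by apply: eq_bigr => i _; rewrite /with_one eqxx subrK.
have -> : \prod_(i <- iota 0 p.+1) poch (with_one b i - with_one b 0%N + 1) n = n`!%:R * \prod_(i <- iota 1 p) poch (b i) n.
  rewrite -[iota 0 p.+1]/(0%N :: iota 1 p) big_cons /with_one eqxx subrr add0r poch1; congr (_ * _).
  rewrite [LHS]big_seq [RHS]big_seq; apply: eq_bigr => i; rewrite mem_iota => /andP[i1 _].
  by rewrite gtn_eqF // subrK.
rewrite invfM; move: (\prod_(i <- iota 0 p.+1) _) ((\prod_(i <- iota 1 p) _)^-1) (n`!%:R^-1) (x ^+ n) => x1 x2 x3 x4; ring.
Qed.

(** In the denominator the index i = 0 gives the parameter 2 - b_j, and i = j gives the
    factorial. *)
Lemma Fj_CS p (a b : nat -> C) j x : (1 <= j <= p)%N ->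
  summ (fun m => useq a (with_one b) (iota 0 p.+1) j m * x ^+ m) ->
  Fj p a b j x = CS (fun m => useq a (with_one b) (iota 0 p.+1) j m * x ^+ m).
Proof.
move=> /andP[j1 jp] s; apply: hypF_CS s _ => n; rewrite big_map big_rcons /= big_map big_filter -[0%N :: iota 1 p]/(iota 0 p.+1) /useq prodf_div.
have ej : with_one b j = b j by rewrite /with_one gtn_eqF.
have -> : \prod_(i <- iota 0 p.+1) poch (a i - with_one b j + 1) n = \prod_(i <- iota 0 p.+1) poch (a i - b j + 1) n.
  by apply: eq_bigr => i _; rewrite ej.
have -> : \prod_(i <- iota 0 p.+1) poch (with_one b i - with_one b j + 1) n = poch (2%:R - b j) n * (n`!%:R * \prod_(i <- iota 1 p | i != j) poch (1 + b i - b j) n).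
  rewrite -[iota 0 p.+1]/(0%N :: iota 1 p) big_cons ej /with_one eqxx; congr (_ * _); first by congr poch; ring.
  rewrite (bigD1_seq j) /= ?iota_uniq //; last by rewrite mem_iota j1 add1n ltnS.
  rewrite gtn_eqF // subrr add0r poch1; congr (_ * _).
  rewrite [LHS]big_seq_cond [RHS]big_seq_cond; apply: eq_bigr => i; rewrite mem_iota => /andP[/andP[i1 _] _].
  by rewrite gtn_eqF //; congr poch; ring.
rewrite !invfM; move: (\prod_(i <- iota 0 p.+1) _) ((\prod_(i <- iota 1 p | _) _)^-1) ((poch (2%:R - b j) n)^-1) (n`!%:R^-1) (x ^+ n) => x1 x2 x3 x4 x5; ring.
Qed.
End Hypergeometric.

(** * Translation of Condition C and conclusion *)

Section Final.
Variable R : realType.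
Local Notation C := R[i].

Lemma integrand_partial p (a b a' b' : nat -> C) z :
  integrand p a b a' b' z = partial_integrand a (with_one b) a' (with_one b') p 1 1 z.
Proof.
apply/funext => s; rewrite /integrand /partial_integrand mul1r; congr (_ * _).
rewrite big_add1 /= big_mkord; apply: eq_bigr => i _.
rewrite /hb /bint add1n /=; congr (_ * _); apply: eq_ppow; ring.
Qed.

Lemma conditionC_ints p (a b a' b' : nat -> C) : conditionC p a b a' b' ->
  ints a (with_one b) a' (with_one b') (iota 0 p.+1).
Proof.
move=> [_ [_ [_ [h1 h2]]]] i; rewrite mem_iota add0n ltnS /= => ip; split; first exact: h1.
rewrite /with_one; case: posnP => [_|i0]; first by rewrite subrr; exact: (isInt_nat R 0).
by apply: h2; rewrite i0.
Qed.

Lemma conditionC_nonres p (a b a' b' : nat -> C) : conditionC p a b a' b' -> nonres a (with_one b) (iota 0 p.+1).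
Proof.
move=> [[h1 h2] [[_ h4] [h5 _]]].
have neg (u v : C) : v = - u -> ~ isInt u -> ~ isInt v.
  by move=> -> hu hv; apply: hu; rewrite -[u]opprK; exact: isIntN.
have m1 (u : C) : ~ isInt u -> ~ isInt (u - 1) by move=> h; have := nonint_int (n := -1) h.
split=> i j; rewrite !mem_iota !add0n !ltnS /= => ip jp; rewrite /with_one.
  case: posnP => [_|j0]; first by apply: m1; exact: (h1 i ip).1.
  by apply: (h5 i j ip _).1; rewrite j0.
case: posnP => [->|i0]; case: posnP => [->|j0] //.
- by move=> _; apply: (neg (b j - 1)); [ring|apply: m1; apply: (h2 j _).1; rewrite j0].
- by move=> _; apply: m1; apply: (h2 i _).1; rewrite i0.
- by move=> /eqP ij; apply: (h4 i j _ _ ij).1; rewrite ?i0 ?j0.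
Qed.
End Final.

Theorem theorem3 (R : realType) (p : nat) (a b a' b' : nat -> R[i]) (z : R[i]) :
  (1 <= p)%N ->
  conditionC p a b a' b' ->
  ~ isInt (psi p a b) ->
  - 2%:R < cre (psi p a b + psi p a' b') ->
  0 < cre (a p + a' p) ->
  0 < cre (b p + b' p - a p - a' p) ->
  (forall j, (1 <= j <= p.-1)%N -> cre (b j + b' j - a p - a' p) < 2%:R) ->
  (forall j, (j <= p.-1)%N -> cre (b p + b' p - a j - a' j) < 2%:R) ->
  0 < cabs z < 1 ->
  (cint_abs p (integrand p a b a' b' z) < +oo)%E ->
  Ipp1 p a b a' b' z =
    lambda0 p a b a' b'* u0 p a b z * u0 p a' b' (conjc z)
    + \sum_(1 <= j < p.+1)
        lambdaj p a b a' b' j * ppow z (1 - b j) (1 - b' j)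
        * Fj p a b j z * Fj p a' b' j (conjc z).
Proof.
move=> _ hC _ _ _ _ _ _ zb fin; have /andP[z0 z1] := zb.
have hI := conditionC_ints hC; have nr := conditionC_nonres hC.
set K := iota 0 p.+1 in hI nr.
pose b1 := with_one b; pose b1' := with_one b'.
have b0 : b1 0%N = 1 by []. have b0' : b1' 0%N = 1 by [].
have mK i : (i \in K) = (i <= p)%N by rewrite /K mem_iota add0n ltnS.
rewrite integrand_partial (cint_abs_Ji 1 z hI) cabs1 mul1e in fin.
rewrite /Ipp1 integrand_partial (cint_Gi 1 hI fin) mul1r.
rewrite (Gi_expansion b0 b0' (iota_uniq 0 p.+1) hI nr zb fin).
have sm (j : nat) : j \in K -> summ (fun m => useq a b1 K j m * z ^+ m) /\ summ (fun m => useq a' b1' K j m * conjc z ^+ m).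
  move=> jK; have [x1 p1] : exists x, pbd (useq a b1 K j) x by apply: pbd_useq => i iK ij; exact: nr.2.
  have [x2 p2] : exists x, pbd (useq a' b1' K j) x by apply: pbd_useq => i iK ij; exact: (nonres_dual hI nr).
  by split; [exact: pbd_geo p1 z1|apply: pbd_geo p2 _; rewrite cabs_conj].
rewrite big_cons; congr (_ + _).
  have [s1 s2] := sm 0%N (ltac:(by rewrite mK)).
  rewrite (u0_CS s1) (u0_CS s2) -[0%N :: iota 1 p]/K /term b0 b0' !subrr ppow00 mulr1 mulrA; congr (_ * _ * _).
  (* Index 0 is not in [iota 1 p], so the exclusion of i = 0 in [muj] removes no factor. *)
  rewrite /muj /lambda0 /= mul1r /index_iota subSS subn0 [LHS]big_seq_cond [RHS]big_seq; apply: eq_big.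
    move=> i; change ((i \in iota 1 p) && (i != 0%N) = (i \in iota 1 p)); by rewrite mem_iota; case: i => //= i; rewrite andbT.
  move=> i; rewrite mem_iota => /andP[/andP[i1 _] _].
  by rewrite b0 b0' !subrK /b1 /b1' /with_one gtn_eqF.
rewrite /index_iota subSS subn0; apply: eq_big_seq => j; rewrite mem_iota add1n ltnS => /andP[j1 jp].
have jb : (1 <= j <= p)%N by rewrite j1.
have [s1 s2] := sm j (ltac:(by rewrite mK)).
have ej : b1 j = b j by rewrite /b1 /with_one gtn_eqF.
have ej' : b1' j = b' j by rewrite /b1' /with_one gtn_eqF.
rewrite (Fj_CS jb s1) (Fj_CS jb s2) -[0%N :: iota 1 p]/K /term ej ej' [LHS]mulrA; congr (_ * _ * _ * _).
rewrite /muj /lambdaj gtn_eqF // /base ej ej' /index_iota subSS subn0; congr (_ * _).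
rewrite [LHS]big_seq_cond [RHS]big_seq_cond; apply: eq_bigr => i; rewrite mem_iota => /andP[/andP[i1 _] _].
by rewrite /b1 /b1' /with_one gtn_eqF.
Qed.
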